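(* Let $T_N$ ($N\ge 2$) be the $N$-dimensional inflated tree constructed from a regular rooted metric tree $T_1$ of finite radius, and let $\hat T_N$ be the corresponding straightened tree, with global coordinates $(\vec s,\theta)\in\hat\Omega\times[0,\hat R)$. Suppose that one of the following holds. (i) There exists a $C^1$-diffeomorphism $\mathcal G:T_N\to\hat T_N$ with inverse $\mathcal F:\hat T_N\to T_N$, and, with $J$ the Jacobian of $\mathcal F$, there is a constant $C>0$ such that $$\Big|\frac{\partial \mathcal F(\vec s,\theta)}{\partial\theta}\Big|\le C\quad\forall(\vec s,\theta)\in\hat T_N,\qquad 0<J(\vec s,\theta_1)\le C\,J(\vec s,\theta_2)\quad\forall\,\theta_1\le\theta_2 .$$ (ii) There exist a $C^1$-diffeomorphism $\mathcal F=\mathcal F(\vec s,\theta):\hat V\to V$ from the inflated vertex $\hat V$ of the straightened tree onto the inflated vertex $V$ of $T_N$, with $\mathcal F(\hat S_j)=S_j$ for $0\le j\le k$, and a constant $C>0$ such that $$\Big|\frac{\partial\mathcal F}{\partial\theta}\Big|<C,\qquad 0<J(\vec s,\theta_1)\le C\,J(\vec s,\theta_2)\ \text{ if }\theta_1\le\theta_2,$$ where $J$ is the Jacobian of $\mathcal F$. Then the Laplace operator on $T_N$ has a purely discrete spectrum.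
   Context: Tree. $T_1$ is an infinite rooted metric tree with root $O$; the generation $\mathrm{gen}(v)$ of a vertex is the number of edges joining it to $O$, and an edge joining vertices of generations $j$ and $j+1$ has generation $j$. $T_1$ is regular: the length of an edge depends only on its generation, and the number of edges joining a vertex $v$ to vertices of generation $\mathrm{gen}(v)+1$ is a constant $k$. The radius is the supremum of the distances of points of $T_1$ to $O$. Inflated tree. Fix $N\ge2$, $\delta\in(0,1)$, a bounded Lipschitz domain $\Omega\subset\mathbb R^{N-1}$ and a bounded Lipschitz domain $V\subset\mathbb R^N$, each containing the origin (its center). $\partial V$ contains $k+1$ disjoint sections: $S_0$, an isometric image of $\Omega$, and $S_1,\dots,S_k$, isometric images of $\delta\Omega$; the orthogonal projection $p_i$ of the center of $V$ into $S_i$ is the image of the center of $\Omega$, respectively $\delta\Omega$. At each vertex $v\ne O$ place a copy $V(v)$ of $\delta^{\mathrm{gen}(v)-1}V$ with center $v$; its section $S_0$ corresponds to the edge arriving from the previous generation and $S_1,\dots,S_k$ to the outgoing edges, each edge being perpendicular to its section. Its skeleton is $V(v)\cap T_1$ (the skeletons being disjoint). The inflated edge $E(e)$ is the product of $e$ minus all skeletons with the cross section $\delta^{\mathrm{gen}(e)}\Omega$. $T_N$ is the $N$-dimensional manifold obtained by joining the inflated edges to the inflated vertices along the corresponding sections. The root section $O\times\Omega_0$ is the cross section of the inflated tree at the root $O$. Straightened tree. $\hat T_N$ is the inflated tree whose cross section $\hat\Omega\subset\mathbb R^{N-1}$ is a box such that $k$ disjoint isometric copies of $k^{-1/(N-1)}\hat\Omega$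 exactly cover $\hat\Omega$ (for example with side lengths $1,k^{1/(N-1)},\dots,k^{(N-2)/(N-1)}$), whose inflated vertex is the cylinder $\hat V=\hat\Omega\times[0,1]$, with $\hat S_0=\hat\Omega\times\{0\}$ and with $\hat S_1,\dots,\hat S_k\subset\hat\Omega\times\{1\}$ the $k$ copies of $k^{-1/(N-1)}\hat\Omega$. It is parameterized by the cylinder $\hat\Omega\times[0,\hat R)$, where $\theta\in[0,\hat R)$ is the axial coordinate measured from the root and $\hat R$ is the radius of $\hat T_N$. Operator. $H^1(T_N)$ is the completion of $\{f\in C^1(T_N):\int_{T_N}(|\nabla f|^2+|f|^2)\,\mathrm d\mathbf x<\infty\}$ in the norm $\big(\int_{T_N}(|\nabla f|^2+|f|^2)\,\mathrm d\mathbf x\big)^{1/2}$, and $H^1_0(T_N)$ is the completion in $H^1(T_N)$ of all functions in $C^1(T_N)$ which vanish on the root section $O\times\Omega_0$. The Laplace operator on $T_N$ is the selfadjoint operator in $L^2(T_N)$ associated (Friedrichs extension) with the form $\int_{T_N}\nabla u\cdot\nabla\overline w\,\mathrm d\mathbf x$, $u,w\in H^1_0(T_N)$; this corresponds to the Dirichlet condition on the root section and the Neumann condition on the rest of the boundary. Purely discrete spectrum means that the spectrum consists of isolated eigenvalues of finite multiplicity. *)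

(* Defs.v *)
From HB Require Import structures.
From mathcomp Require Import all_boot all_order all_algebra.
From mathcomp Require Import all_classical all_reals all_analysis.
From mathcomp Require Import complex.

Set Implicit Arguments.
Unset Strict Implicit.
Unset Printing Implicit Defensive.

Import Order.TTheory GRing.Theory Num.Theory.
Import numFieldNormedType.Exports.

Local Open Scope classical_set_scope.
Local Open Scope ring_scope.

Section transport.
Local Open Scope ereal_scope.
Context {d d'} {T : measurableType d} {T' : measurableType d'} {R : realType}.
Variables (f : T -> T') (g : T' -> T).
Hypotheses (mf : measurable_fun setT f) (mg : measurable_fun setT g).
Hypothesis fK : cancel f g.
Variable mu : {measure set T -> \bar R}.
Hypothesis mu_sigma_finite : sigma_finite setT mu.

Definition transport of measurable_fun setT f & measurable_fun setT g
  & cancel f g & sigma_finite setT mu : set T' -> \bar R := pushforward mu f.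

Local Notation nu := (transport mf mg fK mu_sigma_finite).

Let nu0 : nu set0 = 0.
Proof. by rewrite /transport /pushforward preimage_set0 measure0. Qed.

Let nu_ge0 A : 0 <= nu A. Proof. exact: measure_ge0. Qed.

Let nu_sigma_additive : semi_sigma_additive nu.
Proof.
move=> F mF tF mUF; rewrite /transport /pushforward preimage_bigcup.
apply: measure_semi_sigma_additive.
- by move=> n; rewrite -[X in measurable X]setTI; exact: mf.
- apply/trivIsetP => /= i j _ _ ij; rewrite -preimage_setI.
  by move/trivIsetP : tF => /(_ _ _ _ _ ij) ->//; rewrite preimage_set0.
- by rewrite -preimage_bigcup -[X in measurable X]setTI; exact: mf.
Qed.

HB.instance Definition _ :=
  isMeasure.Build _ _ _ nu nu0 nu_ge0 nu_sigma_additive.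

Let nu_sigma_finite : sigma_finite setT nu.
Proof.
have [F FT mF] := mu_sigma_finite.
exists (fun i => g @^-1` F i).
  by rewrite -preimage_bigcup -FT preimage_setT.
move=> i; have [mFi Fioo] := mF i; split.
  by rewrite -[X in measurable X]setTI; exact: mg.
rewrite /transport /pushforward -comp_preimage.
by rewrite (_ : g \o f = id) ?preimage_id//; apply/funext => x /=; rewrite fK.
Qed.

HB.instance Definition _ :=
  Measure_isSigmaFinite.Build _ _ _ nu nu_sigma_finite.

End transport.

Lemma sigma_finite_prod d1 d2 (T1 : measurableType d1)
    (T2 : measurableType d2) (R : realType)
    (m1 : {sigma_finite_measure set T1 -> \bar R})
    (m2 : {sigma_finite_measure set T2 -> \bar R}) :
  sigma_finite setT (m1 \x m2)%E.
Proof.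
have /sigma_finiteP[F [TF ndF Foo]] := sigma_finiteT m1.
have /sigma_finiteP[G [TG ndG Goo]] := sigma_finiteT m2.
exists (fun n => F n `*` G n).
  rewrite -setXTT TF TG predeqE => -[x y]; split.
    move=> [/= [n _ Fnx] [k _ Gky]]; exists (maxn n k) => //; split.
    - by move: x Fnx; exact/subsetPset/ndF/leq_maxl.
    - by move: y Gky; exact/subsetPset/ndG/leq_maxr.
  by move=> [n _ []/= ? ?]; split; exists n.
move=> k; have [? ?] := Foo k; have [? ?] := Goo k.
split; first exact: measurableX.
by rewrite product_measure1E// lte_mul_pinfty// ge0_fin_numE.
Qed.

Section lebesgue_row.
Context {R : realType}.
Local Notation R' := (measurableTypeR R).

Definition cons_pair n (p : R' * n.-tuple R') : n.+1.-tuple R' :=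
  [tuple of p.1 :: p.2].
Definition uncons n (t : n.+1.-tuple R') : R' * n.-tuple R' :=
  (tnth t ord0, [tuple of behead t]).

Lemma measurable_cons_pair n : measurable_fun setT (@cons_pair n).
Proof. exact: measurable_cons. Qed.

Lemma measurable_uncons n : measurable_fun setT (@uncons n).
Proof.
apply/measurable_fun_pairP; split; first exact: measurable_tnth.
exact: measurable_behead.
Qed.

Lemma cons_pairK n : cancel (@cons_pair n) (@uncons n).
Proof. by move=> [x t]; congr pair; exact/val_inj. Qed.

Fixpoint lebesgue_tuple n : {sigma_finite_measure set (n.-tuple R') -> \bar R} :=
  match n with
  | 0 => dirac [tuple]
  | m.+1 => transport (@measurable_cons_pair m) (@measurable_uncons m)
      (@cons_pairK m) (sigma_finite_prod lebesgue_measure (lebesgue_tuple m))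
  end.

Definition tuple_of_row n (v : 'rV[R]_n) : n.-tuple R' := [tuple v 0 i | i < n].
Definition row_of_tuple n (t : n.-tuple R') : 'rV[R]_n := \row_i tnth t i.

HB.instance Definition _ n := Measurable.copy 'rV[R]_n
  (g_sigma_algebra_preimageType (@tuple_of_row n)).

Lemma row_of_tupleK n : cancel (@row_of_tuple n) (@tuple_of_row n).
Proof. by move=> t; apply: eq_from_tnth => i; rewrite tnth_mktuple mxE. Qed.

Lemma measurable_row_of_tuple n : measurable_fun setT (@row_of_tuple n).
Proof.
move=> _ _ [B mB <-]; rewrite !setTI -comp_preimage.
rewrite (_ : _ \o _ = id) ?preimage_id//.
by apply/funext => t; exact: row_of_tupleK.
Qed.

Lemma measurable_tuple_of_row n : measurable_fun setT (@tuple_of_row n).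
Proof. by move=> _ B mB; exists B. Qed.

Definition lebesgue_row n : {sigma_finite_measure set 'rV[R]_n -> \bar R} :=
  transport (@measurable_row_of_tuple n) (@measurable_tuple_of_row n)
    (@row_of_tupleK n) (sigma_finiteT (lebesgue_tuple n)).

End lebesgue_row.

Section euclid.
Context {R : realType}.

Definition dotp n (x y : 'rV[R]_n) : R := (x *m y^T) 0 0.

(* The library norm on matrices is the sup norm. *)
Definition enorm n (x : 'rV[R]_n) : R := Num.sqrt (dotp x x).

Definition dilate n (c : R) (A : set 'rV[R]_n) : set 'rV[R]_n :=
  [set c *: x | x in A].

(* Near each boundary point the domain lies strictly above the graph of a
   Lipschitz function [phi] over the hyperplane orthogonal to [e]; [phi] is
   defined on the whole space and is constant in the direction [e]. *)
Definition lipschitz_domain n (D : set 'rV[R]_n) : Prop :=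
  [/\ open D, connected D, bounded_set D & forall x, closure D x -> ~ D x ->
    exists (e : 'rV[R]_n) (phi : 'rV[R]_n -> R) (r K : R),
    [/\ 0 < r, enorm e = 1,
        forall y z, `|phi y - phi z| <= K * enorm (y - z),
        forall y t, phi (y + t *: e) = phi y &
        forall y, enorm (y - x) < r -> (D y <-> phi y < dotp y e)]].

(* [C1_on D f df]: [f] is of class C^1 on [D] with derivative [df], where [D]
   is an open set together with some flat pieces of its boundary, on which the
   derivative is the continuous extension of the derivative in the interior.
   Row [i] of [df x] is the partial derivative in the [i]-th direction. *)
Definition C1_on m n (D : set 'rV[R]_m) (f : 'rV[R]_m -> 'rV[R]_n)
    (df : 'rV[R]_m -> 'M[R]_(m, n)) : Prop :=
  [/\ {within D, continuous f}, {within D, continuous df} &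
      forall x, D° x -> differentiable f x /\ jacobian f x = df x].

(* Points of R^(d+1) as pairs of a cross-sectional and an axial coordinate. *)
Definition cyl d (x : 'rV[R]_d) (t : R) : 'rV[R]_(d + 1) := row_mx x t%:M.
Definition transverse d (y : 'rV[R]_(d + 1)) : 'rV[R]_d := lsubmx y.
Definition axial d (y : 'rV[R]_(d + 1)) : R := (rsubmx y) 0 0.

Definition dtheta d (A : 'M[R]_(d + 1)) : 'rV[R]_(d + 1) :=
  row (rshift d ord0) A.

End euclid.

(* Dimension N = d + 1.  The root O has degree one, so that the vertices
   v <> O, and likewise the edges, are indexed by words over 'I_k: the empty
   word is the edge leaving O, respectively its end point, and [i :: s] is the
   [i]-th edge leaving the vertex [s], respectively its end point.  Hence the
   edge [s] has generation [size s] and the vertex [s] generation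
   [(size s).+1].
   [ctr 0], [ctr (lift ord0 i)] are the points p_0, p_(i+1), and
   [x |-> ctr j + x *m frame j] is the isometry onto the section S_j. *)
Record inflated_tree (R : realType) (d k : nat) := InflatedTree {
  branching_gt0 : (0 < k)%N;
  len : nat -> R;
  len_gt0 : forall j, 0 < len j;
  cross : set 'rV[R]_d;
  cross_domain : lipschitz_domain cross;
  cross_center : cross 0;
  body : set 'rV[R]_(d + 1);
  body_domain : lipschitz_domain body;
  body_center : body 0;
  ratio : R;
  ratio_gt0 : 0 < ratio;
  ratio_lt1 : ratio < 1;
  ctr : 'I_k.+1 -> 'rV[R]_(d + 1);
  frame : 'I_k.+1 -> 'M[R]_(d, d + 1);
  sect (j : 'I_k.+1) : set 'rV[R]_(d + 1) :=
    [set ctr j + x *m frame j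
       | x in if j == ord0 then cross else dilate ratio cross];
  frame_isometry : forall j, frame j *m (frame j)^T = 1%:M;
  sect_boundary : forall j, sect j `<=` closure body `\` body;
  sect_disjoint : trivIset setT sect;
  (* p_j is the orthogonal projection of the center *)
  ctr_ortho : forall j, ctr j *m (frame j)^T = 0;
  (* the skeleton consists of the segments from the center to the p_j *)
  skeleton_in_body : forall j t, 0 <= t < 1 -> body (t *: ctr j);
  (* the skeletons at the two ends of each edge are disjoint *)
  skeletons_disjoint0 : enorm (ctr ord0) < len 0;
  skeletons_disjointS : forall j i,
    ratio ^+ j * enorm (ctr (lift ord0 i)) + ratio ^+ j.+1 * enorm (ctr ord0)
      < len j.+1
}.

(* Edge (false) and vertex (true) pieces of an inflated tree. *)
Definition piece (k : nat) : Type := (bool * seq 'I_k)%type.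
Definition Edge k (s : seq 'I_k) : piece k := (false, s).
Definition Vertex k (s : seq 'I_k) : piece k := (true, s).

HB.instance Definition _ k := Countable.on (piece k).
HB.instance Definition _ k := isPointed.Build (piece k) (Edge [::]).
HB.instance Definition _ k := @isMeasurable.Build default_measure_display
  (piece k) discrete_measurable discrete_measurable0
  discrete_measurableC discrete_measurableU.

Section manifold.
Context {R : realType} {d k : nat} (T : inflated_tree R d k).
Local Notation word := (seq 'I_k).
Local Notation point := (piece k * 'rV[R]_(d + 1))%type.

(* The supremum of the distances to O of the points of the metric tree; the
   point at distance [t] from the beginning of the edge [s] is at distance
   [\sum_(i < size s) len T i + t] from O. *)
Definition tree_radius : \bar R :=
  ereal_sup [set r | exists (s : word) (t : R), 0 <= t <= len T (size s) /\
    r = (\sum_(i < size s) len T i + t)%:E].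

Definition edge_cross (s : word) : set 'rV[R]_d :=
  dilate (ratio T ^+ size s) (cross T).
Definition vertex_body (s : word) : set 'rV[R]_(d + 1) :=
  dilate (ratio T ^+ size s) (body T).

(* The length of the edge [s] without the skeletons. *)
Definition edge_len (s : word) : R :=
  match s with
  | [::] => len T 0 - enorm (ctr T ord0)
  | i :: s' => len T (size s)
      - ratio T ^+ size s' * enorm (ctr T (lift ord0 i))
      - ratio T ^+ size s * enorm (ctr T ord0)
  end.

(* T_N is the disjoint union of the inflated edges, which contain their end
   sections, and of the open inflated vertices; each piece has its own
   coordinates, centered for a vertex at the vertex and of the form
   [cyl x t] with [0 <= t <= edge_len s] for an edge. *)
Definition tree : set point := [set p |
  if p.1.1 then vertex_body p.1.2 p.2
  else edge_cross p.1.2 (transverse p.2) /\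
       0 <= axial p.2 <= edge_len p.1.2].

(* T_N without the sections, which are null sets. *)
Definition tree_core : set point := [set p |
  if p.1.1 then vertex_body p.1.2 p.2
  else edge_cross p.1.2 (transverse p.2) /\
       0 < axial p.2 < edge_len p.1.2].

(* The point of the inflated vertex [s] at depth [t] behind the point of its
   [j]-th section with cross-sectional coordinate [x]. *)
Definition behind_sect (s : word) (j : 'I_k.+1) (x : 'rV[R]_d) (t : R) :
    'rV[R]_(d + 1) :=
  ratio T ^+ size s *: ctr T j + x *m frame T j
    - (t / enorm (ctr T j)) *: ctr T j.

(* The isometric chart of T_N around the inflated edge [s]: it continues the
   coordinates of the edge perpendicularly through the two end sections, as
   long as one stays in the adjacent vertices. *)
Definition edge_dom (s : word) : set 'rV[R]_(d + 1) := [set y |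
  let x := transverse y in let t := axial y in
  edge_cross s x /\
  [\/ 0 <= t <= edge_len s,
      edge_len s < t /\ forall h, 0 < h <= t - edge_len s ->
        vertex_body s (behind_sect s ord0 x h) |
      t < 0 /\ if s is i :: s' then forall h, 0 < h <= - t ->
        vertex_body s' (behind_sect s' (lift ord0 i) x h) else False]].

Definition edge_chart (s : word) (y : 'rV[R]_(d + 1)) : point :=
  let x := transverse y in let t := axial y in
  if edge_len s < t then (Vertex s, behind_sect s ord0 x (t - edge_len s))
  else if (s, t < 0) is (i :: s', true) then
    (Vertex s', behind_sect s' (lift ord0 i) x (- t))
  else (Edge s, y).

(* The atlas of T_N; all charts are isometric. The charts are open except
   that of the edge [::], which contains the root section. *)
Definition chart_dom (c : piece k) : set 'rV[R]_(d + 1) :=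
  if c.1 then vertex_body c.2 else edge_dom c.2.
Definition chart (c : piece k) : 'rV[R]_(d + 1) -> point :=
  if c.1 then pair c else edge_chart c.2.

Definition C1_tree n (f : point -> 'rV[R]_n) : Prop :=
  forall c, exists df, C1_on (chart_dom c) (f \o chart c) df.

End manifold.

Section laplace.
Context {R : realType} {d k : nat} (T : inflated_tree R d k).
Local Notation point := (piece k * 'rV[R]_(d + 1))%type.
Local Notation C := R[i].
Local Notation re := (@complex.Re R).
Local Notation im := (@complex.Im R).
Implicit Types u v w f : point -> C.

Definition row_of_complex (z : C) : 'rV[R]_2 :=
  \row_j (if j == ord0 then re z else im z).

Definition volume : set point -> \bar R :=
  (@counting (piece k) R \x lebesgue_row (d + 1))%E.

Definition ae_eq_tree u v : Prop :=
  {ae volume, forall p, tree_core T p -> u p = v p}.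

Definition normsq u : \bar R :=
  (\int[volume]_(p in tree_core T)
     (re (u p) ^+ 2 + im (u p) ^+ 2)%:E)%E.

Definition L2 u : Prop :=
  [/\ measurable_fun (tree_core T) (re \o u),
      measurable_fun (tree_core T) (im \o u) &
      (normsq u < +oo)%E].

Definition inner u v : C :=
  Complex
    (\int[volume]_(p in tree_core T) re (u p * conjc (v p)))
    (\int[volume]_(p in tree_core T) im (u p * conjc (v p))).

(* The [j]-th component of the gradient in the coordinates of the piece. *)
Definition grad f (j : 'I_(d + 1)) : point -> C := fun p =>
  let df := jacobian (row_of_complex \o f \o chart T p.1) p.2 in
  Complex (df j ord0) (df j ord_max).

(* The functions of finite norm in C^1(T_N) which vanish on the root section. *)
Definition test_fun f : Prop :=
  [/\ C1_tree T (row_of_complex \o f),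
      forall x, cross T x -> f (Edge [::], cyl x 0) = 0,
      L2 f & forall j, L2 (grad f j)].

(* [H10 u gu]: [u] belongs to H^1_0(T_N), as a subspace of L^2(T_N), and has
   the gradient [gu]. *)
Definition H10 u (gu : 'I_(d + 1) -> point -> C) : Prop :=
  [/\ L2 u, forall j, L2 (gu j) & exists phi : nat -> point -> C,
    [/\ forall m, test_fun (phi m),
        normsq (phi m \- u) @[m --> \oo] --> 0%E &
        forall j, normsq (grad (phi m) j \- gu j) @[m --> \oo] --> 0%E]].

(* The graph of the (nonnegative) operator associated with the form. *)
Definition laplace u f : Prop :=
  L2 f /\ exists gu, H10 u gu /\
    forall w gw, H10 w gw -> \sum_j inner (gu j) (gw j) = inner f w.

Section spectrum.
Variable A : (point -> C) -> (point -> C) -> Prop.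

Definition resolvent_set : set C := [set lam |
  (forall u, A u (lam \*o u) -> ae_eq_tree u (cst 0)) /\
  exists K : R, forall f, L2 f -> exists u v,
    [/\ A u v, ae_eq_tree (v \- lam \*o u) f &
        (normsq u <= K%:E * normsq f)%E]].

Definition spectrum : set C := ~` resolvent_set.

Definition isolated_in_spectrum (lam : C) : Prop :=
  exists2 e : R, 0 < e &
    forall mu, spectrum mu -> `|mu - lam| < (e%:C)%C -> mu = lam.

Definition eigenvalue_of_finite_multiplicity (lam : C) : Prop :=
  (exists2 u, A u (lam \*o u) & ~ ae_eq_tree u (cst 0)) /\
  exists (m : nat) (b : 'I_m -> point -> C),
    (forall i, A (b i) (lam \*o b i)) /\
    forall u, A u (lam \*o u) -> exists c : 'I_m -> C,
      ae_eq_tree u (fun p => \sum_i c i * b i p).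

Definition purely_discrete : Prop := forall lam, spectrum lam ->
  isolated_in_spectrum lam /\ eigenvalue_of_finite_multiplicity lam.

End spectrum.
End laplace.

(* [slen j] is the length of the inflated edges of generation [j]; the copies
   of the scaled box in the box are its images under the isometries
   [x |-> tile_ctr i + x *m tile_rot i]. *)
Record straight_tree (R : realType) (d k : nat) := StraightTree {
  slen : nat -> R;
  slen_gt0 : forall j, 0 < slen j;
  side : 'rV[R]_d;
  side_gt0 : forall j, 0 < side 0 j;
  box : set 'rV[R]_d := [set x | forall j, `|x 0 j| < side 0 j / 2];
  sratio : R := k%:R `^ (- d%:R^-1);
  tile_ctr : 'I_k -> 'rV[R]_d;
  tile_rot : 'I_k -> 'M[R]_d;
  tile_isometry : forall i, tile_rot i *m (tile_rot i)^T = 1%:M;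
  tile (i : 'I_k) : set 'rV[R]_d :=
    [set tile_ctr i + x *m tile_rot i | x in dilate sratio box];
  tile_disjoint : trivIset setT tile;
  tile_box : forall i, tile i `<=` box;
  tile_cover : box `<=` \bigcup_i closure (tile i)
}.

Section straight.
Context {R : realType} {d k : nat} (S : straight_tree R d k).
Local Notation word := (seq 'I_k).

(* The position in the box of the cross section of the edge [s]. *)
Fixpoint scell_map (s : word) (x : 'rV[R]_d) : 'rV[R]_d :=
  if s is i :: s' then
    scell_map s' (sratio S ^+ size s' *: tile_ctr S i + x *m tile_rot S i)
  else x.
Definition scell (s : word) : set 'rV[R]_d :=
  scell_map s @` dilate (sratio S ^+ size s) (box S).

(* The axial coordinate at which the edges of generation [j] begin; an edge of
   generation [i] is followed by a vertex which is a copy, of height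
   [sratio S ^+ i], of the cylinder over the box. *)
Definition scut (j : nat) : R := \sum_(i < j) (slen S i + sratio S ^+ i).

(* The straightened tree in its global coordinates: the cylinder without the
   walls which separate the cross sections of the different branches. *)
Definition straight : set 'rV[R]_(d + 1) := [set y | exists s : word,
  scell s (transverse y) /\ scut (size s) <= axial y < scut (size s).+1].

(* The inflated vertex is taken with its sections, but without the lateral
   boundary of the cylinder and the part of its top outside the tiles. *)
Definition ssect (j : 'I_k.+1) : set 'rV[R]_(d + 1) :=
  if unlift ord0 j is Some i then [set cyl x 1 | x in tile S i]
  else [set cyl x 0 | x in box S].
Definition sbody : set 'rV[R]_(d + 1) :=
  [set y | box S (transverse y) /\ 0 < axial y < 1].
Definition svertex : set 'rV[R]_(d + 1) := sbody `|` \bigcup_j ssect j.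

End straight.

Section diffeo.
Context {R : realType} {d k : nat}.
Variables (T : inflated_tree R d k) (S : straight_tree R d k).
Local Notation point := (piece k * 'rV[R]_(d + 1))%type.

(* [g] represents [F] near [z] in the chart [c]. *)
Definition local_rep (F : 'rV[R]_(d + 1) -> point) (z : 'rV[R]_(d + 1))
    (c : piece k) (g : 'rV[R]_(d + 1) -> 'rV[R]_(d + 1))
    (dg : 'rV[R]_(d + 1) -> 'M[R]_(d + 1)) : Prop :=
  exists U, [/\ open U, U z,
    forall y, (straight S `&` U) y ->
      chart_dom T c (g y) /\ F y = chart T c (g y) &
    C1_on (straight S `&` U) g dg].

(* Since the charts are isometric, the length of the axial derivative and the
   absolute value of the Jacobian do not depend on the chart. *)
Definition tree_diffeo : Prop :=
  exists (F : 'rV[R]_(d + 1) -> point) (G : point -> 'rV[R]_(d + 1)) (C : R),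
  [/\ [/\ set_fun (straight S) (tree T) F, set_fun (tree T) (straight S) G,
          {in straight S, cancel F G} & {in tree T, cancel G F}],
      C1_tree T G,
      forall z, straight S z -> exists c g dg, local_rep F z c g dg,
      0 < C &
      (forall z c g dg, straight S z -> local_rep F z c g dg ->
         enorm (dtheta (dg z)) <= C) /\
      (forall z1 z2 c1 c2 g1 g2 dg1 dg2,
         straight S z1 -> straight S z2 ->
         transverse z1 = transverse z2 -> axial z1 <= axial z2 ->
         local_rep F z1 c1 g1 dg1 -> local_rep F z2 c2 g2 dg2 ->
         0 < `|\det (dg1 z1)| <= C * `|\det (dg2 z2)|)].

Definition vertex_diffeo : Prop :=
  let V := body T `|` \bigcup_j sect T j in
  exists (F G : 'rV[R]_(d + 1) -> 'rV[R]_(d + 1))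
    (dF dG : 'rV[R]_(d + 1) -> 'M[R]_(d + 1)) (C : R),
  [/\ [/\ set_fun (svertex S) V F, set_fun V (svertex S) G,
          {in svertex S, cancel F G} & {in V, cancel G F}],
      C1_on (svertex S) F dF /\ C1_on V G dG,
      forall j, F @` ssect S j = sect T j,
      0 < C &
      (forall z, svertex S z -> enorm (dtheta (dF z)) < C) /\
      (forall z1 z2, svertex S z1 -> svertex S z2 ->
         transverse z1 = transverse z2 -> axial z1 <= axial z2 ->
         0 < \det (dF z1) <= C * \det (dF z2))].

End diffeo.

(* Main.v *)
(* The spectrum is discrete because the form domain embeds compactly into L^2: for
   every e > 0 there are finitely many integrals l_i over sets of finite measure
   with ||u||^2 <= e (||u||^2 + ||grad u||^2) + C sum_i l_i(u)^2.  On a single piece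
   of the tree this is Rellich's theorem, for domains whose closure can locally be
   translated into the domain.  It remains to make the norm over the generations
   j >= n small, uniformly in u.  Let m_s be the mean of u over the vertex s of
   generation j, delta_j = ratio^j its scale and L_j the length of its edge.
   A straight box around the edge reaches into the vertices at both ends, so that
   |m_s - m_(i::s)|^2 is at most C L_(j+1) / delta_(j+1)^d times the energy nearby,
   while the squared norm over the edge and the vertex s is comparable with
   L_j delta_j^d m_s^2, up to L_j^2 times the energy.  Hence
   Y_j = sum_(|s| = j) delta_j^d m_s^2 grows by the factor rho = k ratio^d from one
   generation to the next, up to the factor 1 + L_(j+1) and the energy.  Since
   sum_j L_j is finite, the recursion from the root gives Y_j <= K max(1, rho)^j,
   which suffices when sum_j L_j max(1, rho)^j is finite.  Otherwise rho > 1, and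
   since sum_j L_j Y_j is finite Y_j / rho^j is small for some large j; the
   recursion backward from there bounds Y_j.  In both cases the squared norm over
   the generation j is at most c_j times that of u in H^1, with sum_j c_j finite.
   The eigenvalues are those of the real form q(u, w) - a h(u, w) - b h(i u, w),
   where h and q are the real parts of the inner products of u, w and of their
   gradients; if a + i b is no eigenvalue, the Riesz theorem and the compactness
   give the resolvent. *)
Require Import Defs.
From HB Require Import structures.
From mathcomp Require Import all_boot all_order all_algebra.
From mathcomp Require Import all_classical all_reals all_analysis.
From mathcomp Require Import measurable_realfun complex ring lra zify.

Set Implicit Arguments.
Unset Strict Implicit.
Unset Printing Implicit Defensive.

Import Order.TTheory GRing.Theory Num.Theory.
Import numFieldNormedType.Exports.

Local Open Scope classical_set_scope.
Local Open Scope ring_scope.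

(** * Lebesgue measure on row vectors *)

Arguments lebesgue_row {R} n : simpl never.

Section row_measurability.
Context {R : realType}.
Local Notation R' := (measurableTypeR R).

(** The pieces of the tree are built from dilates of two fixed domains, the vertex and the cross
    section, but the length of an edge is not bounded by its width, so no single scaling covers an
    edge. Therefore every inequality is derived from translations along segments: transverse ones
    cost the square of the width, axial ones the length of the shift times the thickness of the
    shifted set. The pieces communicate only through the isometric chart around an edge; hence the
    need for the invariance of the measure under isometries. The growth factor 1 + L_(j+1) comes
    from (a + b)^2 <= (1 + L) a^2 + (1 + 1/L) b^2, applied to a vertex mean and its difference to a
    neighbouring mean: the square of this difference carries a factor L, which cancels 1/L, and the
    product of the 1 + L_j converges because sum_j L_j does. An element of H^1_0 is handled together
    with its gradient as a family of real functions, with multiplication by i as a map J on it;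
    compactness is proved for test functions and passes to their closure. *)

Lemma measurable_coord n (i : 'I_n) :
  measurable_fun setT (fun v : 'rV[R]_n => v 0 i).
Proof.
rewrite [X in measurable_fun _ X](_ : _ =
    (@tnth n R' ^~ i) \o (@tuple_of_row R n)).
  by apply: measurableT_comp; [exact: measurable_tnth|exact: measurable_tuple_of_row].
by apply/funext => v; rewrite /= tnth_mktuple.
Qed.

Lemma measurable_to_row d (T : measurableType d) n (f : T -> 'rV[R]_n) :
  (forall i, measurable_fun setT (fun x => f x 0 i)) -> measurable_fun setT f.
Proof.
move=> mf _ B [C mC <-]; rewrite !setTI -comp_preimage.
have mtf : measurable_fun setT (@tuple_of_row R n \o f).
  apply/measurable_fun_tnthP => i.
  rewrite [X in measurable_fun _ X](_ : _ = fun x => f x 0 i); first exact: mf.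
  by apply/funext => x; rewrite /= tnth_mktuple.
by rewrite -[X in measurable X]setTI; exact: mtf.
Qed.

Lemma measurable_addrow n :
  measurable_fun setT (fun p : 'rV[R]_n * 'rV[R]_n => p.1 + p.2).
Proof.
apply: measurable_to_row => i.
rewrite [X in measurable_fun _ X](_ : _ =
  (fun p : 'rV[R]_n * 'rV[R]_n => p.1 0 i + p.2 0 i)); last first.
  by apply/funext => p; rewrite mxE.
by apply: measurable_funD; apply: (measurableT_comp (measurable_coord i)).
Qed.

Lemma measurable_fun_addrow d (T : measurableType d) n (f g : T -> 'rV[R]_n) :
  measurable_fun setT f -> measurable_fun setT g ->
  measurable_fun setT (fun x => f x + g x).
Proof.
move=> mf mg; apply: (@measurableT_comp _ _ _ _ _ _
  (fun p : 'rV[R]_n * 'rV[R]_n => p.1 + p.2) _ (fun x => (f x, g x))).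
  exact: measurable_addrow.
by apply/measurable_fun_pairP; split.
Qed.

Lemma measurable_mulmxr m n (A : 'M[R]_(m, n)) :
  measurable_fun setT (fun v : 'rV[R]_m => v *m A).
Proof.
apply: measurable_to_row => i.
rewrite [X in measurable_fun _ X](_ : _ =
  (fun v : 'rV[R]_m => \sum_(j < m) v 0 j * A j i)); last first.
  by apply/funext => p; rewrite mxE.
apply: measurable_sum => j.
by apply: measurable_funM => //; exact: measurable_coord.
Qed.

Lemma measurable_fun_scalerow d (T : measurableType d) n (f : T -> R) (z : 'rV[R]_n) :
  measurable_fun setT f -> measurable_fun setT (fun x => f x *: z).
Proof.
move=> mf; apply: measurable_to_row => i.
rewrite [X in measurable_fun _ X](_ : _ = (fun x => f x * z 0 i)); last first.
  by apply/funext => p; rewrite mxE.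
exact: measurable_funM.
Qed.

Lemma measurable_oppr n : measurable_fun setT (fun v : 'rV[R]_n => - v).
Proof.
apply: measurable_to_row => i.
rewrite [X in measurable_fun _ X](_ : _ = (fun v : 'rV[R]_n => - v 0 i)); last first.
  by apply/funext => p; rewrite mxE.
by apply: measurableT_comp => //; exact: measurable_coord.
Qed.

Lemma measurable_addc n (z : 'rV[R]_n) : measurable_fun setT (fun v : 'rV[R]_n => v + z).
Proof. by apply: measurable_fun_addrow. Qed.

Lemma countable_bigcup_measurable_row (I : countType) d (T : measurableType d)
    (D : set I) (F : I -> set T) :
  (forall i, D i -> measurable (F i)) -> measurable (\bigcup_(i in D) F i).
Proof.
move=> mF; rewrite [X in measurable X](_ : _ = \bigcup_(n in [set: nat])
  (if unpickle n is Some i then if i \in D then F i else set0 else set0)).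
  apply: bigcupT_measurable => n; case: unpickle => // i.
  by case: ifPn => //; rewrite inE => /mF.
apply/seteqP; split => [x [i Di Fix]|x [n _]].
  by exists (pickle i) => //; rewrite pickleK mem_set.
by case: unpickle => // i; case: ifPn => //; rewrite inE => Di Fix; exists i.
Qed.

(* Open sets are countable unions of cubes with rational data. *)
Definition qcube n (q : 'rV[rat]_n * rat) : set 'rV[R]_n :=
  [set v | forall i, `|v 0 i - ratr (q.1 0 i)| < ratr q.2].

Lemma measurable_cube n (p : 'rV[R]_n) (r : R) :
  measurable [set v : 'rV[R]_n | forall i, `|v 0 i - p 0 i| < r].
Proof.
rewrite [X in measurable X](_ : _ = \bigcap_(i in [set: 'I_n])
  ((fun v : 'rV[R]_n => v 0 i - p 0 i) @^-1` [set x | `|x| < r])); last first.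
  by apply/seteqP; split=> v /= h i; [move=> _; exact: h|exact: h].
apply: fin_bigcap_measurable => // i _.
rewrite -[X in measurable X]setTI.
apply: (@measurable_funB _ _ R setT (fun v : 'rV[R]_n => v 0 i) (cst (p 0 i))) => //.
  exact: measurable_coord.
rewrite (_ : [set x | _] = `]-r, r[%classic).
  exact: measurable_itv.
by apply/seteqP; split => x /=; rewrite in_itv/= ltr_norml.
Qed.

(** The sigma-algebra on row vectors is pulled back from tuples, so its relation to the topology has
    to be established: there are countably many rational cubes, and each point of [U] lies in one
    that is contained in [U]. *)
Lemma open_measurable_row n (U : set 'rV[R]_n) : open U -> measurable U.
Proof.
move=> oU.
pose D := [set q : 'rV[rat]_n * rat | qcube q `<=` U].
rewrite [X in measurable X](_ : _ = \bigcup_(q in D) qcube q).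
  apply: countable_bigcup_measurable_row => q _; have := @measurable_cube n (\row_i ratr (q.1 0 i)) (ratr q.2).
  congr measurable; apply/seteqP; split => v /= h i; have := h i; by rewrite mxE.
apply/seteqP; split; last by move=> v [q qU] /qU.
move=> v Uv; have /nbhs_ballP[e /= e0 eU] := open_nbhs_nbhs (conj oU Uv).
(* The radius is below [e / 2]: [v] is within [r] of the rational center, so every point of the cube
   is within [2 * r] of [v]. *)
have [r /andP[r0 re]] : exists r : rat, 0 < (ratr r : R) < e / 2.
  have [r] := @rat_in_itvoo R 0 (e / 2) (divr_gt0 e0 (ltr0n _ 2)).
  by rewrite in_itv/= => h; exists r.
have hq i : exists q : rat, `|v 0 i - ratr q| < ratr r :> R.
  have [q] := @rat_in_itvoo R (v 0 i - ratr r) (v 0 i + ratr r) ltac:(lra).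
  rewrite in_itv/= => /andP[q1 q2]; exists q; rewrite ltr_norml; apply/andP; split; lra.
pose q i := sval (cid (hq i)).
have qP i : `|v 0 i - ratr (q i)| < ratr r :> R by rewrite /q; case: cid.
exists (\row_i q i, r); last by move=> i /=; rewrite mxE; exact: qP.
move=> w /= hw; apply: eU; split => // i j; rewrite ord1 /ball/=.
have := hw j; rewrite /= mxE => h1; have h2 := qP j.
rewrite (_ : v 0 j - w 0 j = (v 0 j - ratr (q j)) - (w 0 j - ratr (q j))); last by ring.
by apply: le_lt_trans (ler_normB _ _) _; lra.
Qed.

Lemma continuous_measurable_row n (D : set 'rV[R]_n) (f : 'rV[R]_n -> R) :
  open D -> {in D, continuous f} -> measurable_fun D f.
Proof.
move=> oD; rewrite -(continuous_open_subspace f oD) => /continuousP cf.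
apply: (measurability _ (RGenOpens.measurableE R)).
move=> _ [_ [a [b ->] <-]]; have := cf _ (@interval_open R (BRight a) (BLeft b) isT isT).
move=> /open_subspaceP [V oV VD].
rewrite setIC -VD; apply: measurableI; exact: open_measurable_row.
Qed.
End row_measurability.

(** * Monotonicity of integrals of nonnegative functions *)

Section integral_monotonicity.
Local Open Scope ereal_scope.
Context d (T : measurableType d) (R : realType).
Variable mu : {measure set T -> \bar R}.

(** The integral of a nonnegative function is the supremum over the simple functions below it, hence
    monotone for arbitrary functions and sets. The comparisons below can thus be made pointwise. *)
Lemma ge0_le_integral_gen (D E : set T) (f g : T -> \bar R) :
  (forall x, D x -> 0 <= f x) -> (forall x, E x -> 0 <= g x) ->
  (forall x, D x -> E x /\ f x <= g x) ->
  \int[mu]_(x in D) f x <= \int[mu]_(x in E) g x.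
Proof.
move=> f0 g0 fg; rewrite integral_mkcond [leRHS]integral_mkcond.
have f0' x : 0 <= (f \_ D) x by rewrite patchE; case: ifPn => // /set_mem/f0.
have g0' x : 0 <= (g \_ E) x by rewrite patchE; case: ifPn => // /set_mem/g0.
rewrite !ge0_integralTE//; apply: ereal_sup_le => _ [h /= hf <-].
exists h => // x; apply: le_trans (hf x) _; rewrite !patchE.
case: ifPn => [/set_mem Dx|_]; first by have [Ex ?] := fg _ Dx; rewrite mem_set.
by case: ifPn => // /set_mem/g0.
Qed.

Lemma ge0_integral_le_set (D E : set T) (f : T -> \bar R) :
  (forall x, E x -> 0 <= f x) -> D `<=` E ->
  \int[mu]_(x in D) f x <= \int[mu]_(x in E) f x.
Proof.
by move=> f0 DE; apply: ge0_le_integral_gen => // x Dx; [exact/f0/DE|split => //; exact: DE].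
Qed.

End integral_monotonicity.

(** * Translation invariance of the Lebesgue measure *)

Section lebesgue_translation.
Context {R : realType}.
Local Notation R' := (measurableTypeR R).
Local Open Scope ereal_scope.

Lemma lebesgue_measure_shift (z : R) (A : set R) : measurable A ->
  lebesgue_measure ((fun x => (x + z)%R) @^-1` A) = lebesgue_measure A.
Proof.
move=> mA; have mf : measurable_fun setT (fun x : R' => (x + z)%R : R').
  by apply: (@measurable_funD _ _ R setT id (cst z)).
apply/esym; rewrite -[RHS]/(pushforward lebesgue_measure (fun x : R' => (x + z)%R : R') A).
apply: lebesgue_measure_unique => //= _ [[a b]] _ <-.
rewrite /pushforward (_ : _ @^-1` _ = `](a - z)%R, (b - z)%R]%classic); last first.
  by apply/seteqP; split => x; rewrite /= !in_itv/= => /andP[h1 h2]; apply/andP; split; lra.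
rewrite !lebesgue_measure_itv/= !lte_fin ltrD2r; case: ifPn => // _.
by rewrite -!EFinB; congr EFin; ring.
Qed.

Definition tuple_shift n (z : 'rV[R]_n) (t : n.-tuple R') : n.-tuple R' :=
  tuple_of_row (row_of_tuple t + z)%R.

Lemma measurable_tuple_shift n (z : 'rV[R]_n) : measurable_fun setT (tuple_shift z).
Proof.
apply: measurableT_comp; first exact: measurable_tuple_of_row.
by apply: measurable_fun_addrow; first exact: measurable_row_of_tuple.
Qed.

Lemma tuple_shift_cons n (z : 'rV[R]_n.+1) (p : R' * n.-tuple R') :
  tuple_shift z (cons_pair p) =
  cons_pair ((p.1 + z ord0 ord0)%R, tuple_shift (\row_i z ord0 (lift ord0 i)) p.2).
Proof.
apply: eq_from_tnth => i; rewrite tnth_mktuple !mxE.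
case: (unliftP ord0 i) => [j ->|->]; last by rewrite !tnth0.
by rewrite !tnthS tnth_mktuple !mxE.
Qed.

(** Induction on [n]: a shift acts separately on head and tail, and a product measure is determined
    by its values on rectangles. *)
Lemma lebesgue_tuple_shift n (z : 'rV[R]_n) (A : set (n.-tuple R')) : measurable A ->
  lebesgue_tuple n (tuple_shift z @^-1` A) = lebesgue_tuple n A.
Proof.
elim: n z A => [|n ih] z A mA.
  congr (lebesgue_tuple 0 _); apply/seteqP; split => t; rewrite /preimage/= ?(tuple0 t) ?(tuple0 (tuple_shift z _))//.
rewrite /= /transport /pushforward -comp_preimage.
set g := fun p : R' * n.-tuple R' =>
  ((p.1 + z ord0 ord0)%R : R', tuple_shift (\row_i z ord0 (lift ord0 i)) p.2).
have mg : measurable_fun setT g.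
  apply/measurable_fun_pairP; split => /=.
    by apply: (@measurable_funD _ _ R setT fst (cst (z ord0 ord0))).
  by apply: (measurableT_comp (measurable_tuple_shift _)).
have mAc : measurable (@cons_pair R n @^-1` A).
  by rewrite -[X in measurable X]setTI; exact: measurable_cons_pair.
rewrite (_ : (tuple_shift z \o @cons_pair R n) = @cons_pair R n \o g); last first.
  by apply/funext => p /=; rewrite tuple_shift_cons.
rewrite comp_preimage -[LHS]/(pushforward (lebesgue_measure \x lebesgue_tuple n) g _).
apply/esym; apply: product_measure_unique => // B C mB mC.
rewrite /= /pushforward (_ : g @^-1` (B `*` C) =
  ((fun x => (x + z ord0 ord0)%R) @^-1` B) `*` (tuple_shift (\row_i z ord0 (lift ord0 i)) @^-1` C)) //.
rewrite product_measure1E.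
- by congr (_ * _); [exact: lebesgue_measure_shift|exact: ih].
- rewrite -[X in measurable X]setTI.
  by apply: (@measurable_funD _ _ R setT id (cst (z ord0 ord0))).
- by rewrite -[X in measurable X]setTI; exact: measurable_tuple_shift.
Qed.

Lemma lebesgue_rowE n (A : set 'rV[R]_n) :
  lebesgue_row n A = lebesgue_tuple n (@row_of_tuple R n @^-1` A).
Proof. by []. Qed.

Lemma lebesgue_row_shift n (z : 'rV[R]_n) (A : set 'rV[R]_n) : measurable A ->
  lebesgue_row n ((fun v => (v + z)%R) @^-1` A) = lebesgue_row n A.
Proof.
move=> mA; rewrite !lebesgue_rowE.
have mB : measurable (@row_of_tuple R n @^-1` A).
  by rewrite -[X in measurable X]setTI; exact: measurable_row_of_tuple.
rewrite -(lebesgue_tuple_shift z mB).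
suff -> : @row_of_tuple R n @^-1` ((fun v => (v + z)%R) @^-1` A) =
    tuple_shift z @^-1` (@row_of_tuple R n @^-1` A) by [].
apply/funext => t; rewrite /preimage/=; congr (A _).
by apply/rowP => i; rewrite !mxE tnth_mktuple !mxE.
Qed.

Lemma lebesgue_row_cube n (p : 'rV[R]_n) (r : R) : (0 < r)%R ->
  lebesgue_row n [set v | forall i, (`|v 0 i - p 0 i| < r)%R] = ((2 * r) ^+ n)%:E.
Proof.
move=> r0; rewrite lebesgue_rowE.
elim: n p => [|n ih] p.
  rewrite (_ : _ @^-1` _ = setT) /= ?diracE ?in_setT ?expr0//.
  by apply/seteqP; split => // t _ [].
rewrite /= -comp_preimage.
rewrite [X in product_measure1 _ _ X](_ : _ = `](p 0 ord0 - r)%R, (p 0 ord0 + r)%R[%classic `*`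
   (@row_of_tuple R n @^-1` [set v : 'rV[R]_n | forall i, (`|v 0 i - (\row_j p 0 (lift ord0 j)) 0 i| < r)%R])).
  rewrite product_measure1E//.
  - rewrite exprS EFinM; congr (_ * _); last exact: ih.
    rewrite -[LHS]/(lebesgue_measure (`](p 0 ord0 - r)%R, (p 0 ord0 + r)%R[%classic : set R)).
    rewrite lebesgue_measure_itv/= lte_fin ifT; last by lra.
    by rewrite -EFinB; congr EFin; ring.
  - by rewrite -[X in measurable X]setTI; apply: measurable_row_of_tuple => //; exact: measurable_cube.
apply/seteqP; split => -[x t] /=; rewrite in_itv/=.
  move=> h; split; first by have := h ord0; rewrite mxE tnth0 ltr_distl.
  by move=> i; have := h (lift ord0 i); rewrite !mxE tnthS.
move=> [h1 h2] i; case: (unliftP ord0 i) => [j ->|->].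
  by have := h2 j; rewrite !mxE tnthS.
by rewrite mxE tnth0 ltr_distl.
Qed.

End lebesgue_translation.

(** * Uniqueness of translation invariant measures *)

Section haar.
Context {R : realType} {n : nat}.
Local Open Scope ereal_scope.
Local Notation V := 'rV[R]_n.
Variables mu lam : {sigma_finite_measure set V -> \bar R}.
Hypothesis mu_inv : forall (z : V) A, measurable A -> mu ((fun v => (v + z)%R) @^-1` A) = mu A.
Hypothesis lam_inv : forall (z : V) A, measurable A -> lam ((fun v => (v + z)%R) @^-1` A) = lam A.

Lemma measurable_preim d d' (T : measurableType d) (T' : measurableType d') (f : T -> T') (A : set T') :
  measurable_fun setT f -> measurable A -> measurable (f @^-1` A).
Proof. by move=> mf mA; rewrite -[X in measurable X]setTI; exact: mf. Qed.

Lemma fubini_set (S : set (V * V)) : measurable S ->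
  \int[mu]_x lam [set y | S (x, y)] = \int[lam]_y mu [set x | S (x, y)].
Proof.
move=> mS; have := @fubini_tonelli _ _ V V R mu lam (fun p => (\1_S p)%:E).
have -> // : (fun x => \int[lam]_y (\1_S (x, y))%:E) = fun x => lam [set y | S (x, y)].
  apply/funext => x; rewrite (_ : (fun y => _) = (fun y => (\1_[set y | S (x, y)] y)%:E)).
    by rewrite integral_indic// ?setIT//; exact: (measurable_preim (pair1_measurable x)).
  by apply/funext => y; rewrite !indicE; congr (_%:R%:E); apply/idP/idP; rewrite !inE.
have -> // : (fun y => \int[mu]_x (\1_S (x, y))%:E) = fun y => mu [set x | S (x, y)].
  apply/funext => y; rewrite (_ : (fun x => _) = (fun x => (\1_[set x | S (x, y)] x)%:E)).
    by rewrite integral_indic// ?setIT//; exact: (measurable_preim (pair2_measurable y)).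
  by apply/funext => x; rewrite !indicE; congr (_%:R%:E); apply/idP/idP; rewrite !inE.
apply.
  apply/measurable_EFinP; exact: measurable_indic.
by move=> x; rewrite lee_fin.
Qed.

(** Tonelli for the pairs with [x + y] in [A] and [y] in [C], whose sections at fixed [y] are
    translates of [A]. Translating [y] by [- x] gives the pairs with [y] in [A] and [y - x] in [C],
    whose sections at fixed [y] are translates of the reflection of [C]. *)
Lemma haar_symmetry A C : measurable A -> measurable C ->
  mu A * lam C = lam A * mu (-%R @^-1` C).
Proof.
move=> mA mC.
have mf1 : measurable_fun setT (fun p : V * V => (p.1 + p.2)%R) by exact: measurable_addrow.
have mf2 : measurable_fun setT (fun p : V * V => (p.2 - p.1)%R).
  by apply: measurable_fun_addrow => //; apply: (measurableT_comp (@measurable_oppr R n)).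
have h1 := @fubini_set [set p | A (p.1 + p.2)%R /\ C p.2]
  (measurableI _ _ (measurable_preim mf1 mA) (measurable_preim (@measurable_snd _ _ V V) mC)).
have h2 := @fubini_set [set p | A p.2 /\ C (p.2 - p.1)%R]
  (measurableI _ _ (measurable_preim (@measurable_snd _ _ V V) mA) (measurable_preim mf2 mC)).
have mnC : measurable (-%R @^-1` C : set V) by exact: (measurable_preim (@measurable_oppr R n)).
have e1 : mu A * lam C = \int[lam]_y mu [set x | A (x + y)%R /\ C y].
  rewrite (eq_integral (fun y => mu A * (\1_C y)%:E)); last first.
    move=> y _; rewrite indicE; have [/set_mem Cy|/negP nCy] := boolP (y \in C).
      rewrite mule1 -(mu_inv y mA); congr (mu _).
      by apply/seteqP; split => // x [].
    rewrite mule0 (_ : [set x | _] = set0) ?measure0//.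
    by apply/seteqP; split => // x [_ Cy]; apply: nCy; rewrite inE.
  rewrite ge0_integralZl//.
  - by rewrite integral_indic// setIT.
  - by apply/measurable_EFinP; exact: measurable_indic.
have e2 : lam A * mu (-%R @^-1` C) = \int[lam]_y mu [set x | A y /\ C (y - x)%R].
  rewrite (eq_integral (fun y => mu (-%R @^-1` C) * (\1_A y)%:E)); last first.
    move=> y _; rewrite indicE; have [/set_mem Ay|/negP nAy] := boolP (y \in A).
      rewrite mule1 -(mu_inv (- y) mnC); congr (mu _).
      by apply/seteqP; split => x /=; rewrite opprD opprK addrC => // -[].
    rewrite mule0 (_ : [set x | _] = set0) ?measure0//.
    by apply/seteqP; split => // x [Ay]; exfalso; apply: nAy; rewrite inE.
  rewrite ge0_integralZl//.
  - by rewrite integral_indic// setIT muleC.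
  - by apply/measurable_EFinP; exact: measurable_indic.
rewrite e1 e2 -h1 -h2; apply: eq_integral => x _.
have mS : measurable [set y | A y /\ C (y - x)%R].
  by apply: measurableI => //; apply: (measurable_preim (@measurable_addc R n (- x))).
rewrite -(lam_inv x mS); congr (lam _).
by apply/seteqP; split => y /=; rewrite addrK addrC.
Qed.

End haar.

(** * Lebesgue measure under isometries and in cylinder coordinates *)

Section lebesgue_haar.
Context {R : realType}.
Local Open Scope ereal_scope.

(** The test set [C] fixes the normalization: the symmetry becomes an equality of [mu A] and
    [lebesgue_row n A] up to the common factor [lebesgue_row n C], which is finite and positive. *)
Lemma haar_unique n (mu : {sigma_finite_measure set 'rV[R]_n -> \bar R}) (C : set 'rV[R]_n) :
  (forall (z : 'rV[R]_n) A, measurable A -> mu ((fun v => (v + z)%R) @^-1` A) = mu A) ->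
  measurable C -> lebesgue_row n C \is a fin_num -> lebesgue_row n C != 0 ->
  mu (-%R @^-1` C) = lebesgue_row n C ->
  forall A, measurable A -> mu A = lebesgue_row n A.
Proof.
move=> inv mC Cfin C0 muC A mA.
have := @haar_symmetry R n mu (lebesgue_row n) inv (@lebesgue_row_shift R n) A C mA mC.
rewrite muC => h.
have Cp : 0 < lebesgue_row n C by rewrite lt0e C0 measure_ge0.
by apply/eqP; rewrite eq_le -(lee_pmul2r Cfin Cp) h lexx -(lee_pmul2r Cfin Cp) h lexx.
Qed.

Lemma dotp_mulmxr n (Q : 'M[R]_n) (v : 'rV[R]_n) : Q *m Q^T = 1%:M ->
  dotp (v *m Q) (v *m Q) = dotp v v.
Proof. by move=> QQ; rewrite /dotp trmx_mul mulmxA -(mulmxA v) QQ mulmx1. Qed.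

Lemma dotpE n (x y : 'rV[R]_n) : dotp x y = (\sum_i x 0 i * y 0 i)%R.
Proof. by rewrite /dotp mxE; apply: eq_bigr => i _; rewrite mxE. Qed.

Lemma dotpN n (x : 'rV[R]_n) : dotp (- x)%R (- x)%R = dotp x x.
Proof. by rewrite !dotpE; apply: eq_bigr => i _; rewrite !mxE mulrNN. Qed.

Lemma dotp_ge0 n (x : 'rV[R]_n) : (0 <= dotp x x)%R.
Proof. by rewrite dotpE; apply: sumr_ge0 => i _; rewrite -expr2 sqr_ge0. Qed.

Lemma measurable_dotp n : measurable_fun setT (fun v : 'rV[R]_n => dotp v v).
Proof.
rewrite (_ : (fun v => _) = (fun v : 'rV[R]_n => \sum_i v 0 i * v 0 i)%R).
  apply: measurable_sum => i; apply: measurable_funM; exact: measurable_coord.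
by apply/funext => v; rewrite dotpE.
Qed.

Lemma lebesgue_row_isometry n (Q : 'M[R]_n) (A : set 'rV[R]_n) : Q *m Q^T = 1%:M ->
  measurable A -> lebesgue_row n ((fun v => v *m Q) @^-1` A) = lebesgue_row n A.
Proof.
move=> QQ mA.
have QQ' : Q^T *m Q = 1%:M by exact: mulmx1C.
have cQ : cancel (fun v : 'rV[R]_n => v *m Q) (fun v => v *m Q^T).
  by move=> v; rewrite -mulmxA QQ mulmx1.
pose mu : {sigma_finite_measure set 'rV[R]_n -> \bar R} :=
  transport (measurable_mulmxr Q) (measurable_mulmxr Q^T) cQ (sigma_finiteT (lebesgue_row n)).
(* With the bound [n + 1] the ball contains the cube of half-side 1 and is contained in that of
   half-side [n + 1], so its measure is positive and finite. *)
pose C := [set v : 'rV[R]_n | (dotp v v < n%:R + 1)%R].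
have mC : measurable C.
  rewrite /C (_ : [set v | _] = (fun v : 'rV[R]_n => dotp v v) @^-1` `]-oo, (n%:R + 1)%R[%classic).
    by apply: measurable_preim => //; exact: measurable_dotp.
  by apply/seteqP; split => v /=; rewrite in_itv.
have hC1 : [set v : 'rV[R]_n | forall i, (`|v 0 i - (0 : 'rV[R]_n) 0 i| < 1)%R] `<=` C.
  move=> v /= h; rewrite /C/= dotpE.
  apply: (@le_lt_trans _ _ (\sum_(i < n) 1)%R); last by rewrite sumr_const card_ord ltrDl.
  apply: ler_sum => i _; have := h i; rewrite mxE subr0 => hi.
  by rewrite -expr2 -real_normK ?num_real// exprn_ile1// ltW.
have hC2 : C `<=` [set v : 'rV[R]_n | forall i, (`|v 0 i - (0 : 'rV[R]_n) 0 i| < n%:R + 1)%R].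
  move=> v; rewrite /C/= dotpE => h i; rewrite mxE subr0.
  have h1 : (`|v 0 i| ^+ 2 < n%:R + 1)%R.
    apply: le_lt_trans h; rewrite real_normK ?num_real// (bigD1 i)//= -expr2 lerDl.
    by apply: sumr_ge0 => j _; rewrite -expr2 sqr_ge0.
  rewrite ltNge; apply/negP => h2; move: h1; apply/negP; rewrite -leNgt.
  have n1 : (1 <= n%:R + 1 :> R)%R by rewrite lerDr.
  apply: (@le_trans _ _ ((n%:R + 1) ^+ 2)%R); first by rewrite ler_eXnr.
  by rewrite ler_sqr// ?nnegrE//; lra.
have -> : lebesgue_row n ((fun v => v *m Q) @^-1` A) = mu A by [].
apply: (@haar_unique n mu C) => //.
- move=> z B mB; rewrite /mu/= /transport /pushforward.
  have mB' : measurable ((fun v => v *m Q) @^-1` B).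
    by apply: measurable_preim => //; exact: measurable_mulmxr.
  rewrite -[RHS]/(lebesgue_row n ((fun v => v *m Q) @^-1` B)) -(lebesgue_row_shift (z *m Q^T) mB').
  rewrite -[LHS]/(lebesgue_row n ((fun v : 'rV[R]_n => v *m Q) @^-1` ((fun v => (v + z)%R) @^-1` B))).
  suff -> : (fun v : 'rV[R]_n => v *m Q) @^-1` ((fun v => (v + z)%R) @^-1` B) =
    (fun v => (v + z *m Q^T)%R) @^-1` ((fun v => v *m Q) @^-1` B) by [].
  by apply/funext => v; rewrite /preimage/=; congr (B _); rewrite mulmxDl -(mulmxA z) QQ' mulmx1.
- rewrite ge0_fin_numE//; apply: (@le_lt_trans _ _ (lebesgue_row n
    [set v : 'rV[R]_n | forall i, (`|v 0 i - (0 : 'rV[R]_n) 0 i| < n%:R + 1)%R])).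
    by apply: le_measure => //; rewrite inE//; exact: measurable_cube.
  by rewrite lebesgue_row_cube ?ltry// addr_gt0// ltr0n.
- rewrite gt_eqF//; apply: (@lt_le_trans _ _ (lebesgue_row n
    [set v : 'rV[R]_n | forall i, (`|v 0 i - (0 : 'rV[R]_n) 0 i| < 1)%R])).
    by rewrite lebesgue_row_cube// lte_fin exprn_gt0.
  by apply: le_measure => //; rewrite inE//; exact: measurable_cube.
- rewrite /mu/= /transport /pushforward.
  suff -> : (fun v : 'rV[R]_n => v *m Q) @^-1` (-%R @^-1` C) = C by [].
  by apply/funext => v; rewrite /preimage /C/= dotpN dotp_mulmxr.
Qed.

Lemma measurable_cyl d : measurable_fun setT (fun p : 'rV[R]_d * measurableTypeR R => cyl p.1 p.2).
Proof.
apply: measurable_to_row => i; case: (splitP i) => j ij.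
  rewrite (_ : (fun x => _) = (fun p : 'rV[R]_d * measurableTypeR R => p.1 ord0 j)).
    by apply: (measurableT_comp (measurable_coord j)).
  by apply/funext => p; rewrite (_ : i = lshift 1 j) ?row_mxEl//; exact/val_inj.
rewrite (_ : (fun x => _) = (fun p : 'rV[R]_d * measurableTypeR R => p.2)).
  exact: measurable_snd.
apply/funext => p; rewrite (_ : i = rshift d ord0); last first.
  by apply/val_inj; rewrite /= ij ord1.
by rewrite row_mxEr mxE eqxx mulr1n.
Qed.

Lemma measurable_uncyl d : measurable_fun setT
  (fun y : 'rV[R]_(d + 1) => (transverse y, axial y) : 'rV[R]_d * measurableTypeR R).
Proof.
apply/measurable_fun_pairP; split => /=.
  apply: measurable_to_row => i /=.
  rewrite (_ : (fun x => _) = (fun y : 'rV[R]_(d + 1) => y ord0 (lshift 1 i))).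
    exact: measurable_coord.
  by apply/funext => y; rewrite /transverse mxE.
rewrite (_ : _ \o _ = (fun y : 'rV[R]_(d + 1) => y ord0 (rshift d ord0))).
  exact: measurable_coord.
by apply/funext => y; rewrite /= /axial mxE.
Qed.

Lemma cyl_lshift d (x : 'rV[R]_d) t i : cyl x t ord0 (lshift 1 i) = x ord0 i.
Proof. by rewrite /cyl row_mxEl. Qed.
Lemma cyl_rshift d (x : 'rV[R]_d) t : cyl x t ord0 (rshift d ord0) = t.
Proof. by rewrite /cyl row_mxEr mxE eqxx mulr1n. Qed.
Lemma transverse_cyl d (x : 'rV[R]_d) t : transverse (cyl x t) = x.
Proof. by rewrite /transverse row_mxKl. Qed.
Lemma axial_cyl d (x : 'rV[R]_d) t : axial (cyl x t) = t.
Proof. by rewrite /axial row_mxKr mxE eqxx mulr1n. Qed.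
Lemma cyl_uncyl d (y : 'rV[R]_(d + 1)) : cyl (transverse y) (axial y) = y.
Proof.
rewrite /cyl /axial /transverse -{3}(hsubmxK y); congr row_mx.
by apply/rowP => i; rewrite !ord1 !mxE eqxx mulr1n.
Qed.
Lemma cylK d : cancel (fun p : 'rV[R]_d * measurableTypeR R => cyl p.1 p.2)
  (fun y => (transverse y, axial y)).
Proof. by move=> [x t]; rewrite transverse_cyl axial_cyl. Qed.
Lemma cylD d (x x' : 'rV[R]_d) t t' : (cyl x t + cyl x' t' = cyl (x + x') (t + t'))%R.
Proof. by rewrite /cyl add_row_mx -raddfD. Qed.

Lemma lebesgue_row_prod_shift d (z : 'rV[R]_d) (t : R) (A : set ('rV[R]_d * measurableTypeR R)) :
  measurable A -> (lebesgue_row d \x lebesgue_measure)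
    ((fun p : 'rV[R]_d * measurableTypeR R => ((p.1 + z)%R, (p.2 + t)%R : measurableTypeR R)) @^-1` A) =
  (lebesgue_row d \x lebesgue_measure) A.
Proof.
move=> mA; set g := fun p => _.
have mg : measurable_fun setT g.
  apply/measurable_fun_pairP; split => /=.
    exact: measurable_fun_addrow.
  by apply: (@measurable_funD _ _ R setT snd (cst t)).
rewrite -[LHS]/(pushforward (lebesgue_row d \x lebesgue_measure) g _).
apply/esym; apply: product_measure_unique; last exact: mA.
move=> D E mD mE.
rewrite -[LHS]/((lebesgue_row d \x lebesgue_measure) (g @^-1` (D `*` E))).
rewrite (_ : g @^-1` (D `*` E) =
  ((fun x => (x + z)%R) @^-1` D) `*` ((fun x => (x + t)%R) @^-1` E)) //.
rewrite product_measure1E.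
- by congr (_ * _); [exact: lebesgue_row_shift|exact: lebesgue_measure_shift].
- by apply: measurable_preim => //; exact: measurable_addc.
- by apply: measurable_preim => //; apply: (@measurable_funD _ _ R setT id (cst t)).
Qed.

(** [lebesgue_row] splits off the first coordinate whereas [cyl] appends the last one. Uniqueness of
    the invariant measure, tested on a symmetric cube, replaces a permutation of the coordinates. *)
Lemma lebesgue_row_cyl d (A : set 'rV[R]_(d + 1)) : measurable A ->
  (lebesgue_row d \x lebesgue_measure) ((fun p : 'rV[R]_d * measurableTypeR R => cyl p.1 p.2) @^-1` A) =
  lebesgue_row (d + 1) A.
Proof.
move=> mA.
pose mu : {sigma_finite_measure set 'rV[R]_(d + 1) -> \bar R} :=
  transport (@measurable_cyl d) (@measurable_uncyl d) (@cylK d)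
   (sigma_finite_prod (lebesgue_row d) lebesgue_measure).
pose C := [set v : 'rV[R]_(d + 1) | forall i, (`|v 0 i - (0 : 'rV[R]_(d + 1)) 0 i| < 1)%R].
have lC : lebesgue_row (d + 1) C = ((2 * 1) ^+ (d + 1))%:E by exact: lebesgue_row_cube.
rewrite -[LHS]/(mu A); apply: (@haar_unique _ mu C) => //.
- move=> z B mB; rewrite /mu/= /transport /pushforward.
  set g := fun p : 'rV[R]_d * measurableTypeR R =>
    ((p.1 + transverse z)%R, (p.2 + axial z)%R : measurableTypeR R).
  have mB' : measurable ((fun p : 'rV[R]_d * measurableTypeR R => cyl p.1 p.2) @^-1` B).
    by apply: measurable_preim => //; exact: measurable_cyl.
  have -> : (fun p : 'rV[R]_d * measurableTypeR R => cyl p.1 p.2) @^-1` ((fun v => (v + z)%R) @^-1` B) =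
       g @^-1` ((fun p : 'rV[R]_d * measurableTypeR R => cyl p.1 p.2) @^-1` B).
    apply/funext => p; rewrite /preimage/=; congr (B _).
    by rewrite -{1}(cyl_uncyl z) cylD.
  exact: lebesgue_row_prod_shift.
- exact: measurable_cube.
- by rewrite lC.
- by rewrite lC eqe gt_eqF// exprn_gt0.
- rewrite lC -[LHS]/((lebesgue_row d \x lebesgue_measure)
    ((fun p : 'rV[R]_d * measurableTypeR R => cyl p.1 p.2) @^-1` (-%R @^-1` C))).
  rewrite [X in product_measure1 _ _ X](_ : _ =
    [set v : 'rV[R]_d | forall i, (`|v 0 i - (0 : 'rV[R]_d) 0 i| < 1)%R] `*` `](-1)%R, 1%R[%classic).
    rewrite product_measure1E//; last exact: measurable_cube.
    rewrite addn1 exprSr EFinM; congr (_ * _); first exact: lebesgue_row_cube.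
    rewrite -[LHS]/(lebesgue_measure (`](-1)%R, 1%R[%classic : set R)).
    rewrite lebesgue_measure_itv/= lte_fin ifT; last by lra.
    by rewrite -EFinB; congr EFin; ring.
  have hC (v : 'rV[R]_(d + 1)) : C (- v)%R <-> forall i, (`|v ord0 i| < 1)%R.
    by split => h i; have := h i; rewrite !mxE subr0 normrN.
  apply/seteqP; split => -[x t] /=; rewrite in_itv/=.
    move=> /hC h; split.
      by move=> i; have := h (lshift 1 i); rewrite cyl_lshift mxE subr0.
    by have := h (rshift d ord0); rewrite cyl_rshift ltr_norml.
  move=> [h1 h2]; apply/hC => i; case: (splitP i) => j ij.
    rewrite (_ : i = lshift 1 j); last exact/val_inj.
    by have := h1 j; rewrite cyl_lshift mxE subr0.
  rewrite (_ : i = rshift d ord0); last by apply/val_inj; rewrite /= ij ord1.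
  by rewrite cyl_rshift ltr_norml.
Qed.

End lebesgue_haar.

(** * Upper gradients and translations *)

Section mean_square.
Context d (T : measurableType d) (R : realType).
Variable mu : {measure set T -> \bar R}.

Lemma integrable_sqr_finite (Q : set T) (f : T -> R) : measurable Q -> (mu Q < +oo)%E ->
  measurable_fun Q f -> (\int[mu]_(x in Q) (f x ^+ 2)%:E < +oo)%E ->
  mu.-integrable Q (EFin \o f).
Proof.
move=> mQ Qoo mf foo; apply/integrableP; split; first exact/measurable_EFinP.
apply: (@le_lt_trans _ _ (\int[mu]_(x in Q) ((f x ^+ 2)%:E + (1 : R)%:E))%E).
  apply: ge0_le_integral_gen => // x Qx.
    by rewrite -EFinD lee_fin addr_ge0// sqr_ge0.
  split => //=; rewrite -EFinD lee_fin.
  have := sqr_ge0 (`|f x| - 1); rewrite sqrrB1 real_normK ?num_real// => h.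
  have := normr_ge0 (f x); lra.
rewrite ge0_integralD//.
- by rewrite -[X in (_ + X)%E]/(\int[mu]_(x in Q) (cst (1 : R)%:E) x)%E integral_cst// mul1e lte_add_pinfty.
- by move=> x _; rewrite lee_fin sqr_ge0.
- by apply/measurable_EFinP; exact: measurable_funX.
Qed.

Lemma integrable_cst_finite (Q : set T) (c : R) : measurable Q -> (mu Q < +oo)%E ->
  mu.-integrable Q (EFin \o cst c).
Proof.
move=> mQ Qoo; apply/integrableP; split; first exact/measurable_EFinP.
rewrite -[X in (X < _)%E]/(\int[mu]_(x in Q) (cst `|c|%:E) x)%E integral_cst//.
by rewrite lte_mul_pinfty ?lee_fin.
Qed.

Lemma RintegralD_cst (Q : set T) (f : T -> R) (c q : R) : measurable Q -> mu Q = q%:E ->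
  mu.-integrable Q (EFin \o f) ->
  (\int[mu]_(x in Q) (f x + c))%R = (\int[mu]_(x in Q) f x)%R + c * q.
Proof.
move=> mQ Qq fi.
rewrite (@RintegralD _ _ _ mu Q f (cst c))// ?Rintegral_cst ?Qq//.
by apply: integrable_cst_finite => //; rewrite Qq ltry.
Qed.

Lemma sqr_integrable (Q : set T) (f : T -> R) : measurable Q ->
  measurable_fun Q f -> (\int[mu]_(x in Q) (f x ^+ 2)%:E < +oo)%E ->
  mu.-integrable Q (EFin \o (fun x => f x ^+ 2)).
Proof.
move=> mQ mf foo; apply/integrableP; split.
  by apply/measurable_EFinP; exact: measurable_funX.
rewrite (eq_integral (fun x => (f x ^+ 2)%:E))// => x _ /=.
by rewrite ger0_norm ?sqr_ge0.
Qed.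

(** Integrate [(f - c) ^+ 2 >= 0] for the mean [c] of [f]; if the integral on the right is infinite
    there is nothing to prove. *)
Lemma sqr_mean_le (Q : set T) (f : T -> R) (q : R) : measurable Q -> mu Q = q%:E -> 0 < q ->
  measurable_fun Q f ->
  (((\int[mu]_(x in Q) f x)%R ^+ 2)%:E <= q%:E * \int[mu]_(x in Q) (f x ^+ 2)%:E)%E.
Proof.
move=> mQ Qq q0 mf.
have [foo|/negP foo] := boolP (\int[mu]_(x in Q) (f x ^+ 2)%:E < +oo)%E; last first.
  rewrite (_ : \int[mu]_(x in Q) _ = +oo)%E.
    by rewrite gt0_muley ?lte_fin ?leey.
  by apply/eqP; move: foo => /negP; rewrite -leNgt leye_eq.
have Qoo : (mu Q < +oo)%E by rewrite Qq ltry.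
have i1 := integrable_sqr_finite mQ Qoo mf foo.
have i2 := sqr_integrable mQ mf foo.
have icst c : mu.-integrable Q (EFin \o cst c) by exact: integrable_cst_finite.
rewrite -(fineK (integrable_fin_num mQ i2)) -EFinM lee_fin.
set m := (\int[mu]_(x in Q) f x)%R.
rewrite -[fine _]/(\int[mu]_(x in Q) (f x ^+ 2))%R.
set s := (\int[mu]_(x in Q) (f x ^+ 2))%R.
pose c := m / q.
have h : 0 <= (\int[mu]_(x in Q) ((f x ^+ 2 - (2 * c) * f x) + c ^+ 2))%R.
  apply: Rintegral_ge0 => x _; rewrite (_ : _ + _ = (f x - c) ^+ 2) ?sqr_ge0//; ring.
have i3 : mu.-integrable Q (EFin \o (fun x => (2 * c) * f x)).
  by apply: (@integrableZl _ _ _ mu Q mQ (2 * c) (EFin \o f)).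
have i4 := @integrableB _ _ _ mu Q mQ (EFin \o (fun x => f x ^+ 2)) _ i2 i3.
rewrite (RintegralD_cst _ mQ Qq i4) RintegralB// RintegralZl// -/m -/s in h.
have e : m ^+ 2 = q * (c * m) by rewrite /c; field; rewrite gt_eqF.
rewrite e ler_pM2l//.
have e2 : c ^+ 2 * q = c * m by rewrite /c; field; rewrite gt_eqF.
move: h; rewrite e2; lra.
Qed.

End mean_square.

Lemma sum_CauchySchwarz (R : realFieldType) (I : finType) (a b : I -> R) :
  (\sum_i a i * b i) ^+ 2 <= (\sum_i a i ^+ 2) * (\sum_i b i ^+ 2).
Proof.
set P := \sum_i a i * b i; set S := \sum_i a i ^+ 2; set B := \sum_i b i ^+ 2.
have S0 : 0 <= S by apply: sumr_ge0 => i _; exact: sqr_ge0.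
have h t : 0 <= t ^+ 2 * S - 2 * t * P + B.
  rewrite (_ : _ + _ = \sum_i (t * a i - b i) ^+ 2).
    by apply: sumr_ge0 => i _; exact: sqr_ge0.
  rewrite /S /P /B !mulr_sumr -sumrB -big_split/=; apply: eq_bigr => i _; ring.
move: S0; rewrite le_eqVlt => /predU1P[S0|S0].
  have P0 : P = 0.
    apply: big1 => i _; have /eqP := esym S0.
    rewrite psumr_eq0; last by move=> j _; exact: sqr_ge0.
    by move=> /allP/(_ i (mem_index_enum i))/=; rewrite sqrf_eq0 => /eqP ->; rewrite mul0r.
  by rewrite P0 expr0n/= -S0 mul0r.
have := h (P / S).
rewrite (_ : _ + B = (S * B - P ^+ 2) / S); last by field; rewrite gt_eqF.
by rewrite pmulr_lge0 ?invr_gt0// subr_ge0.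
Qed.

Lemma cvgr_sum (R : realType) (T I : Type) (F : set_system T) (FF : Filter F) (r : seq I)
    (f : I -> T -> R) (l : I -> R) :
  (forall i, f i @ F --> l i) -> (fun x => \sum_(i <- r) f i x) @ F --> \sum_(i <- r) l i.
Proof.
move=> fl; elim: r => [|i r ih].
  by rewrite big_nil (_ : (fun x => _) = cst 0); [exact: cvg_cst|apply/funext => x; rewrite big_nil].
rewrite big_cons (_ : (fun x => _) = (fun x => f i x + \sum_(j <- r) f j x)); first exact: cvgD.
by apply/funext => x; rewrite big_cons.
Qed.

Section upper_gradient.
Context {R : realType} {n : nat}.
Local Notation V := 'rV[R]_n.
Local Notation lam := (lebesgue_row n).
Local Notation leb := (@lebesgue_measure R).

(* [G] is the square of an upper gradient of [u] along the segments in [D]. *)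
Definition ugrad (D : set V) (u G : V -> R) : Prop :=
  [/\ measurable D, measurable_fun D u, measurable_fun D G, forall x, D x -> 0 <= G x &
   forall x z : V, (forall r : R, 0 <= r <= 1 -> D (x + r *: z)) ->
     (((u (x + z) - u x) ^+ 2)%:E <=
        (dotp z z)%:E * \int[leb]_(r in `[0%R, 1%R]) (G (x + r *: z))%:E)%E].

Lemma ugrad_sub D E u G : ugrad D u G -> measurable E -> E `<=` D -> ugrad E u G.
Proof.
move=> [mD mu mG G0 h] mE ED; split => //.
- exact: measurable_funS mu.
- exact: measurable_funS mG.
- by move=> x /ED; exact: G0.
- by move=> x z hz; apply: h => r /hz /ED.
Qed.

Lemma ugradB D u G c : ugrad D u G -> ugrad D (fun x => u x - c) G.
Proof.
move=> [mD mu mG G0 h]; split => //; first exact: measurable_funB.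
by move=> x z /h; rewrite (_ : u (x + z) - c - (u x - c) = u (x + z) - u x)//; ring.
Qed.

Lemma ge0_integral_shift (z : V) (B : set V) (f : V -> \bar R) :
  measurable B -> measurable_fun B f -> (forall x, B x -> 0 <= f x)%E ->
  (\int[lam]_(x in (fun v => (v + z)%R) @^-1` B) f (x + z)%R = \int[lam]_(x in B) f x)%E.
Proof.
move=> mB mf f0.
rewrite -(ge0_integral_pushforward (@measurable_addc R n z) lam mB mf); last first.
  by move=> x; rewrite inE => /f0.
apply: eq_measure_integral; first exact: measurable_addc.
by move=> ? A mA AB; exact: lebesgue_row_shift.
Qed.

Lemma ge0_integral_shiftT (z : V) (f : V -> \bar R) :
  measurable_fun setT f -> (forall x, 0 <= f x)%E ->
  (\int[lam]_x f (x + z)%R = \int[lam]_x f x)%E.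
Proof.
by move=> mf f0; rewrite -[RHS](ge0_integral_shift z)// preimage_setT.
Qed.

Lemma patch_EFin (D : set V) (G : V -> R) x : ((EFin \o G) \_ D) x = ((G \_ D) x)%:E.
Proof. by rewrite !patchE; case: ifP. Qed.

Lemma dotp0 (z : V) : 0 <= dotp z z. Proof. exact: dotp_ge0. Qed.

Lemma measurable_line (A : set V) (y z : V) : measurable A ->
  measurable ([set r : R | (0 <= r <= 1) /\ A (y - r *: z)] : set (measurableTypeR R)).
Proof.
move=> mA; rewrite [X in measurable X](_ : _ = `[0%R, 1%R]%classic `&` (fun r : measurableTypeR R => y - r *: z) @^-1` A).
  apply: measurableI; first exact: measurable_itv.
  apply: measurable_preim => //; apply: measurable_fun_addrow => //.
  by apply: (measurableT_comp (@measurable_oppr R n)); exact: measurable_fun_scalerow.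
by apply/seteqP; split => r /=; rewrite in_itv.
Qed.

(* [m] bounds the thickness of [A] in the direction [z]. *)
Lemma translation_estimate_thin D u G (A : set V) (z : V) (m : R) : ugrad D u G -> measurable A ->
  (forall (x : V) (r : R), A x -> 0 <= r <= 1 -> D (x + r *: z)) -> 0 <= m ->
  (forall y, (leb [set r : R | (0 <= r <= 1)%R /\ A (y - r *: z)%R] <= m%:E)%E) ->
  (\int[lam]_(x in A) ((u (x + z) - u x) ^+ 2)%:E <=
   (dotp z z * m)%:E * \int[lam]_(x in D) (G x)%:E)%E.
Proof.
move=> [mD mu mG G0 h] mA hA m0 hm.
pose g : V -> R := G \_ D.
have mg : measurable_fun setT g by apply/(measurable_restrict _ mD measurableT).1; rewrite setTI.
have g0 x : 0 <= g x by rewrite /g patchE; case: ifPn => // /set_mem/G0.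
have intg : (\int[lam]_x (g x)%:E = \int[lam]_(x in D) (G x)%:E)%E.
  rewrite [RHS]integral_mkcond; apply: eq_integral => x _.
  by rewrite -patch_EFin.
pose H (p : V * measurableTypeR R) := (\1_A p.1 * (\1_`[0%R, 1%R]%classic p.2 * g (p.1 + p.2 *: z)))%:E.
have mH : measurable_fun setT H.
  apply/measurable_EFinP; apply: measurable_funM.
    by apply: (@measurableT_comp _ _ _ _ _ _ (\1_A : V -> R)) => //; exact: measurable_indic.
  apply: measurable_funM.
    by apply: (@measurableT_comp _ _ _ _ _ _ (\1_`[0%R, 1%R]%classic : measurableTypeR R -> R)) => //; exact: measurable_indic.
  apply: (measurableT_comp mg); apply: measurable_fun_addrow => //.
  exact: measurable_fun_scalerow.
have H0 p : (0 <= H p)%E.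
  by rewrite lee_fin !mulr_ge0 ?indicE.
have mF := @measurable_fun_fubini_tonelli_F _ _ V (measurableTypeR R) R leb H mH H0.
have F0 x : (0 <= \int[leb]_r H (x, r))%E by exact: integral_ge0.
apply: (@le_trans _ _ (\int[lam]_x ((dotp z z)%:E * \int[leb]_r H (x, r)))%E).
  apply: ge0_le_integral_gen => [x _|x _|x Ax].
  - by rewrite lee_fin sqr_ge0.
  - by rewrite mule_ge0// lee_fin dotp0.
  - split => //; apply: le_trans (h x z _) _; first by move=> r; exact: hA.
    apply: lee_pmul; rewrite ?lee_fin ?dotp0//.
      by apply: integral_ge0 => r /= r01; rewrite lee_fin G0//; apply: hA; rewrite // -in_itv.
    rewrite integral_mkcond le_eqVlt; apply/orP; left; apply/eqP.
    apply: eq_integral => r _; rewrite /H/= !indicE mem_set// mul1r patchE.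
    case: ifPn => r01; last by rewrite mul0r.
    rewrite mul1r /g patchE mem_set//; apply: hA => //.
    by move: r01; rewrite inE/= in_itv.
rewrite ge0_integralZl ?lee_fin ?dotp0// EFinM -muleA.
apply: lee_pmul; rewrite ?lee_fin ?dotp0//; first exact: integral_ge0.
rewrite (@fubini_tonelli _ _ V (measurableTypeR R) R lam leb H mH H0).
(* After the substitution of [x - r *: z] for [x] the factor [g] no longer depends on [r], and the
   integral in [r] is the measure of the parameters for which [x - r *: z] lies in [A], at most
   [m]. *)
pose K (p : V * measurableTypeR R) := (\1_A (p.1 - p.2 *: z) * (\1_`[0%R, 1%R]%classic p.2 * g p.1))%:E.
have mK : measurable_fun setT K.
  apply/measurable_EFinP; apply: measurable_funM.
    apply: (@measurableT_comp _ _ _ _ _ _ (\1_A : V -> R) _ (fun p : V * measurableTypeR R => p.1 - p.2 *: z)) => //.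
    apply: measurable_fun_addrow => //; apply: (measurableT_comp (@measurable_oppr R n)).
    exact: measurable_fun_scalerow.
  apply: measurable_funM.
    by apply: (@measurableT_comp _ _ _ _ _ _ (\1_`[0%R, 1%R]%classic : measurableTypeR R -> R)) => //; exact: measurable_indic.
  exact: (measurableT_comp mg).
have K0 p : (0 <= K p)%E by rewrite lee_fin !mulr_ge0 ?indicE.
rewrite (_ : (\int[leb]_r _)%E = (\int[leb]_r \int[lam]_x K (x, r))%E); last first.
  apply: eq_integral => r _; rewrite -[RHS](ge0_integral_shiftT (r *: z)).
  - by apply: eq_integral => x _; rewrite /K /H /= addrK.
  - exact: measurableT_comp mK (pair2_measurable _).
  - by [].
rewrite -(@fubini_tonelli _ _ V (measurableTypeR R) R lam leb K mK K0).
apply: (@le_trans _ _ (\int[lam]_x (m%:E * (g x)%:E))%E); last first.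
  rewrite ge0_integralZl ?lee_fin//.
  - by rewrite intg.
  - exact/measurable_EFinP.
  - by move=> x _; rewrite lee_fin.
apply: ge0_le_integral_gen => [x _|x _|x _].
- exact: integral_ge0.
- by rewrite mule_ge0// lee_fin.
split => //; set B := [set r : R | 0 <= r <= 1 /\ A (x - r *: z)].
have mB : measurable (B : set (measurableTypeR R)) by exact: measurable_line.
rewrite (_ : (\int[leb]_r _)%E = (\int[leb]_r ((g x)%:E * (\1_B r)%:E))%E); last first.
  apply: eq_integral => r _; rewrite /K/= -EFinM !indicE; congr EFin.
  rewrite mulrA mulrC -natrM mulnb; congr (_ * (nat_of_bool _)%:R).
  apply/andP/idP; rewrite !in_setE /= in_itv/=; by case.
rewrite ge0_integralZl ?lee_fin//.
- rewrite integral_indic// setIT muleC; apply: lee_wpmul2r; first by rewrite lee_fin.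
  exact: hm.
- by apply/measurable_EFinP; exact: measurable_indic.
Qed.

Lemma translation_estimate D u G (A : set V) (z : V) : ugrad D u G -> measurable A ->
  (forall (x : V) (r : R), A x -> 0 <= r <= 1 -> D (x + r *: z)) ->
  (\int[lam]_(x in A) ((u (x + z) - u x) ^+ 2)%:E <=
   (dotp z z)%:E * \int[lam]_(x in D) (G x)%:E)%E.
Proof.
move=> ug mA hA; rewrite -[dotp z z]mulr1; apply: translation_estimate_thin => // y.
apply: (@le_trans _ _ (leb (`[0%R, 1%R]%classic : set R))).
  apply: le_measure; rewrite ?inE; [exact: measurable_line|exact: measurable_itv|].
  by move=> r [/=]; rewrite in_itv.
by rewrite lebesgue_measure_itv/= lte_fin ltr01 oppr0 adde0.
Qed.

Definition cube (p : V) (h : R) := [set v : V | forall i, `|v 0 i - p 0 i| < h].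

Lemma measurable_cube' p h : measurable (cube p h). Proof. exact: measurable_cube. Qed.

Lemma cube_segment p h (x y : V) (r : R) : cube p h x -> cube p h (x + y) -> 0 <= r <= 1 -> cube p h (x + r *: y).
Proof.
move=> cx cy /andP[r0 r1] i; have := cx i; have := cy i; rewrite !mxE !ltr_distl.
set a := x 0 i; set b := y 0 i; set c := p 0 i.
move=> /andP[a1 a2] /andP[b1 b2]; have [b0|b0] := leP 0 b.
  have h1 : 0 <= r * b by rewrite mulr_ge0.
  have h2 : r * b <= b by rewrite ler_piMl.
  apply/andP; split; lra.
have h1 : r * b <= 0 by rewrite mulr_ge0_le0// ltW.
have h2 : b <= r * b by rewrite ler_niMl// ltW.
apply/andP; split; lra.
Qed.

Lemma cube_diff p h (x y : V) : cube p h x -> cube p h (x + y) -> cube 0 (2 * h) y.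
Proof.
move=> cx cy i; have := cx i; have := cy i; rewrite !mxE subr0 !ltr_distl ltr_norml.
move=> /andP[a1 a2] /andP[b1 b2]; apply/andP; split; lra.
Qed.

Lemma dotp_cube h z : 0 < h -> cube 0 h z -> dotp z z <= n%:R * h ^+ 2.
Proof.
move=> h0 cz; rewrite dotpE.
apply: (@le_trans _ _ (\sum_(i < n) h ^+ 2)); last by rewrite sumr_const card_ord mulr_natl.
apply: ler_sum => i _; have := cz i; rewrite mxE subr0 => hi.
by rewrite -expr2 -real_normK ?num_real// lerXn2r ?nnegrE ?(ltW h0)// ltW.
Qed.

(** Put [y = x + z] and integrate over [x] first: for fixed [z] the translation estimate applies to
    the [x] for which both ends lie in [Q], the segment between them being in [Q] by convexity. Only
    the [z] in a cube of half-side [h] contribute. *)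
Lemma convex_poincare2 Q h u G : 0 < h -> ugrad Q u G ->
  (forall (x y : V) (r : R), Q x -> Q (x + y) -> 0 <= r <= 1 -> Q (x + r *: y)) ->
  (forall x y : V, Q x -> Q (x + y) -> cube 0 h y) ->
  (\int[lam]_(x in Q) \int[lam]_(y in Q) ((u y - u x) ^+ 2)%:E <=
   ((2 * h) ^+ n * (n%:R * h ^+ 2))%:E * \int[lam]_(x in Q) (G x)%:E)%E.
Proof.
move=> h0 ug segQ diffQ; have [mD mu mG G0 hG] := ug.
pose w : V -> R := u \_ Q.
have mw : measurable_fun setT w by apply/(measurable_restrict _ mD measurableT).1; rewrite setTI.
pose K (q : V * V) := (\1_Q q.1 * \1_Q (q.1 + q.2) * (w (q.1 + q.2) - w q.1) ^+ 2)%:E.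
have mK : measurable_fun setT K.
  have m1 : measurable_fun setT (fun q : V * V => q.1 + q.2) by exact: measurable_addrow.
  have mi : measurable_fun setT (\1_Q : V -> R) by exact: measurable_indic.
  apply/measurable_EFinP; apply: measurable_funM; first apply: measurable_funM.
  - exact: (measurableT_comp mi).
  - exact: (measurableT_comp mi).
  - apply: measurable_funX; apply: measurable_funB; first exact: (measurableT_comp mw).
    exact: (measurableT_comp mw).
have K0 q : (0 <= K q)%E.
  by rewrite lee_fin; apply: mulr_ge0; [rewrite mulr_ge0 ?indicE|exact: sqr_ge0].
apply: (@le_trans _ _ (\int[lam]_x \int[lam]_z K (x, z))%E).
  apply: ge0_le_integral_gen => [x _|x _|x Qx].
  - by apply: integral_ge0 => y _; rewrite lee_fin sqr_ge0.
  - exact: integral_ge0.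
  - split => //.
    pose k y := (\1_Q y * (w y - w x) ^+ 2)%:E.
    rewrite (_ : \int[lam]_z K (x, z) = \int[lam]_z k (z + x)%R)%E; last first.
      apply: eq_integral => z _; rewrite /K /k/= !indicE mem_set// mul1r.
      by rewrite (addrC x).
    rewrite ge0_integral_shiftT; last 2 first.
    + apply/measurable_EFinP; apply: measurable_funM; first exact: measurable_indic.
      by apply: measurable_funX; exact: measurable_funB.
    + by move=> y; rewrite lee_fin mulr_ge0 ?indicE// sqr_ge0.
    apply: ge0_le_integral_gen => [y _|y _|y Qy].
    + by rewrite lee_fin sqr_ge0.
    + by rewrite lee_fin mulr_ge0 ?indicE// sqr_ge0.
    + by split => //; rewrite /k indicE mem_set// mul1r /w !patchE !mem_set.
rewrite (@fubini_tonelli _ _ V V R lam lam K mK K0).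
pose C := ((n%:R * h ^+ 2)%:E * \int[lam]_(x in Q) (G x)%:E)%E.
have C0 : (0 <= C)%E.
  rewrite mule_ge0//; first by rewrite lee_fin mulr_ge0// sqr_ge0.
  by apply: integral_ge0 => x /G0; rewrite lee_fin.
apply: (@le_trans _ _ (\int[lam]_(z in cube 0 h) (cst C z))%E); last first.
  rewrite integral_cst; last exact: measurable_cube'.
  rewrite [X in (_ * X <= _)%E](_ : _ = ((2 * h) ^+ n)%:E); last by exact: lebesgue_row_cube.
  by rewrite /C muleC EFinM muleA.
rewrite (integral_mkcond (cube 0 h)).
apply: ge0_le_integral_gen => [z _|z _|z _].
- exact: integral_ge0.
- by rewrite patchE; case: ifP.
- split => //; rewrite patchE; case: ifPn => [/set_mem zc|/negP nzc]; last first.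
    rewrite integral0_eq// => x _; rewrite /K/=.
    rewrite !indicE; have [/set_mem Qx|_] := boolP (x \in Q); last by rewrite !mul0r.
    rewrite mul1r; have [/set_mem Qxz|_] := boolP (x + z \in Q); last by rewrite mul0r.
    by exfalso; apply: nzc; rewrite inE; exact: (diffQ _ _ Qx Qxz).
  pose A := [set x | Q x /\ Q (x + z)].
  have mA : measurable A.
    by apply: measurableI => //; apply: (@measurable_preim _ _ _ _ (fun x : V => x + z)) => //; exact: measurable_addc.
  have hA : forall (x : V) (r : R), A x -> 0 <= r <= 1 -> Q (x + r *: z).
    by move=> x r [Qx Qxz]; exact: segQ.
  apply: (@le_trans _ _ (\int[lam]_(x in A) ((u (x + z) - u x) ^+ 2)%:E)%E).
    rewrite [leRHS]integral_mkcond.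
    apply: ge0_le_integral_gen => [//|x _|x _].
      by rewrite patchE; case: ifP => // _; rewrite lee_fin sqr_ge0.
    split => //; rewrite /K/= patchE !indicE.
    case: ifPn => [/set_mem[Qx Qxz]|/negP nA].
      by rewrite !mem_set// !mul1r lee_fin /w !patchE !mem_set.
    have [/set_mem Qx|_] := boolP (x \in Q); last by rewrite !mul0r.
    have [/set_mem Qxz|_] := boolP (x + z \in Q); last by rewrite mulr0 mul0r.
    by exfalso; apply: nA; rewrite inE.
  apply: le_trans (translation_estimate ug mA hA) _.
  apply: lee_pmul; rewrite ?lee_fin ?dotp0//.
    by apply: integral_ge0 => x /G0; rewrite lee_fin.
  exact: dotp_cube.
Qed.

(** [u x - m] is the average over [y] of [u x - u y], so the Cauchy-Schwarz inequality reduces the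
    claim to the double integral. *)
Lemma convex_poincare Q q h u G m : 0 < h -> ugrad Q u G ->
  (forall (x y : V) (r : R), Q x -> Q (x + y) -> 0 <= r <= 1 -> Q (x + r *: y)) ->
  (forall x y : V, Q x -> Q (x + y) -> cube 0 h y) ->
  lam Q = q%:E -> 0 < q -> m = (\int[lam]_(y in Q) u y)%R / q ->
  (\int[lam]_(x in Q) ((u x - m) ^+ 2)%:E <=
   (q^-1 * ((2 * h) ^+ n * (n%:R * h ^+ 2)))%:E * \int[lam]_(x in Q) (G x)%:E)%E.
Proof.
move=> h0 ug segQ diffQ Qq q0 mE; have [mD mu mG G0 hG] := ug.
have hP := convex_poincare2 h0 ug segQ diffQ.
have hx x : Q x -> (((u x - m) ^+ 2)%:E <= (q^-1)%:E * \int[lam]_(y in Q) ((u y - u x) ^+ 2)%:E)%E.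
  move=> Qx.
  have mf : measurable_fun Q (fun y => u y - u x) by exact: measurable_funB.
  have [foo|/negP foo] := boolP (\int[lam]_(y in Q) ((u y - u x) ^+ 2)%:E < +oo)%E; last first.
    rewrite (_ : \int[lam]_(x in Q) _ = +oo)%E.
      by rewrite gt0_muley ?lte_fin ?invr_gt0 ?leey.
    by apply/eqP; move: foo => /negP; rewrite -leNgt leye_eq.
  have := sqr_mean_le mD Qq q0 mf.
  have Qoo : (lam Q < +oo)%E by rewrite Qq ltry.
  have i1 := integrable_sqr_finite mD Qoo mf foo.
  have icst c : lam.-integrable Q (EFin \o cst c) by exact: integrable_cst_finite.
  have -> : (\int[lam]_(y in Q) (u y - u x))%R = q * (m - u x).
    have : (\int[lam]_(y in Q) ((u y - u x) + u x))%R = (\int[lam]_(y in Q) u y)%R.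
      by apply: eq_Rintegral => y _; rewrite /= subrK.
    rewrite (RintegralD_cst (u x) mD Qq i1) mE => <-.
    by field; rewrite gt_eqF.
  move=> h1; have i2 := sqr_integrable mD mf foo.
  rewrite -(fineK (integrable_fin_num mD i2)) -EFinM lee_fin in h1 *.
  rewrite -EFinM lee_fin.
  rewrite -(@ler_pM2l _ (q ^+ 2)); last exact: exprn_gt0.
  rewrite (_ : q ^+ 2 * (u x - m) ^+ 2 = (q * (m - u x)) ^+ 2); last by ring.
  by apply: le_trans h1 _; rewrite expr2 -!mulrA mulVKf ?gt_eqF.
apply: (@le_trans _ _ (\int[lam]_(x in Q) ((q^-1)%:E * \int[lam]_(y in Q) ((u y - u x) ^+ 2)%:E))%E).
  apply: ge0_le_integral_gen => [x _|x _|x Qx].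
  - by rewrite lee_fin sqr_ge0.
  - apply: mule_ge0; first by rewrite lee_fin invr_ge0 ltW.
    apply: integral_ge0 => y _.
    by rewrite lee_fin sqr_ge0.
  - by split => //; exact: hx.
have mw : measurable_fun setT (u \_ Q : V -> R).
  by apply/(measurable_restrict _ mD measurableT).1; rewrite setTI.
have mI : measurable_fun setT (fun x => \int[lam]_y (\1_Q y * ((u \_ Q) y - (u \_ Q) x) ^+ 2)%:E)%E.
  apply: (@measurable_fun_fubini_tonelli_F _ _ V V R lam
    (fun p : V * V => (\1_Q p.2 * ((u \_ Q) p.2 - (u \_ Q) p.1) ^+ 2)%:E)).
    have mi : measurable_fun setT (\1_Q : V -> R) by exact: measurable_indic.
    apply/measurable_EFinP; apply: measurable_funM; first exact: (measurableT_comp mi).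
    apply: measurable_funX; apply: measurable_funB; first exact: (measurableT_comp mw).
    exact: (measurableT_comp mw).
  by move=> z; rewrite lee_fin mulr_ge0 ?indicE// sqr_ge0.
rewrite ge0_integralZl//.
- rewrite EFinM -muleA; apply: lee_pmul => //; first by rewrite lee_fin invr_ge0 ltW.
  by apply: integral_ge0 => x _; apply: integral_ge0 => y _; rewrite lee_fin sqr_ge0.
- apply: (eq_measurable_fun (fun x => \int[lam]_y (\1_Q y * ((u \_ Q) y - (u \_ Q) x) ^+ 2)%:E)%E).
    move=> x Qx; rewrite [RHS]integral_mkcond; apply: eq_integral => y _.
    rewrite indicE !patchE Qx; case: ifPn => Qy; rewrite ?mul1r ?mul0r//.
  exact: measurable_funTS.
- by move=> x _; apply: integral_ge0 => y _; rewrite lee_fin sqr_ge0.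
- by rewrite lee_fin invr_ge0 ltW.
Qed.

Lemma cube_poincare p h u G : 0 < h -> ugrad (cube p h) u G ->
  exists m, (\int[lam]_(x in cube p h) ((u x - m) ^+ 2)%:E <=
   ((2 ^+ n * n%:R * 4) * h ^+ 2)%:E * \int[lam]_(x in cube p h) (G x)%:E)%E.
Proof.
move=> h0 ug; exists ((\int[lam]_(y in cube p h) u y)%R / (2 * h) ^+ n).
have q0 : 0 < (2 * h) ^+ n by rewrite exprn_gt0// mulr_gt0.
apply: le_trans (@convex_poincare _ ((2 * h) ^+ n) (2 * h) u G _ _ ug _ _ _ q0 erefl) _.
- by rewrite mulr_gt0.
- by move=> x y r; exact: cube_segment.
- by move=> x y; exact: cube_diff.
- exact: lebesgue_row_cube.
rewrite le_eqVlt; apply/orP; left; apply/eqP; congr (_%:E * _)%E.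
by rewrite (exprMn _ 2 (2 * h)); field; rewrite gt_eqF.
Qed.

(** The fundamental theorem of calculus along the segment, followed by the Cauchy-Schwarz inequality
    in the parameter and in the components of the gradient. *)
Lemma C1_ugrad m (D : set V) (f : V -> 'rV[R]_m) df (b : 'I_m) : open D -> C1_on D f df ->
  ugrad D (fun x => f x ord0 b) (fun x => \sum_j (df x j b) ^+ 2).
Proof.
move=> oD [cf cdf Jf].
have mD := open_measurable_row oD.
have cf' : {in D, continuous f} by rewrite -(continuous_open_subspace f oD).
have cdf' : {in D, continuous df} by rewrite -(continuous_open_subspace df oD).
have cu : {in D, continuous (fun x => f x ord0 b)}.
  by move=> x Dx; apply: (@continuous_comp _ _ _ f (fun M : 'rV[R]_m => M ord0 b)); [exact: cf'|exact: coord_continuous].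
have cdj j : {in D, continuous (fun x => df x j b)}.
  by move=> x Dx; apply: (@continuous_comp _ _ _ df (fun M : 'M[R]_(n, m) => M j b)); [exact: cdf'|exact: coord_continuous].
have cG : {in D, continuous (fun x => \sum_j (df x j b) ^+ 2)}.
  move=> x Dx; apply: (@cvgr_sum _ _ _ _ (nbhs_filter x)) => j; rewrite expr2.
  rewrite [X in X @ _ --> _](_ : _ = (fun y => df y j b * df y j b)).
    by apply: cvgM; exact: cdj.
  by apply/funext => y; rewrite expr2.
split => //.
- exact: continuous_measurable_row.
- exact: continuous_measurable_row.
- by move=> x _; apply: sumr_ge0 => j _; exact: sqr_ge0.
move=> x z hz.
pose g (y : V) : R := f y ord0 b.
pose phi (r : R) : R := g (x + r *: z).
pose dphi (r : R) := \sum_j z ord0 j * df (x + r *: z) j b.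
have cseg : continuous (fun r : R => x + r *: z).
  by move=> r; apply: cvgD; [exact: cvg_cst|apply: cvgZr_tmp; exact: cvg_id].
have cin (h : V -> R) : {in D, continuous h} -> {in `[0%R, 1%R]%classic, continuous (fun r : R => h (x + r *: z))}.
  move=> ch r /set_mem; rewrite /= in_itv/= => r01.
  apply: (@continuous_comp _ _ _ (fun r : R => x + r *: z) h); first exact: cseg.
  by apply: ch; rewrite inE; exact: hz.
have dphiP (r : R) : 0 <= r <= 1 -> derivable phi r 1 /\ phi^`()%classic r = dphi r.
  move=> r01; have [df_ Je] := Jf _ (open_nbhs_nbhs (conj oD (hz _ r01))).
  have dg : derivable g (x + r *: z) z.
    have := (@derivable_mxP _ _ _ _ f (x + r *: z) z).1 (diff_derivable df_); exact.
  have E : (fun h : R => h^-1 *: ((phi \o shift r) (h *: (1 : R)) - phi r)) =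
     (fun h => h^-1 *: ((g \o shift (x + r *: z)) (h *: z) - g (x + r *: z))).
    apply/funext => h /=; rewrite /phi; congr (_ *: (g _ - _)).
    by rewrite scalerDl /GRing.scale/= mulr1 addrCA.
  split; first by rewrite /derivable E.
  rewrite derive1E /derive E -/(derive g (x + r *: z) z).
  have := deriveEjacobian z df_; rewrite derive_mx; last exact: diff_derivable.
  move=> /matrixP/(_ ord0 b); rewrite !mxE => ->.
  by rewrite Je.
have cdphi : {within `[0%R, 1%R], continuous dphi}.
  apply: continuous_in_subspaceT => r r01; apply: (@cvgr_sum _ _ _ _ (nbhs_filter r)) => j.
  by apply: cvgM; [exact: cvg_cst|exact: (cin _ (cdj j))].
have FTC : (\int[leb]_(r in `[0%R, 1%R]) (dphi r)%:E = (phi 1)%:E - (phi 0)%:E)%E.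
  apply: continuous_FTC2 => //.
    have cphi : {in `[0%R, 1%R]%classic, continuous phi} by exact: cin.
    split.
    - by move=> r; rewrite in_itv/= => /andP[r0 r1]; apply: (dphiP r _).1; rewrite !ltW.
    - by apply: cvg_at_right_filter; apply: cphi; rewrite inE/= in_itv/= lexx ler01.
    - by apply: cvg_at_left_filter; apply: cphi; rewrite inE/= in_itv/= lexx ler01.
  by move=> r; rewrite in_itv/= => /andP[r0 r1]; apply: (dphiP r _).2; rewrite !ltW.
have mdphi : measurable_fun (`[0%R, 1%R]%classic : set (measurableTypeR R)) dphi by apply: subspace_continuous_measurable_fun; [exact: measurable_itv|exact: cdphi].
have leb1 : leb (`[0%R, 1%R]%classic : set R) = (1 : R)%:E.
  by rewrite lebesgue_measure_itv/= lte_fin ltr01 oppr0 adde0.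
have := @sqr_mean_le _ (measurableTypeR R) R leb `[0%R, 1%R]%classic dphi 1 (measurable_itv _) leb1 ltr01 mdphi.
rewrite /Rintegral FTC -EFinB/= mul1e /phi scale1r scale0r addr0 => /le_trans; apply.
have mGz : measurable_fun (`[0%R, 1%R]%classic : set (measurableTypeR R)) (fun r : R => (\sum_j (df (x + r *: z) j b) ^+ 2)%:E).
  apply/measurable_EFinP; apply: subspace_continuous_measurable_fun => //.
  apply: continuous_in_subspaceT => r r01; exact: (cin _ cG).
rewrite -ge0_integralZl//; last 2 first.
- by move=> r _; rewrite lee_fin; apply: sumr_ge0 => j _; exact: sqr_ge0.
- by rewrite lee_fin dotp0.
apply: ge0_le_integral_gen => [r _|r _|r r01].
- by rewrite lee_fin sqr_ge0.
- by rewrite -EFinM lee_fin mulr_ge0 ?dotp0//; apply: sumr_ge0 => j _; exact: sqr_ge0.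
- split => //; rewrite -EFinM lee_fin dotpE.
  under [X in _ <= X * _]eq_bigr do rewrite -expr2.
  exact: sum_CauchySchwarz.
Qed.

End upper_gradient.

(** * Chains of translations in a domain *)

Section integral_cover.
Context d (T : measurableType d) (R : realType).
Variable mu : {measure set T -> \bar R}.

Lemma ge0_integral_cover_le (I : eqType) (s : seq I) (F : I -> set T) (D : set T) (g : T -> \bar R) :
  measurable D -> (forall i, measurable (F i)) -> measurable_fun D g -> (forall x, D x -> 0 <= g x)%E ->
  (forall x, D x -> exists2 i, i \in s & F i x) ->
  (\int[mu]_(x in D) g x <= \sum_(i <- s) \int[mu]_(x in D `&` F i) g x)%E.
Proof.
move=> mD mF mg g0 cov.
have mFi i : measurable (D `&` F i) by exact: measurableI.
have m1 i : measurable_fun setT (g \_ (D `&` F i)).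
  apply/(measurable_restrict _ (mFi i) measurableT).1.
  by rewrite setTI; apply: measurable_funS mg.
have p1 i x : (0 <= (g \_ (D `&` F i)) x)%E.
  by rewrite patchE; case: ifPn => // /set_mem[Dx _]; exact: g0.
under eq_bigr do rewrite integral_mkcond.
rewrite -ge0_integral_sum// integral_mkcond.
apply: ge0_le_integral_gen => [x _|x _|x _].
- by rewrite patchE; case: ifPn => // /set_mem/g0.
- by apply: sume_ge0 => i _.
split => //; rewrite patchE; case: ifPn => [/set_mem Dx|_]; last by apply: sume_ge0.
have [i si Fix] := cov _ Dx.
rewrite (big_rem i)//= {1}patchE mem_set//.
by rewrite leeDl// sume_ge0.
Qed.

Lemma sum_integral_le (I : finType) (P : pred I) (F : I -> set T) (D : set T) (g : T -> \bar R) :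
  measurable D -> (forall i, measurable (F i)) -> (forall i, P i -> F i `<=` D) -> trivIset setT F ->
  measurable_fun D g -> (forall x, D x -> 0 <= g x)%E ->
  (\sum_(i | P i) \int[mu]_(x in F i) g x <= \int[mu]_(x in D) g x)%E.
Proof.
move=> mD mF FD tF mg g0; rewrite -big_filter.
set s := [seq i <- _ | _].
have sP i : i \in s -> F i `<=` D by rewrite mem_filter => /andP[/FD].
have UD : \big[setU/set0]_(i <- s) F i `<=` D.
  by rewrite -bigcup_seq => x [i /= si]; exact: sP.
rewrite -ge0_integral_bigsetU//.
- exact: ge0_integral_le_set.
- by rewrite filter_uniq// index_enum_uniq.
- exact: sub_trivIset tF.
- exact: measurable_funS mg.
- by move=> x /UD; exact: g0.
Qed.
End integral_cover.

Lemma combine_estimates (R : realType) (a b s : R) (X Y : \bar R) :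
  0 <= a -> 0 <= b -> 0 <= s -> (0 <= X)%E -> (0 <= Y)%E ->
  (a%:E * X + (s * b)%:E * Y <= (a + b + 1)%:E * (X + s%:E * Y))%E.
Proof.
move=> a0 b0 s0 X0 Y0; rewrite ge0_muleDr ?mule_ge0 ?lee_fin//.
apply: leeD; first by apply: lee_pmul => //; rewrite lee_fin; lra.
rewrite muleA -EFinM; apply: lee_pmul => //; rewrite lee_fin.
  by rewrite mulr_ge0.
by rewrite mulrC ler_wpM2r//; lra.
Qed.

Section chains.
Context {R : realType} {n : nat}.
Local Notation V := 'rV[R]_n.
Local Notation lam := (lebesgue_row n).

(* [A] is carried inside [D] into [W] by the successive translations [zs]. *)
Fixpoint chain (D A : set V) (zs : seq V) (W : set V) : Prop :=
  if zs is z :: zs' then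
    (forall (x : V) (r : R), A x -> 0 <= r <= 1 -> D (x + r *: z)) /\
    chain D [set v | A (v - z)] zs' W
  else A `<=` W.

(** The factor of the energy in [chain_estimate]: each translation splits a square by [sqr_split],
    which doubles the cost of all translations after it. *)
Fixpoint chain_cost (zs : seq V) : R :=
  if zs is z :: zs' then 2 * dotp z z + 2 * chain_cost zs' else 0.

Lemma chain_cost_ge0 zs : 0 <= chain_cost zs.
Proof. by elim: zs => //= z zs ih; rewrite addr_ge0// mulr_ge0// dotp_ge0. Qed.

Lemma chain_subset D A A' zs W : chain D A zs W -> A' `<=` A -> chain D A' zs W.
Proof.
elim: zs A A' => [|z zs ih] A A' /= ; first by move=> AW AA; exact: subset_trans AW.
move=> [h1 h2] AA; split; first by move=> x r /AA; exact: h1.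
by apply: ih h2 _ => v; exact: AA.
Qed.

Lemma sqr_split (a b : R) : a ^+ 2 <= 2 * b ^+ 2 + 2 * (b - a) ^+ 2.
Proof. have := sqr_ge0 (2 * b - a); nra. Qed.

Lemma chain_estimate D u G A zs W : ugrad D u G -> measurable A -> A `<=` D ->
  W `<=` D -> chain D A zs W ->
  (\int[lam]_(x in A) (u x ^+ 2)%:E <=
   (2 ^+ size zs)%:E * \int[lam]_(x in W) (u x ^+ 2)%:E +
   (chain_cost zs)%:E * \int[lam]_(x in D) (G x)%:E)%E.
Proof.
move=> ug; have [mD mu mG G0 _] := ug.
have GI0 : (0 <= \int[lam]_(x in D) (G x)%:E)%E by apply: integral_ge0 => x /G0; rewrite lee_fin.
elim: zs A => [|z zs ih] A mA AD WD /= ch.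
  rewrite expr0 mul1e mul0e adde0; apply: ge0_integral_le_set => // x _.
  by rewrite lee_fin sqr_ge0.
move: ch => [h1 h2].
have mA' : measurable [set v | A (v - z)].
  by apply: (@measurable_preim _ _ _ _ (fun v : V => v - z)) => //; exact: measurable_addc.
have A'D : [set v | A (v - z)] `<=` D.
  by move=> v /= Av; have := h1 _ 1 Av; rewrite ler01 lexx scale1r subrK; exact.
have IH := ih _ mA' A'D WD h2.
pose w : V -> R := u \_ D.
have mw : measurable_fun setT w.
  by apply/(measurable_restrict _ mD measurableT).1; rewrite setTI.
have wE x : D x -> w x = u x by move=> Dx; rewrite /w patchE mem_set.
have mwz : measurable_fun setT (fun x : V => w (x + z)).
  by apply: (measurableT_comp mw); exact: measurable_addc.
have Dz x : A x -> D (x + z) by move=> Ax; have := h1 _ 1 Ax; rewrite ler01 lexx scale1r; exact.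
apply: (@le_trans _ _ (\int[lam]_(x in A) ((2%:E * (w (x + z)%R ^+ 2)%:E) + 2%:E * ((w (x + z)%R - w x) ^+ 2)%:E))%E).
  apply: ge0_le_integral_gen => [x _|x _|x Ax].
  - by rewrite lee_fin sqr_ge0.
  - by rewrite -!EFinM -EFinD lee_fin addr_ge0// mulr_ge0// sqr_ge0.
  - by split => //; rewrite -!EFinM -EFinD lee_fin !wE; [exact: sqr_split|exact: AD|exact: Dz].
have mm1 : measurable_fun A (fun x : V => (w (x + z) ^+ 2)%:E).
  by apply/measurable_EFinP; apply: measurable_funX; exact: measurable_funTS.
have mm2 : measurable_fun A (fun x : V => ((w (x + z) - w x) ^+ 2)%:E).
  apply/measurable_EFinP; apply: measurable_funX; apply: measurable_funTS.
  exact: measurable_funB.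
rewrite ge0_integralD//; last 4 first.
- by move=> x _; rewrite -EFinM lee_fin mulr_ge0// sqr_ge0.
- exact: measurable_funeM.
- by move=> x _; rewrite -EFinM lee_fin mulr_ge0// sqr_ge0.
- exact: measurable_funeM.
rewrite !ge0_integralZl//; last 2 first.
- by move=> x _; rewrite lee_fin sqr_ge0.
- by move=> x _; rewrite lee_fin sqr_ge0.
have e1 : (\int[lam]_(x in A) (w (x + z)%R ^+ 2)%:E = \int[lam]_(x in [set v | A (v - z)%R]) (u x ^+ 2)%:E)%E.
  rewrite -(ge0_integral_shift z mA'); last 2 first.
  - by apply/measurable_EFinP; apply: measurable_funX; exact: measurable_funS mu.
  - by move=> x _; rewrite lee_fin sqr_ge0.
  rewrite (_ : _ @^-1` _ = A); last first.
    by apply/seteqP; split => x /=; rewrite addrK.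
  by apply: eq_integral => x /set_mem Ax; rewrite wE//; exact: Dz.
have e2 : (\int[lam]_(x in A) ((w (x + z)%R - w x) ^+ 2)%:E <= (dotp z z)%:E * \int[lam]_(x in D) (G x)%:E)%E.
  apply: le_trans (translation_estimate ug mA h1).
  apply: ge0_le_integral_gen => [x _|x _|x Ax]; rewrite ?lee_fin ?sqr_ge0//.
  by split => //; rewrite !wE//; [exact: AD|exact: Dz].
apply: (@le_trans _ _ (2%:E * ((2 ^+ size zs)%:E * \int[lam]_(x in W) (u x ^+ 2)%:E +
   (chain_cost zs)%:E * \int[lam]_(x in D) (G x)%:E) +
   2%:E * ((dotp z z)%:E * \int[lam]_(x in D) (G x)%:E))%E).
  by apply: leeD; apply: lee_pmul => //; rewrite ?e1// integral_ge0// => x _; rewrite lee_fin sqr_ge0.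
have W0 : (0 <= \int[lam]_(x in W) (u x ^+ 2)%:E)%E by apply: integral_ge0 => x _; rewrite lee_fin sqr_ge0.
rewrite ge0_muleDr; last 2 first.
- by rewrite mule_ge0.
- by rewrite mule_ge0// lee_fin chain_cost_ge0.
rewrite !muleA -!EFinM exprS -addeA leeD2l// EFinD ge0_muleDl ?lee_fin ?mulr_ge0 ?dotp_ge0 ?chain_cost_ge0//.
by rewrite addeC.
Qed.


Lemma cover_estimate (I : eqType) (s : seq I) (A : I -> set V) (zs : I -> seq V) D W u G :
  ugrad D u G -> W `<=` D -> (forall i, measurable (A i)) ->
  (forall i, i \in s -> chain D (D `&` A i) (zs i) W) ->
  (forall x, D x -> exists2 i, i \in s & A i x) ->
  (\int[lam]_(x in D) (u x ^+ 2)%:E <=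
   (\sum_(i <- s) 2 ^+ size (zs i))%:E * \int[lam]_(x in W) (u x ^+ 2)%:E +
   (\sum_(i <- s) chain_cost (zs i))%:E * \int[lam]_(x in D) (G x)%:E)%E.
Proof.
move=> ug WD mA chA cov; have [mD mu mG G0 _] := ug.
have GI0 : (0 <= \int[lam]_(x in D) (G x)%:E)%E by apply: integral_ge0 => x /G0; rewrite lee_fin.
have W0 : (0 <= \int[lam]_(x in W) (u x ^+ 2)%:E)%E by apply: integral_ge0 => x _; rewrite lee_fin sqr_ge0.
apply: le_trans (ge0_integral_cover_le lam mD mA _ _ cov) _.
- by apply/measurable_EFinP; exact: measurable_funX.
- by move=> x _; rewrite lee_fin sqr_ge0.
rewrite -!sumEFin !ge0_sume_distrl; last 2 first.
- by move=> i _; rewrite lee_fin chain_cost_ge0.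
- by move=> i _; rewrite lee_fin exprn_ge0.
rewrite -big_split/= big_seq [leRHS]big_seq.
apply: lee_sum => i si; apply: (chain_estimate ug) => //; last exact: chA.
exact: measurableI.
Qed.

Lemma dilateE (t : R) (A : set V) v : 0 < t -> dilate t A v <-> A (t^-1 *: v).
Proof.
move=> t0; split => [[x Ax <-]|Av]; first by rewrite scalerA mulVf ?gt_eqF// scale1r.
by exists (t^-1 *: v) => //; rewrite scalerA divff ?gt_eqF// scale1r.
Qed.

Lemma measurable_dilate t (A : set V) : 0 < t -> measurable A -> measurable (dilate t A).
Proof.
move=> t0 mA; rewrite (_ : dilate t A = (fun v : V => t^-1 *: v) @^-1` A).
  apply: measurable_preim => //; apply: measurable_to_row => i.
  rewrite (_ : (fun x => _) = (fun v : V => t^-1 * v ord0 i)).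
    by apply: measurable_funM => //; exact: measurable_coord.
  by apply/funext => v; rewrite mxE.
by apply/seteqP; split => v; rewrite dilateE.
Qed.

Lemma dilate_subset t (A B : set V) : A `<=` B -> dilate t A `<=` dilate t B.
Proof. by move=> AB _ [x /AB Bx <-]; exists x. Qed.

Lemma chain_dilate t D A zs W : 0 < t -> chain D A zs W ->
  chain (dilate t D) (dilate t A) [seq t *: z | z <- zs] (dilate t W).
Proof.
move=> t0; elim: zs A => [|z zs ih] A /=; first exact: dilate_subset.
move=> [h1 h2]; split.
  move=> _ r [x Ax <-] r01; exists (x + r *: z); first exact: h1.
  by rewrite scalerDr !scalerA (mulrC t).
apply: chain_subset (ih _ h2) _ => v /=; rewrite !dilateE//=.
by rewrite scalerBr scalerA mulVf ?gt_eqF// scale1r.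
Qed.

Lemma dotpZ t (z : V) : dotp (t *: z) (t *: z) = t ^+ 2 * dotp z z.
Proof.
rewrite !dotpE mulr_sumr; apply: eq_bigr => i _; rewrite !mxE expr2.
by rewrite mulrACA.
Qed.

Lemma chain_cost_dilate t zs : chain_cost [seq t *: z | z <- zs] = t ^+ 2 * chain_cost zs.
Proof. by elim: zs => [|z zs ih] /=; rewrite ?mulr0// ih dotpZ; ring. Qed.

Lemma compact_seq_cover (K : set V) (f : V -> set V) : compact K ->
  (forall x, K x -> open (f x) /\ f x x) ->
  exists s : seq V, (forall x, x \in s -> K x) /\ forall y, K y -> exists2 x, x \in s & f x y.
Proof.
rewrite compact_cover => cK hf.
have [|y Ky|s sK cov] := cK V K f; first by move=> x /hf[].
  by exists y => //; have [] := hf _ Ky.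
exists (finmap.enum_fset s); split; first by move=> x /sK; rewrite inE.
by move=> y /cov [x /= xs fxy]; exists x.
Qed.

(* The segment condition: near a boundary point all of [closure D] can be moved
   into [D] by one translation. *)
Definition segdom (D : set V) : Prop :=
  [/\ open D, bounded_set D & forall x, closure D x -> exists (U : set V) (z : V),
    [/\ open U, U x & forall y (r : R), U y -> closure D y -> 0 < r <= 1 -> D (y + r *: z)]].

Lemma bounded_closure (D : set V) : bounded_set D -> bounded_set (closure D).
Proof.
move=> [M [Mr hM]]; exists M; split => // x Mx y Dy.
have cl : closed [set z : V | `|z| <= x].
  rewrite (_ : [set z | _] = (fun z : V => `|z|) @^-1` [set r : R | r <= x])//.
  by apply: preimage_closed; [move=> z _; exact: norm_continuous|exact: closed_le].
have : closure D `<=` [set z : V | `|z| <= x].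
  by rewrite closureE; apply: smallest_sub => // z; exact: hM.
exact.
Qed.

Lemma segdom_compact D : segdom D -> compact (closure D).
Proof.
move=> [_ bD _]; apply: bounded_closed_compact; last exact: closed_closure.
exact: bounded_closure.
Qed.

Lemma row_nbhs (x : V) (U : set V) : open U -> U x ->
  exists2 e : R, 0 < e & forall y : V, (forall i, `|y 0 i - x 0 i| < e) -> U y.
Proof.
move=> oU Ux; have /nbhs_ballP[e /= e0 eU] := open_nbhs_nbhs (conj oU Ux).
exists e => // y hy; apply: eU; split => // i j; rewrite ord1 /ball/= distrC; exact: hy.
Qed.

Lemma open_cube' (x : V) (e : R) : open (cube x e).
Proof.
have [e0|e0] := ltP 0 e; last first.
  case: (posnP n) => [n0|n0].
    rewrite (_ : cube x e = setT); first exact: openT.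
    by apply/seteqP; split => // v _ i; have := ltn_ord i; rewrite {2}n0.
  rewrite (_ : cube x e = set0); first exact: open0.
  apply/seteqP; split => // v /(_ (Ordinal n0)) h.
  by have := le_lt_trans (normr_ge0 _) (lt_le_trans h e0); rewrite ltxx.
rewrite (_ : cube x e = ball x e); first exact: ball_open.
apply/seteqP; split => v.
  by move=> h; split => // i j; rewrite ord1 /ball/= distrC; exact: h.
by move=> [_ h] i; have := h 0 i; rewrite /ball/= distrC.
Qed.

Lemma cubexx (x : V) (e : R) : 0 < e -> cube x e x.
Proof. by move=> e0 i; rewrite subrr normr0. Qed.

Lemma cube_sub (x : V) (e e' : R) : e <= e' -> cube x e `<=` cube x e'.
Proof. by move=> ee v h i; apply: lt_le_trans ee. Qed.

Lemma openI_shift (z : V) (U : set V) : open U -> open [set v | U (v + z)].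
Proof.
move=> oU; rewrite openE => v Uvz; have [e e0 he] := row_nbhs oU Uvz.
apply: filterS (open_nbhs_nbhs (conj (@open_cube' v e) (@cubexx v _ e0))) => y hy.
by apply: he => i; have := hy i; rewrite !mxE (addrC (y 0 i)) (addrC (v 0 i)) addrKA.
Qed.

(** The points with a neighbourhood that a chain carries into [W] form an open set, which is
    relatively closed in [D] because a point can first be moved to a nearby point of the set;
    connectedness yields all of [D]. A boundary point is first pushed into [D] by the segment
    condition, and compactness of the closure leaves finitely many chains. *)
Lemma chain_cover D W : segdom D -> connected D -> open W -> W `<=` D -> W !=set0 ->
  exists (s : seq V) (A : V -> set V) (zs : V -> seq V),
  [/\ forall x, measurable (A x), forall x, x \in s -> chain D (D `&` A x) (zs x) W &
     forall y, D y -> exists2 x, x \in s & A x y].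
Proof.
move=> sD cD oW WD [w Ww]; have [oD bD hD] := sD.
pose good x := exists (U : set V) zs, [/\ open U, U x & chain D (D `&` U) zs W].
have openG : open [set x | good x].
  rewrite openE => x [U [zs [oU Ux ch]]]; apply: (@filterS _ _ _ U).
    by move=> y Uy; exists U, zs.
  exact: open_nbhs_nbhs.
have GD : D `&` [set x | good x] = D.
  apply: cD.
  - by exists w; split; [exact: WD|exists W, [::]; split => //= x []].
  - by exists [set x | good x].
  - exists (closure (D `&` [set x | good x])); first exact: closed_closure.
    apply/seteqP; split => [x [Dx gx]|x [Dx clx]]; first by split => //; exact: subset_closure.
    split => //=; have [e e0 he] := row_nbhs oD Dx.
    have e20 : 0 < e / 2 by rewrite divr_gt0.
    have [y [[Dy [U [zs [oU Uy ch]]]] xy]] := clx _ (open_nbhs_nbhs (conj (@open_cube' x (e / 2)) (@cubexx x _ e20))).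
    have [a a0 ha] := row_nbhs oU Uy.
    pose b := Num.min a (e / 2).
    have b0 : 0 < b by rewrite lt_min a0.
    exists (cube x b), ((y - x) :: zs); split; [exact: open_cube'|exact: (@cubexx x _ b0)|].
    have near (v : V) (r : R) : cube x b v -> 0 <= r <= 1 -> cube x e (v + r *: (y - x)).
      move=> hv /andP[r0 r1] i; rewrite !mxE.
      have h1 : `|v 0 i - x 0 i| < e / 2 by apply: lt_le_trans (hv i) _; rewrite ge_min lexx orbT.
      have h2 : `|r * (y 0 i - x 0 i)| < e / 2.
        rewrite normrM (ger0_norm r0); apply: le_lt_trans (xy i).
        by rewrite ler_piMl.
      rewrite (_ : _ - _ = (v 0 i - x 0 i) + r * (y 0 i - x 0 i)); last by ring.
      by apply: le_lt_trans (ler_normD _ _) _; lra.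
    split => /=; first by move=> v r [_ hv] r01; apply: he; exact: near.
    apply: chain_subset ch _ => v /= [_ hv]; split.
      have := near _ 1 hv; rewrite ler01 lexx scale1r subrK => /(_ isT) h.
      by apply: he.
    apply: ha => i; have := hv i; rewrite !mxE => h; apply: lt_le_trans (_ : b <= a); last by rewrite ge_min lexx.
    by rewrite (_ : v 0 i - y 0 i = v 0 i - (y 0 i - x 0 i) - x 0 i)//; ring.
have Ggood x : D x -> good x by move=> Dx; rewrite -GD in Dx; case: Dx.
have clgood x : closure D x -> good x.
  move=> clx; have [U [z [oU Ux hU]]] := hD _ clx.
  have Dxz : D (x + z).
    by have := hU x 1 Ux clx; rewrite ltr01 lexx scale1r; exact.
  have [U' [zs [oU' U'x ch]]] := Ggood _ Dxz.
  exists (U `&` [set v | U' (v + z)]), (z :: zs); split => //.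
    by apply: openI => //; exact: openI_shift.
  split.
    move=> v r [Dv [Uv _]] /andP[]; rewrite le_eqVlt => /predU1P[<-|r0] r1.
      by rewrite scale0r addr0.
    by apply: hU; rewrite ?r0//; exact: subset_closure.
  apply: chain_subset ch _ => v /= [Dv [Uv U'v]]; rewrite subrK in U'v; split => //.
  by have := hU _ 1 Uv (subset_closure Dv); rewrite ltr01 lexx scale1r subrK; exact.
pose F x : set V * seq V := if pselect (good x) is left g then
   let U := sval (cid g) in (U, sval (cid (svalP (cid g)))) else (set0, [::]).
have FP x : good x -> [/\ open (F x).1, (F x).1 x & chain D (D `&` (F x).1) (F x).2 W].
  by move=> g; rewrite /F; case: pselect => // g'; case: cid => U hU /=; case: cid.
have [s [sD' cov]] := @compact_seq_cover (closure D) (fun x => (F x).1) (segdom_compact sD)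
  (fun x clx => let: And3 a b _ := FP _ (clgood _ clx) in conj a b).
exists s, (fun x => (F x).1), (fun x => (F x).2); split.
- move=> x; case: (pselect (good x)) => [g|ng]; first by have [oU _ _] := FP _ g; exact: open_measurable_row.
  by rewrite /F; case: pselect => //= _; exact: measurable0.
- by move=> x /sD' /clgood /FP[].
- by move=> y Dy; apply: cov; exact: subset_closure.
Qed.

Lemma enorm_cube (v : V) (a r : R) : 0 < r -> cube 0 a v -> n%:R * a ^+ 2 < r ^+ 2 -> 0 < a ->
  enorm v < r.
Proof.
move=> r0 hv har a0; rewrite /enorm -(ger0_norm (ltW r0)) -sqrtr_sqr ltr_sqrt ?exprn_gt0//.
exact: le_lt_trans (dotp_cube a0 hv) har.
Qed.

Lemma dotp_enorm_le (v e : V) : enorm e = 1 -> `|dotp v e| <= enorm v.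
Proof.
move=> e1; have e1' : dotp e e = 1.
  by have := congr1 (fun x => x ^+ 2) e1; rewrite /enorm sqr_sqrtr ?dotp_ge0// expr1n.
rewrite -sqrtr_sqr ler_sqrt; last exact: dotp_ge0.
have := sum_CauchySchwarz (fun i => v 0 i) (fun i => e 0 i).
rewrite -[X in X ^+ 2]dotpE => /le_trans; apply.
under eq_bigr do rewrite expr2; under [X in _ * X]eq_bigr do rewrite expr2.
by rewrite -!dotpE e1' mulr1.
Qed.

Lemma enorm_ge0 (v : V) : 0 <= enorm v. Proof. exact: sqrtr_ge0. Qed.

Lemma coord_le_enorm (v : V) i : `|v 0 i| <= enorm v.
Proof.
rewrite -sqrtr_sqr ler_sqrt; last exact: dotp_ge0.
rewrite dotpE (bigD1 i)//= -expr2 lerDl; apply: sumr_ge0 => j _.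
by rewrite -expr2 sqr_ge0.
Qed.

Lemma dotpDl (x y z : V) : dotp (x + y) z = dotp x z + dotp y z.
Proof. by rewrite /dotp mulmxDl mxE. Qed.
Lemma dotpZl t (x z : V) : dotp (t *: x) z = t * dotp x z.
Proof. by rewrite /dotp -scalemxAl mxE. Qed.
Lemma dotpBl (x y z : V) : dotp (x - y) z = dotp x z - dotp y z.
Proof. by rewrite dotpDl -scaleN1r dotpZl mulN1r. Qed.

(** The half-side of a cube inside the Euclidean ball of radius [r]; the denominator [n + 1] also
    covers [n = 0]. *)
Lemma small_radius (r : R) : 0 < r -> exists2 a : R, 0 < a & n%:R * a ^+ 2 < r ^+ 2.
Proof.
move=> r0; exists (r / (n%:R + 1)); first by rewrite divr_gt0// ltr_wpDl.
have n1 : 0 < n%:R + 1 :> R by rewrite ltr_wpDl.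
rewrite expr_div_n mulrA ltr_pdivrMr ?exprn_gt0// mulrC ltr_pM2l ?exprn_gt0//.
have : 0 <= n%:R :> R by []. nra.
Qed.

(** Since [phi] is constant in the direction [e], a shift by a positive multiple of [e] moves the
    points on or above the graph strictly above it. *)
Lemma lipschitz_segdom D : lipschitz_domain D -> segdom D.
Proof.
move=> [oD cD bD hD]; split => // x clx.
have [Dx|nDx] := pselect (D x).
  by exists D, 0; split => // y r Dy _ _; rewrite scaler0 addr0.
have [e [phi [r [K [r0 e1 lip inv hloc]]]]] := hD _ clx nDx.
have [a a0 ha] := small_radius r0.
have a20 : 0 < a / 2 by rewrite divr_gt0.
have e1' : dotp e e = 1.
  by have := congr1 (fun x => x ^+ 2) e1; rewrite /enorm sqr_sqrtr ?dotp_ge0// expr1n.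
exists (cube x (a / 2)), ((a / 2) *: e); split; [exact: open_cube'|exact: (@cubexx x _ a20)|].
have inr y : cube x a y -> enorm (y - x) < r.
  by move=> hy; apply: enorm_cube r0 _ ha a0 => i; have := hy i; rewrite !mxE subr0.
move=> y s Uy cly /andP[s0 s1].
(* A point below the graph by [g] has no point of [D] within distance [g / (|K| + 1)], because [phi]
   is [K]-Lipschitz and the height is 1-Lipschitz; so it is not in the closure. *)
have key : phi y <= dotp y e.
  rewrite leNgt; apply/negP => lt; pose g := phi y - dotp y e.
  have g0 : 0 < g by rewrite subr_gt0.
  have K1 : 0 < `|K| + 1 by rewrite ltr_wpDl.
  have q0 : 0 < g / (`|K| + 1) by rewrite divr_gt0.
  have [b b0 hb] := small_radius q0.
  have [y' [Dy' [yy' Uy']]] := cly _ (open_nbhs_nbhs (conj (openI (@open_cube' y b) (@open_cube' x (a / 2))) (conj (@cubexx y _ b0) Uy))).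
  have h1 : phi y' < dotp y' e.
    by apply/(hloc y') => //; apply: inr; apply: cube_sub Uy'; lra.
  have h2 : enorm (y - y') < g / (`|K| + 1).
    by apply: enorm_cube q0 _ hb b0 => i; have := yy' i; rewrite !mxE subr0 distrC.
  have h3 := lip y y'; have h4 := dotp_enorm_le (y - y') e1.
  rewrite dotpBl in h4.
  have h5 : K * enorm (y - y') <= `|K| * enorm (y - y').
    by rewrite ler_wpM2r ?enorm_ge0// ler_norm.
  have h6 : enorm (y - y') * (`|K| + 1) < g by rewrite -ltr_pdivlMr.
  have h7 := ler_norm (phi y - phi y'). have h8 := ler_norm (- (dotp y e - dotp y' e)).
  rewrite normrN in h8.
  move: h6; rewrite mulrDr mulr1 mulrC /g; lra.
have sc : y + s *: ((a / 2) *: e) = y + (s * (a / 2)) *: e by rewrite scalerA.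
rewrite sc; apply/hloc.
  apply: inr => i; rewrite !mxE.
  rewrite (_ : _ - _ = (y 0 i - x 0 i) + s * (a / 2) * e 0 i); last by ring.
  apply: le_lt_trans (ler_normD _ _) _.
  have h1 := Uy i.
  have h2 : `|s * (a / 2) * e 0 i| <= a / 2.
    have p : 0 <= s * (a / 2) by rewrite mulr_ge0 ?(ltW s0) ?(ltW a20).
    rewrite normrM (ger0_norm p).
    have h3 : `|e 0 i| <= 1 by rewrite -e1 coord_le_enorm.
    apply: (@le_trans _ _ (s * (a / 2) * 1)); first by rewrite ler_wpM2l.
    by rewrite mulr1 ler_piMl ?(ltW a20).
  lra.
rewrite inv dotpDl dotpZl e1' mulr1; apply: le_lt_trans key _.
by rewrite ltrDl mulr_gt0.
Qed.

(** The chains are chosen in the undilated domain. Dilation by [t] multiplies every translation by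
    [t], which produces the factor [t ^+ 2] and keeps [C] independent of [t]. *)
Lemma domain_estimate D W : segdom D -> connected D -> open W -> W `<=` D -> W !=set0 ->
  exists2 C : R, 0 < C & forall t u G, 0 < t -> ugrad (dilate t D) u G ->
  (\int[lam]_(x in dilate t D) (u x ^+ 2)%:E <=
   C%:E * (\int[lam]_(x in dilate t W) (u x ^+ 2)%:E +
   (t ^+ 2)%:E * \int[lam]_(x in dilate t D) (G x)%:E))%E.
Proof.
move=> sD cD oW WD W0; have [s [A [zs [mA chA cov]]]] := chain_cover sD cD oW WD W0.
pose C1 := \sum_(x <- s) 2 ^+ size (zs x) : R; pose C2 := \sum_(x <- s) chain_cost (zs x).
have C10 : 0 <= C1 by apply: sumr_ge0 => x _; rewrite exprn_ge0.
have C20 : 0 <= C2 by apply: sumr_ge0 => x _; exact: chain_cost_ge0.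
exists (C1 + C2 + 1) => [|t u G t0 ug]; first by rewrite ltr_wpDl// addr_ge0.
have [mD mu mG G0 _] := ug.
have GI0 : (0 <= \int[lam]_(x in dilate t D) (G x)%:E)%E by apply: integral_ge0 => x /G0; rewrite lee_fin.
have WI0 : (0 <= \int[lam]_(x in dilate t W) (u x ^+ 2)%:E)%E by apply: integral_ge0 => x _; rewrite lee_fin sqr_ge0.
apply: le_trans (@cover_estimate _ s (fun x => dilate t (A x)) (fun x => [seq t *: z | z <- zs x])
  (dilate t D) (dilate t W) u G ug _ _ _ _) _.
- exact: dilate_subset.
- by move=> x; exact: measurable_dilate.
- move=> x /chA /(chain_dilate t0) ch; apply: chain_subset ch _ => v [].
  by rewrite !dilateE// => ? ?; split.
- by move=> _ [x /cov[i si Aix] <-]; exists i => //; exists x.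
under eq_bigr do rewrite size_map.
under [X in (_ + X%:E * _)%E]eq_bigr do rewrite chain_cost_dilate.
rewrite -mulr_sumr -/C1 -/C2; apply: combine_estimates => //; exact: sqr_ge0.
Qed.

End chains.

(** * Cylinders over a domain *)

Section cylinders.
Context {R : realType} {d : nat}.
Local Notation lam := (lebesgue_row (d + 1)).

Definition cylset (A : set 'rV[R]_d) (I : set R) : set 'rV[R]_(d + 1) :=
  [set y | A (transverse y) /\ I (axial y)].

Lemma transverseD (x y : 'rV[R]_(d + 1)) : transverse (x + y) = transverse x + transverse y.
Proof. by rewrite /transverse linearD. Qed.
Lemma axialD (x y : 'rV[R]_(d + 1)) : axial (x + y) = axial x + axial y.
Proof. by rewrite /axial linearD mxE. Qed.
Lemma transverseZ r (x : 'rV[R]_(d + 1)) : transverse (r *: x) = r *: transverse x.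
Proof. by rewrite /transverse linearZ. Qed.
Lemma axialZ r (x : 'rV[R]_(d + 1)) : axial (r *: x) = r * axial x.
Proof. by rewrite /axial linearZ mxE. Qed.

Lemma measurable_transverse : measurable_fun setT (@transverse R d).
Proof. exact: (measurableT_comp measurable_fst (@measurable_uncyl R d)). Qed.
Lemma measurable_axial : measurable_fun setT (@axial R d : _ -> measurableTypeR R).
Proof. exact: (measurableT_comp measurable_snd (@measurable_uncyl R d)). Qed.

Lemma measurable_cylset A (I : set R) : measurable A -> measurable (I : set (measurableTypeR R)) ->
  measurable (cylset A I).
Proof.
move=> mA mI; apply: measurableI.
  exact: (measurable_preim measurable_transverse mA).
exact: (measurable_preim measurable_axial mI).
Qed.

Lemma chain_cylset D A zs W I : chain D A zs W ->
  chain (cylset D I) (cylset A I) [seq cyl z 0 | z <- zs] (cylset W I).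
Proof.
elim: zs A => [|z zs ih] A /=; first by move=> AW y [/AW].
move=> [h1 h2]; split.
  move=> y r [Ay Iy] r01; split; rewrite ?transverseD ?axialD ?transverseZ ?axialZ.
    by rewrite transverse_cyl; exact: h1.
  by rewrite axial_cyl mulr0 addr0.
apply: chain_subset (ih _ h2) _ => v [/=].
rewrite transverseD axialD -scaleN1r transverseZ axialZ transverse_cyl axial_cyl.
by rewrite mulr0 addr0 scaleN1r => ? ?; split.
Qed.

Lemma dotp_cyl (x : 'rV[R]_d) t : dotp (cyl x t) (cyl x t) = dotp x x + t ^+ 2.
Proof.
rewrite !dotpE big_split_ord/=; congr (_ + _).
  by apply: eq_bigr => i _; rewrite cyl_lshift.
by rewrite big_ord1 cyl_rshift expr2.
Qed.

Lemma chain_cost_cylset (zs : seq 'rV[R]_d) : chain_cost [seq cyl z 0 | z <- zs] = chain_cost zs.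
Proof. by elim: zs => //= z zs ->; rewrite dotp_cyl expr0n addr0. Qed.

(** All translations are transverse, so the constant does not depend on the axial set [I]: the edges
    may be arbitrarily long in comparison with their width. *)
Lemma cylinder_estimate (D W : set 'rV[R]_d) : segdom D -> connected D -> open W -> W `<=` D -> W !=set0 ->
  exists2 C : R, 0 < C & forall (I : set R) t u G, 0 < t -> ugrad (cylset (dilate t D) I) u G ->
  (\int[lam]_(x in cylset (dilate t D) I) (u x ^+ 2)%:E <=
   C%:E * (\int[lam]_(x in cylset (dilate t W) I) (u x ^+ 2)%:E +
   (t ^+ 2)%:E * \int[lam]_(x in cylset (dilate t D) I) (G x)%:E))%E.
Proof.
move=> sD cD oW WD W0; have [s [A [zs [mA chA cov]]]] := chain_cover sD cD oW WD W0.
pose C1 := \sum_(x <- s) 2 ^+ size (zs x) : R; pose C2 := \sum_(x <- s) chain_cost (zs x).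
have C10 : 0 <= C1 by apply: sumr_ge0 => x _; rewrite exprn_ge0.
have C20 : 0 <= C2 by apply: sumr_ge0 => x _; exact: chain_cost_ge0.
exists (C1 + C2 + 1) => [|I t u G t0 ug]; first by rewrite ltr_wpDl// addr_ge0.
have [mD mu mG G0 _] := ug.
have GI0 : (0 <= \int[lam]_(x in cylset (dilate t D) I) (G x)%:E)%E by apply: integral_ge0 => x /G0; rewrite lee_fin.
have WI0 : (0 <= \int[lam]_(x in cylset (dilate t W) I) (u x ^+ 2)%:E)%E by apply: integral_ge0 => x _; rewrite lee_fin sqr_ge0.
apply: le_trans (@cover_estimate _ _ _ s (fun x => cylset (dilate t (A x)) setT)
  (fun x => [seq cyl z 0 | z <- [seq t *: z | z <- zs x]])
  (cylset (dilate t D) I) (cylset (dilate t W) I) u G ug _ _ _ _) _.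
- by move=> y [/(dilate_subset WD)].
- by move=> x; apply: measurable_cylset => //; exact: measurable_dilate.
- move=> x /chA /(chain_dilate t0) ch; apply: chain_subset (chain_cylset I ch) _ => v [[? ?] [? _]].
  by split => //; rewrite dilateE//; split; rewrite -dilateE.
- by move=> y [hy _]; case: hy => x /cov[i si Aix] xy; exists i => //; split => //; exists x.
under eq_bigr do rewrite !size_map.
under [X in (_ + X%:E * _)%E]eq_bigr do rewrite chain_cost_cylset chain_cost_dilate.
rewrite -mulr_sumr -/C1 -/C2; apply: combine_estimates => //; exact: sqr_ge0.
Qed.

End cylinders.

(** * Poincare inequality and Rellich theorem *)

Lemma absz_shift (z : int) (M : nat) : - M%:Z <= z < M%:Z -> (`|(z + M%:Z)%R|%N < 2 * M)%N.
Proof. by move=> /andP[? ?]; lia. Qed.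

Section local_compactness.
Context {R : realType} {n : nat}.
Implicit Types (s h t q : R) (a : 'I_n -> int).
Local Notation V := 'rV[R]_n.
Local Notation lam := (lebesgue_row n).

Lemma mule_combine (C a b : R) (X : \bar R) : 0 <= a -> 0 <= b ->
  (C%:E * (a%:E * X + b%:E * X) = (C * (a + b))%:E * X)%E.
Proof. by move=> a0 b0; rewrite -ge0_muleDl ?lee_fin// muleA -EFinD -EFinM. Qed.

Lemma dilate_cube t (p : V) h : 0 < t -> dilate t (cube p h) = cube (t *: p) (t * h).
Proof.
move=> t0; apply/seteqP; split => v.
  move=> [x hx <-] i; rewrite !mxE -mulrBr normrM gtr0_norm// ltr_pM2l//; exact: hx.
move=> hv; rewrite dilateE// => i; have := hv i; rewrite !mxE.
rewrite (_ : v 0 i - t * p 0 i = t * (t^-1 * v 0 i - p 0 i)); last by field; rewrite gt_eqF.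
by rewrite normrM gtr0_norm// ltr_pM2l.
Qed.

(** [domain_estimate] is applied to [u - m], where [m] is the mean over the inner cube; the Poincare
    inequality of the cube bounds the remaining norm. *)
Lemma domain_poincare (D : set V) p h : segdom D -> connected D -> 0 < h -> cube p h `<=` D ->
  exists2 C : R, 0 < C & forall t u G, 0 < t -> ugrad (dilate t D) u G ->
  exists m, (\int[lam]_(x in dilate t D) ((u x - m) ^+ 2)%:E <=
   (C * t ^+ 2)%:E * \int[lam]_(x in dilate t D) (G x)%:E)%E.
Proof.
move=> sD cD h0 pD.
have [C C0 hC] := domain_estimate sD cD (@open_cube' _ _ p h) pD (ex_intro _ p (@cubexx _ _ p _ h0)).
pose K := (2 ^+ n * n%:R * 4) * h ^+ 2.
have K0 : 0 <= K by rewrite !mulr_ge0 ?exprn_ge0// ltW.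
exists (C * (K + 1)) => [|t u G t0 ug]; first by rewrite mulr_gt0// ltr_wpDl.
have [mD mu mG G0 _] := ug.
have QD : cube (t *: p) (t * h) `<=` dilate t D by rewrite -dilate_cube//; exact: dilate_subset.
have ugQ : ugrad (cube (t *: p) (t * h)) u G by apply: ugrad_sub ug _ QD; exact: measurable_cube'.
have [m hm] := cube_poincare (mulr_gt0 t0 h0) ugQ.
exists m; apply: le_trans (hC t _ G t0 (ugradB m ug)) _.
rewrite dilate_cube//.
have GI0 : (0 <= \int[lam]_(x in dilate t D) (G x)%:E)%E by apply: integral_ge0 => x /G0; rewrite lee_fin.
have hGQ : (\int[lam]_(x in cube (t *: p) (t * h)) (G x)%:E <= \int[lam]_(x in dilate t D) (G x)%:E)%E.
  by apply: ge0_integral_le_set => // x /G0; rewrite lee_fin.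
apply: (@le_trans _ _ (C%:E * ((K * t ^+ 2)%:E * \int[lam]_(x in dilate t D) (G x)%:E +
   (t ^+ 2)%:E * \int[lam]_(x in dilate t D) (G x)%:E))%E).
  apply: lee_pmul => //; first by rewrite lee_fin ltW.
    rewrite adde_ge0//; first by apply: integral_ge0 => x _; rewrite lee_fin sqr_ge0.
    by rewrite mule_ge0// lee_fin sqr_ge0.
  apply: leeD => //; apply: le_trans hm _.
  rewrite (_ : K * t ^+ 2 = 2 ^+ n * n%:R * 4 * (t * h) ^+ 2); last by rewrite /K; ring.
  apply: lee_wpmul2l => //.
  by rewrite lee_fin !mulr_ge0 ?exprn_ge0 ?mulr_ge0// ltW.
rewrite mule_combine ?(mulr_ge0 K0) ?sqr_ge0//.
by rewrite (_ : C * (K * t ^+ 2 + t ^+ 2) = C * (K + 1) * t ^+ 2)//; ring.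
Qed.

(* Half-open boxes of a grid, so that they are disjoint. *)
Definition hbox (s : R) (a : 'I_n -> int) : set V :=
  [set v | forall i, (a i)%:~R * s <= v 0 i < ((a i)%:~R + 1) * s].

Lemma measurable_hbox s a : measurable (hbox s a).
Proof.
rewrite [X in measurable X](_ : _ = \bigcap_(i in [set: 'I_n])
  ((fun v : V => v 0 i) @^-1` `[(a i)%:~R * s, ((a i)%:~R + 1) * s[%classic)); last first.
  by apply/seteqP; split=> v /= h i; [move=> _; rewrite /= in_itv/=; exact: h|have := h i Logic.I; rewrite /= in_itv/=].
apply: fin_bigcap_measurable => // i _.
by apply: (@measurable_preim _ _ _ _ (fun v : V => v 0 i)) => //; exact: measurable_coord.
Qed.

Lemma hbox_diff s a (x y : V) : hbox s a x -> hbox s a (x + y) -> cube 0 s y.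
Proof.
move=> hx hy i; have := hx i; have := hy i; rewrite !mxE subr0 ltr_norml.
set A := (a i)%:~R * s; rewrite mulrDl mul1r -/A.
by move=> /andP[a1 a2] /andP[b1 b2]; apply/andP; split; lra.
Qed.

Lemma hbox_segment s a (x y : V) (r : R) : hbox s a x -> hbox s a (x + y) -> 0 <= r <= 1 -> hbox s a (x + r *: y).
Proof.
move=> cx cy /andP[r0 r1] i; have := cx i; have := cy i; rewrite !mxE.
set A := _ * s; set B := _ * s; set c := x 0 i; set b := y 0 i.
move=> /andP[a1 a2] /andP[b1 b2]; have [b0|b0] := leP 0 b.
  have h1 : 0 <= r * b by rewrite mulr_ge0.
  have h2 : r * b <= b by rewrite ler_piMl.
  apply/andP; split; lra.
have h1 : r * b <= 0 by rewrite mulr_ge0_le0// ltW.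
have h2 : b <= r * b by rewrite ler_niMl// ltW.
apply/andP; split; lra.
Qed.

Lemma hbox_measure s a : 0 < s -> exists2 q : R, lam (hbox s a) = q%:E & s ^+ n <= q.
Proof.
move=> s0; pose c : V := \row_i (((a i)%:~R + 2^-1) * s).
have s20 : 0 < s / 2 by rewrite divr_gt0.
have h1 : cube c (s / 2) `<=` hbox s a.
  move=> v hv i; have := hv i; rewrite mxE ltr_distl !mulrDl mul1r.
  set A := (a i)%:~R * s; move=> /andP[a1 a2]; apply/andP; split; lra.
have h2 : hbox s a `<=` cube c s.
  move=> v hv i; have := hv i; rewrite mxE ltr_distl !mulrDl mul1r.
  set A := (a i)%:~R * s; move=> /andP[a1 a2]; apply/andP; split; lra.
have m1 : (lam (cube c (s / 2)) <= lam (hbox s a))%E.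
  by apply: le_measure => //; rewrite inE; [exact: measurable_cube'|exact: measurable_hbox].
have m2 : (lam (hbox s a) <= lam (cube c s))%E.
  by apply: le_measure => //; rewrite inE; [exact: measurable_hbox|exact: measurable_cube'].
have fin : lam (hbox s a) \is a fin_num.
  rewrite ge0_fin_numE//; apply: le_lt_trans m2 _.
  by rewrite /cube lebesgue_row_cube// ltry.
exists (fine (lam (hbox s a))); first by rewrite fineK.
rewrite -lee_fin fineK//; apply: le_trans m1; rewrite /cube lebesgue_row_cube//.
by rewrite (_ : 2 * (s / 2) = s)//; field.
Qed.

Lemma hbox_inj s a b v : 0 < s -> hbox s a v -> hbox s b v -> a = b.
Proof.
move=> s0 ha hb; apply/funext => i; have /andP[a1 a2] := ha i; have /andP[b1 b2] := hb i.
have h1 : (a i)%:~R < (b i)%:~R + 1 :> R by rewrite -(ltr_pM2r s0) (le_lt_trans a1).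
have h2 : (b i)%:~R < (a i)%:~R + 1 :> R by rewrite -(ltr_pM2r s0) (le_lt_trans b1).
rewrite -[1]/(1%:~R) -intrD ltr_int ltzD1 in h1.
rewrite -[1]/(1%:~R) -intrD ltr_int ltzD1 in h2.
by apply/eqP; rewrite eq_le h1.
Qed.

Lemma hbox_floor s (v : V) : 0 < s -> hbox s (fun i => Num.floor (v 0 i / s)) v.
Proof.
move=> s0 i; rewrite -ler_pdivlMr// -ltr_pdivrMr//.
have := Num.Theory.floor_itv (v 0 i / s).
by rewrite intrD.
Qed.

Lemma near_seq (T : Type) (I : eqType) (F : set_system T) (FF : Filter F) (s : seq I) (P : I -> T -> Prop) :
  (forall i, i \in s -> F [set a | P i a]) -> F [set a | forall i, i \in s -> P i a].
Proof.
elim: s => [|i s ih] h; first by apply: filterS filterT => a _ i.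
have h1 := h i (mem_head _ _); have h2 := ih (fun j js => h j (mem_behead (s := i :: s) js)).
apply: filterS2 h1 h2 => a Pa Pb j; rewrite inE => /predU1P[->//|]; exact: Pb.
Qed.

(** A margin that works at [y] works, after halving, at all points near [y]; compactness makes it
    uniform. *)
Lemma compact_margin (K D : set V) (z : V) : compact K -> open D -> (forall y, K y -> D (y + z)) ->
  \forall a \near 0^'+, forall y, K y -> cube (y + z) a `<=` D.
Proof.
move=> cK oD KD.
have := (compact_near_coveringP K).1 cK R (0^'+) (fun (a0 : R) y => cube (y + z) a0 `<=` D) _.
apply => y Ky; have [e e0 he] := row_nbhs oD (KD _ Ky).
have e20 : 0 < e / 2 by rewrite divr_gt0.
exists (cube y (e / 2), [set a | a < e / 2]) => /=.
  split; first exact: (open_nbhs_nbhs (conj (@open_cube' _ _ y (e / 2)) (@cubexx _ _ y _ e20))).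
  exact: nbhs_right_lt.
move=> [y' a] [/= hy' ha] v hv; apply: he => i.
have h1 := hy' i; have h2 := hv i; rewrite !mxE in h2 *.
rewrite (_ : _ - _ = (v 0 i - (y' 0 i + z 0 i)) + (y' 0 i - y 0 i)); last by ring.
apply: le_lt_trans (ler_normD _ _) _; lra.
Qed.

(** From [u ^+ 2 <= 2 * (u - m) ^+ 2 + 2 * m ^+ 2] with the mean [m]: the Poincare inequality bounds
    the first term, and the second is the squared integral divided by the volume, for which a lower
    bound is enough. *)
Lemma hbox_estimate (s : R) a u G (q : R) : 0 < s -> lam (hbox s a) = q%:E -> s ^+ n <= q -> ugrad (hbox s a) u G ->
  (\int[lam]_(x in hbox s a) (u x ^+ 2)%:E <=
   (2 * 2 ^+ n * n%:R * s ^+ 2)%:E * \int[lam]_(x in hbox s a) (G x)%:E +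
   (2 / s ^+ n * (\int[lam]_(x in hbox s a) u x)%R ^+ 2)%:E)%E.
Proof.
move=> s0 Qq sq ug; have [mD mu mG G0 _] := ug.
have sn0 : 0 < s ^+ n by rewrite exprn_gt0.
have q0 : 0 < q by exact: lt_le_trans sq.
have GI0 : (0 <= \int[lam]_(x in hbox s a) (G x)%:E)%E by apply: integral_ge0 => x /G0; rewrite lee_fin.
set S := (\int[lam]_(x in hbox s a) u x)%R; pose m := S / q.
have hP := convex_poincare s0 ug (@hbox_segment s a) (@hbox_diff s a) Qq q0 (erefl m).
apply: (@le_trans _ _ (\int[lam]_(x in hbox s a) (2%:E * ((u x - m) ^+ 2)%:E + (cst (2 * m ^+ 2)%:E) x))%E).
  apply: ge0_le_integral_gen => [x _|x _|x Qx].
  - by rewrite lee_fin sqr_ge0.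
  - by rewrite -EFinM -EFinD lee_fin addr_ge0// mulr_ge0// sqr_ge0.
  - split => //; rewrite -EFinM -EFinD lee_fin.
    by have := sqr_ge0 (u x - 2 * m); nra.
have mm : measurable_fun (hbox s a) (fun x => ((u x - m) ^+ 2)%:E).
  by apply/measurable_EFinP; apply: measurable_funX; exact: measurable_funB.
rewrite ge0_integralD//; last 3 first.
- by move=> x _; rewrite -EFinM lee_fin mulr_ge0// sqr_ge0.
- exact: measurable_funeM.
- by move=> x _; rewrite lee_fin mulr_ge0// sqr_ge0.
rewrite ge0_integralZl//; last by move=> x _; rewrite lee_fin sqr_ge0.
have -> : (\int[lam]_(x in hbox s a) (cst (2 * m ^+ 2)%:E x) = (2 * m ^+ 2 * q)%:E)%E.
  rewrite integral_cst//; transitivity ((2 * m ^+ 2)%:E * q%:E)%E; last by rewrite -EFinM.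
  by congr (_ * _)%E; exact: Qq.
apply: leeD.
  apply: (@le_trans _ _ (2%:E * ((q^-1 * ((2 * s) ^+ n * (n%:R * s ^+ 2)))%:E * \int[lam]_(x in hbox s a) (G x)%:E))%E).
    apply: lee_pmul => //; first by apply: integral_ge0 => x _; rewrite lee_fin sqr_ge0.
  rewrite muleA -EFinM; apply: lee_pmul => //.
    by rewrite lee_fin !mulr_ge0 ?invr_ge0 ?exprn_ge0 ?mulr_ge0// ltW.
  rewrite lee_fin exprMn -!mulrA ler_pM2l// mulrCA ler_pM2l ?exprn_gt0//.
  have key (x y : R) : x <= 1 -> 0 <= y -> x * y <= y by move=> *; rewrite ler_piMl.
  rewrite (mulrA q^-1 (s ^+ n)); apply: key; last by rewrite mulr_ge0// sqr_ge0.
  by rewrite mulrC ler_pdivrMr// mul1r.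
rewrite lee_fin (_ : 2 * m ^+ 2 * q = 2 / q * S ^+ 2); last by rewrite /m; field; rewrite gt_eqF.
have key (x y z w : R) : y <= w -> 0 <= z -> x = 2 -> x * y * z <= x * w * z by move=> *; subst; nra.
by apply: key => //; [rewrite lef_pV2|exact: sqr_ge0].
Qed.

(** [D] is pushed inside itself by [t] times the local translations, at an energy cost of order
    [t ^+ 2]. The images keep a margin [a] from the complement, so the boxes of a grid of mesh
    [sg <= a] which they meet lie in [D]; on a box [u] agrees with its mean up to an energy of order
    [sg ^+ 2]. The integrals over the boxes are the finitely many functionals. *)
Lemma rellich (D : set V) : segdom D -> forall eps : R, 0 < eps ->
  exists (I : finType) (Q : I -> set V) (C : R),
  [/\ forall i, [/\ measurable (Q i), Q i `<=` D & (lam (Q i) < +oo)%E] &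
   forall u G, ugrad D u G ->
   (\int[lam]_(x in D) (u x ^+ 2)%:E <= eps%:E * \int[lam]_(x in D) (G x)%:E +
     (C * \sum_i (\int[lam]_(x in Q i) u x)%R ^+ 2)%:E)%E].
Proof.
move=> sD eps eps0; have [oD bD hD] := sD.
have hx x : {p : R * V | closure D x -> 0 < p.1 /\
    forall y (r : R), cube x p.1 y -> closure D y -> 0 < r <= 1 -> D (y + r *: p.2)}.
  apply: cid; have [clx|nclx] := pselect (closure D x); last by exists (0, 0).
  have [U [z [oU Ux hU]]] := hD _ clx; have [e e0 he] := row_nbhs oU Ux.
  by exists (e, z) => _; split => // y r /= hy; apply: hU; apply: he; exact: hy.
pose ex x := (sval (hx x)).1; pose zx x := (sval (hx x)).2.
have ex0 x : closure D x -> 0 < ex x by move=> /(svalP (hx x))[].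
have hz x : closure D x -> forall y (r : R), cube x (ex x) y -> closure D y -> 0 < r <= 1 -> D (y + r *: zx x).
  by move=> /(svalP (hx x))[].
have [s [sD' cov]] := @compact_seq_cover _ _ (closure D) (fun x => cube x (ex x / 2)) (segdom_compact sD)
  (fun x clx => conj (@open_cube' _ _ x (ex x / 2)) (@cubexx _ _ x _ (divr_gt0 (ex0 _ clx) (ltr0n _ 2)))).
pose B := \sum_(x <- s) dotp (zx x) (zx x).
have B0 : 0 <= B by apply: sumr_ge0 => x _; exact: dotp_ge0.
(* [2 * t ^+ 2 * B] is the total cost of the translations; this [t] makes it at most [eps / 2]. *)
pose t := Num.min 1 (eps / (4 * (B + 1))).
have t0 : 0 < t by rewrite lt_min ltr01 divr_gt0// mulr_gt0// ltr_wpDl.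
have t1 : t <= 1 by rewrite ge_min lexx.
have tB : 2 * t ^+ 2 * B <= eps / 2.
  have h1 : t * (4 * (B + 1)) <= eps.
    by rewrite -ler_pdivlMr ?mulr_gt0 ?ltr_wpDl// ge_min lexx orbT.
  have h2 : t ^+ 2 <= t by rewrite expr2 ler_piMr// ltW.
  have h3 : t ^+ 2 * B <= t * B by rewrite ler_wpM2r.
  rewrite -mulrA; nra.
have [a [a0 ha]] : exists a : R, 0 < a /\ forall x, x \in s -> forall y, closure D y -> cube x (ex x / 2) y ->
    cube (y + t *: zx x) a `<=` D.
  have h : \forall a \near 0^'+, forall x, x \in s -> forall y, closure D y -> cube x (ex x / 2) y -> cube (y + t *: zx x) a `<=` D.
    apply: near_seq => x /sD' clx.
    have cK : compact (closure D `&` closure (cube x (ex x / 2))).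
      apply: (@subclosed_compact _ _ (closure D)) => //; last exact: segdom_compact.
      by apply: closedI; exact: closed_closure.
    have hm : forall y, (closure D `&` closure (cube x (ex x / 2))) y -> D (y + t *: zx x).
      move=> y [cly cy]; apply: hz => //; last by rewrite t0.
      have e20 : 0 < ex x / 2 by rewrite divr_gt0// ex0.
      have [y' [y'x y'y]] := cy _ (open_nbhs_nbhs (conj (@open_cube' _ _ y (ex x / 2)) (@cubexx _ _ y _ e20))).
      move=> i; rewrite (_ : _ - _ = (y' 0 i - x 0 i) - (y' 0 i - y 0 i)); last by ring.
      apply: le_lt_trans (ler_normB _ _) _; have := y'x i; have := y'y i; lra.
    apply: filterS (compact_margin cK oD hm) => b hb y cly cy.
    by apply: hb; split => //; exact: subset_closure.
  have [b [b1 b2]] := @filter_ex R (0^'+) (at_right_proper_filter 0) _ (filterI h (nbhs_right_gt 0)).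
  by exists b.
pose c : R := 2 * 2 ^+ n * n%:R.
have c0 : 0 <= c by rewrite !mulr_ge0// exprn_ge0.
pose N1 : R := \sum_(x <- s) 2 ^+ 1.
have N10 : 0 <= N1 by apply: sumr_ge0 => x _.
(* The mesh fits into the margin [a], and [N1] times the Poincare term [c * sg ^+ 2] of the boxes is
   at most [eps / 2]. *)
pose sg := Num.min a (Num.min 1 (eps / (2 * (N1 * c + 1)))).
have K10 : 0 < N1 * c + 1 by rewrite ltr_wpDl// mulr_ge0.
have sg0 : 0 < sg by rewrite !lt_min a0 ltr01 divr_gt0// mulr_gt0.
have sga : sg <= a by rewrite ge_min lexx.
have sgN : N1 * c * sg ^+ 2 <= eps / 2.
  have h0 : sg <= 1 by rewrite /sg !ge_min lexx /= orbT.
  have h1 : sg * (2 * (N1 * c + 1)) <= eps.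
    by rewrite -ler_pdivlMr ?mulr_gt0// !ge_min lexx !orbT.
  have h2 : sg ^+ 2 <= sg by rewrite expr2 ler_piMr// ltW.
  have h3 : N1 * c * sg ^+ 2 <= N1 * c * sg by rewrite ler_wpM2l// mulr_ge0.
  nra.
have [M hM] : exists M : nat, forall v i, D v -> (- M%:Z <= Num.floor (v 0 i / sg)%R < M%:Z)%R.
  have [M0 [_ hM0]] := bD; pose B1 := M0 + 1.
  exists (Num.bound (`|B1| / sg)) => v i Dv.
  have h1 : `|v 0 i| <= `|B1|.
    apply: le_trans (ler_norm _); apply: le_trans (hM0 B1 _ v Dv); last by rewrite ltrDl.
    rewrite -[`|v|]/(mx_norm v) mx_normrE.
    by apply: (@le_bigmax _ _ _ _ (fun ij => `|v ij.1 ij.2|) (0, i)).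
  have h2 : `|v 0 i / sg| < (Num.bound (`|B1| / sg))%:R.
    apply: le_lt_trans (archi_boundP _); last by rewrite divr_ge0// ltW.
    by rewrite normrM (gtr0_norm (_ : 0 < sg^-1)) ?invr_gt0// ler_wpM2r// invr_ge0 ltW.
  move: h2; rewrite ltr_norml => /andP[h3 h4].
  have /andP[f1 f2] := Num.Theory.floor_itv (v 0 i / sg).
  apply/andP; split.
    rewrite -ltzD1 -(ltr_int R) intrD intrN; apply: lt_trans h3 _; by rewrite intrD in f2.
  by rewrite -(ltr_int R); apply: le_lt_trans f1 _.
(* The integer corners of the boxes which meet [D] lie in [[- M, M)]; shifted by [M] they become a
   finite type. *)
pose I := {ffun 'I_n -> 'I_(2 * M)}.
pose af (f : I) (i : 'I_n) : int := (f i)%:Z - M%:Z.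
have afinj f g : af f = af g -> f = g.
  move=> h; apply/ffunP => i; have := congr1 (fun u => u i) h; rewrite /af => /addIr [] ?.
  exact/val_inj.
(* Boxes that are not contained in [D] are replaced by the empty set, for which the estimate is
   trivial. *)
pose Q (f : I) := if `[< hbox sg (af f) `<=` D >] then hbox sg (af f) else set0.
have mQ f : measurable (Q f) by rewrite /Q; case: ifP => _; [exact: measurable_hbox|exact: measurable0].
have QD f : Q f `<=` D by rewrite /Q; case: ifPn => [/asboolP//|_]; exact: sub0set.
have tQ : trivIset setT Q.
  apply/trivIsetP => f g _ _ /eqP fg; rewrite -subset0 => v [].
  rewrite /Q; do 2 case: ifPn => // _; move=> h1 h2; apply: fg.
  by apply: afinj; exact: hbox_inj h1 h2.
have floorQ v : cube v a `<=` D -> exists f, Q f v.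
  move=> vD; have Dv : D v by apply: vD; exact: cubexx.
  pose fl (i : 'I_n) := Num.floor (v 0 i / sg).
  have flP i : (`|(fl i + M%:Z)%R|%N < 2 * M)%N by exact: absz_shift (hM v i Dv).
  exists [ffun i => Ordinal (flP i)].
  have afE : af [ffun i => Ordinal (flP i)] = fl.
    apply/funext => i; rewrite /af ffunE /=.
    have /andP[f1 f2] := hM v i Dv; rewrite gez0_abs; last by rewrite -lerBlDr sub0r.
    by rewrite addrK.
  rewrite /Q afE asboolT; first exact: hbox_floor.
  move=> w hw; apply: vD; apply: (cube_sub sga) => i.
  have hv := @hbox_floor sg v sg0.
  have := @hbox_diff sg fl v (w - v) hv; rewrite addrC subrK => /(_ hw i).
  by rewrite !mxE subr0.
pose C0 : R := 2 / sg ^+ n.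
exists I, Q, (N1 * C0); split.
  move=> f; split => //; rewrite /Q; case: ifP => _; last by rewrite measure0.
  by have [q -> _] := @hbox_measure sg (af f) sg0; rewrite ltry.
move=> u G ug; have [mD mu mG G0 _] := ug.
have GI0 : (0 <= \int[lam]_(x in D) (G x)%:E)%E by apply: integral_ge0 => x /G0; rewrite lee_fin.
pose W := \bigcup_(f in [set: I]) Q f.
have WD : W `<=` D by move=> v [f _]; exact: QD.
have mW : measurable W by apply: fin_bigcup_measurable => //; exact: finite_finset.
have ch x : x \in s -> chain D (D `&` cube x (ex x / 2)) [:: t *: zx x] W.
  move=> xs; split.
    move=> y r [Dy cy] /andP[]; rewrite le_eqVlt => /predU1P[<- _|r0 r1]; first by rewrite scale0r addr0.
    rewrite scalerA; apply: hz (sD' _ xs) _ _ _ _ _.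
    - by apply: cube_sub cy; have := ex0 _ (sD' _ xs); lra.
    - exact: subset_closure.
    - by rewrite mulr_gt0//= mulr_ile1// ltW.
  move=> v [Dv cv]; have := ha x xs _ (subset_closure Dv) cv; rewrite subrK.
  by move=> /floorQ[f Qf]; exists f.
have := cover_estimate ug WD (fun x => @measurable_cube' _ _ x (ex x / 2)) ch
  (fun y Dy => cov y (subset_closure Dy)).
rewrite -/N1 => hcov.
have [gy|gy] := eqVneq (\int[lam]_(x in D) (G x)%:E)%E +oo%E.
  by rewrite gy gt0_muley ?lte_fin// addye// leey.
have gfin : (\int[lam]_(x in D) (G x)%:E)%E \is a fin_num by rewrite ge0_fin_numE// ltey.
set g := fine (\int[lam]_(x in D) (G x)%:E)%E.
have gE : (\int[lam]_(x in D) (G x)%:E = g%:E)%E by rewrite fineK.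
have g0 : 0 <= g by rewrite -lee_fin -gE.
have hW : (\int[lam]_(x in W) (u x ^+ 2)%:E <= (c * sg ^+ 2 * g + C0 * \sum_i (\int[lam]_(x in Q i) u x)%R ^+ 2)%:E)%E.
  have mu2 : measurable_fun D (fun x => (u x ^+ 2)%:E) by apply/measurable_EFinP; exact: measurable_funX.
  apply: (@le_trans _ _ (\sum_(f <- index_enum I) \int[lam]_(x in W `&` Q f) (u x ^+ 2)%:E)%E).
    apply: ge0_integral_cover_le => //.
    - exact: measurable_funS mu2.
    - by move=> x _; rewrite lee_fin sqr_ge0.
    - by move=> v [f _ Qf]; exists f => //; exact: mem_index_enum.
  apply: (@le_trans _ _ (\sum_f ((c * sg ^+ 2)%:E * \int[lam]_(x in Q f) (G x)%:E + (C0 * (\int[lam]_(x in Q f) u x)%R ^+ 2)%:E))%E).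
    apply: lee_sum => f _; apply: (@le_trans _ _ (\int[lam]_(x in Q f) (u x ^+ 2)%:E)%E).
      by apply: ge0_integral_le_set => [x _|x []//]; rewrite lee_fin sqr_ge0.
    rewrite /Q; case: ifPn => [/asboolP hD1|_].
      have [q Qq sq] := @hbox_measure sg (af f) sg0.
      apply: hbox_estimate Qq sq _ => //; apply: ugrad_sub ug _ hD1; exact: measurable_hbox.
    rewrite !integral_set0 mule0 add0e lee_fin mulr_ge0 ?sqr_ge0// /C0 divr_ge0// exprn_ge0//; exact: ltW.
  rewrite big_split EFinD; apply: leeD.
    rewrite -ge0_sume_distrr; last first.
      by move=> f _; apply: integral_ge0 => x /QD/G0; rewrite lee_fin.
    rewrite (EFinM (c * sg ^+ 2) g) -gE; apply: lee_wpmul2l; first by rewrite lee_fin mulr_ge0// sqr_ge0.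
    apply: (@sum_integral_le _ _ _ lam I xpredT Q D) => //; exact/measurable_EFinP.
  by rewrite sumEFin mulr_sumr.
apply: le_trans hcov _; rewrite gE.
apply: (@le_trans _ _ (N1%:E * (c * sg ^+ 2 * g + C0 * \sum_i (\int[lam]_(x in Q i) u x)%R ^+ 2)%:E +
   (\sum_(i <- s) chain_cost [:: t *: zx i])%:E * g%:E)%E).
  by apply: leeD => //; apply: lee_wpmul2l => //; rewrite lee_fin.
have -> : \sum_(i <- s) chain_cost [:: t *: zx i] = 2 * t ^+ 2 * B.
  rewrite /B mulr_sumr; apply: eq_bigr => x _ /=; rewrite dotpZ; ring.
set S := \sum_i _; rewrite -!EFinM -!EFinD lee_fin.
have h1 : N1 * c * sg ^+ 2 * g <= eps / 2 * g by rewrite ler_wpM2r.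
have h2 : 2 * t ^+ 2 * B * g <= eps / 2 * g by rewrite ler_wpM2r.
rewrite (_ : N1 * (c * sg ^+ 2 * g + C0 * S) = N1 * c * sg ^+ 2 * g + N1 * C0 * S); last by ring.
lra.
Qed.

End local_compactness.

(** * Eigenvalues of a form with compact embedding *)

Section form_space.
Context {R : realType} {M : lmodType R}.
Variable D : M -> Prop.

Definition linear_subspace := D 0 /\ forall (a : R) x y, D x -> D y -> D (a *: x + y).

Definition linear_on (F : M -> R) :=
  forall (a : R) x y, D x -> D y -> F (a *: x + y) = a * F x + F y.

Definition sym_form (B : M -> M -> R) :=
  [/\ forall z, D z -> linear_on (B^~ z), forall x y, D x -> D y -> B x y = B y x &
      forall x, D x -> 0 <= B x x].

Definition complete_form (B : M -> M -> R) := forall x : nat -> M, (forall n, D (x n)) ->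
  (forall e : R, 0 < e -> exists N, forall m n, (N <= m)%N -> (N <= n)%N ->
     B (x m - x n) (x m - x n) < e) ->
  exists2 y, D y & forall e : R, 0 < e -> exists N, forall n, (N <= n)%N -> B (x n - y) (x n - y) < e.

Hypothesis sD : linear_subspace.

Lemma subspace0 : D 0. Proof. by case: sD. Qed.
Lemma subspaceP a x y : D x -> D y -> D (a *: x + y). Proof. by case: sD => _; exact. Qed.
Lemma subspaceD x y : D x -> D y -> D (x + y).
Proof. by move=> Dx Dy; rewrite -(scale1r x); exact: subspaceP. Qed.
Lemma subspaceZ a x : D x -> D (a *: x).
Proof. by move=> Dx; rewrite -[_ *: _]addr0; apply: subspaceP => //; exact: subspace0. Qed.
Lemma subspaceB x y : D x -> D y -> D (x - y).
Proof. by move=> Dx Dy; apply: subspaceD => //; rewrite -scaleN1r; exact: subspaceZ. Qed.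
Lemma subspace_sum n (c : 'I_n -> R) (x : 'I_n -> M) :
  (forall i, D (x i)) -> D (\sum_i c i *: x i).
Proof.
move=> Dx; apply: (big_ind D) => [|a b|i _]; first exact: subspace0.
  exact: subspaceD.
exact: subspaceZ.
Qed.

Section linear_on.
Variables (F : M -> R) (lF : linear_on F).
Lemma linear_onD x y : D x -> D y -> F (x + y) = F x + F y.
Proof. by move=> Dx Dy; rewrite -{1}(scale1r x) lF// mul1r. Qed.
Lemma linear_on0 : F 0 = 0.
Proof. by have := linear_onD subspace0 subspace0; rewrite addr0 => h; lra. Qed.
Lemma linear_onZ a x : D x -> F (a *: x) = a * F x.
Proof. by move=> Dx; rewrite -{1}[a *: x]addr0 lF//; [rewrite linear_on0 addr0|exact: subspace0]. Qed.
Lemma linear_onB x y : D x -> D y -> F (x - y) = F x - F y.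
Proof. by move=> Dx Dy; rewrite addrC -scaleN1r lF// addrC mulN1r. Qed.
Lemma linear_on_sum n (c : 'I_n -> R) (x : 'I_n -> M) : (forall i, D (x i)) ->
  F (\sum_i c i *: x i) = \sum_i c i * F (x i).
Proof.
move=> Dx; elim: n c x Dx => [|n ih] c x Dx; first by rewrite !big_ord0 linear_on0.
rewrite !big_ord_recl lF ?ih//; exact: subspace_sum.
Qed.
End linear_on.

Section sym_form.
Variables (B : M -> M -> R) (fB : sym_form B).
Let Bl z : D z -> linear_on (B^~ z). Proof. by case: fB => + _ _; exact. Qed.
Let Bs x y : D x -> D y -> B x y = B y x. Proof. by case: fB => _ + _; exact. Qed.

Lemma sym_form_ge0 x : D x -> 0 <= B x x. Proof. by case: fB => _ _; exact. Qed.

Lemma sym_formr z : D z -> linear_on (B z).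
Proof.
move=> Dz a x y Dx Dy; rewrite Bs//; last exact: subspaceP.
by rewrite Bl// (Bs Dx)// (Bs Dy).
Qed.

Lemma sym_form_expand t x y : D x -> D y ->
  B (x + t *: y) (x + t *: y) = B x x + 2 * t * B x y + t ^+ 2 * B y y.
Proof.
move=> Dx Dy; have Dty := subspaceZ t Dy; have Ds := subspaceD Dx Dty.
rewrite (linear_onD (Bl Ds))// (linear_onZ (Bl Ds))//.
rewrite (linear_onD (sym_formr Dx))// (linear_onD (sym_formr Dy))//.
rewrite (linear_onZ (sym_formr Dx))// (linear_onZ (sym_formr Dy))// (Bs Dy Dx); ring.
Qed.

Lemma sym_formB x y : D x -> D y -> B (x - y) (x - y) = B x x - 2 * B x y + B y y.
Proof. by move=> Dx Dy; rewrite -scaleN1r sym_form_expand//; ring. Qed.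
End sym_form.

Lemma discriminant_le (a b c : R) : 0 <= c -> (forall t, 0 <= a + 2 * t * b + t ^+ 2 * c) ->
  b ^+ 2 <= a * c.
Proof.
move=> c0 h; have [cE|c1] := eqVneq c 0.
  rewrite {}cE in h *; have [->|b0] := eqVneq b 0; first by rewrite mulr0 expr0n.
  have := h (- (a + 1) / (2 * b)); rewrite (_ : _ + _ = -1); last by field; rewrite b0.
  by rewrite ler0N1.
have cp : 0 < c by rewrite lt_neqAle eq_sym c1.
have := h (- b / c); rewrite (_ : _ + _ = (a * c - b ^+ 2) / c); last by field.
by rewrite pmulr_lge0 ?invr_gt0// subr_ge0.
Qed.

Lemma form_CauchySchwarz B x y : sym_form B -> D x -> D y -> B x y ^+ 2 <= B x x * B y y.
Proof.
move=> fB Dx Dy; apply: discriminant_le; first exact: sym_form_ge0 fB _ Dy.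
move=> t; rewrite -sym_form_expand//; apply: (sym_form_ge0 fB).
by apply: subspaceD => //; exact: subspaceZ.
Qed.

Lemma sqr_le_eps (a b : R) : (forall e : R, 0 < e -> a ^+ 2 <= e * b) -> a = 0.
Proof.
move=> h; apply/eqP; rewrite -sqrf_eq0 eq_le sqr_ge0 andbT leNgt; apply/negP => a0.
have b0 : 0 < b by have := h 1 ltr01; rewrite mul1r; exact: lt_le_trans.
have := h (a ^+ 2 / (2 * b)) (divr_gt0 a0 (mulr_gt0 (ltr0n _ 2) b0)).
have -> : a ^+ 2 / (2 * b) * b = a ^+ 2 / 2 by field; rewrite gt_eqF.
move: (a ^+ 2) a0 => c c0; lra.
Qed.

(* A minimizing sequence of [B u u - 2 F u] is a Cauchy sequence, by the
   parallelogram identity. *)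
Lemma riesz B F K : sym_form B -> complete_form B -> linear_on F ->
  (forall w, D w -> F w ^+ 2 <= K * B w w) ->
  exists2 u, D u & forall w, D w -> B u w = F w.
Proof.
move=> fB cB lF FK.
pose J u := B u u - 2 * F u.
have Jexp t x w : D x -> D w -> J (x + t *: w) = J x + 2 * t * (B x w - F w) + t ^+ 2 * B w w.
  move=> Dx Dw; have Dt := subspaceZ t Dw.
  rewrite /J sym_form_expand// (linear_onD lF)// (linear_onZ lF)//; ring.
have Jlb u : D u -> - `|K| <= J u.
  move=> Du; have h1 := FK _ Du; have h2 := sym_form_ge0 fB Du.
  have h3 : F u ^+ 2 <= `|K| * B u u.
    by apply: le_trans h1 _; rewrite ler_wpM2r// ler_norm.
  have h4 : 0 <= `|K| by [].
  rewrite leNgt; apply/negP => h5; have h6 : B u u + `|K| < 2 * F u by rewrite /J in h5; lra.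
  by have := sqr_ge0 (B u u - `|K|); nra.
pose S := [set J u | u in D].
have infS : has_inf S.
  split; first by exists (J 0); exists 0 => //; exact: subspace0.
  by exists (- `|K|) => _ [u Du <-]; exact: Jlb.
pose m := inf S.
have mJ u : D u -> m <= J u by move=> Du; apply: ge_inf; [by case: infS|exists u].
have hx n : exists u, D u /\ J u < m + n.+1%:R^-1.
  have [_ [u Du <-] hu] := @inf_adherent _ S (n.+1%:R^-1) ltac:(by rewrite invr_gt0) infS.
  by exists u.
have [x xP] := choice hx.
have Dx n : D (x n) by case: (xP n).
have small (e : R) : 0 < e -> exists N, forall n, (N <= n)%N -> n.+1%:R^-1 < e.
  move=> e0; exists (Num.bound e^-1) => n Nn; rewrite invf_plt ?posrE//.
  apply: lt_le_trans (_ : (Num.bound e^-1)%:R <= _); last by rewrite ler_nat leqW.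
  by apply: archi_boundP; rewrite invr_ge0 ltW.
(* Near the infimum the first variation is small: [J (x n + t *: w) >= m] for every [t] is a
   condition on a discriminant. *)
have Bx w n : D w -> (B (x n) w - F w) ^+ 2 <= n.+1%:R^-1 * B w w.
  move=> Dw; apply: discriminant_le; first exact: sym_form_ge0 fB _ Dw.
  move=> t; have := mJ _ (subspaceD (Dx n) (subspaceZ t Dw)); rewrite Jexp//.
  have [_ +] := xP n; rewrite -/m; move: (n.+1%:R^-1) => i; lra.
have [e e0|y Dy hy] := cB x Dx.
  have [N hN] := small (e / 4) ltac:(by rewrite divr_gt0).
  exists N => i j Ni Nj; rewrite sym_formB//.
  (* [x i] plus this vector is the midpoint of [x i] and [x j], where [J] is still at least [m]. *)
  have Dz := subspaceZ 2^-1 (subspaceB (Dx j) (Dx i)).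
  have := mJ _ (subspaceD (Dx i) Dz); rewrite Jexp//; last exact: subspaceB.
  rewrite sym_formB// (linear_onB (sym_formr fB (Dx i)))// (linear_onB lF)//.
  have [_ h1] := xP i; have [_ h2] := xP j; have h3 := hN _ Ni; have h4 := hN _ Nj.
  rewrite /J in h1 h2 *; case: fB => _ Bs _; rewrite (Bs (x j) (x i))//.
  move: (i.+1%:R^-1) (j.+1%:R^-1) h1 h2 h3 h4 => p r h1 h2 h3 h4.
  move: (B (x i) (x i)) (B (x j) (x j)) (B (x i) (x j)) (F (x i)) (F (x j)) h1 h2 => b1 b2 b3 f1 f2 h1 h2.
  rewrite (_ : _ + _ + _ = b1 / 4 + b2 / 4 + b3 / 2 - f1 - f2); last by field.
  lra.
exists y => // w Dw; apply/eqP; rewrite -subr_eq0; apply/eqP.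
apply: (@sqr_le_eps _ (4 * B w w)) => e e0.
have [N1 h1] := small e e0; have [N2 h2] := hy e e0.
pose n := maxn N1 N2; have {}h1 := h1 n (leq_maxl _ _); have {}h2 := h2 n (leq_maxr _ _).
have h3 := Bx w n Dw; have h4 := form_CauchySchwarz fB (subspaceB (Dx n) Dy) Dw.
have h5 := sym_form_ge0 fB Dw.
rewrite (linear_onB (let: And3 a _ _ := fB in a w Dw))//= in h4.
have h6 : n.+1%:R^-1 * B w w <= e * B w w by rewrite ler_wpM2r// ltW.
have h7 : B (x n - y) (x n - y) * B w w <= e * B w w by rewrite ler_wpM2r// ltW.
set p := B (x n) w in h3 h4; set b := B y w in h4 *.
have := sqr_ge0 ((p - F w) + (p - b)).
rewrite (_ : (b - F w) ^+ 2 = 2 * (p - F w) ^+ 2 + 2 * (p - b) ^+ 2 - (p - F w + (p - b)) ^+ 2); last by ring.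
move: (n.+1%:R^-1 * B w w) (B (x n - y) (x n - y) * B w w) h3 h4 h6 h7 => s t h3 h4 h6 h7.
lra.
Qed.

Lemma complete_form_equiv B S (c C : R) : 0 < c -> 0 < C -> complete_form B ->
  (forall x, D x -> c * B x x <= S x x) -> (forall x, D x -> S x x <= C * B x x) -> complete_form S.
Proof.
move=> c0 C0 cB lo up x Dx cx; have [e e0|y Dy hy] := cB x Dx.
  have [N hN] := cx (c * e) (mulr_gt0 c0 e0); exists N => i j Ni Nj.
  rewrite -(ltr_pM2l c0); apply: le_lt_trans (hN i j Ni Nj); apply: lo; exact: subspaceB.
exists y => // e e0; have [N hN] := hy (e / C) (divr_gt0 e0 C0); exists N => n Nn.
apply: le_lt_trans (up _ (subspaceB (Dx n) Dy)) _.
by rewrite mulrC -ltr_pdivlMr//; exact: hN.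
Qed.

(* For [Z] with [S (Z x) w = N x w], the equation [u + Z u = g] is solved by
   [u = v - Z v] with [v - Z (Z v) = g], which is symmetric and coercive. *)
Lemma lax_milgram_skew S N F (K b : R) : sym_form S -> complete_form S ->
  (forall z, D z -> linear_on (N^~ z)) -> (forall x y, D x -> D y -> N x y = - N y x) ->
  0 <= K -> 0 <= b -> (forall x y, D x -> D y -> N x y ^+ 2 <= K * (S x x * S y y)) ->
  linear_on F -> (forall w, D w -> F w ^+ 2 <= b * S w w) ->
  exists u, [/\ D u, forall w, D w -> S u w + N u w = F w & S u u <= b].
Proof.
move=> fS cS Nl Ns K0 b0 NK lF Fb.
have Nr z : D z -> linear_on (N z).
  move=> Dz a x y Dx Dy; rewrite Ns//; last exact: subspaceP.
  by rewrite Nl// (Ns x)// (Ns y)//; ring.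
have [g Dg hg] := riesz fS cS lF Fb.
have hZ x : exists z, D x -> D z /\ forall w, D w -> S z w = N x w.
  have [Dx|] := pselect (D x); last by exists 0.
  have [|z Dz zP] := riesz (K := K * S x x) fS cS (Nr x Dx); last by exists z.
  by move=> w Dw; rewrite -mulrA; exact: NK.
have [Z ZP] := choice hZ.
have DZ x : D x -> D (Z x) by move=> /ZP[].
have SZ x w : D x -> D w -> S (Z x) w = N x w by move=> /ZP[_]; exact.
have [Sl Ss S0] := fS.
pose S' v w := S v w + S (Z v) (Z w).
have S'E v w : D v -> D w -> S' v w = S v w + N v (Z w).
  by move=> Dv Dw; rewrite /S' SZ//; exact: DZ.
have fS' : sym_form S'.
  split.
  - move=> z Dz a x y Dx Dy; have DZz := DZ _ Dz.
    rewrite !S'E//; last exact: subspaceP.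
    by rewrite Sl// Nl//; ring.
  - move=> x y Dx Dy; rewrite /S' (Ss x)// (Ss (Z x))//; exact: DZ.
  - move=> x Dx; rewrite /S' addr_ge0// S0//; exact: DZ.
have ZK x : D x -> S (Z x) (Z x) <= K * S x x.
  move=> Dx; have DZx := DZ _ Dx; have h1 := NK x (Z x) Dx DZx; rewrite -SZ// in h1.
  have h2 := S0 _ DZx; have h3 := S0 _ Dx; set s := S (Z x) (Z x) in h1 h2 *.
  have [->|s0] := eqVneq s 0; first by rewrite mulr_ge0.
  have sp : 0 < s by rewrite lt_neqAle eq_sym s0.
  by rewrite -(ler_pM2r sp) -expr2 -mulrA.
have cS' : complete_form S'.
  apply: (@complete_form_equiv S S' 1 (1 + K)) => //; first by rewrite ltr_pwDl.
    by move=> x Dx; rewrite mul1r lerDl S0//; exact: DZ.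
  by move=> x Dx; rewrite mulrDl mul1r lerD2l ZK.
have [|v Dv hv] := riesz (K := S g g) fS' cS' (sym_formr fS Dg).
  move=> w Dw; apply: le_trans (form_CauchySchwarz fS Dg Dw) _.
  by rewrite ler_wpM2l ?S0// lerDl S0//; exact: DZ.
have DZv := DZ _ Dv; have Du := subspaceB Dv DZv.
have sol w : D w -> S (v - Z v) w + N (v - Z v) w = F w.
  move=> Dw; rewrite (linear_onB (Sl w Dw))// (linear_onB (Nl w Dw))// SZ//.
  have := hv w Dw; rewrite hg// /S' (Ss (Z v))//; last exact: DZ.
  by rewrite SZ// (Ns w)// => <-; ring.
exists (v - Z v); split => //.
(* Skewness gives [N u u = 0], so that testing with the solution [u] itself yields [S u u = F u],
   and the bound of [F] turns into [S u u <= b]. *)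
have := sol _ Du; have := Ns _ _ Du Du => n0; rewrite (_ : N _ _ = 0); last by lra.
rewrite addr0 => h1; have h2 := Fb _ Du; rewrite -h1 in h2; have h3 := S0 _ Du.
set s := S (v - Z v) (v - Z v) in h2 h3 *.
have [s0|s0] := eqVneq s 0; last by rewrite -(ler_pM2r (_ : 0 < s)) -?expr2// lt_neqAle eq_sym s0.
by rewrite s0.
Qed.

(** * Fredholm alternative for the pencil of the forms *)

Section fredholm.
Variables (h q : M -> M -> R) (J : M -> M).
Hypotheses (fh : sym_form h) (fq : sym_form q).
Hypothesis cE : complete_form (fun x y => h x y + q x y).
Hypotheses (DJ : forall x, D x -> D (J x)) (lJ : forall a x y, J (a *: x + y) = a *: J x + J y)
  (JJ : forall x, J (J x) = - x).
Hypotheses (hJ : forall x y, D x -> D y -> h (J x) (J y) = h x y)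
  (qJ : forall x y, D x -> D y -> q (J x) (J y) = q x y).
Hypothesis compact_form : forall e : R, 0 < e -> exists m (l : 'I_m -> M -> R) (K : R),
  [/\ forall i, linear_on (l i), forall i x, D x -> l i x ^+ 2 <= K * h x x &
      forall x, D x -> h x x <= e * q x x + \sum_i l i x ^+ 2].

Let hl z : D z -> linear_on (h^~ z). Proof. by case: fh => + _ _; exact. Qed.
Let hs x y : D x -> D y -> h x y = h y x. Proof. by case: fh => _ + _; exact. Qed.
Let h0 x : D x -> 0 <= h x x. Proof. by case: fh => _ _; exact. Qed.
Let ql z : D z -> linear_on (q^~ z). Proof. by case: fq => + _ _; exact. Qed.
Let qs x y : D x -> D y -> q x y = q y x. Proof. by case: fq => _ + _; exact. Qed.
Let q0 x : D x -> 0 <= q x x. Proof. by case: fq => _ _; exact. Qed.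

(* The real form of the equation [(A - (a + i b)) u = f], with [J] the
   multiplication by [i]. *)
Definition pencil (a b : R) u w := q u w - a * h u w - b * h (J u) w.

Definition eigenvector a b u := D u /\ forall w, D w -> pencil a b u w = 0.

Lemma skew_J (B : M -> M -> R) : sym_form B -> (forall x y, D x -> D y -> B (J x) (J y) = B x y) ->
  forall x y, D x -> D y -> B (J x) y = - B (J y) x.
Proof.
move=> [Bl Bs _] BJ x y Dx Dy; have DJx := DJ Dx; have DJy := DJ Dy.
rewrite -BJ// JJ -scaleN1r -[_ *: x]addr0 Bl//; last exact: subspace0.
rewrite (linear_on0 (Bl _ DJy)) addr0 mulN1r Bs//.
Qed.

(** Testing with [J u]: the terms [q u (J u)] and [h u (J u)] vanish by skewness, and
    [b * h u u = 0] is left. *)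
Lemma eigenvalue_real a b u : eigenvector a b u -> h u u != 0 -> b = 0.
Proof.
move=> [Du eu] hu; have DJu := DJ Du; have := eu _ DJu; rewrite /pencil hJ// hs// qs//.
have hz : h (J u) u = 0 by have := skew_J fh hJ Du Du => ?; lra.
have qz : q (J u) u = 0 by have := skew_J fq qJ Du Du => ?; lra.
rewrite hz qz => bh; have {}bh : b * h u u = 0 by lra.
by move/eqP: bh; rewrite mulf_eq0 (negbTE hu) orbF => /eqP.
Qed.

Lemma eigenvector_ortho a a' u v : eigenvector a 0 u -> eigenvector a' 0 v -> a != a' -> h u v = 0.
Proof.
move=> [Du eu] [Dv ev] aa; have := eu _ Dv; have := ev _ Du; rewrite /pencil (qs Dv)// (hs Dv)// => h1 h2.
have : (a - a') * h u v = 0 by lra.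
by move/eqP; rewrite mulf_eq0 subr_eq0 (negbTE aa) => /eqP.
Qed.

Lemma kernel_row n m (A : 'M[R]_(n, m)) : (m < n)%N -> exists2 c : 'rV[R]_n, c != 0 & c *m A = 0.
Proof.
move=> mn; have : kermx A != 0.
  by rewrite -mxrank_eq0 mxrank_ker subn_eq0 -ltnNge; apply: leq_ltn_trans (rank_leq_col _) mn.
move=> /rowV0Pn[c /sub_kermxP cA c0]; by exists c.
Qed.

Definition orthonormal_family n (u : 'I_n -> M) := forall i j, h (u i) (u j) = (i == j)%:R.

Lemma orthonormal_expand n (u : 'I_n -> M) (c : 'I_n -> R) : (forall i, D (u i)) -> orthonormal_family u ->
  forall j, h (\sum_i c i *: u i) (u j) = c j.
Proof.
move=> Du ou j; rewrite (linear_on_sum (hl (Du j)) _ Du) (bigD1 j)//= ou eqxx mulr1.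
by rewrite big1 ?addr0// => i /negbTE ij; rewrite ou ij mulr0.
Qed.

(** If there were more orthonormal eigenvectors than functionals, some nonzero combination [x] would
    be annihilated by all [l i]. Then [h x x <= e * q x x], whereas [q x x <= |L| * h x x]; this is
    impossible because [e * |L| < 1]. *)
Lemma eigenvector_count (L : R) : exists m, forall n (u : 'I_n -> M) (a : 'I_n -> R),
  (forall i, eigenvector (a i) 0 (u i)) -> (forall i, a i <= L) -> orthonormal_family u -> (n <= m)%N.
Proof.
have [|m [l [K [ll lK hl']]]] := @compact_form (2 * (`|L| + 1))^-1.
  by rewrite invr_gt0 mulr_gt0// ltr_wpDl.
exists m => n u a eu aL ou; rewrite leqNgt; apply/negP => mn.
have Du i : D (u i) by case: (eu i).
have [c c0 cA] := kernel_row (\matrix_(i < n, j < m) l j (u i)) mn.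
pose x := \sum_i c 0 i *: u i.
have Dx : D x by exact: subspace_sum.
have lx j : l j x = 0.
  rewrite (linear_on_sum (ll j) _ Du); have := congr1 (fun A : 'rV_m => A 0 j) cA.
  by rewrite mxE => /eqP; rewrite mxE => /eqP; under eq_bigr do rewrite mxE.
have hxu j : h x (u j) = c 0 j by exact: orthonormal_expand.
have hxx : h x x = \sum_i c 0 i ^+ 2.
  rewrite {2}/x (linear_on_sum (sym_formr fh Dx) _ Du); apply: eq_bigr => i _.
  by rewrite hxu.
have qxu j : q x (u j) = a j * c 0 j.
  have [_ /(_ x Dx)] := eu j; rewrite /pencil (qs (Du j))// (hs (Du j))// hxu => ?; lra.
have qxx : q x x = \sum_i a i * c 0 i ^+ 2.
  rewrite {2}/x (linear_on_sum (sym_formr fq Dx) _ Du); apply: eq_bigr => i _.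
  by rewrite qxu; ring.
have qL : q x x <= `|L| * h x x.
  rewrite qxx hxx mulr_sumr; apply: ler_sum => i _; rewrite ler_wpM2r ?sqr_ge0//.
  by apply: le_trans (aL i) _; exact: ler_norm.
have hx0 : 0 < h x x.
  rewrite hxx lt_neqAle sumr_ge0 ?andbT// => [|i _]; last exact: sqr_ge0.
  apply: contra c0; rewrite eq_sym psumr_eq0 => [/allP hc|i _]; last exact: sqr_ge0.
  apply/eqP/rowP => i; rewrite mxE; apply/eqP; rewrite -sqrf_eq0.
  by have := hc i (mem_index_enum i).
have := hl' _ Dx; rewrite big1 ?addr0 => [|i _]; last by rewrite lx expr0n.
move=> h1; have h2 : 0 < 2 * (`|L| + 1) by rewrite mulr_gt0// ltr_wpDl.
rewrite mulrC ler_pdivlMr// in h1; have := normr_ge0 L; nra.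
Qed.

Lemma form_sum_le n (c : 'I_n -> R) (x : 'I_n -> M) : (forall i, D (x i)) ->
  h (\sum_i c i *: x i) (\sum_i c i *: x i) <= 2 ^+ n * \sum_i c i ^+ 2 * h (x i) (x i).
Proof.
elim: n c x => [|n ih] c x Dx; first by rewrite !big_ord0 mulr0 (linear_on0 (hl subspace0)).
rewrite !big_ord_recl; set y := \sum_i _; set s := \sum_i _.
have Dy : D y by exact: subspace_sum.
have Dc := subspaceZ (c ord0) (Dx ord0).
have h1 := h0 (subspaceB Dc Dy); rewrite sym_formB// in h1.
have h2 := sym_form_expand fh 1 Dc Dy; rewrite scale1r in h2; rewrite {}h2.
have h3 : h y y <= 2 ^+ n * s by exact: ih.
have h4 : h (c ord0 *: x ord0) (c ord0 *: x ord0) = c ord0 ^+ 2 * h (x ord0) (x ord0).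
  by rewrite (linear_onZ (hl Dc))// (linear_onZ (sym_formr fh (Dx _)))//; ring.
have h5 : c ord0 ^+ 2 * h (x ord0) (x ord0) <= 2 ^+ n * (c ord0 ^+ 2 * h (x ord0) (x ord0)).
  by rewrite ler_peMl ?exprn_ege1 ?ler1n// mulr_ge0 ?sqr_ge0 ?h0.
rewrite h4 in h1 *; rewrite [2 ^+ n.+1]exprS; move: h1 h3 h5; set t := c ord0 ^+ 2 * _; set p := 2 ^+ n.
set z := h _ y; set w := h y y => h1 h3 h5; rewrite (_ : 2 * p * (t + s) = 2 * (p * t) + 2 * (p * s)); last by ring.
by move: (p * t) (p * s) h3 h5 => pt ps h3 h5; lra.
Qed.

(** Adding [k * \sum_i l i u * l i w] makes the symmetric part coercive, and the perturbed equation
    is solved by [lax_milgram_skew]. Removing this perturbation of finite rank is a linear system of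
    size [m], which is regular because a kernel vector would produce an eigenvector. *)
Lemma fredholm a b : (forall u, eigenvector a b u -> h u u = 0) ->
  exists C, forall F B, 0 <= B -> linear_on F -> (forall w, D w -> F w ^+ 2 <= B * h w w) ->
    exists u, [/\ D u, forall w, D w -> pencil a b u w = F w & h u u <= C * B].
Proof.
move=> noeig.
have a1 : 0 < `|a| + 1 by rewrite ltr_wpDl.
have [|m [l [K [ll lK hl']]]] := @compact_form (2 * (`|a| + 1))^-1.
  by rewrite invr_gt0 mulr_gt0.
pose k := `|a| + 1.
pose S u w := q u w - a * h u w + k * \sum_i l i u * l i w.
pose N u w := - b * h (J u) w.
have lS z : D z -> linear_on (fun u => \sum_i l i u * l i z).
  move=> Dz c x y Dx Dy; rewrite mulr_sumr -big_split; apply: eq_bigr => i _ /=.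
  by rewrite ll//; ring.
(* The parameter [1 / (2 * k)] in the compactness bound gives
   [k * h <= q / 2 + k * \sum_i l i ^+ 2], and [k - |a| = 1] leaves one copy of [h]. *)
have Slo x : D x -> 2^-1 * (h x x + q x x) <= S x x.
  move=> Dx; rewrite /S; have := hl' _ Dx; under [X in k * X]eq_bigr do rewrite -expr2.
  set s := \sum_i _ => h1.
  have h2 : k * h x x <= 2^-1 * q x x + k * s.
    have := ler_wpM2l (ltW a1) h1; rewrite mulrDr -/k (_ : k * (_ * _) = 2^-1 * q x x)//.
    by rewrite /k; field; rewrite gt_eqF.
  have h3 : a * h x x <= `|a| * h x x by rewrite ler_wpM2r ?h0// ler_norm.
  have h4 := h0 Dx; rewrite /k in h2 *; lra.
have [C C0 Sup] : exists2 C : R, 0 < C & forall x, D x -> S x x <= C * (h x x + q x x).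
  exists (1 + `|a| + k * (m%:R * `|K|)) => [|x Dx].
    by rewrite ltr_wpDr ?mulr_ge0 ?ltr_wpDr// ltW.
  have h4 := h0 Dx; have h5 := q0 Dx.
  have h1 : \sum_i l i x * l i x <= m%:R * `|K| * h x x.
    apply: (@le_trans _ _ (\sum_(i < m) `|K| * h x x)).
      apply: ler_sum => i _; rewrite -expr2; apply: le_trans (lK i x Dx) _.
      by rewrite ler_wpM2r// ler_norm.
    by rewrite sumr_const card_ord -mulr_natl; lra.
  have h2 : - a * h x x <= `|a| * h x x by rewrite ler_wpM2r// -normrN ler_norm.
  have h3 : k * (\sum_i l i x * l i x) <= k * (m%:R * `|K|) * h x x.
    by rewrite -mulrA ler_wpM2l// ltW.
  have h6 : 0 <= `|a| * q x x by rewrite mulr_ge0.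
  have h7 : 0 <= k * (m%:R * `|K|) * q x x by rewrite !mulr_ge0// ltW.
  rewrite /S; nra.
have fS : sym_form S.
  split=> [z Dz c x y Dx Dy|x y Dx Dy|x Dx].
  - by rewrite /S hl// ql// lS//; ring.
  - rewrite /S hs// qs//; congr (_ + _ * _); apply: eq_bigr => i _; exact: mulrC.
  - by apply: le_trans (Slo _ Dx); rewrite mulr_ge0// addr_ge0// ?h0 ?q0.
have cS : complete_form S by apply: complete_form_equiv C0 cE Slo Sup; rewrite invr_gt0.
have hS x : D x -> h x x <= 2 * S x x by move=> Dx; have := Slo _ Dx; have := q0 Dx; lra.
have Nl z : D z -> linear_on (N^~ z).
  move=> Dz c x y Dx Dy; rewrite /N lJ hl//; [ring|exact: DJ|exact: DJ].
have Ns x y : D x -> D y -> N x y = - N y x.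
  by move=> Dx Dy; rewrite /N (skew_J fh hJ Dx Dy); ring.
have NK x y : D x -> D y -> N x y ^+ 2 <= 4 * b ^+ 2 * (S x x * S y y).
  move=> Dx Dy; have DJx := DJ Dx; have h1 := form_CauchySchwarz fh DJx Dy; rewrite hJ// in h1.
  have h2 : h x x * h y y <= (2 * S x x) * (2 * S y y) by apply: ler_pM; rewrite ?h0 ?hS.
  rewrite /N exprMn sqrrN (_ : 4 * _ * _ = b ^+ 2 * ((2 * S x x) * (2 * S y y))); last by ring.
  by rewrite ler_wpM2l ?sqr_ge0//; exact: le_trans h2.
have solve F B : 0 <= B -> linear_on F -> (forall w, D w -> F w ^+ 2 <= B * h w w) ->
    exists u, [/\ D u, forall w, D w -> S u w + N u w = F w & h u u <= 4 * B].
  move=> B0 lF FB; have [|||||u [Du Fu uB]] := @lax_milgram_skew S N F (4 * b ^+ 2) (2 * B) fS cS Nl Ns.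
  - by rewrite mulr_ge0// sqr_ge0.
  - by rewrite mulr_ge0.
  - exact: NK.
  - exact: lF.
  - move=> w Dw; apply: le_trans (FB _ Dw) _; rewrite -mulrA mulrCA ler_wpM2l// hS//.
  by exists u; split => //; have := hS _ Du; lra.
have lK' i w : D w -> l i w ^+ 2 <= `|K| * h w w.
  by move=> Dw; apply: le_trans (lK i w Dw) _; rewrite ler_wpM2r ?h0// ler_norm.
have he i : exists e, [/\ D e, forall w, D w -> S e w + N e w = l i w & h e e <= 4 * `|K|].
  by apply: solve => // w; exact: lK'.
have [e eP] := choice he.
have De i : D (e i) by case: (eP i).
have penE u w : pencil a b u w = S u w + N u w - k * \sum_i l i u * l i w.
  by rewrite /pencil /S /N; ring.
have SNl w : D w -> linear_on (fun u => S u w + N u w).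
  by move=> Dw c x y Dx Dy; rewrite Nl//; case: fS => /(_ w Dw) -> // _ _; ring.
have SNe (c : 'I_m -> R) w : D w -> S (\sum_i c i *: e i) w + N (\sum_i c i *: e i) w = \sum_i c i * l i w.
  move=> Dw; rewrite (linear_on_sum (SNl _ Dw) _ De); apply: eq_bigr => i _.
  by case: (eP i) => _ -> .
(* A solution is sought as [v + k *: \sum_i c i *: e i], where [v] solves the perturbed equation and
   [c i] is the value of [l i] at the solution; this requirement reads [c *m A = (l j v)_j]. *)
pose A : 'M[R]_m := 1%:M - k *: \matrix_(i, j) l j (e i).
have lA (c : 'rV[R]_m) j : (c *m A) 0 j = c 0 j - k * l j (\sum_i c 0 i *: e i).
  rewrite (linear_on_sum (ll j) _ De) /A mulmxBr mulmx1 -scalemxAr !mxE; congr (_ - _ * _).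
  by apply: eq_bigr => i _; rewrite !mxE.
have uA : A \in unitmx.
  rewrite -row_free_unit -kermx_eq0; apply/negPn/negP => /rowV0Pn[c /sub_kermxP cA c0].
  pose u := \sum_i (k * c 0 i) *: e i.
  have Du : D u by exact: subspace_sum.
  have luE j : l j u = c 0 j.
    have := congr1 (fun A : 'rV_m => A 0 j) cA; rewrite lA mxE (linear_on_sum (ll j) _ De).
    rewrite /u (linear_on_sum (ll j) _ De) mulr_sumr => /eqP; rewrite subr_eq0 => /eqP ->.
    by apply: eq_bigr => i _; rewrite mulrA.
  have hu : h u u = 0.
    apply: noeig; split => // w Dw; rewrite penE SNe// mulr_sumr -sumrB big1// => i _.
    by rewrite luE; ring.
  move/eqP: c0; apply; apply/rowP => j; rewrite mxE -luE; apply/eqP; rewrite -sqrf_eq0 eq_le sqr_ge0 andbT.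
  by have := lK j u Du; rewrite hu mulr0.
pose P j i : R := invmx A j i.
pose y j := \sum_i (k * P j i) *: e i.
have Dy j : D (y j) by exact: subspace_sum.
pose C1 := 2 ^+ m * \sum_j h (y j) (y j).
have C10 : 0 <= C1 by rewrite mulr_ge0 ?exprn_ge0// sumr_ge0// => j _; exact: h0.
exists (8 + 2 * C1 * (4 * `|K|)) => F B B0 lF FB.
have [v [Dv vF vB]] := solve F B B0 lF FB.
pose c j := l j v; pose g := (\row_j c j) *m invmx A.
have gE i : g 0 i = \sum_j c j * P j i by rewrite mxE; apply: eq_bigr => j _; rewrite mxE.
pose z := \sum_i (k * g 0 i) *: e i.
have Dz : D z by exact: subspace_sum.
have lz j : l j (v + z) = g 0 j.
  rewrite (linear_onD (ll j))//; have := lA g j; rewrite /g mulmxKV// mxE -/g => h1.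
  rewrite -/(c j) h1 (linear_on_sum (ll j) _ De) /z (linear_on_sum (ll j) _ De) mulr_sumr.
  by under [X in _ + X]eq_bigr do rewrite -mulrA; rewrite subrK.
exists (v + z); split; first exact: subspaceD.
  move=> w Dw; rewrite penE (linear_onD (SNl _ Dw))// vF// SNe//.
  under [X in k * X]eq_bigr do rewrite lz.
  by rewrite mulr_sumr; under [X in _ - X]eq_bigr do rewrite mulrA; rewrite addrK.
have zE : z = \sum_j c j *: y j.
  rewrite /z; under [RHS]eq_bigr do rewrite scaler_sumr.
  rewrite exchange_big; apply: eq_bigr => i _; rewrite gE mulr_sumr scaler_suml.
  by apply: eq_bigr => j _; rewrite scalerA mulrCA.
have hz : h z z <= C1 * (`|K| * (4 * B)).
  rewrite zE; apply: le_trans (form_sum_le c Dy) _; rewrite /C1 -!mulrA ler_wpM2l ?exprn_ge0//.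
  rewrite mulr_suml; apply: ler_sum => j _; rewrite mulrC ler_wpM2l ?h0//.
  by apply: le_trans (lK' j v Dv) _; rewrite ler_wpM2l.
have h1 := sym_formB fh Dv Dz; have h2 := h0 (subspaceB Dv Dz).
have h3 := sym_form_expand fh 1 Dv Dz; rewrite scale1r in h3; rewrite h3.
lra.
Qed.

End fredholm.
End form_space.

(** * Square integrable functions *)

Lemma exp2_small {R : realType} (c e : R) : 0 <= c -> 0 < e -> exists j, c / 2 ^+ j < e.
Proof.
move=> c0 e0; exists (Num.bound (c / e)).
rewrite ltr_pdivrMr ?exprn_gt0// mulrC -ltr_pdivrMr//.
apply: lt_le_trans (archi_boundP _) _; first by rewrite divr_ge0// ltW.
by rewrite -natrX ler_nat ltnW// ltn_expl.
Qed.

Section square_integrable.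
Context {d} {T : measurableType d} {R : realType}.
Variables (mu : {measure set T -> \bar R}) (E : set T).
Hypothesis mE : measurable E.

Definition sqint (f : T -> R) :=
  measurable_fun E f /\ (\int[mu]_(x in E) (f x ^+ 2)%:E < +oo)%E.

Definition ip (f g : T -> R) : R := (\int[mu]_(x in E) (f x * g x))%R.

Lemma sqint_le (f g : T -> R) : measurable_fun E f -> (\int[mu]_(x in E) (g x)%:E < +oo)%E ->
  (forall x, E x -> f x ^+ 2 <= g x) -> sqint f.
Proof.
move=> mf goo fg; split=> //; apply: le_lt_trans goo; apply: ge0_le_integral_gen => x Ex.
- by rewrite lee_fin sqr_ge0.
- by rewrite lee_fin (le_trans _ (fg x Ex))// sqr_ge0.
- by split => //; rewrite lee_fin fg.
Qed.

Lemma sqint2_lty f g (a b : R) : sqint f -> sqint g ->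
  (\int[mu]_(x in E) (a ^+ 2 * f x ^+ 2 + b ^+ 2 * g x ^+ 2)%:E < +oo)%E.
Proof.
move=> [mf foo] [mg goo]; under eq_integral do rewrite EFinD (EFinM (a ^+ 2)) (EFinM (b ^+ 2)).
have mf2 : measurable_fun E (fun x => (f x ^+ 2)%:E) by apply/measurable_EFinP; exact: measurable_funX.
have mg2 : measurable_fun E (fun x => (g x ^+ 2)%:E) by apply/measurable_EFinP; exact: measurable_funX.
have f0 x : (0 <= (f x ^+ 2)%:E)%E by rewrite lee_fin sqr_ge0.
have g0 x : (0 <= (g x ^+ 2)%:E)%E by rewrite lee_fin sqr_ge0.
have a0 : (0 <= (a ^+ 2)%:E)%E by rewrite lee_fin sqr_ge0.
have b0 : (0 <= (b ^+ 2)%:E)%E by rewrite lee_fin sqr_ge0.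
rewrite ge0_integralD//; last 4 first.
- by move=> x _; rewrite mule_ge0.
- exact: measurable_funeM.
- by move=> x _; rewrite mule_ge0.
- exact: measurable_funeM.
by rewrite !ge0_integralZl// lte_add_pinfty// lte_mul_pinfty.
Qed.

Lemma sqintP a f g : sqint f -> sqint g -> sqint (fun x => a * f x + g x).
Proof.
move=> hf hg; have [mf foo] := hf; have [mg goo] := hg.
apply: (@sqint_le _ (fun x => (2 * a) ^+ 2 * f x ^+ 2 + 2 ^+ 2 * g x ^+ 2)).
- by apply: measurable_funD => //; exact: measurable_funM.
- exact: sqint2_lty.
- by move=> x _; have := sqr_ge0 (a * f x - g x); have := sqr_ge0 (a * f x); have := sqr_ge0 (g x); nra.
Qed.

Lemma sqint0 : sqint (fun=> 0).
Proof. by split => //; under eq_integral do rewrite expr0n; rewrite integral0 ltry. Qed.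

Lemma sqintB f g : sqint f -> sqint g -> sqint (fun x => f x - g x).
Proof. by move=> hf hg; have := sqintP (-1) hg hf; under eq_fun do rewrite mulN1r addrC. Qed.

Lemma sqint_integrable f g : sqint f -> sqint g -> mu.-integrable E (fun x => (f x * g x)%:E).
Proof.
move=> hf hg; have [mf foo] := hf; have [mg goo] := hg.
apply/integrableP; split; first by apply/measurable_EFinP; exact: measurable_funM.
apply: le_lt_trans (sqint2_lty 1 1 hf hg); apply: ge0_le_integral_gen => x Ex //.
  by rewrite lee_fin !expr1n !mul1r addr_ge0 ?sqr_ge0.
split => //; rewrite -[(`|_|)%E]/(`|f x * g x|%:E) lee_fin !expr1n !mul1r normrM.
have := sqr_ge0 (`|f x| - `|g x|); rewrite -(real_normK (num_real (f x))) -(real_normK (num_real (g x))).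
have := normr_ge0 (f x); have := normr_ge0 (g x); nra.
Qed.

Lemma ipC f g : ip f g = ip g f.
Proof. by congr fine; apply: eq_integral => x _; rewrite mulrC. Qed.

Lemma ipP a f g h : sqint f -> sqint g -> sqint h ->
  ip (fun x => a * f x + g x) h = a * ip f h + ip g h.
Proof.
move=> hf hg hh; have fh := sqint_integrable hf hh; have gh := sqint_integrable hg hh.
rewrite /ip -RintegralZl// -RintegralD//; last exact: (integrableZl _ _ fh).
by apply: eq_Rintegral => x _; rewrite mulrDl mulrA.
Qed.

Lemma ip_parallelogram f g : sqint f -> sqint g ->
  ip (fun x => f x + g x) (fun x => f x + g x) + ip (fun x => g x - f x) (fun x => g x - f x) =
  2 * ip f f + 2 * ip g g.
Proof.
move=> hf hg.
have ex a : ip (fun x => a * f x + g x) (fun x => a * f x + g x) = a ^+ 2 * ip f f + 2 * a * ip f g + ip g g.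
  have h := sqintP a hf hg.
  rewrite ipP// !(ipC _ (fun x => a * f x + g x)) !ipP// (ipC g f); ring.
have -> : (fun x => f x + g x) = (fun x => 1 * f x + g x) by apply/funext => x; ring.
have -> : (fun x => g x - f x) = (fun x => -1 * f x + g x) by apply/funext => x; ring.
rewrite !ex; ring.
Qed.

Lemma ipE f : sqint f -> (\int[mu]_(x in E) (f x ^+ 2)%:E = (ip f f)%:E)%E.
Proof.
move=> [mf foo]; rewrite /ip /Rintegral; under [in RHS]eq_integral do rewrite -expr2.
by rewrite fineK// ge0_fin_numE// integral_ge0// => x _; rewrite lee_fin sqr_ge0.
Qed.

Lemma ip_ge0 f : 0 <= ip f f.
Proof. by apply: Rintegral_ge0 => x _; rewrite -expr2 sqr_ge0. Qed.

Lemma ip_eq0 f : sqint f -> ip f f = 0 -> {ae mu, forall x, E x -> f x = 0}.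
Proof.
move=> hf f0; have [mf _] := hf.
have mf2 : measurable_fun E (fun x => (f x ^+ 2)%:E) by apply/measurable_EFinP; exact: measurable_funX.
have : (\int[mu]_(x in E) `|(f x ^+ 2)%:E| = 0)%E.
  under eq_integral do rewrite gee0_abs ?lee_fin ?sqr_ge0//.
  by rewrite ipE// f0.
move=> /(ae_eq_integral_abs mu mE mf2); apply: filterS => x h Ex; have [/eqP] := h Ex.
by rewrite sqrf_eq0 => /eqP.
Qed.

Lemma ip_eq0E (f : T -> R) : measurable_fun E f -> {ae mu, forall x, E x -> f x = 0} -> ip f f = 0.
Proof.
move=> mf f0; rewrite /ip /Rintegral (ae_eq_integral (cst 0%E))//.
- by rewrite integral0.
- by apply/measurable_EFinP; exact: measurable_funM.
- by apply: filterS f0 => x h Ex /=; rewrite h// mulr0.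
Qed.

Lemma integral_sqint_le f A : measurable A -> A `<=` E -> (mu A < +oo)%E -> sqint f ->
  mu.-integrable A (EFin \o f) /\ (\int[mu]_(x in A) f x)%R ^+ 2 <= fine (mu A) * ip f f.
Proof.
move=> mA AE Aoo hf; have [mf foo] := hf; have mfA := measurable_funS mE AE mf.
have h1 : (\int[mu]_(x in A) (f x ^+ 2)%:E <= (ip f f)%:E)%E.
  by rewrite -ipE//; apply: ge0_integral_le_set => // x _; rewrite lee_fin sqr_ge0.
have h2 : (\int[mu]_(x in A) (f x ^+ 2)%:E < +oo)%E by apply: le_lt_trans h1 _; rewrite ltry.
have iA := integrable_sqr_finite mA Aoo mfA h2; split => //.
have qE : mu A = (fine (mu A))%:E by rewrite fineK// ge0_fin_numE.
have [q0|q0] := eqVneq (fine (mu A)) 0.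
  rewrite q0 mul0r /Rintegral (_ : (\int[mu]_(x in A) _)%E = 0%E) ?expr0n//.
  apply: null_set_integral => //; first exact/measurable_EFinP.
  by rewrite qE q0.
have qp : 0 < fine (mu A) by rewrite lt_neqAle eq_sym q0 fine_ge0.
rewrite -lee_fin; apply: le_trans (sqr_mean_le mA qE qp mfA) _.
by rewrite EFinM; apply: lee_wpmul2l => //; rewrite lee_fin ltW.
Qed.

(** Repeated use of [(x + y) ^+ 2 <= 2 * x ^+ 2 + 2 * y ^+ 2]. The growing weights are affordable
    along a subsequence whose increments decay like [4 ^- i]. *)
Lemma telescope_sqr_le (g : nat -> R) j l :
  (g (l + j)%N - g j) ^+ 2 <= \sum_(i < l) 2 ^+ i.+1 * (g (i + j).+1 - g (i + j)%N) ^+ 2.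
Proof.
elim: l j => [|l ih] j; first by rewrite add0n subrr expr0n big_ord0.
rewrite big_ord_recl /= add0n expr1; have := ih j.+1; rewrite addnS -addSn.
have -> : \sum_(i < l) 2 ^+ (bump 0 i).+1 * (g (bump 0 i + j).+1 - g (bump 0 i + j)%N) ^+ 2 =
    2 * \sum_(i < l) 2 ^+ i.+1 * (g (i + j.+1).+1 - g (i + j.+1)%N) ^+ 2.
  by rewrite mulr_sumr; apply: eq_bigr => i _; rewrite /bump add1n addSn addnS exprS mulrA.
set s := \sum_(i < l) _; have := sqr_ge0 ((g j.+1 - g j) - (g (l.+1 + j)%N - g j.+1)).
set a := g (l.+1 + j)%N; set b := g j.+1; set c := g j.
rewrite (_ : (a - c) ^+ 2 = 2 * (b - c) ^+ 2 + 2 * (a - b) ^+ 2 - (b - c - (a - b)) ^+ 2); last by ring.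
lra.
Qed.

(* Along a fast subsequence [g], with [S = \sum_k 2^k (g_(k+1) - g_k)^2]
   integrable, one has [(g_l - g_j)^2 <= 2^(1-j) S] for [l >= j]. *)
Lemma sqint_complete (f : nat -> T -> R) : (forall n, sqint (f n)) ->
  (forall e : R, 0 < e -> exists N, forall m n, (N <= m)%N -> (N <= n)%N ->
     ip (fun x => f m x - f n x) (fun x => f m x - f n x) < e) ->
  exists2 g, sqint g & forall e : R, 0 < e -> exists N, forall n, (N <= n)%N ->
     ip (fun x => f n x - g x) (fun x => f n x - g x) < e.
Proof.
move=> hf cf.
(* Squared increments below [4 ^- k] with weights [2 ^ k] leave a geometric series: the integral of
   [S] is at most 2, so [S] is finite almost everywhere. *)
have e0 k : 0 < (4 ^+ k)^-1 :> R by rewrite invr_gt0 exprn_gt0.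
have [N NP] := choice (fun k => cf _ (e0 k)).
(* The partial sums of [N] are nondecreasing and satisfy [N k <= n k]. *)
pose n k := \sum_(i < k.+1) N i.
have nN k : (N k <= n k)%N by rewrite /n big_ord_recr leq_addl.
have nS k : (n k <= n k.+1)%N by rewrite /n [leqRHS]big_ord_recr leq_addr.
pose g k := f (n k).
have hg k : sqint (g k) by exact: hf.
pose D k x := (g k.+1 x - g k x) ^+ 2.
have D0 k x : 0 <= D k x by exact: sqr_ge0.
have mD k : measurable_fun E (D k).
  by apply: measurable_funX; have [] := sqintB (hg k.+1) (hg k).
have iD k : (\int[mu]_(x in E) (D k x)%:E <= ((4 ^+ k)^-1)%:E)%E.
  rewrite ipE; last exact: sqintB.
  by rewrite lee_fin ltW// NP// (leq_trans (nN k)).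
pose S x : \bar R := (\sum_(0 <= k <oo) (2 ^+ k * D k x)%:E)%E.
have t0 k x : (0 <= (2 ^+ k * D k x)%:E)%E by rewrite lee_fin mulr_ge0// exprn_ge0.
have mt k : measurable_fun E (fun x => (2 ^+ k * D k x)%:E).
  by apply/measurable_EFinP; exact: measurable_funM.
have mS : measurable_fun E S by apply: ge0_emeasurable_sum => // k x *; exact: t0.
have iS : (\int[mu]_(x in E) S x <= 2%:E)%E.
  rewrite integral_nneseries//; apply: lime_le.
    by apply: is_cvg_nneseries => k _ _; apply: integral_ge0 => x _; exact: t0.
  near=> m; apply: (@le_trans _ _ (\sum_(0 <= k < m) ((2^-1) ^+ k : R)%:E)%E).
    apply: lee_sum => k _; under eq_integral do rewrite EFinM.
    rewrite ge0_integralZl//; last first.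
      by move=> x _; rewrite lee_fin.
      by apply/measurable_EFinP.
    apply: le_trans (lee_wpmul2l _ (iD k)) _ => //.
    rewrite -EFinM lee_fin (_ : (4 : R) = 2 * 2); last by ring.
    by rewrite exprMn invfM mulrA divff ?mul1r ?exprVn// expf_neq0.
  rewrite sumEFin lee_fin.
  suff -> : \sum_(0 <= k < m) (2^-1) ^+ k = 2 - 2 * (2^-1) ^+ m :> R by rewrite gerBl mulr_ge0// exprn_ge0.
  elim: (m) => [|i ih]; first by rewrite big_geq// expr0 mulr1 subrr.
  by rewrite big_nat_recr//= ih exprS; field.
have S0 x : (0 <= S x)%E by apply: nneseries_ge0.
pose A := E `&` [set x | (S x < +oo)%E].
have mA : measurable A.
  rewrite /A (_ : [set x | (S x < +oo)%E] = S @^-1` `[0%E, +oo%E[%classic); first exact: (mS mE _ (emeasurable_itv _)).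
  by apply/seteqP; split => x /=; rewrite in_itv/= S0.
have AE : A `<=` E by apply: subIsetl.
have nA : mu (E `\` A) = 0%E.
  apply/negligibleP; first exact: measurableD.
  have iSE : mu.-integrable E S.
    apply/integrableP; split => //; under eq_integral do rewrite gee0_abs//.
    by apply: le_lt_trans iS _; rewrite ltry.
  apply: negligibleS (integrable_ae mE iSE) => x [Ex nAx] /(_ Ex) Sx; apply: nAx; split => //=.
  by rewrite -ge0_fin_numE.
pose K x := fine (S x).
have SK x : A x -> S x = (K x)%:E by move=> [_ h]; rewrite /K fineK// ge0_fin_numE.
have gl x j l : A x -> (g (l + j)%N x - g j x) ^+ 2 <= 2 / 2 ^+ j * K x.
  move=> Ax; apply: le_trans (telescope_sqr_le (fun k => g k x) j l) _.
  have h : (\sum_(i < l + j) 2 ^+ i * D i x <= K x).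
    rewrite -lee_fin -SK// -sumEFin.
    apply: le_trans (nneseries_lim_ge (l + j) (fun k _ _ => t0 k x)).
    by rewrite big_mkord.
  apply: (@le_trans _ _ (2 / 2 ^+ j * \sum_(i < l + j) 2 ^+ i * D i x)); last first.
    by rewrite ler_wpM2l// divr_ge0// exprn_ge0.
  rewrite -(big_mkord xpredT (fun i => 2 ^+ i * D i x)) (@big_cat_nat _ _ _ j)//= ?leq_addl//.
  have -> : \sum_(j <= i < l + j) 2 ^+ i * D i x = \sum_(i < l) 2 ^+ (i + j) * D (i + j)%N x.
    by rewrite -{1}(add0n j) big_addn addnK big_mkord.
  rewrite mulrDr.
  rewrite -[leLHS]add0r lerD ?mulr_ge0 ?sumr_ge0 ?divr_ge0 ?exprn_ge0//.
    by move=> i _; rewrite mulr_ge0// exprn_ge0.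
  rewrite mulr_sumr le_eqVlt; apply/orP; left; apply/eqP; apply: eq_bigr => i _.
  by rewrite exprD exprS /D; field; rewrite expf_neq0.
have cg x : A x -> cvgn (fun k => g k x).
  move=> Ax; apply/cauchy_cvgP; apply: cauchy_exP => e e_gt0.
  have K0 : 0 <= K x by rewrite fine_ge0.
  have [j hj] : exists j, 2 / 2 ^+ j * K x < e ^+ 2.
    have [j hj] := exp2_small (mulr_ge0 (ler0n R 2) K0) (exprn_gt0 2 e_gt0).
    by exists j; rewrite mulrAC.
  exists (g j x); exists j => //= l /= jl; rewrite /ball/=.
  have := gl x j (l - j)%N Ax; rewrite subnK// => h.
  rewrite distrC -(ltr_pXn2r (n := 2))// ?nnegrE ?ltW// real_normK ?num_real//.
  exact: le_lt_trans hj.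
pose F x := if x \in A then limn (fun k => g k x) else 0.
have FA x : A x -> g k x @[k --> \oo] --> F x.
  by move=> Ax; rewrite /F mem_set//; exact: cg.
have mF : measurable_fun E F.
  apply: (@measurable_fun_cvg _ _ _ E (fun k x => g k x * \1_A x) F) => [k|x Ex].
    by apply: measurable_funM => //; case: (hg k).
  have [Ax|nAx] := pselect (A x).
    by rewrite indicE mem_set//=; under eq_fun do rewrite mulr1; exact: FA.
  rewrite /F memNset//; under eq_fun do rewrite indicE memNset// mulr0.
  exact: cvg_cst.
have Fg x j : A x -> (F x - g j x) ^+ 2 <= 2 / 2 ^+ j * K x.
  move=> Ax; have h : (g l x - g j x) ^+ 2 @[l --> \oo] --> (F x - g j x) ^+ 2.
    by rewrite expr2; under eq_fun do rewrite expr2; apply: cvgM; apply: cvgB; [exact: FA|exact: cvg_cst|exact: FA|exact: cvg_cst].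
  rewrite -(cvg_lim _ h)//; apply: limr_le; first by apply/cvg_ex; eexists; exact: h.
  by exists j => //= l /= jl; have := gl x j (l - j)%N Ax; rewrite subnK.
have iK : (\int[mu]_(x in A) (K x)%:E <= 2%:E)%E.
  apply: le_trans iS; apply: ge0_le_integral_gen => x.
  - by move=> _; rewrite lee_fin fine_ge0.
  - by [].
  - by move=> Ax; split; [exact: AE|rewrite SK].
have mK : measurable_fun A (fun x => (K x)%:E).
  apply/measurable_EFinP; apply: (measurable_comp measurableT) => //.
  exact: measurable_funS mS.
have iFg j : (\int[mu]_(x in E) ((F x - g j x) ^+ 2)%:E <= (4 / 2 ^+ j)%:E)%E.
  rewrite (ge0_negligible_integral (measurableD mE mA))//; last 2 first.
  - apply/measurable_EFinP; apply: measurable_funX; apply: measurable_funB => //; by case: (hg j).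
  - by move=> x _; rewrite lee_fin sqr_ge0.
  rewrite setDD (setIidr AE).
  apply: (@le_trans _ _ (\int[mu]_(x in A) ((2 / 2 ^+ j)%:E * (K x)%:E))%E).
    apply: ge0_le_integral_gen => x Ax.
    - by rewrite lee_fin sqr_ge0.
    - by rewrite mule_ge0// lee_fin ?divr_ge0 ?exprn_ge0// fine_ge0.
    - by split => //; rewrite -EFinM lee_fin Fg.
  rewrite ge0_integralZl//; last by move=> x _; rewrite lee_fin fine_ge0.
  apply: le_trans (lee_wpmul2l _ iK) _; first by rewrite lee_fin divr_ge0// exprn_ge0.
  by rewrite -EFinM lee_fin mulrAC -natrM.
have hFg j : sqint (fun x => F x - g j x).
  split; last by apply: le_lt_trans (iFg j) _; rewrite ltry.
  by apply: measurable_funB => //; case: (hg j).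
have hF : sqint F.
  have := sqintP 1 (hFg 0) (hg 0); congr sqint; apply/funext => x; ring.
exists F => // e e_gt0.
have [j hj] : exists j, 4 / 2 ^+ j < e / 4.
  by apply: exp2_small => //; rewrite divr_gt0.
exists (N j) => i Ni.
have h1 : ip (fun x => f i x - g j x) (fun x => f i x - g j x) < e / 4.
  apply: lt_trans (NP j i (n j) Ni (nN j)) _; apply: le_lt_trans hj.
  rewrite (_ : (4 : R) ^+ j = 2 ^+ j * 2 ^+ j); last by rewrite -exprMn; congr (_ ^+ _); ring.
  rewrite invfM ler_wpM2r ?invr_ge0 ?exprn_ge0//.
  have : (2 : R) ^- j <= 1 by rewrite invf_le1 ?exprn_gt0// exprn_ege1// ler1n.
  lra.
have h2 : ip (fun x => F x - g j x) (fun x => F x - g j x) < e / 4.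
  apply: le_lt_trans hj; rewrite -lee_fin -ipE//; exact: hFg.
have := ip_parallelogram (hFg j) (sqintB (hf i) (hg j)).
have := ip_ge0 (fun x => F x - g j x + (f i x - g j x)).
rewrite (_ : (fun x => f i x - F x) = (fun x => f i x - g j x - (F x - g j x))); last by apply/funext => x; ring.
lra.
Unshelve. all: by end_near.
Qed.

End square_integrable.

(** * Estimates along a cylinder *)

Lemma nat_floor {R : realType} (x : R) : 0 <= x -> exists n : nat, n%:R <= x < n.+1%:R.
Proof.
move=> x0; have h : exists n : nat, x < n%:R by exists (Num.bound x); exact: archi_boundP.
case: (ex_minnP h) => [[|m] xm hm]; first by rewrite ltNge x0 in xm.
exists m; rewrite xm andbT leNgt; apply/negP => /hm; by rewrite ltnn.
Qed.

Lemma sume_cst {R : realType} n (c : \bar R) : (0 <= c)%E -> (\sum_(i < n) c = n%:R%:E * c)%E.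
Proof.
move=> c0; elim: n => [|n ih]; first by rewrite big_ord0 mul0e.
by rewrite big_ord_recr/= ih -natr1 EFinD ge0_muleDl ?lee_fin// mul1e.
Qed.

Lemma ge0_mule_lincomb {R : realType} (c a b : R) (X Y : \bar R) : 0 <= a -> 0 <= b ->
  (0 <= X)%E -> (0 <= Y)%E ->
  (c%:E * (a%:E * X + b%:E * Y) = (c * a)%:E * X + (c * b)%:E * Y)%E.
Proof. by move=> a0 b0 X0 Y0; rewrite ge0_muleDr ?mule_ge0 ?lee_fin// !muleA -!EFinM. Qed.

Section slabs.
Context {R : realType} {d : nat}.
Local Notation lam := (lebesgue_row (d + 1)).
Local Notation leb := (@lebesgue_measure R).
Local Notation V := 'rV[R]_(d + 1).
Local Notation slab A a b := (cylset A [set` Interval (BRight a%R) (BLeft b%R)]).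

(** An axial segment of length [|s|] spends at most the fraction [(b - a) / |s|] of its parameters
    in [A]; this turns the factor [s ^+ 2] of the plain estimate into [|s| * (b - a)]. *)
Lemma slab_diff (D A : set V) u G (s a b : R) : ugrad D u G -> measurable A -> s != 0 -> a <= b ->
  (forall x, A x -> a <= axial x <= b) ->
  (forall (x : V) (r : R), A x -> 0 <= r <= 1 -> D (x + r *: cyl 0 s)) ->
  (\int[lam]_(x in A) ((u (x + cyl 0%R s) - u x) ^+ 2)%:E <=
   (`|s| * (b - a))%:E * \int[lam]_(x in D) (G x)%:E)%E.
Proof.
move=> ug mA s0 ab hA hD.
have sp : 0 < `|s| by rewrite normr_gt0.
have m0 : 0 <= (b - a) / `|s| by rewrite divr_ge0// subr_ge0.
have -> : `|s| * (b - a) = dotp (cyl (0 : 'rV[R]_d) s) (cyl 0 s) * ((b - a) / `|s|).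
  rewrite dotp_cyl (_ : dotp 0 0 = 0) ?add0r; last by rewrite dotpE big1// => i _; rewrite mxE mul0r.
  by rewrite -(real_normK (num_real s)); field; rewrite gt_eqF.
apply: translation_estimate_thin => // y.
have [s_gt0|s_lt0|/esym/eqP] := ltgtP 0 s; last by rewrite (negbTE s0).
  apply: (@le_trans _ _ (leb (`[(axial y - b) / s, (axial y - a) / s]%classic : set R))).
    apply: le_measure; rewrite ?inE; [exact: measurable_line|exact: measurable_itv|].
    move=> r [_ /hA]; rewrite -scaleN1r scalerA mulN1r axialD axialZ axial_cyl => /andP[h1 h2].
    by rewrite /= in_itv/= ler_pdivrMr// ler_pdivlMr//; apply/andP; split; lra.
  rewrite lebesgue_measure_itv/= lte_fin; case: ifPn => _; last by rewrite lee_fin.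
  rewrite -EFinD lee_fin gtr0_norm// -mulrBl ler_wpM2r ?invr_ge0 ?(ltW s_gt0)//; lra.
apply: (@le_trans _ _ (leb (`[(a - axial y) / - s, (b - axial y) / - s]%classic : set R))).
  apply: le_measure; rewrite ?inE; [exact: measurable_line|exact: measurable_itv|].
  move=> r [_ /hA]; rewrite -scaleN1r scalerA mulN1r axialD axialZ axial_cyl => /andP[h1 h2].
  by rewrite /= in_itv/= ler_pdivrMr ?oppr_gt0// ler_pdivlMr ?oppr_gt0//; apply/andP; split; lra.
rewrite lebesgue_measure_itv/= lte_fin; case: ifPn => _; last by rewrite lee_fin.
rewrite -EFinD lee_fin ltr0_norm// -mulrBl ler_wpM2r ?invr_ge0 ?oppr_ge0 ?(ltW s_lt0)//; lra.
Qed.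

Lemma slab_le (D A B : set V) u G (s a b : R) : ugrad D u G -> measurable A -> measurable B ->
  s != 0 -> a <= b -> (forall x, A x -> a <= axial x <= b) -> B `<=` D ->
  (forall x : V, A x -> B (x + cyl 0 s)) ->
  (forall (x : V) (r : R), A x -> 0 <= r <= 1 -> D (x + r *: cyl 0 s)) ->
  (\int[lam]_(x in A) (u x ^+ 2)%:E <= 2%:E * \int[lam]_(x in B) (u x ^+ 2)%:E +
   (2 * (`|s| * (b - a)))%:E * \int[lam]_(x in D) (G x)%:E)%E.
Proof.
move=> ug mA mB s0 ab hA BD AB hD.
have := slab_diff ug mA s0 ab hA hD; have [mD mu mG G0 _] := ug => hdiff.
pose z : V := cyl 0 s.
have AD : A `<=` D by move=> x Ax; have := hD x 0 Ax; rewrite scale0r addr0; apply; rewrite lexx ler01.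
have muA : measurable_fun A u by exact: measurable_funS mu.
pose A' := (fun v => v + z) @^-1` B.
have mA' : measurable A' by apply: measurable_preim => //; exact: measurable_addc.
have muz : measurable_fun A (fun x => u (x + z)).
  apply: (@measurable_comp _ _ _ _ _ _ B) => //.
  - by move=> _ [x Ax <-]; exact: AB.
  - exact: measurable_funS mu.
  - by apply: measurable_funTS; exact: measurable_addc.
have m1 : measurable_fun A (fun x => (u (x + z) ^+ 2)%:E).
  by apply/measurable_EFinP; exact: measurable_funX.
have m2 : measurable_fun A (fun x => ((u (x + z) - u x) ^+ 2)%:E).
  by apply/measurable_EFinP; apply: measurable_funX; exact: measurable_funB.
apply: (@le_trans _ _ (\int[lam]_(x in A) (2%:E * (u (x + z) ^+ 2)%:E + 2%:E * ((u (x + z) - u x) ^+ 2)%:E))%E).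
  apply: ge0_le_integral_gen => x Ax.
  - by rewrite lee_fin sqr_ge0.
  - by rewrite -!EFinM -EFinD lee_fin addr_ge0// mulr_ge0// sqr_ge0.
  - by split => //; rewrite -!EFinM -EFinD lee_fin sqr_split.
rewrite ge0_integralD//; last 4 first.
- by move=> x _; rewrite -EFinM lee_fin mulr_ge0// sqr_ge0.
- exact: measurable_funeM.
- by move=> x _; rewrite -EFinM lee_fin mulr_ge0// sqr_ge0.
- exact: measurable_funeM.
rewrite !ge0_integralZl//; last 2 first.
- by move=> x _; rewrite lee_fin sqr_ge0.
- by move=> x _; rewrite lee_fin sqr_ge0.
apply: leeD; last by rewrite EFinM -muleA; apply: lee_wpmul2l.
apply: lee_wpmul2l => //.
rewrite -(ge0_integral_shift z mB); last 2 first.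
- by apply/measurable_EFinP; apply: measurable_funX; exact: measurable_funS mu.
- by move=> x _; rewrite lee_fin sqr_ge0.
by apply: ge0_integral_le_set => // x _; rewrite lee_fin sqr_ge0.
Qed.

Lemma cylset_shift (A : set 'rV[R]_d) (I : set R) (x : V) (r s : R) : A (transverse x) ->
  I (axial x + r * s) -> cylset A I (x + r *: cyl 0 s).
Proof.
move=> Ax Ix; split; rewrite ?transverseD ?axialD ?transverseZ ?axialZ.
  by rewrite transverse_cyl scaler0 addr0.
by rewrite axial_cyl.
Qed.

Lemma cylset_shift1 (A : set 'rV[R]_d) (I : set R) (x : V) (s : R) : A (transverse x) ->
  I (axial x + s) -> cylset A I (x + cyl 0 s).
Proof. by move=> Ax Ix; rewrite -[cyl 0 s]scale1r; apply: cylset_shift; rewrite ?mul1r. Qed.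

(** A shift by [l + h] of a set of thickness [h]: the energy gets the factor [(l + h) * h] instead
    of [(l + h) ^+ 2]. After division by the volume of the collar, the squared difference of
    neighbouring means is of first order in the length. *)
Lemma collar_to_collar (A : set 'rV[R]_d) (l h : R) u G : 0 < l -> 0 < h -> measurable A ->
  ugrad (slab A (- h) (l + h)) u G ->
  (\int[lam]_(x in slab A (- h) 0%R) (u x ^+ 2)%:E <=
   2%:E * \int[lam]_(x in slab A l (l + h)) (u x ^+ 2)%:E +
   (2 * ((l + h) * h))%:E * \int[lam]_(x in slab A ((- h)%R) ((l + h)%R)) (G x)%:E)%E.
Proof.
move=> l0 h0 mA ug.
have := @slab_le _ (slab A (- h) 0%R) (slab A l (l + h)) u G (l + h) (- h) 0 ug.
rewrite gtr0_norm ?addr_gt0// sub0r opprK; apply.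
- by apply: measurable_cylset => //; exact: measurable_itv.
- by apply: measurable_cylset => //; exact: measurable_itv.
- by rewrite gt_eqF// addr_gt0.
- lra.
- by move=> x [_ /=]; rewrite in_itv/= => /andP[? ?]; rewrite !ltW.
- by move=> x [Ax /=]; rewrite !in_itv/= => /andP[? ?]; split => //=; rewrite in_itv/=; apply/andP; split; lra.
- move=> x [Ax /=]; rewrite !in_itv/= => /andP[? ?]; apply: cylset_shift1 => //=.
  by rewrite in_itv/=; apply/andP; split; lra.
- move=> x r [Ax /=]; rewrite !in_itv/= => /andP[h1 h2] /andP[r0 r1]; apply: cylset_shift => //=.
  by rewrite in_itv/=; apply/andP; split; nra.
Qed.

(** The edge is cut into slices of thickness [h / 2], at most [2 * l / h + 1] of them, and each
    slice is translated into the collar behind the end of the edge. *)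
Lemma edge_le_collar (A : set 'rV[R]_d) (l h : R) u G : 0 < l -> 0 < h -> measurable A ->
  ugrad (slab A 0%R (l + h)) u G ->
  (\int[lam]_(x in slab A 0%R l) (u x ^+ 2)%:E <=
   (2 * (2 * l / h + 1))%:E * \int[lam]_(x in slab A l (l + h)) (u x ^+ 2)%:E +
   (2 * (l + h) ^+ 2)%:E * \int[lam]_(x in slab A 0%R (l + h)) (G x)%:E)%E.
Proof.
move=> l0 h0 mA ug; have [mD mu mG G0 _] := ug.
have lh0 : 0 <= 2 * l / h by rewrite divr_ge0 ?mulr_ge0// ltW.
have [n /andP[n1 n2]] := nat_floor lh0.
rewrite ler_pdivlMr// in n1; rewrite ltr_pdivrMr// in n2.
have mI (I : interval R) : measurable (cylset A [set` I]).
  by apply: measurable_cylset => //; exact: measurable_itv.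
pose F (i : 'I_n.+1) : set V := cylset setT `[i%:R * (h / 2), i.+1%:R * (h / 2)].
have mF i : measurable (F i) by apply: measurable_cylset => //; exact: measurable_itv.
have S1 : slab A 0%R l `<=` slab A 0%R (l + h).
  by move=> x [Ax /=]; rewrite in_itv/= => /andP[? ?]; split => //=; rewrite in_itv/=; apply/andP; split; lra.
have S2 : slab A l (l + h) `<=` slab A 0%R (l + h).
  by move=> x [Ax /=]; rewrite in_itv/= => /andP[? ?]; split => //=; rewrite in_itv/=; apply/andP; split; lra.
set GI := (\int[lam]_(x in _) (G x)%:E)%E; set J := (\int[lam]_(x in slab A l _) _)%E.
have GI0 : (0 <= GI)%E by apply: integral_ge0 => x /G0; rewrite lee_fin.
have J0 : (0 <= J)%E by apply: integral_ge0 => x _; rewrite lee_fin sqr_ge0.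
have mu2 : measurable_fun (slab A 0%R (l + h)) (fun x => (u x ^+ 2)%:E).
  by apply/measurable_EFinP; exact: measurable_funX.
apply: (@le_trans _ _ (\sum_(i < n.+1) \int[lam]_(x in slab A 0%R l `&` F i) (u x ^+ 2)%:E)%E).
  apply: ge0_integral_cover_le => //.
  - exact: measurable_funS mu2.
  - by move=> x _; rewrite lee_fin sqr_ge0.
  - move=> x [_ /=]; rewrite in_itv/= => /andP[x0 xl].
    have [|i /andP[i1 i2]] := @nat_floor _ (axial x / (h / 2)).
      by rewrite !divr_ge0// ltW.
    rewrite ler_pdivlMr ?divr_gt0// in i1; rewrite ltr_pdivrMr ?divr_gt0// in i2.
    have ilt : (i < n.+1)%N.
      by rewrite -(ltr_nat R) -(ltr_pM2r h0); lra.
    exists (Ordinal ilt); first exact: mem_index_enum.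
    by split => //=; rewrite in_itv/= i1 ltW.
apply: (@le_trans _ _ (\sum_(i < n.+1) (2%:E * J + ((l + h) * h)%:E * GI))%E).
  (* This shift carries the slice onto [[l + h / 4, l + 3 * h / 4]], well inside the open collar. *)
  apply: lee_sum => i _; pose s := l + h / 4 - i%:R * (h / 2).
  have ih : i%:R * h <= 2 * l.
    by apply: le_trans n1; rewrite ler_wpM2r ?(ltW h0)// ler_nat -ltnS.
  have i0 : 0 <= i%:R * h by rewrite mulr_ge0// ltW.
  have s0 : 0 < s by rewrite /s; lra.
  have hi : i.+1%:R * (h / 2) - i%:R * (h / 2) = h / 2 by rewrite -natr1; ring.
  have := @slab_le (slab A 0%R (l + h)) (slab A 0%R l `&` F i) (slab A l (l + h)) u G s
    (i%:R * (h / 2)) (i.+1%:R * (h / 2)) ug (measurableI _ _ (mI _) (mF i)) (mI _).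
  rewrite hi (gtr0_norm s0) gt_eqF// => /(_ isT) hs; apply: le_trans (hs _ _ _ _ _) _.
  - by lra.
  - by move=> x [_ [_ /=]]; rewrite in_itv.
  - exact: S2.
  - move=> x [[Ax /=]]; rewrite in_itv/= => /andP[? ?] [_ /=]; rewrite in_itv/= => /andP[? ?].
    by apply: cylset_shift1 => //=; rewrite in_itv/= /s; apply/andP; split; lra.
  - move=> x r [[Ax /=]]; rewrite in_itv/= => /andP[? ?] [_ /=]; rewrite in_itv/= => /andP[? ?] /andP[? ?].
    have ? : 0 <= r * s by rewrite mulr_ge0// ltW.
    have ? : r * s <= s by rewrite ler_piMl// ltW.
    have sE : s = l + h / 4 - i%:R * (h / 2) by [].
    by apply: cylset_shift => //=; rewrite in_itv/=; apply/andP; split; lra.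
  rewrite -/J -/GI; apply: leeD => //; apply: lee_wpmul2r => //; rewrite lee_fin.
  rewrite (_ : 2 * _ = s * h); last by field.
  by rewrite ler_pM2r// /s; lra.
rewrite sume_cst; last by rewrite adde_ge0// mule_ge0// lee_fin mulr_ge0// ltW// addr_gt0.
have n0 : n.+1%:R <= 2 * l / h + 1.
  by rewrite -natr1 lerD2r ler_pdivlMr.
rewrite ge0_mule_lincomb// ?mulr_ge0 ?(ltW h0) ?(ltW (addr_gt0 l0 h0))//.
apply: leeD; apply: lee_wpmul2r => //; rewrite lee_fin; first by rewrite mulrC ler_wpM2l.
have : n.+1%:R * h <= 2 * l + h by rewrite -natr1 mulrDl mul1r lerD2r.
move: (n.+1%:R) => m hm; rewrite mulrCA (_ : 2 * _ = (l + h) * (2 * (l + h))); last by ring.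
rewrite ler_wpM2l ?ltW ?addr_gt0//; lra.
Qed.

(** The collar is translated back onto each of the disjoint slices of thickness [h] of the edge.
    Their number is the integer part of [l / h]; the fractional part accounts for the additional
    collar term on the right. *)
Lemma collar_le_edge (A : set 'rV[R]_d) (l h : R) u G : 0 < l -> 0 < h -> measurable A ->
  ugrad (slab A 0%R (l + h)) u G ->
  ((l / h)%:E * \int[lam]_(x in slab A l (l + h)) (u x ^+ 2)%:E <=
   2%:E * \int[lam]_(x in slab A 0%R l) (u x ^+ 2)%:E +
   \int[lam]_(x in slab A l (l + h)) (u x ^+ 2)%:E +
   (2 * l ^+ 2)%:E * \int[lam]_(x in slab A 0%R (l + h)) (G x)%:E)%E.
Proof.
move=> l0 h0 mA ug; have [mD mu mG G0 _] := ug.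
have lh0 : 0 <= l / h by rewrite divr_ge0// ltW.
have [n /andP[n1 n2]] := nat_floor lh0.
have mI (I : interval R) : measurable (cylset A [set` I]).
  by apply: measurable_cylset => //; exact: measurable_itv.
pose F (i : 'I_n) : set V := slab A (i%:R * h) (i.+1%:R * h).
have n1' : n%:R * h <= l by rewrite -ler_pdivlMr.
have iP (i : 'I_n) : 0 <= i%:R * h /\ i%:R * h + h <= l.
  split; first by rewrite mulr_ge0// ltW.
  apply: le_trans n1'; rewrite -{2}(mul1r h) -mulrDl natr1 ler_wpM2r ?(ltW h0)// ler_nat; exact: ltn_ord.
have iS (i : nat) : i.+1%:R * h = i%:R * h + h by rewrite -natr1; ring.
have S1 : slab A 0%R l `<=` slab A 0%R (l + h).
  by move=> x [Ax /=]; rewrite in_itv/= => /andP[? ?]; split => //=; rewrite in_itv/=; apply/andP; split; lra.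
have FS i : F i `<=` slab A 0%R l.
  have [? ?] := iP i; move=> x [Ax /=]; rewrite iS in_itv/= => /andP[? ?]; split => //=.
  by rewrite in_itv/=; apply/andP; split; lra.
set GI := (\int[lam]_(x in _) (G x)%:E)%E; set J := (\int[lam]_(x in slab A l _) _)%E.
set X := (\int[lam]_(x in slab A 0%R l) _)%E.
have GI0 : (0 <= GI)%E by apply: integral_ge0 => x /G0; rewrite lee_fin.
have J0 : (0 <= J)%E by apply: integral_ge0 => x _; rewrite lee_fin sqr_ge0.
have X0 : (0 <= X)%E by apply: integral_ge0 => x _; rewrite lee_fin sqr_ge0.
have mu2 : measurable_fun (slab A 0%R (l + h)) (fun x => (u x ^+ 2)%:E).
  by apply/measurable_EFinP; exact: measurable_funX.
have e1 : (\sum_(i < n) \int[lam]_(x in F i) (u x ^+ 2)%:E <= X)%E.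
  apply: sum_integral_le => //.
  - by move=> i; exact: mI.
  - apply/trivIsetP => i j _ _ /eqP ij; rewrite -subset0 => x [[_ /=] +] [_ /=].
    rewrite !iS !in_itv/= => /andP[a1 a2] /andP[b1 b2]; apply: ij; apply/val_inj.
    have key (p q : nat) : (p < q)%N -> p%:R * h + h <= q%:R * h.
      by move=> pq; rewrite -iS ler_wpM2r ?(ltW h0)// ler_nat.
    by case: (ltngtP (val i) (val j)) => // /key h1; exfalso; lra.
  - exact: measurable_funS mu2.
  - by move=> x _; rewrite lee_fin sqr_ge0.
have e2 : (n%:R%:E * J <= 2%:E * X + (n%:R)%:E * ((2 * (l * h))%:E * GI))%E.
  have L0 : (0 <= (2 * (l * h))%:E * GI)%E by rewrite mule_ge0// lee_fin !mulr_ge0// ltW.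
  rewrite -(sume_cst n J0) -(sume_cst n L0).
  apply: (@le_trans _ _ (\sum_(i < n) (2%:E * \int[lam]_(x in F i) (u x ^+ 2)%:E + (2 * (l * h))%:E * GI))%E).
    apply: lee_sum => i _; have [i0 il] := iP i.
    have s0 : l - i%:R * h > 0 by lra.
    have := @slab_le (slab A 0%R (l + h)) (slab A l (l + h)) (F i) u G (- (l - i%:R * h))
      l (l + h) ug (mI _) (mI _).
    rewrite oppr_eq0 gt_eqF// normrN (gtr0_norm s0) (_ : l + h - l = h); last by ring.
    move=> /(_ isT) hs; apply: le_trans (hs _ _ _ _ _) _.
    - by lra.
    - by move=> x [_ /=]; rewrite in_itv/= => /andP[? ?]; rewrite !ltW.
    - exact: subset_trans (FS i) S1.
    - move=> x [Ax /=]; rewrite in_itv/= => /andP[? ?].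
      by apply: cylset_shift1 => //=; rewrite iS in_itv/=; apply/andP; split; lra.
    - move=> x r [Ax /=]; rewrite in_itv/= => /andP[? ?] /andP[? ?].
      have ? : 0 <= r * (l - i%:R * h) by rewrite mulr_ge0// ltW.
      have ? : r * (l - i%:R * h) <= (l - i%:R * h) by rewrite ler_piMl// ltW.
      by apply: cylset_shift => //=; rewrite in_itv/=; apply/andP; split; lra.
    rewrite -/GI; apply: leeD => //; apply: lee_wpmul2r => //; rewrite lee_fin ler_pM2l//.
    by rewrite ler_pM2r//; lra.
  rewrite big_split; apply: leeD => //.
  rewrite -ge0_sume_distrr; first exact: lee_wpmul2l.
  by move=> i _; apply: integral_ge0 => x _; rewrite lee_fin sqr_ge0.
apply: (@le_trans _ _ (n.+1%:R%:E * J)%E); first by apply: lee_wpmul2r => //; rewrite lee_fin ltW.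
rewrite -natr1 EFinD ge0_muleDl ?lee_fin// mul1e addeAC; apply: leeD => //.
apply: le_trans e2 _; apply: leeD => //; rewrite muleA -EFinM; apply: lee_wpmul2r => //.
by rewrite lee_fin mulrCA ler_pM2l// mulrCA expr2 ler_pM2l.
Qed.

Lemma open_cubes n (D : set 'rV[R]_n) : (forall x, D x -> exists2 e : R, 0 < e & cube x e `<=` D) -> open D.
Proof.
move=> h; rewrite openE => x /h[e e0 he]; rewrite /interior; apply: (filterS he).
exact: (open_nbhs_nbhs (conj (@open_cube' _ _ x e) (@cubexx _ _ x _ e0))).
Qed.

Lemma cube_transverse (x y : V) e : cube x e y -> cube (transverse x) e (transverse y).
Proof. by move=> h i; rewrite !mxE; exact: h. Qed.

Lemma cube_axial (x y : V) e : cube x e y -> `|axial y - axial x| < e.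
Proof. by move=> h; rewrite /axial !mxE; exact: h. Qed.

Lemma closure_cubes n (D : set 'rV[R]_n) x :
  closure D x <-> forall e : R, 0 < e -> exists2 y, D y & cube x e y.
Proof.
split=> [h e e0|h B /nbhs_ballP[e /= e0 eB]].
  by have [y [Dy xy]] := h _ (open_nbhs_nbhs (conj (@open_cube' _ _ x e) (@cubexx _ _ x _ e0))); exists y.
have [y Dy xy] := h _ e0; exists y; split => //; apply: eB; split => // i j.
by rewrite ord1 /ball/= distrC; exact: xy.
Qed.

Lemma coord_le_norm n (y : 'rV[R]_n) i : `|y 0 i| <= `|y|.
Proof.
by rewrite -[`|y|]/(mx_norm y) mx_normrE; apply: (@le_bigmax _ _ _ _ (fun ij => `|y ij.1 ij.2|) (0, i)).
Qed.

Lemma norm_le_coord n (y : 'rV[R]_n) c : 0 <= c -> (forall i, `|y 0 i| <= c) -> `|y| <= c.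
Proof.
move=> c0 h; rewrite -[`|y|]/(mx_norm y) mx_normrE.
by apply: bigmax_le => // -[i j] _ /=; rewrite ord1.
Qed.

Lemma closure_cylset (A : set 'rV[R]_d) l x : closure (slab A 0%R l) x ->
  closure A (transverse x) /\ 0 <= axial x <= l.
Proof.
move=> /closure_cubes clx; split.
  apply/closure_cubes => e e0; have [y [Ay _] xy] := clx e e0.
  by exists (transverse y) => //; exact: cube_transverse.
apply/andP; split; rewrite leNgt; apply/negP => h.
  have [|y [_ /=]] := clx (- axial x); first by rewrite oppr_gt0.
  by rewrite in_itv/= => /andP[? ?] /cube_axial; rewrite ltr_norml => /andP[? ?]; lra.
have [|y [_ /=]] := clx (axial x - l); first by rewrite subr_gt0.
by rewrite in_itv/= => /andP[? ?] /cube_axial; rewrite ltr_norml => /andP[? ?]; lra.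
Qed.

(** The translation of the cross section is combined with an axial shift by [l / 3] away from the
    nearer end, which also treats the edges where both parts of the boundary meet. *)
Lemma segdom_cylset (A : set 'rV[R]_d) l : segdom A -> 0 < l -> segdom (slab A 0%R l).
Proof.
move=> [oA bA hA] l0; split.
- apply: open_cubes => x [Ax /=]; rewrite in_itv/= => /andP[x0 xl].
  have [e e0 he] := row_nbhs oA Ax.
  exists (Num.min e (Num.min (axial x) (l - axial x))); first by rewrite !lt_min e0 x0 subr_gt0.
  move=> y hy; split.
    by apply: he; apply: cube_transverse; apply: cube_sub hy; rewrite ge_min lexx.
  have := cube_axial hy; rewrite !lt_min !ltr_norml => /and3P[_ /andP[? ?] /andP[? ?]].
  by rewrite /= in_itv/=; apply/andP; split; lra.
- have [M [Mr hM]] := bA; exists (Num.max M l); split; first exact: num_real.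
  move=> r; rewrite gt_max => /andP[Mr' lr] y [Ay /=]; rewrite in_itv/= => /andP[y0 yl].
  apply: norm_le_coord => [|i]; first lra.
  case: (splitP i) => j ij.
    rewrite (_ : i = lshift 1 j); last exact/val_inj.
    apply: le_trans (hM r Mr' _ Ay); have := coord_le_norm (transverse y) j.
    by rewrite mxE.
  rewrite (_ : i = rshift d ord0); last by apply/val_inj; rewrite /= ij ord1.
  move: y0 yl; rewrite /axial mxE => y0 yl; rewrite gtr0_norm//; lra.
- move=> x /closure_cylset[clA /andP[x0 xl]].
  have [U [z [oU Ux hU]]] := hA _ clA.
  have [xh|xh] := leP (axial x) (l / 2).
    exists [set y | U (transverse y) /\ axial y < 2 * l / 3], (cyl z (l / 3)); split.
    + apply: open_cubes => y [Uy yl]; have [e e0 he] := row_nbhs oU Uy.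
      exists (Num.min e (2 * l / 3 - axial y)); first by rewrite !lt_min e0 subr_gt0.
      move=> w hw; split.
        by apply: he; apply: cube_transverse; apply: cube_sub hw; rewrite ge_min lexx.
      by have := cube_axial hw; rewrite !lt_min !ltr_norml => /and3P[_ ? ?]; lra.
    + by split => //=; lra.
    + move=> y r [Uy yl] /closure_cylset[cly /andP[y0 _]] /andP[r0 r1]; split.
        by rewrite transverseD transverseZ transverse_cyl; apply: hU; rewrite // r0.
      rewrite /= axialD axialZ axial_cyl in_itv/=; apply/andP; split; nra.
  exists [set y | U (transverse y) /\ l / 3 < axial y], (cyl z (- (l / 3))); split.
  + apply: open_cubes => y [Uy yl]; have [e e0 he] := row_nbhs oU Uy.
    exists (Num.min e (axial y - l / 3)); first by rewrite !lt_min e0 subr_gt0.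
    move=> w hw; split.
      by apply: he; apply: cube_transverse; apply: cube_sub hw; rewrite ge_min lexx.
    by have := cube_axial hw; rewrite !lt_min !ltr_norml => /and3P[_ ? ?]; lra.
  + by split => //=; lra.
  + move=> y r [Uy yl] /closure_cylset[cly /andP[_ y0]] /andP[r0 r1]; split.
      by rewrite transverseD transverseZ transverse_cyl; apply: hU; rewrite // r0.
    rewrite /= axialD axialZ axial_cyl in_itv/=; apply/andP; split; nra.
Qed.

Lemma segdom_dilate n (A : set 'rV[R]_n) t : segdom A -> 0 < t -> segdom (dilate t A).
Proof.
move=> [oA bA hA] t0.
have cubeZ (x y : 'rV[R]_n) e : cube x (t * e) y -> cube (t^-1 *: x) e (t^-1 *: y).
  move=> h i; have := h i; rewrite !mxE -mulrBr normrM gtr0_norm ?invr_gt0//.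
  by rewrite (mulrC t) -ltr_pdivrMr// mulrC.
have clZ y : closure (dilate t A) y -> closure A (t^-1 *: y).
  move=> /closure_cubes cly; apply/closure_cubes => e e0.
  have [w /(dilateE _ _ t0) Aw yw] := cly _ (mulr_gt0 t0 e0).
  by exists (t^-1 *: w) => //; exact: cubeZ.
split.
- apply: open_cubes => x /(dilateE _ _ t0) Ax; have [e e0 he] := row_nbhs oA Ax.
  exists (t * e); first by rewrite mulr_gt0.
  by move=> y hy; apply/dilateE => //; apply: he; exact: cubeZ.
- have [M [Mr hM]] := bA; exists (t * M); split; first exact: num_real.
  move=> r Mr' _ [x Ax <-].
  have hx : `|x| <= r / t by apply: hM => //; rewrite ltr_pdivlMr// mulrC.
  apply: norm_le_coord => [|i].
    by have := le_trans (normr_ge0 x) hx; rewrite pmulr_lge0// invr_gt0.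
  rewrite mxE normrM gtr0_norm// mulrC -ler_pdivlMr//; exact: le_trans (coord_le_norm x i) hx.
- move=> x /clZ clx; have [U [z [oU Ux hU]]] := hA _ clx.
  exists [set y | U (t^-1 *: y)], (t *: z); split => //.
    apply: open_cubes => y Uy; have [e e0 he] := row_nbhs oU Uy.
    exists (t * e); first by rewrite mulr_gt0.
    by move=> w hw; apply: he; exact: cubeZ.
  move=> y r Uy /clZ cly r01; apply/dilateE => //.
  rewrite scalerDr !scalerA (_ : _ *: z = r *: z); first exact: hU.
  by congr (_ *: _); field; rewrite gt_eqF.
Qed.

End slabs.

(** * Recursive estimates over the generations *)

Section tail_sequences.
Context {R : realType}.
Variables (L : nat -> R) (Lam rho C : R).
Hypotheses (L0 : forall j, 0 < L j) (sumL : forall n, \sum_(i < n) L i <= Lam).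
Hypotheses (rho0 : 0 < rho) (C0 : 0 <= C).

(** The accumulated growth factors, which stay between 1 and [expR Lam]. *)
Let w n := \prod_(i < n) (1 + L i).

Let w_gt0 n : 0 < w n.
Proof. by apply: prodr_gt0 => i _; rewrite addr_gt0. Qed.

Let wS n : w n.+1 = w n * (1 + L n). Proof. by rewrite /w big_ord_recr. Qed.

Let w_ge1 n : 1 <= w n.
Proof.
elim: n => [|n ih]; first by rewrite /w big_ord0.
by rewrite wS mulr_ege1// lerDl ltW.
Qed.

Let w_le n : w n <= expR Lam.
Proof.
apply: (@le_trans _ _ (expR (\sum_(i < n) L i))); last by rewrite ler_expR.
elim: n => [|n ih]; first by rewrite /w !big_ord0 expR0.
rewrite wS big_ord_recr expRD; apply: ler_pM => //; [exact: ltW|by rewrite ltW// addr_gt0|exact: expR_ge1Dx].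
Qed.

Let Lam0 : 0 <= Lam. Proof. by have := sumL 0; rewrite big_ord0. Qed.

Let L_le j : L j <= Lam.
Proof.
apply: le_trans (sumL j.+1); rewrite big_ord_recr lerDr; apply: sumr_ge0 => i _; exact: ltW.
Qed.

(* [X j] and [D j] stand for the squared norm and the energy over the generation
   [j], [Y j] for the weighted sum of the squares of its vertex means. *)
Record tail_data (X Y D : nat -> R) (B : R) : Prop := TailData {
  tail_X0 : forall j, 0 <= X j;
  tail_Y0 : forall j, 0 <= Y j;
  tail_D0 : forall j, 0 <= D j;
  tail_sumX : forall n, \sum_(i < n) X i <= B;
  tail_sumD : forall n, \sum_(i < n) D i <= B;
  tail_fwd : forall j, Y j.+1 <= (1 + L j.+1) * rho * Y j + C * (D j + D j.+1);
  tail_bwd : forall j, rho * Y j <= (1 + L j.+1) * Y j.+1 + C * (D j + D j.+1);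
  tail_root : Y 0%N <= C * (X 0%N + D 0%N);
  tail_up : forall j, X j <= C * (L j * Y j + L j ^+ 2 * D j);
  tail_lo : forall j, L j * Y j <= C * (X j + L j ^+ 2 * D j) }.

Let sum_D2 X Y D B n : tail_data X Y D B -> \sum_(i < n) (D i + D i.+1) <= 2 * B.
Proof.
move=> [_ _ D0 _ sD _ _ _ _ _]; rewrite big_split; have h1 := sD n; have h2 := sD n.+1.
rewrite big_ord_recl in h2; have := D0 0%N.
by rewrite /= (_ : \sum_(i < n) D i.+1 = \sum_(i < n) D (lift ord0 i))// => ?; lra.
Qed.

(** A discrete Gronwall argument. The rate [r] plays the role of the maximum of 1 and [rho]: with
    [r >= 1] every earlier energy term is dominated by the current factor [w j.+1 * r ^+ j]. *)
Let tail_forward (r : R) X Y D B j : 1 <= r -> rho <= r -> tail_data X Y D B ->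
  Y j <= expR Lam * (4 * C) * B * r ^+ j.
Proof.
move=> r1 rr td; have [X0 Y0 D0 sX sD hf _ h0 _ _] := td.
have r0 : 0 < r by lra.
have claim : Y j <= w j.+1 * r ^+ j * (Y 0%N + C * \sum_(i < j) (D i + D i.+1)).
  elim: j => [|j ih].
    by rewrite big_ord0 mulr0 addr0 expr0 mulr1 ler_peMl.
  apply: le_trans (hf j) _; rewrite big_ord_recr /= (mulrDr C (\sum_(i < j) _)) addrA.
  set S := Y 0%N + _ in ih *; set E := C * (D j + D j.+1).
  have S0 : 0 <= S.
    by rewrite addr_ge0// mulr_ge0// sumr_ge0// => i _; rewrite addr_ge0.
  have E0 : 0 <= E by rewrite mulr_ge0// addr_ge0.
  rewrite (mulrDr _ S E); apply: lerD.
    rewrite (wS j.+1) exprS; apply: (@le_trans _ _ ((1 + L j.+1) * r * Y j)).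
      by rewrite ler_wpM2r// ler_wpM2l// addr_ge0// ltW.
    apply: le_trans (ler_wpM2l (_ : 0 <= (1 + L j.+1) * r) ih) _.
      by rewrite mulr_ge0 ?addr_ge0 ?ltW.
    by rewrite le_eqVlt; apply/orP; left; apply/eqP; ring.
  by rewrite ler_peMl// mulr_ege1// exprn_ege1.
apply: le_trans claim _.
have hs : Y 0%N + C * \sum_(i < j) (D i + D i.+1) <= 4 * C * B.
  have h1 := sX 1%N; have h2 := sD 1%N; rewrite !big_ord1 in h1 h2.
  have h3 := ler_wpM2l C0 (sum_D2 j td).
  have h4 : C * (X 0%N + D 0%N) <= C * (2 * B) by rewrite ler_wpM2l//; lra.
  by have := h0; lra.
have hs0 : 0 <= Y 0%N + C * \sum_(i < j) (D i + D i.+1).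
  by rewrite addr_ge0// mulr_ge0// sumr_ge0// => i _; rewrite addr_ge0.
have rj : 0 <= r ^+ j by rewrite exprn_ge0// ltW.
rewrite (mulrAC (w j.+1)) (_ : expR Lam * (4 * C) * B * r ^+ j = expR Lam * (4 * C * B) * r ^+ j); last by ring.
 apply: ler_wpM2r => //; apply: ler_pM => //; exact: ltW.
Qed.

(* [\sum_i L i * Y i] is bounded and [\sum_i L i * rho ^+ i] is not: averaging the
   backward estimates from [m] to [j] with the weights [L m * rho ^+ m] leaves only
   the contribution of [D]. *)
Let tail_backward X Y D B j : 1 <= rho -> (forall M, exists n, M < \sum_(i < n) L i * rho ^+ i) ->
  tail_data X Y D B -> Y j <= expR Lam * (C * (1 + Lam ^+ 2) + 2 * C) * B.
Proof.
move=> r1 ub td; have [X0 Y0 D0 sX sD _ hb _ _ hlo] := td.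
have E0 : 0 < expR Lam by exact: expR_gt0.
(* [tail_bwd] is iterated [l] times; each step divides by [rho >= 1], so the energies enter with
   weights at most one. *)
have claim l : Y j <= w (j + l).+1 * (rho ^- l * Y (j + l)%N + C * \sum_(i < l) (D (j + i)%N + D (j + i).+1)).
  elim: l => [|l ih].
    by rewrite big_ord0 mulr0 addr0 expr0 invr1 mul1r addn0 ler_peMl.
  apply: le_trans ih _; rewrite addnS (wS (j + l).+1) -mulrA ler_wpM2l ?(ltW (w_gt0 _))//.
  rewrite big_ord_recr /= (mulrDr C (\sum_(i < l) _)).
  have h1 := hb (j + l)%N; set S := C * \sum_(i < l) _; set F := C * (D (j + l)%N + _) in h1 *.
  have S0 : 0 <= S by rewrite mulr_ge0// sumr_ge0// => i _; rewrite addr_ge0.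
  have F0 : 0 <= F by rewrite mulr_ge0// addr_ge0.
  have rl : 0 < rho ^- l by rewrite invr_gt0 exprn_gt0.
  have h2 : rho ^- l * Y (j + l)%N <= rho ^- l.+1 * ((1 + L (j + l).+1) * Y (j + l).+1 + F).
    by rewrite exprS invfM -mulrA mulrCA ler_pM2l// mulrC ler_pdivlMr// mulrC.
  have h3 : rho ^- l.+1 * F <= F.
    by rewrite ler_piMl// invf_le1 ?exprn_gt0// exprn_ege1.
  have h4 : 0 <= L (j + l).+1 * (S + F) by rewrite mulr_ge0 ?addr_ge0// ltW.
  rewrite mulrDr in h2; set y := Y (j + l).+1 in h2 *; set p := rho ^- l.+1 in h2 h3 *.
  rewrite (_ : (1 + _) * _ = p * ((1 + L (j + l).+1) * y) + S + F + L (j + l).+1 * (S + F)); last by ring.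
  lra.
have bound m : (j <= m)%N -> L m * rho ^+ m * Y j <= expR Lam * (rho ^+ j * (L m * Y m) + 2 * C * B * (L m * rho ^+ m)).
  move=> jm; have := claim (m - j)%N; rewrite subnKC// => h.
  have h1 : C * \sum_(i < m - j) (D (j + i)%N + D (j + i).+1) <= 2 * C * B.
    rewrite (mulrC 2) -mulrA ler_wpM2l//; apply: le_trans (sum_D2 m td).
    rewrite -(big_mkord xpredT (fun i => D i + D i.+1)) (@big_cat_nat _ _ _ j)//=.
    have -> : \sum_(j <= i < m) (D i + D i.+1) = \sum_(i < m - j) (D (j + i)%N + D (j + i).+1).
      by rewrite -{1}(add0n j) big_addn big_mkord; apply: eq_bigr => i _; rewrite addnC.
    by rewrite lerDr sumr_ge0// => i _; rewrite addr_ge0.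
  have rjm : rho ^- (m - j) = rho ^+ j / rho ^+ m.
    by rewrite -{2}(subnKC jm) exprD invfM mulrA divff ?mul1r// expf_neq0// gt_eqF.
  have h2 : Y j <= expR Lam * (rho ^- (m - j) * Y m + 2 * C * B).
    apply: le_trans h _; apply: ler_pM => //; first exact: ltW.
    - rewrite addr_ge0 ?mulr_ge0 ?invr_ge0 ?exprn_ge0 ?(ltW rho0)// sumr_ge0// => i _.
      by rewrite addr_ge0.
    - by rewrite lerD2l.
  have Lr : 0 < L m * rho ^+ m by rewrite mulr_gt0// exprn_gt0.
  apply: le_trans (ler_wpM2l (ltW Lr) h2) _; rewrite rjm le_eqVlt; apply/orP; left; apply/eqP.
  by field; rewrite expf_neq0// gt_eqF.
have B0 : 0 <= B by apply: le_trans (sX 0%N); rewrite big_ord0.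
have sLY n : \sum_(i < n) L i * Y i <= C * (1 + Lam ^+ 2) * B.
  apply: (@le_trans _ _ (\sum_(i < n) (C * X i + C * Lam ^+ 2 * D i))).
    apply: ler_sum => i _; apply: le_trans (hlo i) _; rewrite mulrDr lerD2l -mulrA ler_wpM2l//.
    by rewrite ler_wpM2r// ler_sqr ?nnegrE// ltW.
  rewrite big_split -!mulr_sumr /= mulrDr mulr1 mulrDl; apply: lerD.
    by apply: ler_wpM2l => //; exact: sX.
  by apply: ler_wpM2l; [rewrite mulr_ge0// sqr_ge0|exact: sD].
(* The weights from [j] on must add up to some [W > rho ^+ j], so that division by [W] leaves a
   bound which does not depend on [j]. *)
have [n hn] := ub (\sum_(i < j) L i * rho ^+ i + rho ^+ j).
have jn : (j <= n)%N.
  rewrite leqNgt; apply/negP => nj; move: hn; rewrite ltNge => /negP; apply.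
  rewrite -[leLHS]addr0; apply: lerD; last by rewrite exprn_ge0// ltW.
  rewrite -!(big_mkord xpredT (fun i => L i * rho ^+ i)) (@big_cat_nat _ _ _ n 0 j)//=; last exact: ltnW.
  by rewrite lerDl sumr_ge0// => i _; rewrite mulr_ge0 ?exprn_ge0 ?ltW.
pose W := \sum_(j <= i < n) L i * rho ^+ i.
have hW : rho ^+ j < W.
  move: hn; rewrite -!(big_mkord xpredT (fun i => L i * rho ^+ i)) (@big_cat_nat _ _ _ j 0 n)//=.
  by rewrite ltrD2l.
have rj : 0 < rho ^+ j by rewrite exprn_gt0.
have W0 : 0 < W by exact: lt_trans hW.
have : W * Y j <= expR Lam * (rho ^+ j * (C * (1 + Lam ^+ 2) * B) + 2 * C * B * W).
  apply: (@le_trans _ _ (\sum_(j <= i < n) expR Lam * (rho ^+ j * (L i * Y i) + 2 * C * B * (L i * rho ^+ i)))).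
    rewrite /W mulr_suml; apply: ler_sum_nat => i /andP[ji _]; exact: bound.
  rewrite -mulr_sumr ler_wpM2l ?(ltW E0)// big_split -!mulr_sumr /= lerD2r ler_wpM2l ?(ltW rj)//.
  apply: le_trans (sLY n); rewrite -(big_mkord xpredT (fun i => L i * Y i)) (@big_cat_nat _ _ _ j 0 n)//=.
  by rewrite lerDr sumr_ge0// => i _; rewrite mulr_ge0// ltW.
move=> h; rewrite -(ler_pM2l W0); apply: le_trans h _.
set p := C * (1 + Lam ^+ 2) * B.
have h1 : rho ^+ j * p <= W * p.
  by apply: ler_wpM2r; [rewrite !mulr_ge0// addr_ge0// sqr_ge0|exact: ltW].
rewrite (_ : W * _ = expR Lam * (W * p + 2 * C * B * W)); last by rewrite /p; ring.
by apply: ler_wpM2l; [exact: ltW|rewrite lerD2r].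
Qed.

Lemma tail_sequences : exists c : nat -> R, (forall j, 0 <= c j) /\
  (exists M, forall n, \sum_(i < n) c i <= M) /\
  forall X Y D B, tail_data X Y D B -> forall j, X j <= c j * B.
Proof.
(* [th] is the growth granted to [Y]; a bound of [Y j] by a multiple of [th j] is sufficient once
   [L j * th j] is summable. It is used with 1 and with the powers of [rho]. *)
have main (th : nat -> R) (K : R) : (forall j, 0 <= th j) -> 0 <= K ->
    (exists M, forall n, \sum_(i < n) L i * th i <= M) ->
    (forall X Y D B, tail_data X Y D B -> forall j, Y j <= K * B * th j) ->
    exists c : nat -> R, (forall j, 0 <= c j) /\ (exists M, forall n, \sum_(i < n) c i <= M) /\
      forall X Y D B, tail_data X Y D B -> forall j, X j <= c j * B.
  move=> th0 K0 [M hM] hY; exists (fun j => C * (K * (L j * th j) + Lam * L j)); split; [|split].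
  - by move=> j; rewrite mulr_ge0// addr_ge0// mulr_ge0// ?mulr_ge0// ltW.
  - exists (C * (K * M + Lam * Lam)) => n; rewrite -mulr_sumr ler_wpM2l// big_split -!mulr_sumr /=.
    by apply: lerD; apply: ler_wpM2l => //; [exact: hM|exact: sumL].
  - move=> X Y D B td j; have hy := hY _ _ _ _ td j; have [X0 Y0 D0 sX sD _ _ _ hup _] := td.
    apply: le_trans (hup j) _; rewrite -mulrA ler_wpM2l// mulrDl; apply: lerD.
      by rewrite (_ : _ * B = L j * (K * B * th j)); [rewrite ler_wpM2l// ltW|ring].
    have DB : D j <= B.
      by apply: le_trans (sD j.+1); rewrite big_ord_recr lerDr sumr_ge0.
    by rewrite expr2; apply: ler_pM => //; rewrite ?mulr_ge0 ?ler_wpM2r// ltW.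
have E0 : 0 < expR Lam by exact: expR_gt0.
have [r1|r1] := leP rho 1.
  apply: (main (fun=> 1) (expR Lam * (4 * C))) => //.
  - by rewrite !mulr_ge0// ltW.
  - by exists Lam => n; under eq_bigr do rewrite mulr1.
  - move=> X Y D B td j; have := tail_forward (r := 1) j (lexx _) r1 td.
    by rewrite expr1n.
have [bd|ub] := pselect (exists M, forall n, \sum_(i < n) L i * rho ^+ i <= M).
  apply: (main (fun j => rho ^+ j) (expR Lam * (4 * C))) => //.
  - by move=> j; rewrite exprn_ge0// ltW.
  - by rewrite !mulr_ge0// ltW.
  - by move=> X Y D B td j; apply: tail_forward td; rewrite // ltW.
apply: (main (fun=> 1) (expR Lam * (C * (1 + Lam ^+ 2) + 2 * C))) => //.
- by rewrite mulr_ge0 ?addr_ge0 ?mulr_ge0 ?addr_ge0 ?sqr_ge0// ltW.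
- by exists Lam => n; under eq_bigr do rewrite mulr1.
- move=> X Y D B td j; rewrite mulr1; apply: tail_backward td; first exact: ltW.
  move=> M; apply: contrapT => h; apply: ub; exists M => n.
  by rewrite leNgt; apply/negP => hn; apply: h; exists n.
Qed.

End tail_sequences.

Lemma bounded_sum_tail {R : realType} (c : nat -> R) M : (forall j, 0 <= c j) ->
  (forall n, \sum_(i < n) c i <= M) ->
  forall e : R, 0 < e -> exists n, forall N, \sum_(n <= i < N) c i <= e.
Proof.
move=> c0 cM e e0.
pose S := [set \sum_(i < n) c i | n in [set: nat]].
have supS : has_sup S.
  by split; [exists (\sum_(i < 0) c i); exists 0%N|exists M => _ [n _ <-]].
have [_ [n _ <-] hn] := sup_adherent e0 supS.
exists n => N; have [nN|Nn] := leqP n N; last by rewrite big_geq ?ltW// ltnW.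
have : \sum_(i < N) c i <= sup S by apply: sup_upper_bound => //; exists N.
rewrite -!(big_mkord xpredT c) in hn *; rewrite (@big_cat_nat _ _ _ n 0 N)//=; lra.
Qed.

(** * Collars behind the sections *)

Section affine_isometry.
Context {R : realType} {n : nat}.
Local Notation V := 'rV[R]_n.
Local Notation lam := (lebesgue_row n).
Variables (Q : 'M[R]_n) (c : V).
Hypothesis QQ : Q *m Q^T = 1%:M.

Lemma measurable_affine : measurable_fun setT (fun v : V => v *m Q + c).
Proof.
by apply: (measurableT_comp (@measurable_addc R n c)); exact: measurable_mulmxr.
Qed.

Lemma ge0_integral_affine (B : set V) (F : V -> \bar R) :
  measurable B -> measurable_fun B F -> (forall x, B x -> 0 <= F x)%E ->
  (\int[lam]_(x in (fun v => (v *m Q + c)%R) @^-1` B) F (x *m Q + c)%R = \int[lam]_(x in B) F x)%E.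
Proof.
move=> mB mF F0.
rewrite -(ge0_integral_pushforward measurable_affine lam mB mF); last first.
  by move=> x; rewrite inE => /F0.
apply: eq_measure_integral; first exact: measurable_affine.
move=> mA A mA' AB; rewrite /pushforward.
transitivity (lam (mulmx^~ Q @^-1` ((fun v => v + c) @^-1` A))); first by [].
rewrite lebesgue_row_isometry//; first exact: lebesgue_row_shift.
by apply: measurable_preim => //; exact: measurable_addc.
Qed.

Lemma jacobian_affine m (f g : V -> 'rV[R]_m) (y : V) : differentiable f y ->
  differentiable g (y *m Q + c) -> (\forall z \near y, f z = g (z *m Q + c)) ->
  jacobian f y = Q *m jacobian g (y *m Q + c).
Proof.
move=> df dg fg; apply/row_matrixP => i; rewrite !rowE mulmxA.
rewrite -!deriveEjacobian// (near_eq_derive _ fg) /derive; congr (lim _).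
set p := (fun h => _); set q := (fun h => _); suff -> : p = q by [].
apply/funext => h; rewrite /p /q /= mulmxDl -scalemxAl.
by congr (_ *: (g _ - _)); rewrite addrA.
Qed.

Lemma sum_sqr_isometry m (A : 'M[R]_(n, m)) b :
  \sum_j ((Q *m A) j b) ^+ 2 = \sum_j (A j b) ^+ 2.
Proof.
have h (B : 'M[R]_(n, m)) : \sum_j (B j b) ^+ 2 = dotp (col b B)^T (col b B)^T.
  by rewrite dotpE; apply: eq_bigr => j _; rewrite !mxE expr2.
rewrite !h /dotp !trmxK; have -> : col b (Q *m A) = Q *m col b A by rewrite !colE mulmxA.
by rewrite trmx_mul -mulmxA (mulmxA Q^T) (mulmx1C QQ) mul1mx.
Qed.

End affine_isometry.

Section C1_sub.
Context {R : realType} {m n : nat}.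

Lemma C1_on_sub (D E : set 'rV[R]_m) (f : 'rV[R]_m -> 'rV[R]_n) df : C1_on D f df -> open E ->
  E `<=` D -> C1_on E f df.
Proof.
move=> [cf cdf h] oE ED; split.
- exact: continuous_subspaceW cf.
- exact: continuous_subspaceW cdf.
- move=> x /interior_subset Ex; apply: h; apply: (filterS ED).
  exact: (open_nbhs_nbhs (conj oE Ex)).
Qed.

End C1_sub.

Section collar.
Context {R : realType} {d k : nat} (T : inflated_tree R d k).
Local Notation V := 'rV[R]_(d + 1).
Implicit Types (j : 'I_k.+1) (x : 'rV[R]_d).

Definition sect_dom j := if j == ord0 then cross T else dilate (Defs.ratio T) (cross T).

Lemma sect_dom0 j : sect_dom j 0.
Proof.
rewrite /sect_dom; case: ifP => _; first exact: cross_center.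
by exists 0; [exact: cross_center|rewrite scaler0].
Qed.

Lemma ctr_sect j : sect T j (ctr T j).
Proof. by exists 0; [exact: sect_dom0|rewrite mul0mx addr0]. Qed.

(** The origin belongs to the open body, whereas [ctr T j] lies on a section and hence outside
    it. *)
Lemma enorm_ctr_gt0 j : 0 < enorm (ctr T j).
Proof.
rewrite lt_neqAle enorm_ge0 andbT; apply/negP => /eqP h.
have [_ nb] := sect_boundary (ctr_sect j); apply: nb.
rewrite (_ : ctr T j = 0); first exact: body_center.
apply/rowP => i; rewrite mxE; apply/eqP; rewrite -normr_le0.
by apply: le_trans (coord_le_enorm _ _) _; rewrite -h.
Qed.

Lemma enorm_sqr n (v : 'rV[R]_n) : enorm v ^+ 2 = dotp v v.
Proof. by rewrite sqr_sqrtr// dotp_ge0. Qed.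

(* The isometry which maps the cross section onto the plane of the section
   [j] and the axis onto the skeleton, with orientation [s = 1] or [-1]. *)
Definition axis_mx j (s : R) : 'M[R]_(d + 1) :=
  col_mx (frame T j) ((s / enorm (ctr T j)) *: ctr T j).

Lemma axis_mx_isometry j s : s ^+ 2 = 1 -> axis_mx j s *m (axis_mx j s)^T = 1%:M.
Proof.
move=> s1; have c0 := enorm_ctr_gt0 j.
rewrite /axis_mx tr_col_mx mul_col_row frame_isometry linearZ /= -!scalemxAr -!scalemxAl ctr_ortho.
have -> : frame T j *m (ctr T j)^T = 0 by rewrite -[LHS]trmxK trmx_mul trmxK ctr_ortho trmx0.
rewrite !scaler0 (_ : _ *: _ = 1%:M) -?scalar_mx_block// scalerA.
apply/matrixP => a b; rewrite !ord1 mxE -[(_ *m _) 0 0]/(dotp (ctr T j) (ctr T j)) -enorm_sqr mxE eqxx.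
by rewrite -expr2 -exprMn mulfVK ?gt_eqF// s1.
Qed.

Lemma cyl_axis_mx j s x t : cyl x t *m axis_mx j s = x *m frame T j + (t * (s / enorm (ctr T j))) *: ctr T j.
Proof. by rewrite /cyl /axis_mx mul_row_col mul_scalar_mx scalerA. Qed.

Lemma frame_span j (v : V) : dotp v (ctr T j) = 0 -> v = v *m (frame T j)^T *m frame T j.
Proof.
move=> v0; have /mulmx1C := axis_mx_isometry j (expr1n _ 2 : (1 : R) ^+ 2 = 1).
rewrite /axis_mx tr_col_mx mul_row_col [((_ *: ctr T j)^T)]linearZ /= -scalemxAl -scalemxAr scalerA.
move=> /(congr1 (mulmx v)); rewrite mulmx1 mulmxDr -!scalemxAr !mulmxA.
rewrite (_ : v *m (ctr T j)^T = 0); last by apply/matrixP => a b; rewrite !ord1 -[LHS]/(dotp v (ctr T j)) v0 mxE.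
by rewrite mul0mx scaler0 addr0.
Qed.

Lemma dotpD_le n (u v : 'rV[R]_n) : dotp (u + v) (u + v) <= 2 * dotp u u + 2 * dotp v v.
Proof.
rewrite !dotpE !mulr_sumr -big_split; apply: ler_sum => i _; rewrite mxE.
have := sqr_ge0 (u 0 i - v 0 i); rewrite /= ; nra.
Qed.

Lemma dotp_cube_lt n (v : 'rV[R]_n) a r : 0 < a -> n%:R * a ^+ 2 < r ^+ 2 -> cube 0 a v -> dotp v v < r ^+ 2.
Proof. by move=> a0 ar /(dotp_cube a0) h; exact: le_lt_trans ar. Qed.

Lemma sqr_enorm_lt n (v : 'rV[R]_n) r : 0 < r -> dotp v v < r ^+ 2 -> enorm v < r.
Proof. move=> r0 h; have h2 : enorm v ^+ 2 < r ^+ 2 by rewrite sqr_sqrtr ?dotp_ge0.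
by move: h2; rewrite ltr_pXn2r// ?nnegrE ?enorm_ge0// ltW. Qed.

(* The section being flat, the graph function [phi] of a Lipschitz chart at its
   center is affine along it; the normal is transversal to the direction [e]
   of the chart, and the skeleton tells on which side the body lies. *)
Lemma collar_in_body j : exists2 c : R, 0 < c & forall x h, cube 0 c x -> 0 < h < c ->
  body T (ctr T j + x *m frame T j - (h / enorm (ctr T j)) *: ctr T j).
Proof.
set p := ctr T j; set N := enorm p; have N0 : 0 < N by exact: enorm_ctr_gt0.
set F := frame T j.
have [n nE] : exists n : V, n = - N^-1 *: p by eexists.
have [obody _ _ lip] := body_domain T.
have [clp nbp] := sect_boundary (ctr_sect j).
have [e [phi [r [K [r0 e1 phiK phie hb]]]]] := lip _ clp nbp.
have nF : n *m F^T = 0 by rewrite nE -scalemxAl ctr_ortho scaler0.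
have nn : dotp n n = 1.
  by rewrite nE dotpZ -enorm_sqr sqrrN -exprMn mulVf ?expr1n// gt_eqF.
have ee : dotp e e = 1 by rewrite -enorm_sqr e1 expr1n.
have FF x : dotp (x *m F) (x *m F) = dotp x x.
  by rewrite /dotp trmx_mul mulmxA -(mulmxA x) frame_isometry mulmx1.
pose nu := dotp n e.
have dom_open : open (sect_dom j).
  have [oc _ _ _] := cross_domain T; rewrite /sect_dom; case: ifP => _ //.
  by have [] := segdom_dilate (lipschitz_segdom (cross_domain T)) (ratio_gt0 T).
have [a a0 ha] := row_nbhs dom_open (sect_dom0 j).
have r20 : 0 < r / 2 by rewrite divr_gt0.
(* A point of the section is not strictly above the graph, being outside the body. It is not
   strictly below either: by the Lipschitz bound a whole ball around it would miss the body,
   although it belongs to the closure. *)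
have flat x : cube 0 a x -> dotp x x < (r / 2) ^+ 2 -> phi (p + x *m F) = dotp (p + x *m F) e.
  move=> xa xr; set q := p + x *m F.
  have [clq nbq] : (closure (body T) `\` body T) q.
    by apply: (@sect_boundary _ _ _ T j); exists x => //; apply: ha => i; exact: xa.
  have qp : q - p = x *m F by rewrite /q addrAC subrr add0r.
  have qr : enorm (q - p) < r.
    by apply: sqr_enorm_lt => //; rewrite qp FF; apply: lt_trans xr _; rewrite ltr_pXn2r ?nnegrE ?ltW//; lra.
  apply/eqP; rewrite eq_le; apply/andP; split; last by rewrite leNgt; apply/negP => /(hb _ qr).
  rewrite leNgt; apply/negP => hq; pose g := phi q - dotp q e.
  have g0 : 0 < g by rewrite subr_gt0.
  have K1 : 0 < 1 + `|K| by rewrite ltr_pwDl.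
  pose eta := Num.min (r / 2) (g / (1 + `|K|)).
  have eta0 : 0 < eta by rewrite lt_min r20 divr_gt0.
  have [b b0 hbb] := small_radius (n := d + 1) eta0.
  have [y By yq] := (closure_cubes _ _).1 clq b b0.
  have yq0 : cube 0 b (y - q) by move=> i; have := yq i; rewrite !mxE subr0.
  have dyq := dotp_cube_lt b0 hbb yq0.
  have eyq := sqr_enorm_lt eta0 dyq.
  have eta1 : eta <= r / 2 by rewrite ge_min lexx.
  have eta2 : eta * (1 + `|K|) <= g by rewrite -ler_pdivlMr// ge_min lexx orbT.
  have yr : enorm (y - p) < r.
    apply: sqr_enorm_lt => //; rewrite (_ : y - p = (y - q) + (q - p)); last by rewrite addrA subrK.
    apply: le_lt_trans (dotpD_le _ _) _; rewrite qp FF.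
    have : eta ^+ 2 <= (r / 2) ^+ 2 by rewrite ler_pXn2r ?nnegrE ?(ltW eta0) ?(ltW r20).
    rewrite expr_div_n in xr *; move: xr dyq; move: (eta ^+ 2) (r ^+ 2) => ? ? ? ?; lra.
  have := (hb _ yr).1 By => h1.
  have h2 := phiK q y; rewrite -[q - y]opprB in h2.
  have h3 : K * enorm (- (y - q)) <= `|K| * eta.
    rewrite (_ : enorm (- _) = enorm (y - q)); last by rewrite /enorm dotpN.
    apply: le_trans (ler_norm _) _; rewrite normrM ler_wpM2l// ger0_norm ?enorm_ge0// ltW//.
  have h4 := dotp_enorm_le (y - q) e1; rewrite dotpBl in h4.
  have h5 := ler_norm (phi q - phi y); have h6 := ler_norm (dotp y e - dotp q e).
  have h7 := lt_le_trans (le_lt_trans h6 (le_lt_trans h4 eyq)) (lexx eta).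
  have h8 := le_trans h5 (le_trans h2 h3).
  rewrite /g mulrDr mulr1 in eta2; move: eta2 h7 h8 h1; rewrite (mulrC eta).
  move: (`|K| * eta) (phi q) (phi y) (dotp q e) (dotp y e) => a1 a2 a3 a4 a5; lra.
have [x0 x0E] : exists x0, x0 = e *m F^T by eexists.
pose B : R := \sum_i `|x0 0 i|.
have B0 : 0 <= B by apply: sumr_ge0.
have x0B i : `|x0 0 i| <= B by rewrite /B (bigD1 i)//= lerDl sumr_ge0.
have pn : p = - N *: n by rewrite nE scalerA mulrNN divff ?scale1r// gt_eqF.
(* Otherwise [e] would be tangent to the section; a small step along [e] changes the height
   [dotp _ e] but not [phi], contrary to [flat]. *)
have nu0 : nu != 0.
  apply/negP => /eqP nu0.
  have eF : e = x0 *m F.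
    rewrite x0E; apply: frame_span; rewrite -/p pn dotpE.
    transitivity (- N * nu); last by rewrite nu0 mulr0.
    by rewrite /nu dotpE mulr_sumr; apply: eq_bigr => i _; rewrite !mxE; ring.
  have B1 : 0 < B + 1 by rewrite ltr_wpDl.
  pose s : R := Num.min a (r / 2) / (2 * (B + 1)).
  have s0 : 0 < s by rewrite divr_gt0 ?mulr_gt0// lt_min a0.
  have sB : s * (2 * (B + 1)) = Num.min a (r / 2) by rewrite mulfVK// gt_eqF// mulr_gt0.
  have sa : s * (2 * (B + 1)) <= a by rewrite sB ge_min lexx.
  have sr : s * (2 * (B + 1)) <= r / 2 by rewrite sB ge_min lexx orbT.
  have h1 : cube 0 a (s *: x0).
    move=> i; rewrite !mxE subr0 normrM gtr0_norm//; apply: lt_le_trans sa; rewrite ltr_pM2l//.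
    by have := x0B i; lra.
  have h2 : dotp (s *: x0) (s *: x0) < (r / 2) ^+ 2.
    rewrite dotpZ -FF -eF ee mulr1 ltr_pXn2r ?nnegrE ?(ltW s0) ?(ltW r20)//.
    by apply: lt_le_trans sr; rewrite ltr_pMr//; lra.
  have := flat _ h1 h2; rewrite -scalemxAl -eF phie dotpDl dotpZl ee.
  have := flat 0 (@cubexx _ _ 0 _ a0); rewrite mul0mx addr0 => -> //; first by move=> ?; lra.
  by rewrite dotpE big1 ?exprn_gt0// => i _; rewrite mxE mul0r.
have [a2 a20 ha2] := small_radius (n := d) r20.
pose a3 : R := Num.min a a2.
have a30 : 0 < a3 by rewrite lt_min a0.
have nup : 0 < `|nu| by rewrite normr_gt0.
have nuB : 0 < 1 + B / `|nu| by rewrite ltr_pwDl// divr_ge0.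
(* The oblique projection [x - (h / nu) *: x0] used below has coordinates less than
   [c * (1 + B / |nu|)], so it remains in the range of [flat]. *)
pose c : R := Num.min (a3 / (1 + B / `|nu|)) (Num.min (r / 2) N).
have c0 : 0 < c by rewrite !lt_min divr_gt0//= r20.
have ca : c * (1 + B / `|nu|) <= a3 by rewrite -ler_pdivlMr// ge_min lexx.
have cr : c <= r / 2 by rewrite !ge_min lexx !orbT.
have cN : c <= N by rewrite !ge_min lexx !orbT.
(* The point is reached from the plane of the section by moving [h / nu] along [e]. This leaves
   [phi] unchanged, and on the plane [phi] equals the height; so the sign of [h / nu] decides. *)
have iff x h : cube 0 c x -> 0 < h < c -> (body T (p + x *m F + h *: n) <-> 0 < h / nu).
  move=> xc /andP[h0 hc]; set y := p + _ + _; pose t := h / nu.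
  pose x' := x - t *: x0.
  have ca3 : c <= a3.
    by apply: le_trans ca; rewrite ler_peMr ?(ltW c0)// lerDl divr_ge0.
  have x'a : cube 0 a3 x'.
    move=> i; rewrite !mxE subr0; apply: le_lt_trans (ler_normB _ _) _; rewrite normrM.
    have h1 := xc i; rewrite !mxE subr0 in h1.
    apply: lt_le_trans ca; rewrite mulrDr mulr1 ltr_leD//.
    rewrite /t normrM normfV (gtr0_norm h0) mulrAC mulrA ler_wpM2r ?invr_ge0//.
    by apply: ler_pM => //; exact: ltW.
  have x'1 : cube 0 a x' by apply: cube_sub x'a; rewrite ge_min lexx.
  have x'2 : dotp x' x' < (r / 2) ^+ 2.
    by apply: (dotp_cube_lt a20 ha2); apply: cube_sub x'a; rewrite ge_min lexx orbT.
  have yE : y = p + x' *m F + t *: e.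
    have : h *: n - t *: e = - t *: x0 *m F.
      have -> : - t *: x0 = (h *: n - t *: e) *m F^T.
        by rewrite x0E mulmxBl -!scalemxAl nF scaler0 sub0r scaleNr.
      apply: frame_span; rewrite -/p pn dotpE.
      transitivity (- N * (h * dotp n n - t * nu)); last by rewrite nn /t mulfVK// mulr1 subrr mulr0.
      rewrite /nu !dotpE !mulr_sumr -sumrB mulr_sumr; apply: eq_bigr => i _; rewrite !mxE; ring.
    move=> hE; rewrite /y /x' mulmxBl -scalemxAl; rewrite scaleNr mulNmx -scalemxAl in hE.
    by rewrite addrA -[RHS]addrA -hE -addrA subrK addrA.
  have yr : enorm (y - p) < r.
    apply: sqr_enorm_lt => //; rewrite (_ : y - p = x *m F + h *: n); last by apply: (addIr p); rewrite subrK /y -addrA addrC.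
    have xF : dotp (x *m F + h *: n) (x *m F + h *: n) = dotp x x + h ^+ 2.
      rewrite (_ : x *m F + h *: n = cyl x h *m axis_mx j (-1)).
        by rewrite dotp_mulmxr ?dotp_cyl// axis_mx_isometry// sqrrN expr1n.
      by rewrite cyl_axis_mx nE scalerA mulN1r.
    rewrite xF; have hx : dotp x x < (r / 2) ^+ 2.
      by apply: (dotp_cube_lt a20 ha2); apply: cube_sub xc; rewrite (le_trans ca3)// ge_min lexx orbT.
    have hh : h ^+ 2 <= (r / 2) ^+ 2 by rewrite ler_pXn2r ?nnegrE ?ltW//; lra.
    have : 0 < r ^+ 2 by rewrite exprn_gt0.
    by move: hx hh; rewrite expr_div_n; lra.
  have -> : body T y <-> phi y < dotp y e by exact: hb.
  have -> : phi y = dotp (p + x' *m F) e by rewrite yE phie flat.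
  have -> : dotp y e = dotp (p + x' *m F) e + t by rewrite yE (dotpDl (p + x' *m F)) dotpZl ee mulr1.
  by rewrite ltrDl.
(* The sign is read off at a point of the skeleton close to the section, which is known to lie in
   the body. *)
have nuP : 0 < nu.
  have c2 : 0 < c / 2 < c by rewrite divr_gt0//=; lra.
  have : body T (p + 0 *m F + (c / 2) *: n).
    rewrite mul0mx addr0 nE scalerA -{1}(scale1r p) -scalerDl.
    apply: skeleton_in_body; rewrite mulrN ltrBlDr ltrDl subr_ge0 mulr_gt0 ?divr_gt0 ?invr_gt0// andbT.
    by rewrite ler_pdivrMr// mul1r; lra.
  move=> /(iff _ _ (@cubexx _ _ 0 _ c0) c2); rewrite pmulr_rgt0 ?invr_gt0//.
  by case/andP: c2.
exists c => // x h xc hc.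
have := (iff x h xc hc).2; rewrite nE scalerA mulrN scaleNr; apply.
by case/andP: hc => h0 _; rewrite divr_gt0.
Qed.

(** One height serves all sections, as the minimum over finitely many of them, and all vertices by
    dilation; the minimum with [e] also provides a cube inside the cross section. *)
Lemma collar_in_vertex : exists c : R, [/\ 0 < c, forall (s : seq 'I_k) j x h,
   cube 0 (c * Defs.ratio T ^+ size s) x -> 0 < h < c * Defs.ratio T ^+ size s ->
   vertex_body T s (behind_sect T s j x h) &
   forall s : seq 'I_k, cube 0 (c * Defs.ratio T ^+ size s) `<=` edge_cross T s].
Proof.
have [c cP] := choice (fun j => let: ex_intro2 c c0 hc := collar_in_body j in ex_intro _ c (conj c0 hc)).
have [oc _ _ _] := cross_domain T.
have [e e0 he] := row_nbhs oc (cross_center T).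
pose c1 := \big[Num.min/e]_j c j.
have c1e : c1 <= e by rewrite /c1; apply: bigmin_le_id.
have c1c j : c1 <= c j by exact: bigmin_le_cond.
have c10 : 0 < c1.
  by apply/bigmin_gtP; split => // j _; case: (cP j).
have tp (s : seq 'I_k) : 0 < Defs.ratio T ^+ size s by rewrite exprn_gt0// ratio_gt0.
exists c1; split => //.
  move=> s j x h xc /andP[h0 hc]; apply/dilateE => //.
  set t := Defs.ratio T ^+ size s in xc hc *; have t0 : 0 < t by exact: tp.
  have -> : t^-1 *: behind_sect T s j x h =
      ctr T j + (t^-1 *: x) *m frame T j - (t^-1 * h / enorm (ctr T j)) *: ctr T j.
    by rewrite /behind_sect scalerBr scalerDr !scalerA mulVf ?gt_eqF// scale1r -scalemxAl mulrA.
  have [_ hj] := cP j; apply: hj.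
    move=> i; have := xc i; rewrite !mxE !subr0 normrM gtr0_norm ?invr_gt0// => hi.
    by rewrite mulrC ltr_pdivrMr//; apply: lt_le_trans hi _; rewrite ler_wpM2r ?(ltW t0).
  rewrite mulr_gt0 ?invr_gt0//= mulrC ltr_pdivrMr//; apply: lt_le_trans hc _.
  by rewrite ler_wpM2r ?(ltW t0).
move=> s x xc; apply/dilateE => //; apply: he => i; have := xc i; rewrite !mxE !subr0.
rewrite normrM gtr0_norm ?invr_gt0// => hi.
by rewrite mulrC ltr_pdivrMr//; apply: lt_le_trans hi _; rewrite ler_wpM2r ?(ltW (tp s)).
Qed.

End collar.

(** * Functions on the pieces of the tree *)

Section pieces.
Context {R : realType} {d k : nat} (T : inflated_tree R d k).
Local Notation V := 'rV[R]_(d + 1).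
Local Notation lam := (lebesgue_row (d + 1)).
Local Notation word := (seq 'I_k).
Local Notation point := (piece k * V)%type.
Local Notation slab A a b := (cylset A [set` Interval (BRight a%R) (BLeft b%R)]).
Implicit Types s : word.

Definition pdom (c : piece k) : set V :=
  if c.1 then vertex_body T c.2 else slab (edge_cross T c.2) 0%R (edge_len T c.2).

Lemma scale_gt0 s : 0 < Defs.ratio T ^+ size s.
Proof. by rewrite exprn_gt0// ratio_gt0. Qed.

Lemma edge_len_gt0 s : 0 < edge_len T s.
Proof.
case: s => [|i s] /=; first by rewrite subr_gt0 skeletons_disjoint0.
by have := skeletons_disjointS T (size s) i; lra.
Qed.

Lemma segdom_vertex s : segdom (vertex_body T s).
Proof. exact: segdom_dilate (lipschitz_segdom (body_domain T)) (scale_gt0 s). Qed.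

Lemma segdom_pdom c : segdom (pdom c).
Proof.
case: c => -[] s; first exact: segdom_vertex.
apply: segdom_cylset; last exact: edge_len_gt0.
exact: segdom_dilate (lipschitz_segdom (cross_domain T)) (scale_gt0 s).
Qed.

Lemma open_pdom c : open (pdom c). Proof. by have [] := segdom_pdom c. Qed.

Lemma measurable_pdom c : measurable (pdom c).
Proof. by apply: open_measurable_row; exact: open_pdom. Qed.

Lemma tree_coreE (p : point) : tree_core T p <-> pdom p.1 p.2.
Proof.
by rewrite /tree_core /pdom /=; case: p => -[[] s] y //=; rewrite /cylset /= in_itv.
Qed.

Lemma ugrad_eq n (D : set 'rV[R]_n) u u' G G' : ugrad D u G -> (forall x, D x -> u' x = u x) ->
  (forall x, D x -> G' x = G x) -> ugrad D u' G'.
Proof.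
move=> [mD mu mG G0 h] uu GG; split => //.
- by apply: eq_measurable_fun mu => x /set_mem/uu.
- by apply: eq_measurable_fun mG => x /set_mem/GG.
- by move=> x Dx; rewrite GG// G0.
move=> x z hz; rewrite !uu; last 2 first.
- by have := hz 0; rewrite scale0r addr0; apply; rewrite lexx ler01.
- by have := hz 1; rewrite scale1r; apply; rewrite lexx ler01.
have -> : (\int[lebesgue_measure]_(r in `[0%R, 1%R]) (G' (x + r *: z))%:E =
    \int[lebesgue_measure]_(r in `[0%R, 1%R]) (G (x + r *: z))%:E)%E.
  by apply: eq_integral => r /set_mem; rewrite /= in_itv/= => r01; rewrite GG//; exact: hz.
exact: h.
Qed.

(* [behind_sect] in the coordinates [cyl x t], with [e = -1] for the section
   at the end of an edge and [e = 1] for the one at its beginning. *)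
Lemma behind_sect_axis s j (e t0 : R) (y : V) : e ^+ 2 = 1 ->
  behind_sect T s j (transverse y) (- e * (axial y - t0)) =
  y *m axis_mx T j e + (Defs.ratio T ^+ size s - e * t0 / enorm (ctr T j)) *: ctr T j.
Proof.
move=> _; rewrite -{3}(cyl_uncyl y) cyl_axis_mx /behind_sect scalerBl addrCA -!addrA.
congr (_ + (_ + _)); rewrite -[LHS]scaleNr -[RHS]scalerBl; congr (_ *: _); ring.
Qed.

Lemma ge0_integral_affine_le (Q : 'M[R]_(d + 1)) (c : V) (B S : set V) (F : V -> \bar R) :
  Q *m Q^T = 1%:M -> measurable B -> measurable S -> measurable_fun B F ->
  (forall x, B x -> 0 <= F x)%E -> (forall x, S x -> B (x *m Q + c)) ->
  (\int[lam]_(x in S) F (x *m Q + c)%R <= \int[lam]_(x in B) F x)%E.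
Proof.
move=> QQ mB mS mF F0 SB; rewrite -(ge0_integral_affine c QQ mB mF F0).
have m1 : measurable ((fun v => v *m Q + c) @^-1` B).
  by apply: measurable_preim => //; exact: measurable_affine.
apply: ge0_integral_le_set => //.
by move=> x; exact: F0.
Qed.

Lemma slab_measure (A : set 'rV[R]_d) (I : set R) : measurable A ->
  measurable (I : set (measurableTypeR R)) ->
  lam (cylset A I) = (lebesgue_row d A * lebesgue_measure I)%E.
Proof.
move=> mA mI; rewrite -lebesgue_row_cyl; last exact: measurable_cylset.
rewrite (_ : _ @^-1` _ = A `*` I); last first.
  apply/seteqP; split => -[x t] /=; rewrite /cylset /= ?transverse_cyl ?axial_cyl//.
exact: product_measure1E.
Qed.

Lemma slab_split (A : set 'rV[R]_d) (a l b : R) (g : V -> \bar R) : a < l < b -> measurable A ->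
  measurable_fun (slab A a b) g -> (forall x, slab A a b x -> 0 <= g x)%E ->
  (\int[lam]_(x in slab A a b) g x <= \int[lam]_(x in slab A a l) g x + \int[lam]_(x in slab A l b) g x)%E.
Proof.
move=> /andP[al lb] mA mg g0.
have mI (I : interval R) : measurable (cylset A [set` I]).
  by apply: measurable_cylset => //; exact: measurable_itv.
have mN : measurable (cylset A [set l]) by apply: measurable_cylset => //; exact: measurable_set1.
have m1 : measurable ([set l] : set (measurableTypeR R)) by exact: measurable_set1.
have N0 : lam (cylset A [set l]) = 0%E by rewrite (slab_measure mA m1) lebesgue_measure_set1 mule0.
rewrite (ge0_negligible_integral mN)//.
pose F (i : bool) := if i then slab A a l else slab A l b.
have mF i : measurable (F i) by case: i; exact: mI.
apply: le_trans (@ge0_integral_cover_le _ _ _ lam _ [:: true; false] F _ g _ mF _ _ _) _.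
- exact: measurableD.
- by apply: measurable_funS mg => //; exact: subIsetl.
- by move=> x [/g0].
- move=> x [[Ax /=]]; rewrite in_itv/= => /andP[xa xb] nx.
  have [xl|xl|xl] := ltgtP (axial x) l.
  + by exists true => //; split => //=; rewrite in_itv/= xa.
  + by exists false => //; split => //=; rewrite in_itv/= xl.
  + by exfalso; apply: nx.
rewrite big_cons big_seq1; apply: leeD.
  apply: ge0_integral_le_set; [|by move=> x []].
  move=> x [Ax /=]; rewrite in_itv/= => /andP[? ?]; apply: g0; split => //=.
  by rewrite in_itv/=; apply/andP; split; lra.
apply: ge0_integral_le_set; [|by move=> x []].
move=> x [Ax /=]; rewrite in_itv/= => /andP[? ?]; apply: g0; split => //=.
by rewrite in_itv/=; apply/andP; split; lra.
Qed.

Section C1_tree.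
Variables (n : nat) (F : point -> 'rV[R]_n) (b : 'I_n).
Hypothesis CF : C1_tree T F.

(** For a complex function, written in two real components, [b] selects the real or the imaginary
    part. *)
Definition comp_of (p : point) : R := F p 0 b.
Definition grad2 (p : point) : R := \sum_j (jacobian (F \o chart T p.1) p.2 j b) ^+ 2.

Lemma grad2_vertex s y :
  grad2 (Vertex s, y) = \sum_j (jacobian (F \o pair (Vertex s)) y j b) ^+ 2.
Proof. by []. Qed.

Lemma grad2_ge0 p : 0 <= grad2 p.
Proof. by apply: sumr_ge0 => j _; exact: sqr_ge0. Qed.

Lemma chart_ugrad c (D : set V) : open D -> (forall y, D y -> chart_dom T c y) ->
  ugrad D (fun y => comp_of (chart T c y)) (fun y => \sum_j (jacobian (F \o chart T c) y j b) ^+ 2) /\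
  (forall y, D y -> differentiable (F \o chart T c) y).
Proof.
move=> oD Dc; have [df hdf] := CF c; have hD := C1_on_sub hdf oD Dc.
have [_ _ hJ] := hD.
have Di y : D y -> D° y by move=> Dy; exact: (open_nbhs_nbhs (conj oD Dy)).
split; last by move=> y /Di/hJ[].
apply: ugrad_eq (C1_ugrad b oD hD) _ _ => // y /Di/hJ[_ <-//].
Qed.

Lemma edge_dom_pdom s : pdom (Edge s) `<=` edge_dom T s.
Proof.
move=> y [Ay /=]; rewrite in_itv/= => /andP[y0 yl]; split => //.
by apply: Or31; rewrite !ltW.
Qed.

Lemma edge_chart_pdom s (y : V) : 0 <= axial y <= edge_len T s -> edge_chart T s y = (Edge s, y).
Proof. by move=> /andP[y0 yl]; rewrite /edge_chart ltNge yl /= (ltNge (axial y)) y0; case: s yl. Qed.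

Lemma piece_ugrad c : ugrad (pdom c) (fun y => comp_of (c, y)) (fun y => grad2 (c, y)).
Proof.
case: c => -[] s.
  have [h _] := @chart_ugrad (Vertex s) _ (@open_pdom (Vertex s)) (fun x => id).
  exact: h.
have [h _] := @chart_ugrad (Edge s) _ (@open_pdom (Edge s)) (@edge_dom_pdom s).
apply: ugrad_eq h _ _ => // y [_ /=]; rewrite in_itv/= => /andP[y0 yl].
by rewrite /chart /= edge_chart_pdom// !ltW.
Qed.

(** * The chart of an edge, continued into the adjacent vertices *)

Section box.
Variable c : R.
Hypothesis c0 : 0 < c.
Hypothesis collar : forall s j x (h : R), cube 0 (c * Defs.ratio T ^+ size s) x ->
  0 < h < c * Defs.ratio T ^+ size s -> vertex_body T s (behind_sect T s j x h).
Hypothesis cubec : forall s, cube 0 (c * Defs.ratio T ^+ size s) `<=` edge_cross T s.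

Let hh s := c * Defs.ratio T ^+ size s.
Let A s : set 'rV[R]_d := cube 0 (hh s).
Let l s := edge_len T s.

Let hh_gt0 s : 0 < hh s. Proof. by rewrite mulr_gt0// scale_gt0. Qed.

Let open_slab s a e : open (slab (A s) a e).
Proof.
apply: open_cubes => x [Ax /=]; rewrite in_itv/= => /andP[xa xe].
have [r r0 hr] := row_nbhs (@open_cube' _ _ 0 (hh s)) Ax.
exists (Num.min r (Num.min (axial x - a) (e - axial x))); first by rewrite !lt_min r0 !subr_gt0 xa.
move=> y hy; split.
  by apply: hr; apply: cube_transverse; apply: cube_sub hy; rewrite ge_min lexx.
have := cube_axial hy; rewrite !lt_min !ltr_norml => /and3P[_ /andP[? ?] /andP[? ?]].
by rewrite /= in_itv/=; apply/andP; split; lra.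
Qed.

Lemma measurable_slab s a e : measurable (slab (A s) a e).
Proof. by apply: open_measurable_row; exact: open_slab. Qed.

Let scaleS (i : 'I_k) s : hh (i :: s) <= hh s.
Proof.
by rewrite /hh /= ler_wpM2l ?(ltW c0)// exprS ler_piMl ?(ltW (scale_gt0 s)) ?(ltW (ratio_lt1 T)).
Qed.

Let box_dom0 s : slab (A s) 0%R (l s + hh s) `<=` edge_dom T s.
Proof.
move=> y [Ay /=]; rewrite in_itv/= => /andP[y0 yl]; split; first exact: cubec.
have [yl'|yl'] := leP (axial y) (l s); first by apply: Or31; rewrite ltW.
apply: Or32; split => // t /andP[t0 tl]; apply: collar => //.
by rewrite t0 /= (le_lt_trans tl)// ltrBlDl.
Qed.

Let box_dom i s : slab (A (i :: s)) (- hh (i :: s)) (l (i :: s) + hh (i :: s)) `<=` edge_dom T (i :: s).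
Proof.
move=> y [Ay /=]; rewrite in_itv/= => /andP[y0 yl].
have [yneg|ypos] := ltP (axial y) 0; last first.
  have [yz|yz] := eqVneq (axial y) 0.
    split; first exact: cubec.
    by apply: Or31; rewrite yz lexx ltW// edge_len_gt0.
  by apply: box_dom0; split => //=; rewrite in_itv/= yl andbT lt_neqAle eq_sym yz.
split; first exact: cubec.
apply: Or33; split => // t /andP[t0 tl]; apply: collar.
  by apply: cube_sub Ay; exact: scaleS.
rewrite t0 /=; apply: lt_le_trans (scaleS i s); apply: le_lt_trans tl _; rewrite -/(hh _); lra.
Qed.

Definition box_comp s (y : V) : R := comp_of (edge_chart T s y).
Definition box_grad2 s (y : V) : R := \sum_j (jacobian (F \o edge_chart T s) y j b) ^+ 2.

Lemma box_ugrad0 s : ugrad (slab (A s) 0%R (l s + hh s)) (box_comp s) (box_grad2 s).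
Proof. exact: (@chart_ugrad (Edge s) _ (@open_slab _ _ _) (@box_dom0 s)).1. Qed.

Lemma box_ugrad i s : ugrad (slab (A (i :: s)) (- hh (i :: s)) (l (i :: s) + hh (i :: s)))
  (box_comp (i :: s)) (box_grad2 (i :: s)).
Proof. exact: (@chart_ugrad (Edge (i :: s)) _ (@open_slab _ _ _) (@box_dom i s)).1. Qed.

(** Beyond the end of the edge its chart is an affine isometry into the vertex. The two jacobians
    differ by an orthogonal factor, so the squared gradient is the same in both charts. *)
Lemma chart_child s (y : V) : slab (A s) (l s) (l s + hh s) y ->
  let Q := axis_mx T ord0 (-1) in
  let z := (Defs.ratio T ^+ size s - -1 * l s / enorm (ctr T ord0)) *: ctr T ord0 in
  [/\ edge_chart T s y = (Vertex s, y *m Q + z), vertex_body T s (y *m Q + z) &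
      box_grad2 s y = grad2 (Vertex s, y *m Q + z)].
Proof.
move=> yS Q z.
have QQ : Q *m Q^T = 1%:M by apply: axis_mx_isometry; rewrite sqrrN expr1n.
have ec (x : V) : slab (A s) (l s) (l s + hh s) x -> edge_chart T s x = (Vertex s, x *m Q + z).
  move=> [_ /=]; rewrite in_itv/= => /andP[xl _]; rewrite /edge_chart xl /=; congr pair.
  by rewrite -behind_sect_axis ?sqrrN ?expr1n// opprK mul1r.
have vb : vertex_body T s (y *m Q + z).
  rewrite -behind_sect_axis ?sqrrN ?expr1n// opprK mul1r.
  move: yS => [Ay /=]; rewrite in_itv/= => /andP[y0 yl]; apply: collar => //.
  by rewrite subr_gt0 y0 /= ltrBlDl.
split; [exact: ec|exact: vb|].
have l0 := edge_len_gt0 s.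
have df : differentiable (F \o edge_chart T s) y.
  have [_ h] := @chart_ugrad (Edge s) _ (@open_slab s 0 (l s + hh s)) (@box_dom0 s).
  apply: h; move: yS => [Ay /=]; rewrite in_itv/= => /andP[y0 yl]; split => //=.
  by rewrite in_itv/= yl andbT (lt_trans _ y0).
have dg : differentiable (F \o pair (Vertex s)) (y *m Q + z).
  have [_ h] := @chart_ugrad (Vertex s) _ (@open_pdom (Vertex s)) (fun x => id).
  exact: h.
have fg : \forall x \near y, (F \o edge_chart T s) x = (F \o pair (Vertex s)) (x *m Q + z).
  near=> x; rewrite /= ec//; near: x.
  exact: (open_nbhs_nbhs (conj (@open_slab _ _ _) yS)).
rewrite grad2_vertex -(sum_sqr_isometry QQ); apply: eq_bigr => j _.
by rewrite (jacobian_affine df dg fg).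
Unshelve. all: by end_near.
Qed.

(** The counterpart before the beginning of the edge: the chart enters the preceding vertex through
    its section [lift ord0 i], with the opposite orientation of the axis. *)
Lemma chart_parent i s (y : V) : slab (A (i :: s)) (- hh (i :: s)) 0%R y ->
  let Q := axis_mx T (lift ord0 i) 1 in
  let z := (Defs.ratio T ^+ size s - 1 * 0 / enorm (ctr T (lift ord0 i))) *: ctr T (lift ord0 i) in
  [/\ edge_chart T (i :: s) y = (Vertex s, y *m Q + z), vertex_body T s (y *m Q + z) &
      box_grad2 (i :: s) y = grad2 (Vertex s, y *m Q + z)].
Proof.
move=> yS Q z.
have QQ : Q *m Q^T = 1%:M by apply: axis_mx_isometry; rewrite expr1n.
have l0 := edge_len_gt0 (i :: s).
have ec (x : V) : slab (A (i :: s)) (- hh (i :: s)) 0%R x -> edge_chart T (i :: s) x = (Vertex s, x *m Q + z).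
  move=> [_ /=]; rewrite in_itv/= => /andP[_ x0].
  rewrite /edge_chart ltNge ltW ?(lt_trans x0 l0)//= x0; congr pair.
  by rewrite -behind_sect_axis ?expr1n// subr0 mulN1r.
have vb : vertex_body T s (y *m Q + z).
  rewrite -behind_sect_axis ?expr1n// subr0 mulN1r.
  move: yS => [Ay /=]; rewrite in_itv/= => /andP[y0 yl]; apply: collar => //.
    by apply: cube_sub Ay; exact: scaleS.
  by rewrite oppr_gt0 yl /=; apply: lt_le_trans (scaleS i s); rewrite ltrNl.
split; [exact: ec|exact: vb|].
have df : differentiable (F \o edge_chart T (i :: s)) y.
  have [_ h] := @chart_ugrad (Edge (i :: s)) _ (@open_slab (i :: s) (- hh (i :: s)) (l (i :: s) + hh (i :: s))) (@box_dom i s).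
  apply: h; move: yS => [Ay /=]; rewrite in_itv/= => /andP[y0 yl]; split => //=.
  by rewrite in_itv/= y0 /= (lt_trans yl)// addr_gt0// hh_gt0.
have dg : differentiable (F \o pair (Vertex s)) (y *m Q + z).
  have [_ h] := @chart_ugrad (Vertex s) _ (@open_pdom (Vertex s)) (fun x => id).
  exact: h.
have fg : \forall x \near y, (F \o edge_chart T (i :: s)) x = (F \o pair (Vertex s)) (x *m Q + z).
  near=> x; rewrite /= ec//; near: x.
  exact: (open_nbhs_nbhs (conj (@open_slab _ _ _) yS)).
rewrite grad2_vertex -(sum_sqr_isometry QQ); apply: eq_bigr => j _.
by rewrite (jacobian_affine df dg fg).
Unshelve. all: by end_near.
Qed.

Local Notation "'D[' c ]" := (\int[lam]_(y in pdom c) (grad2 (c, y))%:E)%E (at level 0).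

Lemma comp_child_le s (p : R) :
  (\int[lam]_(y in slab (A s) (l s) (l s + hh s)) ((box_comp s y - p) ^+ 2)%:E <=
   \int[lam]_(y in pdom (Vertex s)) ((comp_of (Vertex s, y) - p) ^+ 2)%:E)%E.
Proof.
have [mD mu mG G0 _] := piece_ugrad (Vertex s).
have QQ : axis_mx T ord0 (-1) *m (axis_mx T ord0 (-1))^T = 1%:M by apply: axis_mx_isometry; rewrite sqrrN expr1n.
rewrite (eq_integral (fun y => ((comp_of (Vertex s, y *m axis_mx T ord0 (-1) +
  (Defs.ratio T ^+ size s - -1 * l s / enorm (ctr T ord0)) *: ctr T ord0) - p) ^+ 2)%:E)); last first.
  by move=> y /set_mem /chart_child[+ _ _]; rewrite /box_comp => ->.
apply: (@ge0_integral_affine_le _ _ (pdom (Vertex s)) _ (fun y => ((comp_of (Vertex s, y) - p) ^+ 2)%:E)) => //.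
- exact: measurable_slab.
- by apply/measurable_EFinP; apply: measurable_funX; exact: measurable_funB.
- by move=> x _; rewrite lee_fin sqr_ge0.
- by move=> y /chart_child[].
Qed.

Lemma grad_child_le s :
  (\int[lam]_(y in slab (A s) (l s) (l s + hh s)) (box_grad2 s y)%:E <= D[Vertex s])%E.
Proof.
have [mD mu mG G0 _] := piece_ugrad (Vertex s).
have QQ : axis_mx T ord0 (-1) *m (axis_mx T ord0 (-1))^T = 1%:M by apply: axis_mx_isometry; rewrite sqrrN expr1n.
rewrite (eq_integral (fun y => (grad2 (Vertex s, y *m axis_mx T ord0 (-1) +
  (Defs.ratio T ^+ size s - -1 * l s / enorm (ctr T ord0)) *: ctr T ord0))%:E)); last first.
  by move=> y /set_mem /chart_child[_ _ ->].
apply: (@ge0_integral_affine_le _ _ (pdom (Vertex s)) _ (fun y => (grad2 (Vertex s, y))%:E)) => //.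
- exact: measurable_slab.
- exact/measurable_EFinP.
- by move=> y /chart_child[].
Qed.

Lemma comp_parent_le i s (p : R) :
  (\int[lam]_(y in slab (A (i :: s)) (- hh (i :: s)) 0%R) ((box_comp (i :: s) y - p) ^+ 2)%:E <=
   \int[lam]_(y in pdom (Vertex s)) ((comp_of (Vertex s, y) - p) ^+ 2)%:E)%E.
Proof.
have [mD mu mG G0 _] := piece_ugrad (Vertex s).
set j := lift ord0 i.
have QQ : axis_mx T j 1 *m (axis_mx T j 1)^T = 1%:M by apply: axis_mx_isometry; rewrite expr1n.
rewrite (eq_integral (fun y => ((comp_of (Vertex s, y *m axis_mx T j 1 +
  (Defs.ratio T ^+ size s - 1 * 0 / enorm (ctr T j)) *: ctr T j) - p) ^+ 2)%:E)); last first.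
  by move=> y /set_mem /chart_parent[+ _ _]; rewrite /box_comp => ->.
apply: (@ge0_integral_affine_le _ _ (pdom (Vertex s)) _ (fun y => ((comp_of (Vertex s, y) - p) ^+ 2)%:E)) => //.
- exact: measurable_slab.
- by apply/measurable_EFinP; apply: measurable_funX; exact: measurable_funB.
- by move=> x _; rewrite lee_fin sqr_ge0.
- by move=> y /chart_parent[].
Qed.

Lemma grad_parent_le i s :
  (\int[lam]_(y in slab (A (i :: s)) (- hh (i :: s)) 0%R) (box_grad2 (i :: s) y)%:E <= D[Vertex s])%E.
Proof.
have [mD mu mG G0 _] := piece_ugrad (Vertex s).
set j := lift ord0 i.
have QQ : axis_mx T j 1 *m (axis_mx T j 1)^T = 1%:M by apply: axis_mx_isometry; rewrite expr1n.
rewrite (eq_integral (fun y => (grad2 (Vertex s, y *m axis_mx T j 1 +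
  (Defs.ratio T ^+ size s - 1 * 0 / enorm (ctr T j)) *: ctr T j))%:E)); last first.
  by move=> y /set_mem /chart_parent[_ _ ->].
apply: (@ge0_integral_affine_le _ _ (pdom (Vertex s)) _ (fun y => (grad2 (Vertex s, y))%:E)) => //.
- exact: measurable_slab.
- exact/measurable_EFinP.
- by move=> y /chart_parent[].
Qed.

Let slab_edge s : slab (A s) 0%R (l s) `<=` pdom (Edge s).
Proof. by move=> y [Ay Iy]; split => //; exact: cubec. Qed.

Lemma comp_edge_le s (p : R) :
  (\int[lam]_(y in slab (A s) 0%R (l s)) ((box_comp s y - p) ^+ 2)%:E <=
   \int[lam]_(y in pdom (Edge s)) ((comp_of (Edge s, y) - p) ^+ 2)%:E)%E.
Proof.
rewrite (eq_integral (fun y => ((comp_of (Edge s, y) - p) ^+ 2)%:E)); last first.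
  move=> y /set_mem [_ /=]; rewrite in_itv/= => /andP[y0 yl].
  by rewrite /box_comp edge_chart_pdom// !ltW.
apply: ge0_integral_le_set => [x _|x]; [by rewrite lee_fin sqr_ge0|exact: slab_edge].
Qed.

Lemma edge_comp_core s :
  (\int[lam]_(y in slab (A s) 0%R (l s)) (comp_of (Edge s, y) ^+ 2)%:E =
   \int[lam]_(y in slab (A s) 0%R (l s)) (box_comp s y ^+ 2)%:E)%E.
Proof.
apply: eq_integral => y /set_mem [_ /=]; rewrite in_itv/= => /andP[y0 yl].
by rewrite /box_comp edge_chart_pdom// !ltW.
Qed.

Lemma grad_edge_le s :
  (\int[lam]_(y in slab (A s) 0%R (l s)) (box_grad2 s y)%:E <= D[Edge s])%E.
Proof.
apply: ge0_integral_le_set => [x _|x]; [by rewrite lee_fin; exact: (grad2_ge0 (Edge s, x))|exact: slab_edge].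
Qed.

Lemma grad_box0_le s :
  (\int[lam]_(y in slab (A s) 0%R (l s + hh s)) (box_grad2 s y)%:E <= D[Edge s] + D[Vertex s])%E.
Proof.
have [mD mu mG G0 _] := box_ugrad0 s.
apply: le_trans (@slab_split _ _ (l s) _ (fun y => (box_grad2 s y)%:E) _ _ _ _) _.
- by rewrite edge_len_gt0 /= ltrDl hh_gt0.
- exact: measurable_cube'.
- exact/measurable_EFinP.
- by move=> x /G0; rewrite lee_fin.
by apply: leeD; [exact: grad_edge_le|exact: grad_child_le].
Qed.

Lemma grad_box_le i s :
  (\int[lam]_(y in slab (A (i :: s)) (- hh (i :: s)) (l (i :: s) + hh (i :: s))) (box_grad2 (i :: s) y)%:E
   <= D[Vertex s] + (D[Edge (i :: s)] + D[Vertex (i :: s)]))%E.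
Proof.
have [mD mu mG G0 _] := box_ugrad i s; have l0 := edge_len_gt0 (i :: s); have h0 := hh_gt0 (i :: s).
apply: le_trans (@slab_split _ _ 0%R _ (fun y => (box_grad2 (i :: s) y)%:E) _ _ _ _) _.
- by rewrite oppr_lt0 h0 /= addr_gt0.
- exact: measurable_cube'.
- exact/measurable_EFinP.
- by move=> x /G0; rewrite lee_fin.
by apply: leeD; [exact: grad_parent_le|exact: grad_box0_le].
Qed.

End box.
End C1_tree.
End pieces.

(** * Estimates between adjacent pieces *)

Ltac pos := repeat first [assumption | done | apply: sqr_ge0 | apply: addr_ge0 | apply: mulr_ge0
  | apply: exprn_ge0 | rewrite invr_ge0].

Lemma EFinM_le (R : realType) (a x : R) (X : \bar R) : 0 <= a -> (X <= x%:E)%E ->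
  (a%:E * X <= (a * x)%:E)%E.
Proof. by move=> a0 Xx; rewrite (EFinM a); apply: lee_wpmul2l. Qed.

Lemma EFinD_le (R : realType) (x y : R) (X Y : \bar R) : (X <= x%:E)%E -> (Y <= y%:E)%E ->
  (X + Y <= (x + y)%:E)%E.
Proof. by move=> Xx Yy; rewrite (EFinD x); apply: leeD. Qed.

Section mean_split.
Context {R : realType} {d} {T : measurableType d} (mu : {measure set T -> \bar R}).
Variables (D : set T) (u : T -> R) (q : R).
Hypotheses (mD : measurable D) (mu_D : mu D = q%:E) (mf : measurable_fun D u).

Let mX (p : R) : measurable_fun D (fun x => ((u x - p) ^+ 2)%:E).
Proof. by apply/measurable_EFinP; apply: measurable_funX; exact: measurable_funB. Qed.

Let s0 (p : R) x : (0 <= ((u x - p) ^+ 2)%:E)%E. Proof. by rewrite lee_fin sqr_ge0. Qed.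

Lemma mean_split_up (m p : R) : (\int[mu]_(x in D) ((u x - p) ^+ 2)%:E <=
  2%:E * \int[mu]_(x in D) ((u x - m) ^+ 2)%:E + (2 * (m - p) ^+ 2 * q)%:E)%E.
Proof.
apply: (@le_trans _ _ (\int[mu]_(x in D) (2%:E * ((u x - m) ^+ 2)%:E + (cst (2 * (m - p) ^+ 2)%:E) x))%E).
  apply: ge0_le_integral_gen => x Dx.
  - exact: s0.
  - by rewrite adde_ge0 ?mule_ge0// lee_fin mulr_ge0// sqr_ge0.
  - split => //; rewrite -EFinM -EFinD lee_fin.
    rewrite (_ : (u x - p) ^+ 2 = 2 * (u x - m) ^+ 2 + 2 * (m - p) ^+ 2 - (u x - m - (m - p)) ^+ 2); last by ring.
    by rewrite gerBl sqr_ge0.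
rewrite ge0_integralD//; last 3 first.
- by move=> x _; rewrite mule_ge0.
- exact: measurable_funeM.
- by move=> x _; rewrite lee_fin mulr_ge0// sqr_ge0.
rewrite ge0_integralZl//; apply: leeD => //.
by rewrite integral_cst// EFinM mu_D.
Qed.

Lemma mean_split_diff (m p : R) : (((m - p) ^+ 2 * q)%:E <=
  2%:E * \int[mu]_(x in D) ((u x - m) ^+ 2)%:E + 2%:E * \int[mu]_(x in D) ((u x - p) ^+ 2)%:E)%E.
Proof.
rewrite -!ge0_integralZl// -ge0_integralD//; last 4 first.
- by move=> x _; rewrite mule_ge0.
- exact: measurable_funeM.
- by move=> x _; rewrite mule_ge0.
- exact: measurable_funeM.
rewrite EFinM -mu_D -integral_cst//; apply: ge0_le_integral_gen => x Dx.
- by rewrite lee_fin sqr_ge0.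
- by rewrite adde_ge0// mule_ge0.
- split => //; rewrite -!EFinM -EFinD lee_fin.
  rewrite (_ : (m - p) ^+ 2 = 2 * (u x - m) ^+ 2 + 2 * (u x - p) ^+ 2 - (u x - m + (u x - p)) ^+ 2); last by ring.
  by rewrite gerBl sqr_ge0.
Qed.
End mean_split.

Section estimates.
Context {R : realType} {d k : nat} (T : inflated_tree R d k).
Local Notation V := 'rV[R]_(d + 1).
Local Notation lam := (lebesgue_row (d + 1)).
Local Notation word := (seq 'I_k).
Local Notation point := (piece k * V)%type.
Local Notation slab A a b := (cylset A [set` Interval (BRight a%R) (BLeft b%R)]).
Local Notation scale s := (Defs.ratio T ^+ size s).
Implicit Types s : word.

Definition sqnorm n (F : point -> 'rV[R]_n) (b : 'I_n) (c : piece k) : \bar R :=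
  (\int[lam]_(y in pdom T c) (comp_of F b (c, y) ^+ 2)%:E)%E.
Definition energy n (F : point -> 'rV[R]_n) (b : 'I_n) (c : piece k) : \bar R :=
  (\int[lam]_(y in pdom T c) (grad2 T F b (c, y))%:E)%E.

Lemma edge_len_le s : edge_len T s <= len T (size s).
Proof.
have h (j : 'I_k.+1) t : 0 <= Defs.ratio T ^+ t * enorm (ctr T j).
  by rewrite mulr_ge0 ?enorm_ge0// exprn_ge0// ltW// ratio_gt0.
case: s => [|i s] /=; first by rewrite gerBl enorm_ge0.
by have := h (lift ord0 i) (size s); have := h ord0 (size s).+1; lra.
Qed.

(** The incoming skeleton of a vertex is shorter than the edge that contains it. This one-sided
    comparison allows powers of the scale to be traded for powers of the length. *)
Lemma scale_le_len : exists2 c : R, 0 < c & forall s, c * scale s <= len T (size s).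
Proof.
exists (enorm (ctr T ord0)) => [|s]; first exact: enorm_ctr_gt0.
have := edge_len_gt0 T s; case: s => [|i s] /= h; first by rewrite expr0 mulr1; lra.
have : 0 <= Defs.ratio T ^+ size s * enorm (ctr T (lift ord0 i)).
  by rewrite mulr_ge0 ?enorm_ge0// exprn_ge0// ltW// ratio_gt0.
by rewrite mulrC; lra.
Qed.

Lemma len_le_edge : exists2 c : R, 0 < c & forall s, len T (size s) <= edge_len T s + c * scale s.
Proof.
pose B : R := \sum_j enorm (ctr T j).
have hB j : enorm (ctr T j) <= B by rewrite /B (bigD1 j)//= lerDl sumr_ge0// => i _; exact: enorm_ge0.
have r0 := ratio_gt0 T.
have B0 : 0 <= B by apply: le_trans (hB ord0); exact: enorm_ge0.
exists (B / Defs.ratio T + B + 1) => [|s].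
  by rewrite ltr_wpDl// addr_ge0// divr_ge0// ltW.
case: s => [|i s] /=.
  rewrite expr0 mulr1; have := hB ord0; have : 0 <= B / Defs.ratio T by rewrite divr_ge0// ltW.
  lra.
have e0 : 0 < Defs.ratio T ^+ size s by rewrite exprn_gt0.
have h1 := ler_wpM2l (ltW e0) (hB (lift ord0 i)).
have h2 : Defs.ratio T ^+ (size s).+1 * enorm (ctr T ord0) <= Defs.ratio T ^+ (size s).+1 * B.
  by rewrite ler_wpM2l// exprn_ge0// ltW.
have h3 : B / Defs.ratio T * Defs.ratio T ^+ (size s).+1 = Defs.ratio T ^+ size s * B.
  by rewrite exprS; field; rewrite gt_eqF.
have h4 : 0 < Defs.ratio T ^+ (size s).+1 by rewrite exprn_gt0.
rewrite !mulrDl h3 mul1r; rewrite (mulrC B); lra.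
Qed.

Lemma vertex_measure : exists a b : R, [/\ 0 < a, 0 <= b & forall s, exists q : R,
  [/\ lam (vertex_body T s) = q%:E, a * scale s ^+ (d + 1) <= q & q <= b * scale s ^+ (d + 1)]].
Proof.
have [ob _ bb _] := body_domain T.
have [e e0 he] := row_nbhs ob (body_center T).
have [M [Mr hM]] := bb; pose M1 := `|M| + 2.
have M10 : 0 < M1 by rewrite ltr_wpDl.
have he' : cube 0 e `<=` body T by move=> y hy; apply: he => i; exact: hy.
have hM' : body T `<=` cube 0 M1.
  move=> y By i; rewrite mxE subr0; apply: le_lt_trans (coord_le_norm y i) _.
  apply: (@le_lt_trans _ _ (`|M| + 1)); last by rewrite /M1; lra.
  by apply: hM => //; rewrite (le_lt_trans (ler_norm M))// ltrDl.
exists ((2 * e) ^+ (d + 1)), ((2 * M1) ^+ (d + 1)); split.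
- by rewrite exprn_gt0// mulr_gt0.
- by rewrite exprn_ge0// mulr_ge0// ltW.
move=> s; have t0 := scale_gt0 T s.
have h1 : cube 0 (scale s * e) `<=` vertex_body T s.
  by rewrite -[X in cube X _](scaler0 _ (scale s)) -dilate_cube//; exact: dilate_subset.
have h2 : vertex_body T s `<=` cube 0 (scale s * M1).
  by rewrite -[X in cube X _](scaler0 _ (scale s)) -dilate_cube//; exact: dilate_subset.
have mV : measurable (vertex_body T s) by exact: (measurable_pdom T (Vertex s)).
have m1 : (lam (cube 0 (scale s * e)) <= lam (vertex_body T s))%E.
  by apply: le_measure => //; rewrite inE//; exact: measurable_cube'.
have m2 : (lam (vertex_body T s) <= lam (cube 0 (scale s * M1)))%E.
  by apply: le_measure => //; rewrite inE//; exact: measurable_cube'.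
have E1 : lam (cube 0 (scale s * e)) = ((2 * e) ^+ (d + 1) * scale s ^+ (d + 1))%:E.
  by rewrite /cube lebesgue_row_cube ?mulr_gt0// -exprMn; congr (_ ^+ _)%:E; ring.
have E2 : lam (cube 0 (scale s * M1)) = ((2 * M1) ^+ (d + 1) * scale s ^+ (d + 1))%:E.
  by rewrite /cube lebesgue_row_cube ?mulr_gt0// -exprMn; congr (_ ^+ _)%:E; ring.
have fin : lam (vertex_body T s) \is a fin_num.
  by rewrite ge0_fin_numE//; apply: le_lt_trans m2 _; rewrite E2 ltry.
exists (fine (lam (vertex_body T s))); split.
- by rewrite fineK.
- by rewrite -lee_fin fineK// -E1.
- by rewrite -lee_fin fineK// -E2.
Qed.

(** [m] is a choice of vertex means, [x] and [g] are the squared norms and the energies of the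
    pieces, and [scale s ^+ d] is the cross-sectional area up to a constant. [C] is independent of
    the function. *)
Record estimates (C : R) (m : word -> R) (x g : piece k -> R) : Prop := Estimates {
  est_step : forall i s, scale (i :: s) ^+ d * (m s - m (i :: s)) ^+ 2 <=
    C * len T (size s).+1 * ((g (Edge s) + g (Vertex s)) + (g (Edge (i :: s)) + g (Vertex (i :: s))));
  est_root : m [::] ^+ 2 <= C * ((x (Edge [::]) + x (Vertex [::])) + (g (Edge [::]) + g (Vertex [::])));
  est_up : forall s, x (Edge s) + x (Vertex s) <=
    C * (len T (size s) * scale s ^+ d * m s ^+ 2 + len T (size s) ^+ 2 * (g (Edge s) + g (Vertex s)));
  est_lo : forall s, len T (size s) * scale s ^+ d * m s ^+ 2 <=
    C * (x (Edge s) + x (Vertex s) + len T (size s) ^+ 2 * (g (Edge s) + g (Vertex s))) }.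

(* [m s] is a mean over the vertex [s]; [h] and [l] are the height of the collars
   and the length of the edge. *)
Lemma raw_estimates : exists (c a b CP CE : R), [/\ 0 < c, 0 < a, 0 <= b, 0 < CP & 0 < CE] /\
  forall n (F : point -> 'rV[R]_n) (b0 : 'I_n) (x g : piece k -> R), C1_tree T F ->
  (forall e, sqnorm F b0 e = (x e)%:E) -> (forall e, energy F b0 e = (g e)%:E) ->
  exists m : word -> R,
  [/\ forall s, x (Vertex s) <= 2 * (CP * scale s ^+ 2 * g (Vertex s)) + 2 * m s ^+ 2 * (b * scale s ^+ (d + 1)),
      forall s, m s ^+ 2 * (a * scale s ^+ (d + 1)) <= 2 * x (Vertex s) + 2 * (CP * scale s ^+ 2 * g (Vertex s)),
      forall s, let h := c * scale s in let l := edge_len T s in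
        x (Edge s) <= CE * (2 * (2 * l / h + 1) * x (Vertex s) + 2 * (l + h) ^+ 2 * (g (Edge s) + g (Vertex s))
          + scale s ^+ 2 * g (Edge s)),
      forall s, let h := c * scale s in let l := edge_len T s in
        (l / h) * (m s ^+ 2 * ((2 * h) ^+ d * h)) <= 2 * (2 * x (Edge s) + x (Vertex s) +
          2 * l ^+ 2 * (g (Edge s) + g (Vertex s))) + 2 * (l / h) * (CP * scale s ^+ 2 * g (Vertex s)) &
      forall i s, let h := c * scale (i :: s) in let l := edge_len T (i :: s) in
        (m s - m (i :: s)) ^+ 2 * ((2 * h) ^+ d * h) <= 2 * (CP * scale s ^+ 2 * g (Vertex s)) +
          2 * (2 * (CP * scale (i :: s) ^+ 2 * g (Vertex (i :: s))) +
               2 * ((l + h) * h) * (g (Vertex s) + (g (Edge (i :: s)) + g (Vertex (i :: s)))))].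
Proof.
have [c [c0 collar cubec]] := collar_in_vertex T.
have [a [b [a0 b0 hV]]] := vertex_measure.
have [ob cb bb lb] := body_domain T.
have [e e0 he] := row_nbhs ob (body_center T).
have he' : cube 0 e `<=` body T by move=> y hy; apply: he => i; exact: hy.
have [CP CP0 hCP] := domain_poincare (lipschitz_segdom (body_domain T)) cb e0 he'.
have [oc cc _ _] := cross_domain T.
have cW : cube 0 c `<=` cross T.
  move=> y hy; have := cubec [::] y; rewrite /edge_cross expr0 mulr1 => /(_ hy).
  by move=> [z Cz]; rewrite scale1r => <-.
have [CE CE0 hCE] := cylinder_estimate (lipschitz_segdom (cross_domain T)) cc (@open_cube' _ _ 0 c) cW
  (ex_intro _ 0 (@cubexx _ _ 0 _ c0)).
exists c, a, b, CP, CE; split => // n F b1 x g CF xE gE.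
have hm s : exists m : R, (\int[lam]_(y in pdom T (Vertex s)) ((comp_of F b1 (Vertex s, y) - m) ^+ 2)%:E <=
    (CP * scale s ^+ 2 * g (Vertex s))%:E)%E.
  have [m hm] := hCP _ _ _ (scale_gt0 T s) (piece_ugrad b1 CF (Vertex s)).
  by exists m; apply: le_trans hm _; rewrite (EFinM (CP * scale s ^+ 2)) -gE.
have [m mP] := choice hm.
have x0 e1 : 0 <= x e1.
  by rewrite -lee_fin -xE; apply: integral_ge0 => y _; rewrite lee_fin sqr_ge0.
have g0 e1 : 0 <= g e1.
  by rewrite -lee_fin -gE; apply: integral_ge0 => y _; rewrite lee_fin grad2_ge0.
have sub0 (u : point -> R) (S : set V) e1 : (\int[lam]_(y in S) ((u (e1, y) - 0) ^+ 2)%:E =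
    \int[lam]_(y in S) (u (e1, y) ^+ 2)%:E)%E.
  by apply: eq_integral => y _; rewrite subr0.
pose h s := c * scale s; pose l s := edge_len T s.
have h_gt0 s : 0 < h s by rewrite mulr_gt0// scale_gt0.
have l_gt0 s : 0 < l s by exact: edge_len_gt0.
have mA s : measurable (cube (0 : 'rV[R]_d) (h s)) by exact: measurable_cube'.
pose u s := box_comp T F b1 s.
have XJ s : (\int[lam]_(y in slab (cube 0 (h s)) (l s) (l s + h s)) (u s y ^+ 2)%:E <= (x (Vertex s))%:E)%E.
  have := comp_child_le b1 CF collar cubec s 0; rewrite -xE /sqnorm.
  under eq_integral do rewrite subr0.
  by under [X in (_ <= X)%E -> _]eq_integral do rewrite subr0.
have GB s : (\int[lam]_(y in slab (cube 0 (h s)) 0%R (l s + h s)) (box_grad2 T F b1 s y)%:E <=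
    (g (Edge s) + g (Vertex s))%:E)%E.
  by rewrite EFinD -!gE; exact: grad_box0_le.
have muS s (a1 : R) : lam (slab (cube (0 : 'rV[R]_d) (h s)) a1 (a1 + h s)) = ((2 * h s) ^+ d * h s)%:E.
  have mI : measurable ([set` `]a1, (a1 + h s)%R[] : set (measurableTypeR R)) by exact: measurable_itv.
  rewrite (slab_measure (mA s) mI) /cube lebesgue_row_cube// lebesgue_measure_itv/= lte_fin ltrDl h_gt0 -EFinB EFinM.
  by congr (_ * _%:E)%E; ring.
have mS s (a1 a2 : R) : measurable (slab (cube (0 : 'rV[R]_d) (h s)) a1 a2).
  by apply: measurable_cylset => //; exact: measurable_itv.
exists m; split.
- move=> s; have [q [qE qa qb]] := hV s; rewrite -lee_fin -xE /sqnorm -(sub0 (comp_of F b1)).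
  have [_ mu _ _ _] := piece_ugrad b1 CF (Vertex s).
  apply: le_trans (mean_split_up (measurable_pdom T (Vertex s)) qE mu (m s) 0) _.
  rewrite [leRHS]EFinD; apply: leeD; first by rewrite (EFinM 2) lee_wpmul2l.
  by rewrite lee_fin subr0 ler_wpM2l// mulr_ge0// sqr_ge0.
- move=> s; have [q [qE qa qb]] := hV s; rewrite -lee_fin.
  have [_ mu _ _ _] := piece_ugrad b1 CF (Vertex s).
  have := mean_split_diff (measurable_pdom T (Vertex s)) qE mu 0 (m s).
  rewrite sub0 -/(sqnorm F b1 (Vertex s)) xE sub0r sqrrN => hh.
  apply: (@le_trans _ _ (m s ^+ 2 * q)%:E); first by rewrite lee_fin ler_wpM2l// sqr_ge0.
  by apply: le_trans hh _; rewrite [leRHS]EFinD !(EFinM 2); apply: leeD => //; rewrite lee_wpmul2l.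
(* Transverse translations reduce the full cross section to the inner cube, and axial ones reduce
   the edge over this cube to the collar in the vertex. *)
- move=> s; rewrite /= -/(h s) -/(l s) -lee_fin -xE.
  apply: le_trans (hCE _ _ _ _ (scale_gt0 T s) (piece_ugrad b1 CF (Edge s))) _.
  rewrite (EFinM CE); apply: lee_wpmul2l; first by rewrite lee_fin ltW.
  rewrite [in leRHS]EFinD (EFinM (scale s ^+ 2)) -gE; apply: leeD => //.
  have -> : dilate (scale s) (cube (0 : 'rV[R]_d) c) = cube 0 (h s) by rewrite dilate_cube ?scale_gt0// scaler0 mulrC.
  have := edge_comp_core T F b1 c s; rewrite /= => ->.
  apply: le_trans (edge_le_collar (l_gt0 s) (h_gt0 s) (mA s) (box_ugrad0 b1 CF collar cubec s)) _.
  apply: EFinD_le; apply: EFinM_le; [|exact: XJ| |exact: GB].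
    have lh : 0 <= l s / h s by rewrite divr_ge0// ltW.
    by move: lh; rewrite -mulrA; move: (l s / h s) => lh lh0; lra.
  by rewrite mulr_ge0// sqr_ge0.
(* The mean is compared with the function on the collar inside the vertex, and the collar with the
   edge, which is longer by the factor [l / h]. *)
- move=> s; rewrite /= -/(h s) -/(l s).
  set XJs := (\int[lam]_(y in slab (cube 0 (h s)) (l s) (l s + h s)) (u s y ^+ 2)%:E)%E.
  have XJ0 : (0 <= XJs)%E by apply: integral_ge0 => y _; rewrite lee_fin sqr_ge0.
  have XJfin : XJs \is a fin_num by rewrite ge0_fin_numE//; apply: le_lt_trans (XJ s) _; rewrite ltry.
  have XJE : XJs = (fine XJs)%:E by rewrite fineK.
  have ug := box_ugrad0 b1 CF collar cubec s.
  have [mug mu _ _ _] := ug.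
  have muJ : measurable_fun (slab (cube 0 (h s)) (l s) (l s + h s)) (u s).
    apply: (measurable_funS mug _ mu); move=> y [Ay /=]; rewrite !in_itv/= => /andP[y1 y2]; split => //=.
    by rewrite in_itv/= y2 andbT (lt_trans (l_gt0 s)).
  have := mean_split_diff (mS _ _ _) (muS s (l s)) muJ 0 (m s).
  rewrite sub0r sqrrN (_ : (\int[lam]_(y in slab _ _ _) ((u s y - 0) ^+ 2)%:E)%E = XJs); last first.
    by apply: eq_integral => y _; rewrite subr0.
  have hP := le_trans (comp_child_le b1 CF collar cubec s (m s)) (mP s).
  rewrite XJE => h1.
  have {}h1 : m s ^+ 2 * ((2 * h s) ^+ d * h s) <= 2 * fine XJs + 2 * (CP * scale s ^+ 2 * g (Vertex s)).
    rewrite -lee_fin; apply: le_trans h1 _; rewrite [leRHS]EFinD !(EFinM 2); apply: leeD => //.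
    exact: lee_wpmul2l.
  have h2 : (l s / h s) * fine XJs <= 2 * x (Edge s) + x (Vertex s) + 2 * l s ^+ 2 * (g (Edge s) + g (Vertex s)).
    rewrite -lee_fin (EFinM (l s / h s)) -XJE.
    apply: le_trans (collar_le_edge (l_gt0 s) (h_gt0 s) (mA s) ug) _.
    apply: EFinD_le.
      apply: EFinD_le; last exact: XJ.
      apply: EFinM_le => //; rewrite -xE /sqnorm -(sub0 (comp_of F b1)).
      apply: le_trans (comp_edge_le F b1 cubec s 0); rewrite le_eqVlt; apply/orP; left; apply/eqP.
      by apply: eq_integral => y _; rewrite subr0.
    apply: EFinM_le; last exact: GB.
    by rewrite mulr_ge0// sqr_ge0.
  have lh0 : 0 <= l s / h s by rewrite divr_ge0// ltW.
  apply: le_trans (ler_wpM2l lh0 h1) _.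
  rewrite mulrDr mulrCA; apply: lerD; first by rewrite ler_wpM2l.
  by rewrite mulrCA mulrA.
(* On the collar before the edge the function is close to [m s]; translated to the collar behind the
   edge it is close to [m t]. *)
- move=> i s; rewrite /= -/(h (i :: s)) -/(l (i :: s)); set t := i :: s.
  have ug := box_ugrad b1 CF c0 collar cubec i s.
  have [mug mu _ _ _] := ug.
  have muI : measurable_fun (slab (cube 0 (h t)) (- h t) 0%R) (u t).
    apply: (measurable_funS mug _ mu); move=> y [Ay /=]; rewrite !in_itv/= => /andP[y1 y2]; split => //.
    have lh : 0 < l t + h t by rewrite addr_gt0.
    have yI : axial y < l t + h t by exact: lt_trans lh.
    by rewrite /mkset in_itv; apply/andP; split; [exact: y1|exact: yI].
  have muE := muS t (- h t); rewrite addNr in muE.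
  rewrite -lee_fin; apply: le_trans (mean_split_diff (mS _ _ _) muE muI (m s) (m t)) _.
  apply: EFinD_le; apply: EFinM_le => //.
    exact: le_trans (comp_parent_le b1 CF c0 collar cubec i s (m s)) (mP s).
  apply: le_trans (collar_to_collar (l_gt0 t) (h_gt0 t) (mA t) (ugradB (m t) ug)) _.
  apply: EFinD_le.
    apply: EFinM_le => //.
    exact: le_trans (comp_child_le b1 CF collar cubec t (m t)) (mP t).
  have lt0 := ltW (l_gt0 t); have ht0 := ltW (h_gt0 t).
  have lh0 : 0 <= 2 * ((l t + h t) * h t) by apply: mulr_ge0 => //; apply: mulr_ge0 => //; exact: addr_ge0.
  apply: (EFinM_le lh0).
  rewrite !EFinD -!gE; exact: grad_box_le.
Qed.

(** * Elimination of the scales in favour of the lengths *)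

Section algebra.
Variables (c kp CP CE : R).
Hypotheses (c0 : 0 < c) (kp0 : 0 < kp) (CP0 : 0 < CP) (CE0 : 0 < CE).
Variables (q L l : R).
Hypotheses (q0 : 0 < q) (l0 : 0 < l) (qL : q <= kp * L) (lL : l <= L).

Let L0 : 0 < L. Proof. exact: lt_le_trans lL. Qed.
Let c_ : 0 <= c. Proof. exact: ltW. Qed.
Let kp_ : 0 <= kp. Proof. exact: ltW. Qed.
Let CP_ : 0 <= CP. Proof. exact: ltW. Qed.
Let q_ : 0 <= q. Proof. exact: ltW. Qed.
Let L_ : 0 <= L. Proof. exact: ltW. Qed.

Let qg g : 0 <= g -> q ^+ 2 * g <= kp ^+ 2 * (L ^+ 2 * g).
Proof.
move=> g0; rewrite mulrA -exprMn ler_wpM2r// ler_sqr ?nnegrE//; exact: mulr_ge0.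
Qed.

(** [q] is the scale, [l] and [L] are the lengths of the edge without and with the skeletons, [D] is
    the ratio, [Q] stands for [q ^+ d] and [M] for a squared difference of means. By [q <= kp * L]
    every term on the right is at most a multiple of [L * q], and one factor [q] cancels. *)
Lemma step_algebra D c4 Q M gV gE gV' : 0 < D -> 0 < c4 -> 0 <= gV -> 0 <= gE -> 0 <= gV' ->
  M * (c4 * Q * q) <= 2 * (CP * (q / D) ^+ 2 * gV) +
    2 * (2 * (CP * q ^+ 2 * gV') + 2 * ((l + c * q) * (c * q)) * (gV + (gE + gV'))) ->
  Q * M <= ((2 * CP * kp / D ^+ 2 + 4 * CP * kp + 4 * (1 + c * kp) * c) / c4) * L * (gV + (gE + gV')).
Proof.
move=> D0 c40 gV0 gE0 gV'0 h.
set G := gV + (gE + gV') in h *.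
have GV : gV <= G by rewrite /G; lra.
have GV' : gV' <= G by rewrite /G; lra.
have G0 : 0 <= G by exact: le_trans GV.
have qq : q ^+ 2 <= kp * L * q by rewrite expr2 ler_wpM2r// ltW.
have h1 : CP * (q / D) ^+ 2 * gV <= CP / D ^+ 2 * (kp * L * q) * G.
  have CD : 0 <= CP / D ^+ 2 by rewrite divr_ge0 ?sqr_ge0// ltW.
  rewrite (_ : CP * (q / D) ^+ 2 * gV = CP / D ^+ 2 * q ^+ 2 * gV); last by field; rewrite gt_eqF.
  apply: ler_pM => //; first by rewrite mulr_ge0 ?sqr_ge0.
  exact: ler_wpM2l.
have h2 : CP * q ^+ 2 * gV' <= CP * (kp * L * q) * G.
  apply: ler_pM => //; first by rewrite mulr_ge0 ?sqr_ge0// ltW.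
  by rewrite ler_wpM2l// ltW.
have h3 : (l + c * q) * (c * q) * G <= ((1 + c * kp) * c) * L * q * G.
  rewrite ler_wpM2r// (_ : (1 + c * kp) * c * L * q = ((1 + c * kp) * L) * (c * q)); last by ring.
  rewrite ler_wpM2r ?mulr_ge0 ?(ltW c0) ?(ltW q0)//.
  have := lL; have := ler_wpM2l (ltW c0) qL; lra.
have qc : 0 < c4 * q by rewrite mulr_gt0.
rewrite -(ler_pM2l qc); apply: le_trans (_ : M * (c4 * Q * q) <= _); first by rewrite le_eqVlt; apply/orP; left; apply/eqP; ring.
apply: le_trans h _.
rewrite (_ : c4 * q * _ = 2 * (CP / D ^+ 2 * (kp * L * q) * G) + 2 * (2 * (CP * (kp * L * q) * G) + 2 * (((1 + c * kp) * c) * L * q * G))).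
  lra.
by field; rewrite !gt_eqF.
Qed.

(** The number of slices, of order [l / q], times the volume of the vertex, of order [Q * q], gives
    the volume [L * Q] of the edge: the singular factor [1 / q] disappears. *)
Lemma up_algebra b Q M xE xV gE gV : 0 <= b -> 0 <= Q * M -> 0 <= gE -> 0 <= gV ->
  xV <= 2 * (CP * q ^+ 2 * gV) + 2 * M * (b * (Q * q)) ->
  xE <= CE * (2 * (2 * l / (c * q) + 1) * xV + 2 * (l + c * q) ^+ 2 * (gE + gV) + q ^+ 2 * gE) ->
  xE + xV <= (2 * CP * kp ^+ 2 + 2 * b * kp +
      CE * (2 * (2 / c + kp) * (2 * CP * kp + 2 * b) + 2 * (1 + c * kp) ^+ 2 + kp ^+ 2)) *
    (L * Q * M + L ^+ 2 * (gE + gV)).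
Proof.
move=> b0 M0 gE0 gV0 hV hE.
set P := L * Q * M; set G := L ^+ 2 * (gE + gV).
have P0 : 0 <= P by rewrite /P -mulrA mulr_ge0// ltW.
have G0 : 0 <= G by rewrite /G mulr_ge0 ?sqr_ge0 ?addr_ge0.
have gVG : L ^+ 2 * gV <= G by rewrite /G ler_wpM2l ?sqr_ge0// lerDr.
have gEG : L ^+ 2 * gE <= G by rewrite /G ler_wpM2l ?sqr_ge0// lerDl.
have QqM : Q * M * q <= kp * P.
  by rewrite (_ : kp * P = Q * M * (kp * L)); [rewrite ler_wpM2l|rewrite /P; ring].
have qV : CP * q ^+ 2 * gV <= CP * (kp ^+ 2 * G).
  rewrite -mulrA ler_wpM2l ?(ltW CP0)//; apply: le_trans (qg gV0) _.
  by rewrite ler_wpM2l ?sqr_ge0.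
have bq : b * (Q * M * q) <= b * (kp * P) by rewrite ler_wpM2l.
have h1 : xV <= 2 * CP * kp ^+ 2 * G + 2 * b * kp * P by lra.
have h2 : (2 * l / (c * q) + 1) * xV <= (2 / c + kp) * (2 * CP * kp * G + 2 * b * P).
  have e0 : 0 <= 2 * l / (c * q) + 1 by rewrite addr_ge0// divr_ge0// ?mulr_ge0// ltW.
  apply: le_trans (ler_wpM2l e0 hV) _.
  have -> : (2 * l / (c * q) + 1) * (2 * (CP * q ^+ 2 * gV) + 2 * M * (b * (Q * q))) =
     (2 / c * l + q) * (2 * CP * (q * gV) + 2 * b * (Q * M)) by field; rewrite !gt_eqF.
  have f1 : 2 / c * l + q <= (2 / c + kp) * L.
    have ci : 0 <= 2 / c by rewrite divr_ge0// ltW.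
    by have := qL; have := ler_wpM2l ci lL; lra.
  have f0 : 0 <= 2 * CP * (q * gV) + 2 * b * (Q * M).
    by pos.
  apply: le_trans (ler_wpM2r f0 f1) _; rewrite -[leLHS]mulrA; apply: ler_wpM2l; first by pos.
  have f2 : L * (q * gV) <= kp * G.
    apply: (@le_trans _ _ (kp * (L ^+ 2 * gV))); last by rewrite ler_wpM2l// ltW.
    rewrite (_ : kp * (L ^+ 2 * gV) = L * (kp * L * gV)); last by ring.
    by rewrite ler_wpM2l ?(ltW L0)// ler_wpM2r.
  have := ler_wpM2l (ltW CP0) f2; rewrite /P; lra.
have h3 : (l + c * q) ^+ 2 * (gE + gV) <= (1 + c * kp) ^+ 2 * G.
  rewrite /G mulrA -exprMn ler_wpM2r ?addr_ge0// ler_sqr ?nnegrE.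
  - by have := lL; have := ler_wpM2l (ltW c0) qL; lra.
  - by rewrite addr_ge0 ?mulr_ge0// ltW.
  - by rewrite mulr_ge0 ?addr_ge0 ?mulr_ge0// ltW.
have h4 : q ^+ 2 * gE <= kp ^+ 2 * G.
  by apply: le_trans (qg gE0) _; rewrite ler_wpM2l ?sqr_ge0.
have h5 : xE <= CE * (2 * ((2 / c + kp) * (2 * CP * kp * G + 2 * b * P)) + 2 * ((1 + c * kp) ^+ 2 * G) + kp ^+ 2 * G).
  apply: le_trans hE _; rewrite ler_wpM2l ?(ltW CE0)//; lra.
pose A1 := 2 * b * kp + CE * (2 * (2 / c + kp) * (2 * b)).
pose A2 := 2 * CP * kp ^+ 2 + CE * (2 * (2 / c + kp) * (2 * CP * kp) + 2 * (1 + c * kp) ^+ 2 + kp ^+ 2).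
have ck : 0 <= 2 / c + kp by rewrite addr_ge0 ?divr_ge0// ltW.
have A10 : 0 <= A1.
  by rewrite /A1 addr_ge0// !mulr_ge0// ltW.
have A20 : 0 <= A2.
  by have e0 := ltW CE0; rewrite /A2; pos.
apply: (@le_trans _ _ (A1 * P + A2 * G)); first by rewrite /A1 /A2; lra.
rewrite (_ : (_ * (P + G)) = (A1 * P + A2 * G) + (A2 * P + A1 * G)); last by rewrite /A1 /A2; ring.
by rewrite lerDl addr_ge0// mulr_ge0.
Qed.

Lemma lo_algebra a c2 c4 Q M xE xV gE gV : 0 < a -> 0 < c2 -> 0 < c4 -> 0 <= Q * M -> 0 <= gE -> 0 <= gV ->
  0 <= xE -> 0 <= xV -> L <= l + c2 * q ->
  M * (a * (Q * q)) <= 2 * xV + 2 * (CP * q ^+ 2 * gV) ->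
  (l / (c * q)) * (M * (c4 * Q * q)) <=
    2 * (2 * xE + xV + 2 * l ^+ 2 * (gE + gV)) + 2 * (l / (c * q)) * (CP * q ^+ 2 * gV) ->
  L * Q * M <= (c / c4 * (8 + 2 / c * CP * kp) + c2 / a * (2 + 2 * CP * kp ^+ 2)) *
    (xE + xV + L ^+ 2 * (gE + gV)).
Proof.
move=> a0 c20 c40 QM0 gE0 gV0 xE0 xV0 hL h1 h2.
set G := L ^+ 2 * (gE + gV).
have G0 : 0 <= G by rewrite /G mulr_ge0 ?sqr_ge0 ?addr_ge0.
have gVG : L ^+ 2 * gV <= G by rewrite /G ler_wpM2l ?sqr_ge0// lerDr.
have qV : CP * q ^+ 2 * gV <= CP * (kp ^+ 2 * G).
  rewrite -mulrA ler_wpM2l ?(ltW CP0)//; apply: le_trans (qg gV0) _.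
  by rewrite ler_wpM2l ?sqr_ge0.
have lG : l ^+ 2 * (gE + gV) <= G.
  rewrite /G ler_wpM2r ?addr_ge0// ler_sqr ?nnegrE//; exact: ltW.
have lq : l * q * gV <= kp * G.
  apply: (@le_trans _ _ (kp * (L ^+ 2 * gV))); last by rewrite ler_wpM2l// ltW.
  rewrite (_ : kp * (L ^+ 2 * gV) = L * (kp * L) * gV); last by ring.
  by rewrite ler_wpM2r//; apply: ler_pM => //; exact: ltW.
have clq := ler_wpM2l (ltW CP0) lq.
have {}h1 : q * (Q * M) <= a^-1 * (2 * xV + 2 * (CP * (kp ^+ 2 * G))).
  rewrite ler_pdivlMl//; lra.
have {}h2 : l * (Q * M) <= c / c4 * (2 * (2 * xE + xV + 2 * G) + 2 / c * (CP * (kp * G))).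
  have cc : 0 < c4 / c by rewrite divr_gt0.
  rewrite -(ler_pM2l cc).
  rewrite (_ : c4 / c * (l * (Q * M)) = (l / (c * q)) * (M * (c4 * Q * q))); last by field; rewrite !gt_eqF.
  apply: le_trans h2 _.
  rewrite (_ : 2 * (l / (c * q)) * (CP * q ^+ 2 * gV) = 2 / c * (CP * (l * q * gV))); last by field; rewrite !gt_eqF.
  have ci : 0 <= 2 / c by rewrite divr_ge0// ltW.
  have := ler_wpM2l ci clq.
  rewrite (_ : c4 / c * (c / c4 * _) = (2 * (2 * xE + xV + 2 * G) + 2 / c * (CP * (kp * G)))); first lra.
  by field; rewrite !gt_eqF.
have h3 : L * (Q * M) <= l * (Q * M) + c2 * (q * (Q * M)).
  by rewrite (mulrA c2) -mulrDl ler_wpM2r.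
have h4 := ler_wpM2l (ltW c20) h1.
rewrite -mulrA; apply: le_trans h3 _.
apply: le_trans (lerD h2 h4) _; rewrite [leRHS]mulrDl; apply: lerD.
  have c4_ := ltW c40.
  rewrite -[leRHS]mulrA; apply: ler_wpM2l; first by pos.
  have z0 : 0 <= 2 / c * CP * kp * (xE + xV) by pos.
  lra.
have a_ := ltW a0; have c2_ := ltW c20.
rewrite -[leRHS]mulrA [leLHS]mulrA; apply: ler_wpM2l; first by pos.
have z0 : 0 <= CP * kp ^+ 2 by rewrite mulr_ge0 ?sqr_ge0// ltW.
have : 0 <= CP * kp ^+ 2 * (xE + xV) by rewrite mulr_ge0// addr_ge0.
lra.
Qed.

End algebra.

Lemma tree_estimates : exists2 C : R, 0 <= C &
  forall n (F : point -> 'rV[R]_n) (b0 : 'I_n) (x g : piece k -> R), C1_tree T F ->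
  (forall e, sqnorm F b0 e = (x e)%:E) -> (forall e, energy F b0 e = (g e)%:E) ->
  exists m, estimates C m x g.
Proof.
have [c [a [b [CP [CE [[c0 a0 b0 CP0 CE0] raw]]]]]] := raw_estimates.
have [c3 c30 hc3] := scale_le_len; have [c2 c20 hc2] := len_le_edge.
pose kp : R := c3^-1.
have kp0 : 0 < kp by rewrite invr_gt0.
have qL s : scale s <= kp * len T (size s) by rewrite /kp ler_pdivlMl.
pose c4 : R := (2 * c) ^+ d * c.
have c40 : 0 < c4 by rewrite mulr_gt0// exprn_gt0// mulr_gt0.
have r0 := ratio_gt0 T.
have hE s : (2 * (c * scale s)) ^+ d * (c * scale s) = c4 * scale s ^+ d * scale s.
  by rewrite /c4 (mulrA 2 c) exprMn; move: (scale s ^+ d) (scale s) => y z; ring.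
have QE s : scale s ^+ (d + 1) = scale s ^+ d * scale s by rewrite addn1 exprSr.
pose C1 := (2 * CP * kp / Defs.ratio T ^+ 2 + 4 * CP * kp + 4 * (1 + c * kp) * c) / c4.
pose C2 := (2 + 2 * CP) / a.
pose C3 := 2 * CP * kp ^+ 2 + 2 * b * kp +
      CE * (2 * (2 / c + kp) * (2 * CP * kp + 2 * b) + 2 * (1 + c * kp) ^+ 2 + kp ^+ 2).
pose C4 := c / c4 * (8 + 2 / c * CP * kp) + c2 / a * (2 + 2 * CP * kp ^+ 2).
have [c_ a_ CP_ CE_] := And4 (ltW c0) (ltW a0) (ltW CP0) (ltW CE0).
have [kp_ c2_ c4_ r_] := And4 (ltW kp0) (ltW c20) (ltW c40) (ltW r0).
have C10 : 0 <= C1 by rewrite /C1; pos.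
have C20 : 0 <= C2 by rewrite /C2; pos.
have C30 : 0 <= C3 by rewrite /C3; pos.
have C40 : 0 <= C4 by rewrite /C4; pos.
exists (C1 + C2 + C3 + C4); first by pos.
move=> n F b1 x g CF xE gE; have [m [r1 r2 r3 r4 r5]] := raw n F b1 x g CF xE gE.
exists m.
have x0 e1 : 0 <= x e1.
  by rewrite -lee_fin -xE; apply: integral_ge0 => y _; rewrite lee_fin sqr_ge0.
have g0 e1 : 0 <= g e1.
  by rewrite -lee_fin -gE; apply: integral_ge0 => y _; rewrite lee_fin grad2_ge0.
have QM s : 0 <= scale s ^+ d * m s ^+ 2 by rewrite mulr_ge0 ?sqr_ge0// exprn_ge0// ltW// scale_gt0.
have mono (A B : R) : 0 <= B -> forall C', 0 <= C' -> C' <= C1 + C2 + C3 + C4 -> A <= C' * B -> A <= (C1 + C2 + C3 + C4) * B.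
  by move=> B0 C' C'0 CC h; apply: le_trans h _; rewrite ler_wpM2r.
split.
- move=> i s; have := r5 i s; rewrite /= -/(size (i :: s)) hE => h.
  rewrite -mulrA; apply: (mono _ _ _ C1) => //; [|lra|].
    by rewrite mulr_ge0 ?addr_ge0// ltW// len_gt0.
  have qE : scale s = scale (i :: s) / Defs.ratio T by rewrite /= exprS mulrC mulKf// gt_eqF.
  have := step_algebra c0 CP0 (scale_gt0 T (i :: s)) (qL (i :: s)) (edge_len_le (i :: s))
    r0 c40 (g0 (Vertex s)) (g0 (Edge (i :: s))) (g0 (Vertex (i :: s))) (M := (m s - m (i :: s)) ^+ 2).
  rewrite -qE => /(_ _ h) /le_trans; apply; rewrite -mulrA ler_wpM2l// ler_wpM2l ?(ltW (len_gt0 _ _))//.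
  by have := g0 (Edge s); lra.
- apply: (mono _ _ _ C2) => //; [by rewrite !addr_ge0|lra|].
  have := r2 [::]; rewrite /= !expr1n !mulr1 => h.
  rewrite /C2 mulrAC ler_pdivlMr//; apply: le_trans h _.
  have := x0 (Edge [::]); have := x0 (Vertex [::]); have := g0 (Edge [::]); have := g0 (Vertex [::]).
  move=> p1 p2 p3 p4; have := mulr_ge0 (ltW CP0) p2; have := mulr_ge0 (ltW CP0) p3; have := mulr_ge0 (ltW CP0) p4; lra.
- move=> s; apply: (mono _ _ _ C3) => //; [|lra|].
    have l0 := ltW (len_gt0 T (size s)).
    by rewrite -mulrA; apply: addr_ge0; apply: mulr_ge0; rewrite ?sqr_ge0// addr_ge0.
  apply: (up_algebra c0 kp0 CP0 CE0 (scale_gt0 T s) (edge_len_gt0 T s) (qL s) (edge_len_le s)) => //.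
  by rewrite -QE.
- move=> s; apply: (mono _ _ _ C4) => //; [|lra|].
    by rewrite !addr_ge0// mulr_ge0 ?sqr_ge0 ?addr_ge0.
  apply: (lo_algebra c0 kp0 CP0 (scale_gt0 T s) (edge_len_gt0 T s) (qL s) (edge_len_le s) (c2 := c2)) => //.
    by rewrite -QE.
  by rewrite -hE; exact: r4.
Qed.

End estimates.

(** * Decay over the generations *)

Section words.
Context {R : realType} (k : nat).
Implicit Types f g : seq 'I_k -> R.

Definition word_sum j f : R := \sum_(t : j.-tuple 'I_k) f t.

Lemma word_sum0 f : word_sum 0 f = f [::].
Proof.
rewrite /word_sum (bigD1 [tuple])//= big1 ?addr0// => t /negP; case.
by apply/eqP; rewrite tuple0.
Qed.

Lemma word_sumS j f : word_sum j.+1 f = \sum_(i < k) word_sum j (fun s => f (i :: s)).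
Proof.
rewrite /word_sum pair_bigA /=.
rewrite (reindex (fun p : 'I_k * j.-tuple 'I_k => [tuple of p.1 :: p.2]))//=.
exists (fun t => (thead t, [tuple of behead t])) => [[i t] _|t _] /=.
  by rewrite theadE; congr pair; exact/val_inj.
by rewrite [RHS]tuple_eta; exact/val_inj.
Qed.

Lemma word_sum_ge0 j f : (forall s, 0 <= f s) -> 0 <= word_sum j f.
Proof. by move=> f0; apply: sumr_ge0. Qed.

Lemma word_sum_le j f g : (forall s, size s = j -> f s <= g s) -> word_sum j f <= word_sum j g.
Proof. by move=> fg; apply: ler_sum => t _; apply: fg; rewrite size_tuple. Qed.

Lemma eq_word_sum j f g : (forall s, size s = j -> f s = g s) -> word_sum j f = word_sum j g.
Proof. by move=> fg; apply: eq_bigr => t _; apply: fg; rewrite size_tuple. Qed.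

Lemma word_sumD j f g : word_sum j (fun s => f s + g s) = word_sum j f + word_sum j g.
Proof. by rewrite /word_sum big_split. Qed.

Lemma word_sumZ j (a : R) f : word_sum j (fun s => a * f s) = a * word_sum j f.
Proof. by rewrite /word_sum mulr_sumr. Qed.

End words.

Section tree_tail.
Context {R : realType} {d k : nat} (T : inflated_tree R d k).
Local Notation point := (piece k * 'rV[R]_(d + 1))%type.
Local Notation scale s := (Defs.ratio T ^+ size s).
Hypothesis hT : (tree_radius T < +oo)%E.

(** Along one fixed branch these sums are distances from the root, hence bounded by the radius. *)
Lemma len_sum_bounded : exists Lam : R, forall n, \sum_(i < n) len T i <= Lam.
Proof.
have i0 : 'I_k by exists 0%N; exact: branching_gt0 T.
have h n : ((\sum_(i < n) len T i)%:E <= tree_radius T)%E.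
  apply: ereal_sup_ubound; exists (nseq n i0), 0; rewrite size_nseq addr0 lexx ltW//.
  exact: len_gt0.
have fin : tree_radius T \is a fin_num.
  rewrite ge0_fin_numE//; apply: le_trans (h 0%N); by rewrite big_ord0.
by exists (fine (tree_radius T)) => n; rewrite -lee_fin fineK.
Qed.

(** The difference of the two sides is [L^-1 * (L * (a - e) - e) ^+ 2]. The weight is taken to be
    the length because [est_step] supplies a factor [L] for the error [e ^+ 2]. *)
Lemma sqr_le_split (L a e : R) : 0 < L -> a ^+ 2 <= (1 + L) * (a - e) ^+ 2 + (1 + L^-1) * e ^+ 2.
Proof.
move=> L0; rewrite -subr_ge0.
rewrite (_ : _ - _ = L^-1 * (L * (a - e) - e) ^+ 2); last by field; rewrite gt_eqF.
by rewrite mulr_ge0 ?sqr_ge0// invr_ge0 ltW.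
Qed.

Definition generation_sum j (x : piece k -> R) : R :=
  word_sum j (fun s => x (Edge s) + x (Vertex s)).

Lemma tree_tail : exists c : nat -> R, (forall j, 0 <= c j) /\
  (exists M, forall n, \sum_(i < n) c i <= M) /\
  forall n (F : point -> 'rV[R]_n) (b0 : 'I_n) (x g : piece k -> R) (B : R), C1_tree T F ->
  (forall e, sqnorm T F b0 e = (x e)%:E) -> (forall e, energy T F b0 e = (g e)%:E) ->
  (forall N, \sum_(j < N) generation_sum j x <= B) ->
  (forall N, \sum_(j < N) generation_sum j g <= B) ->
  forall j, generation_sum j x <= c j * B.
Proof.
have [Lam hLam] := len_sum_bounded; have [C C0 hC] := tree_estimates T.
have k1 : 1 <= k%:R :> R by rewrite ler1n (branching_gt0 T).
have r0 := ratio_gt0 T.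
pose rho : R := k%:R * Defs.ratio T ^+ d.
have rho0 : 0 < rho by rewrite mulr_gt0 ?exprn_gt0// (lt_le_trans _ k1).
have Lam0 : 0 <= Lam by have := hLam 0%N; rewrite big_ord0.
have LLam j : len T j <= Lam.
  apply: le_trans (hLam j.+1); rewrite big_ord_recr lerDr; apply: sumr_ge0 => i _; exact/ltW/len_gt0.
(* [C'] absorbs the product of [1 + L^-1] and [L], at most [1 + Lam], and the [k] edges that share
   the energy of the preceding vertex. *)
pose C' := (1 + Lam) * C * k%:R.
have CC' : C <= C'.
  by rewrite /C' -mulrA mulrCA -[leLHS]mulr1 ler_wpM2l// mulr_ege1// lerDl.
have C'0 : 0 <= C' by exact: le_trans CC'.
have [c [c0 [cM hc]]] := tail_sequences (len_gt0 T) hLam rho0 C'0.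
exists c; split => //; split => // n F b0 x g B CF xE gE sx sg.
have [m [est1 est2 est3 est4]] := hC n F b0 x g CF xE gE.
have x0 e1 : 0 <= x e1.
  by rewrite -lee_fin -xE; apply: integral_ge0 => y _; rewrite lee_fin sqr_ge0.
have g0 e1 : 0 <= g e1.
  by rewrite -lee_fin -gE; apply: integral_ge0 => y _; rewrite lee_fin grad2_ge0.
have sc (s : seq 'I_k) : 0 <= scale s ^+ d by do 2!apply: exprn_ge0; exact: ltW.
pose Y j := word_sum j (fun s => scale s ^+ d * m s ^+ 2).
pose e i s := scale (i :: s) ^+ d * (m s - m (i :: s)) ^+ 2.
have Y0 j : 0 <= Y j by apply: word_sum_ge0 => s; rewrite mulr_ge0// sqr_ge0.
have D0 j : 0 <= generation_sum j g by apply: word_sum_ge0 => s; exact: addr_ge0.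
have X0 j : 0 <= generation_sum j x by apply: word_sum_ge0 => s; exact: addr_ge0.
(* Each vertex has [k] successors, with weights smaller by [ratio ^+ d]: this is the origin of
   [rho]. *)
have rhoY j : rho * Y j = \sum_(i < k) word_sum j (fun s => scale (i :: s) ^+ d * m s ^+ 2).
  rewrite (eq_bigr (fun i => Defs.ratio T ^+ d * Y j)).
    by rewrite sumr_const card_ord -mulr_natl mulrA.
  by move=> i _; rewrite -word_sumZ; apply: eq_word_sum => s _; rewrite /= exprS exprMn mulrA.
have err j : (1 + (len T j.+1)^-1) * (\sum_(i < k) word_sum j (e i)) <=
    C' * (generation_sum j g + generation_sum j.+1 g).
  have L0 := len_gt0 T j.+1.
  have h : \sum_(i < k) word_sum j (e i) <=
      C * len T j.+1 * (k%:R * generation_sum j g + generation_sum j.+1 g).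
    apply: (@le_trans _ _ (\sum_(i < k) word_sum j (fun s => C * len T j.+1 *
        ((g (Edge s) + g (Vertex s)) + (g (Edge (i :: s)) + g (Vertex (i :: s))))))).
      apply: ler_sum => i _; apply: word_sum_le => s sj.
      by have := est1 i s; rewrite sj.
    rewrite (eq_bigr (fun i => C * len T j.+1 * (generation_sum j g +
       word_sum j (fun s => g (Edge (i :: s)) + g (Vertex (i :: s)))))); last first.
      by move=> i _; rewrite word_sumZ word_sumD.
    rewrite -mulr_sumr big_split sumr_const card_ord -(mulr_natl (generation_sum j g)) /=.
    by rewrite -(word_sumS j (fun s => g (Edge s) + g (Vertex s))).
  have iL : 0 <= 1 + (len T j.+1)^-1 by rewrite addr_ge0 ?invr_ge0 ?ltW.
  apply: le_trans (ler_wpM2l iL h) _.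
  have -> : (1 + (len T j.+1)^-1) * (C * len T j.+1 * (k%:R * generation_sum j g + generation_sum j.+1 g))
     = C * (len T j.+1 + 1) * (k%:R * generation_sum j g + generation_sum j.+1 g).
    by field; rewrite gt_eqF.
  have -> : C' * (generation_sum j g + generation_sum j.+1 g) =
     C * (1 + Lam) * (k%:R * (generation_sum j g + generation_sum j.+1 g)) by rewrite /C'; ring.
  apply: ler_pM.
  - by rewrite mulr_ge0// addr_ge0// ltW.
  - by rewrite addr_ge0// mulr_ge0.
  - by rewrite ler_wpM2l// addrC lerD2l.
  - by rewrite mulrDr lerD2l ler_peMl.
apply: (hc _ Y (fun j => generation_sum j g)); split => //.
- move=> j; have L0 := len_gt0 T j.+1; rewrite -mulrA rhoY /Y word_sumS.
  apply: le_trans (lerD (lexx _) (err j)); rewrite !mulr_sumr -big_split; apply: ler_sum => i _ /=.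
  rewrite -!(@word_sumZ _ _ j) -word_sumD; apply: word_sum_le => s sj.
  have := ler_wpM2l (sc (i :: s)) (sqr_le_split (m (i :: s)) (m (i :: s) - m s) L0).
  move/le_trans; apply; rewrite /e /= le_eqVlt; apply/orP; left; apply/eqP.
  by move: (Defs.ratio T ^+ (size s).+1 ^+ d) ((len T j.+1)^-1) => z w; ring.
- move=> j; have L0 := len_gt0 T j.+1; rewrite rhoY /Y word_sumS.
  apply: le_trans (lerD (lexx _) (err j)); rewrite !mulr_sumr -big_split; apply: ler_sum => i _ /=.
  rewrite -!(@word_sumZ _ _ j) -word_sumD; apply: word_sum_le => s sj.
  have := ler_wpM2l (sc (i :: s)) (sqr_le_split (m s) (m s - m (i :: s)) L0).
  move/le_trans; apply; rewrite /e /= le_eqVlt; apply/orP; left; apply/eqP.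
  by move: (Defs.ratio T ^+ (size s).+1 ^+ d) ((len T j.+1)^-1) => z w; ring.
- rewrite /Y /generation_sum !word_sum0 expr1n mul1r; apply: le_trans est2 _.
  by rewrite ler_wpM2r// !addr_ge0.
- move=> j; have L0 := len_gt0 T j.
  apply: (@le_trans _ _ (C * (len T j * Y j + len T j ^+ 2 * generation_sum j g))); last first.
    by rewrite ler_wpM2r// addr_ge0// mulr_ge0 ?sqr_ge0// ltW.
  rewrite -!word_sumZ -word_sumD -word_sumZ; apply: word_sum_le => s sj.
  by have := est3 s; rewrite sj mulrA.
- move=> j; have L0 := len_gt0 T j.
  apply: (@le_trans _ _ (C * (generation_sum j x + len T j ^+ 2 * generation_sum j g))); last first.
    by rewrite ler_wpM2r// addr_ge0// mulr_ge0 ?sqr_ge0// ltW.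
  rewrite -!word_sumZ -word_sumD -word_sumZ; apply: word_sum_le => s sj.
  by have := est4 s; rewrite sj mulrA.
Qed.

End tree_tail.

(** * Compactness on the tree *)

Section volume.
Context {R : realType} {d k : nat} (T : inflated_tree R d k).
Local Notation V := 'rV[R]_(d + 1).
Local Notation lam := (lebesgue_row (d + 1)).
Local Notation point := (piece k * V)%type.
Implicit Types c : piece k.

(** The same set function as [volume], with its structure of a measure. *)
Definition vol : {measure set point -> \bar R} := (@counting (piece k) R \x lebesgue_row (d + 1))%E.

Definition slice c (D : set V) : set point := [set p | p.1 = c /\ D p.2].

Lemma measurable_slice c D : measurable D -> measurable (slice c D).
Proof.
move=> mD; rewrite (_ : slice c D = [set c] `*` D); last by apply/seteqP; split => -[].
by apply: measurableX.
Qed.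

Lemma measurable_pair_piece c : measurable_fun setT (fun y : V => (c, y) : point).
Proof. by apply: measurable_fun_pair. Qed.

Lemma vol_slice c (A : set point) : measurable A -> A `<=` slice c setT ->
  vol A = lam [set y | A (c, y)].
Proof.
move=> mA Ac; rewrite /vol /= /product_measure1.
have xE x : (lam \o xsection A) x = (if x == c then lam [set y | A (c, y)] else 0)%E.
  rewrite /=; case: eqP => [->|xc].
    by congr (lam _); apply/seteqP; split => y; rewrite xsectionE.
  rewrite (_ : xsection A x = set0) ?measure0//; apply/seteqP; split => y //.
  by rewrite xsectionE => /Ac[].
under eq_integral do rewrite xE.
have m0 : measurable_fun setT (fun x : piece k => if x == c then lam [set y | A (c, y)] else 0%E) by [].
rewrite (_ : [set: piece k] = [set c] `|` ~` [set c]); last by rewrite setUv.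
rewrite ge0_integral_setU//; last 2 first.
- by move=> x _; case: eqP.
- by rewrite disj_set2E setICr.
rewrite (eq_integral (cst (lam [set y | A (c, y)]))) ?integral_cst//; last first.
  by move=> x /set_mem ->; rewrite eqxx.
rewrite [X in (_ + X)%E](eq_integral (cst 0%E)) ?integral0 ?adde0; last first.
  by move=> x /set_mem/= /eqP/negbTE ->.
transitivity (lam [set y | A (c, y)] * 1)%E; last exact: mule1.
by congr (_ * _)%E; rewrite /= /counting asboolT// fset_set1 finmap.cardfs1.
Qed.

Lemma ge0_integral_slice c (D : set V) (f : point -> \bar R) : measurable D ->
  measurable_fun (slice c D) f -> (forall p, slice c D p -> 0 <= f p)%E ->
  (\int[vol]_(p in slice c D) f p = \int[lam]_(y in D) f (c, y))%E.
Proof.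
move=> mD mf f0; have ms := measurable_slice c mD.
have preE : (fun y : V => (c, y) : point) @^-1` slice c D = D.
  by apply/seteqP; split => y; rewrite /slice/=; [case|].
have := ge0_integral_pushforward (measurable_pair_piece c) lam ms mf.
rewrite preE => <-; last by move=> x; rewrite inE => /f0.
apply: eq_measure_integral; first exact: measurable_pair_piece.
move=> mp A mA' AB; apply: (vol_slice mA').
by move=> p /AB[].
Qed.

Lemma measurable_fun_slice c (D : set V) (f : point -> R) : measurable D ->
  measurable_fun D (fun y => f (c, y)) -> measurable_fun (slice c D) f.
Proof.
move=> mD mf _ B mB; have := measurable_slice c (mf mD B mB).
congr measurable; apply/seteqP; split => -[c' y]; rewrite /slice/= => -[].
  by move=> -> [].
by move=> [-> ?].
Qed.

Lemma tree_core_slices : tree_core T = \bigcup_c slice c (pdom T c).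
Proof.
apply/seteqP; split => [p /tree_coreE hp|p [c _ [pc hp]]]; first by exists p.1.
by apply/tree_coreE; rewrite pc.
Qed.

Let countable_piece : countable [set: piece k]. Proof. exact: countableP. Qed.

Lemma measurable_tree_core : measurable (tree_core T).
Proof.
rewrite tree_core_slices; apply: countable_bigcupT_measurable => // c.
exact: (measurable_slice c (measurable_pdom T c)).
Qed.

Lemma measurable_fun_tree (f : point -> R) :
  (forall c, measurable_fun (pdom T c) (fun y => f (c, y))) -> measurable_fun (tree_core T) f.
Proof.
move=> mf _ B mB; rewrite tree_core_slices setI_bigcupl.
apply: countable_bigcupT_measurable => // c.
exact: (measurable_fun_slice (measurable_pdom T c) (mf c) (measurable_slice c (measurable_pdom T c)) mB).
Qed.

(** The countably many pieces are grouped by generations, each of which is a finite disjoint union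
    of slices, so that one series over the generations remains. *)
Lemma ge0_integral_tree (f : point -> \bar R) : measurable_fun (tree_core T) f ->
  (forall p, tree_core T p -> 0 <= f p)%E ->
  (\int[vol]_(p in tree_core T) f p = \sum_(j <oo) \sum_(t : j.-tuple 'I_k)
    (\int[lam]_(y in pdom T (Edge t)) f (Edge t, y) + \int[lam]_(y in pdom T (Vertex t)) f (Vertex t, y)))%E.
Proof.
move=> mf f0.
have sub c : slice c (pdom T c) `<=` tree_core T by rewrite tree_core_slices => p hp; exists c.
have ms c := measurable_slice c (measurable_pdom T c).
pose W j (p : bool * j.-tuple 'I_k) : piece k := (p.1, tval p.2).
pose G j : set point := \big[setU/set0]_(p <- enum {: bool * j.-tuple 'I_k}) slice (W j p) (pdom T (W j p)).
have GE j p : G j p <-> tree_core T p /\ size p.1.2 = j.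
  rewrite /G -bigcup_seq; split.
    by move=> [[b t] _ hp]; split; [exact: sub hp|case: hp => -> _ /=; rewrite size_tuple].
  move=> [/tree_coreE hp pj]; have sj : size p.1.2 == j by rewrite pj.
  exists (p.1.1, Tuple sj); first by rewrite /= mem_enum.
  by rewrite /slice /W /= -surjective_pairing.
have mG j : measurable (G j) by apply: bigsetU_measurable => p _; exact: ms.
have GS j : G j `<=` tree_core T by move=> p /GE[].
have -> : tree_core T = \bigcup_j G j.
  apply/seteqP; split => [p hp|p [j _] /GE[]//]; by exists (size p.1.2) => //; apply/GE.
have UG : \bigcup_j G j = tree_core T.
  by apply/seteqP; split => [p [j _] /GE[]//|p hp]; exists (size p.1.2) => //; apply/GE.
rewrite ge0_integral_bigcup//; first last.
- by move=> i j _ _ [p [/GE[_ pi] /GE[_ pj]]]; rewrite -pi -pj.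
- by move=> p; rewrite UG => /f0.
- by rewrite UG.
apply: eq_eseriesr => j _.
rewrite /G ge0_integral_bigsetU; first last.
- by move=> p /GS/f0.
- exact: (measurable_funS measurable_tree_core (@GS j) mf).
- move=> [b t] [b' t'] _ _ [p [[p1 _] [p2 _]]]; move: p2; rewrite p1 /W /= => -[-> tt].
  by congr pair; exact/val_inj.
- exact: enum_uniq.
- by move=> p; exact: ms.
rewrite (eq_bigr (fun p => \int[lam]_(y in pdom T (W j p)) f (W j p, y)))%E; last first.
  move=> p _; rewrite ge0_integral_slice//; first exact: measurable_pdom.
    exact: (measurable_funS measurable_tree_core (@sub _) mf).
  by move=> q /sub/f0.
rewrite big_enum/= -(pair_bigA _ (fun b t => \int[lam]_(y in pdom T (W j (b, t))) f (W j (b, t), y))%E).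
rewrite big_bool [RHS]big_split; exact: addeC.
Qed.
Lemma integral_slice c (D : set V) (f : point -> R) : measurable D ->
  measurable_fun D (fun y => f (c, y)) ->
  (\int[vol]_(p in slice c D) f p = \int[lam]_(y in D) f (c, y))%R.
Proof.
move=> mD mf; have ms := measurable_slice c mD.
have mf' : measurable_fun (slice c D) (EFin \o f).
  by apply/measurable_EFinP; exact: measurable_fun_slice.
rewrite /Rintegral integralE [in RHS]integralE; congr (fine (_ - _)).
  rewrite [LHS](ge0_integral_slice mD (measurable_funepos mf')); last by move=> p _; exact: funepos_ge0.
  by apply: eq_integral => y _; rewrite !funeposE.
rewrite [LHS](ge0_integral_slice mD (measurable_funeneg mf')); last by move=> p _; exact: funeneg_ge0.
by apply: eq_integral => y _; rewrite !funenegE.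
Qed.

Lemma integral_generations (f : point -> R) (x : piece k -> R) : measurable_fun (tree_core T) f ->
  (forall p, 0 <= f p) ->
  (forall c, (\int[lam]_(y in pdom T c) (f (c, y))%:E = (x c)%:E)%E) ->
  (\int[vol]_(p in tree_core T) (f p)%:E = \sum_(j <oo) (generation_sum j x)%:E)%E.
Proof.
move=> mf f0 fx; rewrite ge0_integral_tree; last 2 first.
- exact/measurable_EFinP.
- by move=> p _; rewrite lee_fin.
apply: eq_eseriesr => j _; rewrite /generation_sum /word_sum -sumEFin.
by apply: eq_bigr => t _; rewrite EFinD !fx.
Qed.

Lemma fin_integral_pdom c (f : point -> R) : measurable_fun (tree_core T) f -> (forall p, 0 <= f p) ->
  (\int[vol]_(p in tree_core T) (f p)%:E < +oo)%E ->
  (\int[lam]_(y in pdom T c) (f (c, y))%:E = (fine (\int[lam]_(y in pdom T c) (f (c, y))%:E))%:E)%E.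
Proof.
move=> mf f0 foo; have md := measurable_pdom T c.
have sub : slice c (pdom T c) `<=` tree_core T by rewrite tree_core_slices => p hp; exists c.
rewrite fineK// ge0_fin_numE; last by apply: integral_ge0 => y _; rewrite lee_fin.
apply: le_lt_trans foo; rewrite -(ge0_integral_slice (c := c) (f := EFin \o f))//; last 2 first.
- by apply/measurable_EFinP; exact: (measurable_funS measurable_tree_core sub mf).
- by move=> p _; rewrite /= lee_fin.
by apply: ge0_integral_le_set => // p _; rewrite lee_fin.
Qed.

Section compactness.
Hypothesis hT : (tree_radius T < +oo)%E.

(** The generations from some [n] on contribute at most [eps / 2] times the full norm; each of the
    finitely many remaining pieces is treated by [rellich] with [eps / 2]. *)
Lemma tree_compactness (eps : R) : 0 < eps -> exists (I : finType) (Q : I -> set point) (C : R),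
  [/\ forall i, [/\ measurable (Q i), Q i `<=` tree_core T & (vol (Q i) < +oo)%E], 0 <= C &
  forall n (F : point -> 'rV[R]_n) (b : 'I_n), C1_tree T F -> forall A D : R,
    (\int[vol]_(p in tree_core T) (comp_of F b p ^+ 2)%:E = A%:E)%E ->
    (\int[vol]_(p in tree_core T) (grad2 T F b p)%:E = D%:E)%E ->
    A <= eps * (A + D) + C * \sum_i (\int[vol]_(p in Q i) comp_of F b p)%R ^+ 2].
Proof.
move=> eps0; have e20 : 0 < eps / 2 by rewrite divr_gt0.
have [c [c0 [[M cM] tail]]] := tree_tail hT.
have [n hn] := bounded_sum_tail c0 cM e20.
(* The index type, the sets and the constant are packed into one dependent pair, so that they can be
   chosen for all pieces at once. *)
have /choice[IQC hIQC] : forall e, exists P : {I : finType & (I -> set V) * R}%type,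
    let Q := (projT2 P).1 in let C := (projT2 P).2 in
    [/\ forall i, [/\ measurable (Q i), Q i `<=` pdom T e & (lam (Q i) < +oo)%E] &
     forall u G, ugrad (pdom T e) u G ->
     (\int[lam]_(x in pdom T e) (u x ^+ 2)%:E <= (eps / 2)%:E * \int[lam]_(x in pdom T e) (G x)%:E +
     (C * \sum_i (\int[lam]_(x in Q i) u x)%R ^+ 2)%:E)%E].
  move=> e; have [I [Q [C h]]] := rellich (segdom_pdom T e) e20.
  by exists (existT _ I (Q, C)).
pose I e := projT1 (IQC e); pose Q e : I e -> set V := (projT2 (IQC e)).1; pose C e : R := (projT2 (IQC e)).2.
(* [J] enumerates the pieces of the generations below [n]; a further dependent sum collects their
   functionals in one finite type. *)
pose J : finType := {j : 'I_n & (bool * j.-tuple 'I_k)%type}.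
pose W (p : J) : piece k := ((tagged p).1, tval (tagged p).2).
exists {p : J & I (W p)}, (fun q => slice (W (tag q)) (Q (W (tag q)) (tagged q))), (\sum_p `|C (W p)|); split.
- move=> [p i] /=; have [/(_ i)[mQ QD Qoo] _] := hIQC (W p); split.
  + exact: measurable_slice.
  + by move=> z [zp /QD hz]; apply/tree_coreE; rewrite zp.
  + rewrite (@vol_slice (W p)); [|exact: measurable_slice|by move=> z []].
    by rewrite (_ : [set y | _] = Q (W p) i)//; apply/seteqP; split => y; rewrite /slice/=; [case|].
- exact: sumr_ge0.
move=> m F b CF A D hA hD.
have mu e : measurable_fun (pdom T e) (fun y => comp_of F b (e, y)) by have [] := piece_ugrad b CF e.
have mG e : measurable_fun (pdom T e) (fun y => grad2 T F b (e, y)) by have [] := piece_ugrad b CF e.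
have mu2 : measurable_fun (tree_core T) (fun p => comp_of F b p ^+ 2).
  by apply: measurable_funX; exact: measurable_fun_tree.
have mG2 : measurable_fun (tree_core T) (grad2 T F b) by exact: measurable_fun_tree.
have u0 p : 0 <= comp_of F b p ^+ 2 by exact: sqr_ge0.
have G0 := grad2_ge0 T F b.
have Aoo : (\int[vol]_(p in tree_core T) (comp_of F b p ^+ 2)%:E < +oo)%E by rewrite hA ltry.
have Doo : (\int[vol]_(p in tree_core T) (grad2 T F b p)%:E < +oo)%E by rewrite hD ltry.
pose x e := fine (sqnorm T F b e); pose g e := fine (energy T F b e).
have xE e : sqnorm T F b e = (x e)%:E by exact: (fin_integral_pdom e mu2 u0 Aoo).
have gE e : energy T F b e = (g e)%:E by exact: (fin_integral_pdom e mG2 G0 Doo).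
have x0 e1 : 0 <= x e1.
  by rewrite -lee_fin -xE; apply: integral_ge0 => y _; rewrite lee_fin sqr_ge0.
have g0 e1 : 0 <= g e1.
  by rewrite -lee_fin -gE; apply: integral_ge0 => y _; rewrite lee_fin grad2_ge0.
have AE := integral_generations mu2 u0 xE; rewrite hA in AE.
have DE := integral_generations mG2 G0 gE; rewrite hD in DE.
have gs0 (y : piece k -> R) j : (forall e, 0 <= y e) -> 0 <= generation_sum j y :> R.
  by move=> y0; apply: word_sum_ge0 => s; exact: addr_ge0.
have part (y : piece k -> R) (Y : R) N : (forall e, 0 <= y e) -> (Y%:E = \sum_(j <oo) (generation_sum j y)%:E)%E ->
    \sum_(j < N) generation_sum j y <= Y :> R.
  move=> y0 YE; rewrite -lee_fin YE -sumEFin -(big_mkord xpredT (fun j => (generation_sum j y)%:E)).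
  by apply: nneseries_lim_ge => j _ _; rewrite lee_fin gs0.
have A0 : 0 <= A by have := part x A 0%N x0 AE; rewrite big_ord0.
have D0 : 0 <= D by have := part g D 0%N g0 DE; rewrite big_ord0.
have ht := tail _ F b x g (A + D) CF xE gE.
have {}ht j : generation_sum j x <= c j * (A + D).
  apply: ht => N.
    by apply: le_trans (part x A N x0 AE) _; rewrite lerDl.
  by apply: le_trans (part g D N g0 DE) _; rewrite lerDr.
have high : A <= \sum_(j < n) generation_sum j x + eps / 2 * (A + D).
  rewrite -lee_fin AE (nneseries_split 0 n); last by move=> j _; rewrite lee_fin gs0.
  rewrite add0n big_mkord sumEFin EFinD leeD2l//.
  apply: lime_le; first by apply: is_cvg_nneseries => j _ _; rewrite lee_fin gs0.
  apply: nearW => N; rewrite sumEFin lee_fin.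
  apply: le_trans (_ : \sum_(n <= i < N) c i * (A + D) <= _).
    by apply: ler_sum.
  by rewrite -mulr_suml ler_wpM2r ?addr_ge0.
pose K e : R := `|C e| * \sum_i (\int[lam]_(y in @Q e i) comp_of F b (e, y))%R ^+ 2.
have low e : x e <= eps / 2 * g e + K e.
  have [_ h] := hIQC e; have := h _ _ (piece_ugrad b CF e).
  rewrite -/(sqnorm T F b e) -/(energy T F b e) xE gE -EFinM -EFinD lee_fin => /le_trans; apply.
  by rewrite lerD2l ler_wpM2r ?ler_norm// sumr_ge0// => i _; exact: sqr_ge0.
have lowS : \sum_(j < n) generation_sum j x <= eps / 2 * D + \sum_(j < n) generation_sum j K.
  apply: (@le_trans _ _ (\sum_(j < n) (eps / 2 * generation_sum j g + generation_sum j K))).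
    apply: ler_sum => j _; rewrite -word_sumZ -word_sumD; apply: word_sum_le => s _.
    by rewrite mulrDr addrACA; apply: lerD.
  rewrite big_split -mulr_sumr lerD2r ler_wpM2l ?(ltW e20)//; exact: part.
have KE : \sum_(j < n) generation_sum j K = \sum_(p : J) K (W p).
  have -> : \sum_(p : J) K (W p) = \sum_(j < n) \sum_(q : bool * j.-tuple 'I_k) K (q.1, tval q.2).
    by rewrite sig_big_dep; apply: eq_bigr.
  apply: eq_bigr => j _; rewrite -(pair_bigA _ (fun b t => K (b, tval t))) big_bool /= addrC.
  by rewrite /generation_sum /word_sum big_split.
have hK : \sum_(p : J) K (W p) <= (\sum_p `|C (W p)|) *
    \sum_(q : {p : J & I (W p)}) (\int[vol]_(z in slice (W (tag q)) (Q (W (tag q)) (tagged q))) comp_of F b z)%R ^+ 2.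
  pose a (p : J) := \sum_(i : I (W p)) (\int[lam]_(y in Q (W p) i) comp_of F b (W p, y))%R ^+ 2.
  have a0 p : 0 <= a p by apply: sumr_ge0 => i _; exact: sqr_ge0.
  have -> : \sum_(q : {p : J & I (W p)}) (\int[vol]_(z in slice (W (tag q)) (Q (W (tag q)) (tagged q))) comp_of F b z)%R ^+ 2 = \sum_p a p.
    rewrite /a sig_big_dep.
    apply: eq_bigr => -[p i] _ /=; have [/(_ i)[mQ QD _] _] := hIQC (W p).
    by rewrite integral_slice//; exact: (measurable_funS (measurable_pdom T _) QD (mu _)).
  rewrite mulr_suml; apply: ler_sum => p _; rewrite /K ler_wpM2l// (bigD1 p)//= lerDl.
  by apply: sumr_ge0.
apply: le_trans high _; have := lowS; rewrite KE => h1.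
have := le_trans h1 (lerD (lexx _) hK) => h2.
have : 0 <= eps / 2 * A by rewrite mulr_ge0// ltW.
move: h2; lra.
Qed.
End compactness.

End volume.

(** * Test functions *)

Section mulmx_calculus.
Context {R : realType}.

Lemma cvg_matrix (I : Type) (F : set_system I) (FF : Filter F) m n (f : I -> 'M[R]_(m, n)) (l : 'M[R]_(m, n)) :
  (forall i j, f x i j @[x --> F] --> l i j) -> f x @[x --> F] --> l.
Proof.
move=> h U [P hP PU]; apply: (@filterS _ F _ [set x | forall i j, P i j (f x i j)]).
  by move=> x hx; apply: PU.
by apply: filter_forall => i; apply: filter_forall => j; exact: h (hP i j).
Qed.

Lemma continuous_mulmxr m n p (A : 'M[R]_(n, p)) : continuous (fun X : 'M[R]_(m, n) => X *m A).
Proof.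
move=> X; apply: (cvg_matrix (nbhs_filter X)) => i j.
rewrite mxE (_ : (fun Y : 'M[R]_(m, n) => (Y *m A) i j) = (fun Y => \sum_l Y i l * A l j)); last first.
  by apply/funext => Y; rewrite mxE.
apply: (@cvgr_sum _ _ _ _ (nbhs_filter X)) => l.
by apply: cvgMr_tmp; exact: coord_continuous.
Qed.

Lemma mulmx_jacobian m n (f : 'rV[R]_m -> 'rV[R]_n) (x v : 'rV[R]_m) : differentiable f x ->
  v *m jacobian f x = 'd f x v.
Proof. by move=> df; rewrite -(deriveEjacobian v df) deriveE. Qed.

Lemma jacobian_mulmxr m n p (A : 'M[R]_(n, p)) (f : 'rV[R]_m -> 'rV[R]_n) (h : 'rV[R]_m -> 'rV[R]_p) x :
  differentiable f x -> differentiable h x ->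
  differentiable (fun y => f y *m A + h y) x /\
  jacobian (fun y => f y *m A + h y) x = jacobian f x *m A + jacobian h x.
Proof.
move=> df dh; have cA := @continuous_mulmxr 1 n p A.
have dA y : differentiable (mulmxr A : 'rV[R]_n -> 'rV[R]_p) y by exact: linear_differentiable.
have dfA : differentiable (mulmxr A \o f) x by apply: differentiable_comp.
have dsum : differentiable ((mulmxr A \o f) + h) x by exact: differentiableD.
split; first exact: dsum.
have dE : 'd ((mulmxr A \o f) + h) x = ((mulmxr A \o 'd f x) \+ 'd h x) :> ('rV_m -> 'rV_p).
  transitivity ('d (mulmxr A \o f) x \+ 'd h x); first exact: (diffD dfA dh).
  have E1 : 'd (mulmxr A \o f) x = mulmxr A \o 'd f x :> ('rV_m -> 'rV_p).
    transitivity ('d (mulmxr A : 'rV[R]_n -> 'rV[R]_p) (f x) \o 'd f x); first exact: (diff_comp df (dA _)).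
    have E2 := @diff_lin R _ _ (mulmxr A : {linear 'rV_n -> 'rV_p}) (f x) cA.
    by rewrite E2.
  by apply/funext => v; congr (_ + _); have := congr1 (fun F => F v) E1.
apply/row_matrixP => i; rewrite !rowE mulmxDr mulmxA.
transitivity ((mulmxr A \o 'd f x \+ 'd h x) 'e_i); last first.
  by congr (_ *m A + _); symmetry; exact: mulmx_jacobian.
by rewrite -dE; exact: mulmx_jacobian.
Qed.

Lemma C1_on_mulmxr m n p (A : 'M[R]_(n, p)) D (f : 'rV[R]_m -> 'rV[R]_n) (h : 'rV[R]_m -> 'rV[R]_p) df dh :
  C1_on D f df -> C1_on D h dh ->
  C1_on D (fun y => f y *m A + h y) (fun y => df y *m A + dh y).
Proof.
move=> [cf cdf Jf] [ch cdh Jh]; split.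
- have c1 : {within D, continuous (mulmxr A \o f)}.
    by move=> y; apply: (@continuous_comp (subspace D) _ _ f (mulmxr A) y (cf y)); exact: continuous_mulmxr.
  by move=> y; exact: (cvgD (c1 y) (ch y)).
- have c1 : {within D, continuous (mulmxr A \o df)}.
    by move=> y; apply: (@continuous_comp (subspace D) _ _ df (mulmxr A) y (cdf y)); exact: continuous_mulmxr.
  by move=> y; exact: (cvgD (c1 y) (cdh y)).
- move=> y Dy; have [df1 <-] := Jf y Dy; have [dh1 <-] := Jh y Dy.
  exact: jacobian_mulmxr.
Qed.

End mulmx_calculus.

Section test_functions.
Context {R : realType} {d k : nat} (T : inflated_tree R d k).
Local Notation V := 'rV[R]_(d + 1).
Local Notation point := (piece k * V)%type.
Local Notation C := R[i].
Local Notation E := (tree_core T).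
Local Notation vol := (@vol R d k).

Definition comps (f : point -> C) (b : 'I_2) : point -> R := comp_of (row_of_complex \o f) b.

Definition cplx (f : 'I_2 -> point -> R) : point -> C := fun p => Complex (f ord0 p) (f ord_max p).

Lemma ord2P (P : 'I_2 -> Prop) : P ord0 -> P ord_max -> forall b, P b.
Proof.
move=> P0 P1 [[|[|//]] h]; first by rewrite (_ : Ordinal h = ord0)//; exact/val_inj.
by rewrite (_ : Ordinal h = ord_max)//; exact/val_inj.
Qed.

Lemma comps0 f p : comps f ord0 p = complex.Re (f p). Proof. by rewrite /comps /comp_of /= mxE. Qed.
Lemma comps1 f p : comps f ord_max p = complex.Im (f p). Proof. by rewrite /comps /comp_of /= mxE. Qed.

Lemma cplxK f : comps (cplx f) = f.
Proof. by apply/funext; apply: ord2P; apply/funext => p; rewrite ?comps0 ?comps1. Qed.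

Lemma compsK f : cplx (comps f) = f.
Proof. by apply/funext => p; rewrite /cplx comps0 comps1; case: (f p). Qed.

Lemma row_of_cplx f p : row_of_complex (cplx f p) = \row_b f b p.
Proof. by apply/rowP; apply: ord2P; rewrite !mxE. Qed.

Lemma sum2 (a : 'I_2 -> R) : \sum_b a b = a ord0 + a ord_max.
Proof.
by rewrite big_ord_recl big_ord1; congr (_ + a _); exact/val_inj.
Qed.

Lemma L2P f : L2 T f <-> forall b, sqint vol E (comps f b).
Proof.
have m2 (g : point -> R) : measurable_fun E g -> measurable_fun E (fun x => (g x ^+ 2)%:E).
  by move=> mg; apply/measurable_EFinP; exact: measurable_funX.
have cE0 : comps f ord0 = @complex.Re R \o f by apply/funext => p; rewrite comps0.
have cE1 : comps f ord_max = @complex.Im R \o f by apply/funext => p; rewrite comps1.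
have nE : measurable_fun E (comps f ord0) -> measurable_fun E (comps f ord_max) -> normsq T f =
    (\int[vol]_(p in E) (comps f ord0 p ^+ 2)%:E + \int[vol]_(p in E) (comps f ord_max p ^+ 2)%:E)%E.
  move=> mf0 mf1; rewrite -ge0_integralD//.
  - by apply: eq_integral => p _; rewrite comps0 comps1.
  - exact: measurable_tree_core.
  - by move=> p _; rewrite lee_fin sqr_ge0.
  - exact: m2.
  - by move=> p _; rewrite lee_fin sqr_ge0.
  - exact: m2.
have i0 b : (0 <= \int[vol]_(p in E) (comps f b p ^+ 2)%:E)%E.
  by apply: integral_ge0 => p _; rewrite lee_fin sqr_ge0.
split=> [[mf0 mf1 foo]|h].
  rewrite -cE0 in mf0; rewrite -cE1 in mf1; rewrite nE// in foo.
  apply: ord2P; split => //; apply: le_lt_trans foo; [exact: leeDl|exact: leeDr].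
have [mf0 f0] := h ord0; have [mf1 f1] := h ord_max.
split; rewrite -?cE0 -?cE1//.
by rewrite nE// lte_add_pinfty.
Qed.

Lemma normsqE f : L2 T f -> normsq T f = (\sum_b ip vol E (comps f b) (comps f b))%:E.
Proof.
move=> /L2P hf; have [mf0 f0] := hf ord0; have [mf1 f1] := hf ord_max.
have m2 (g : point -> R) : measurable_fun E g -> measurable_fun E (fun x => (g x ^+ 2)%:E).
  by move=> mg; apply/measurable_EFinP; exact: measurable_funX.
rewrite sum2 EFinD -!ipE// -ge0_integralD//.
- by apply: eq_integral => p _; rewrite comps0 comps1.
- exact: measurable_tree_core.
- by move=> p _; rewrite lee_fin sqr_ge0.
- exact: m2.
- by move=> p _; rewrite lee_fin sqr_ge0.
- exact: m2.
Qed.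

(** A complex function with its gradient in real components: [None] is the value, [Some j] the
    [j]-th derivative. Storing the gradient makes the form a sum of real inner products on a vector
    space. *)
Definition field := option 'I_(d + 1) -> 'I_2 -> point -> R^o.

Definition field_of (u : point -> C) (gu : 'I_(d + 1) -> point -> C) : field :=
  fun o b => if o is Some j then comps (gu j) b else comps u b.

Definition jet f : field := field_of f (grad T f).

Lemma jet_grad f j b p : jet f (Some j) b p = jacobian (row_of_complex \o f \o chart T p.1) p.2 j b.
Proof. by move: b; apply: ord2P; rewrite /jet /field_of ?comps0 ?comps1. Qed.

Lemma sqint_eq (f g : point -> R) : (forall p, E p -> f p = g p) -> sqint vol E f -> sqint vol E g.
Proof.
move=> fg [mf foo]; split.
  by apply: eq_measurable_fun mf => p /set_mem/fg.
rewrite (eq_integral (fun p => (f p ^+ 2)%:E))//.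
by move=> p /set_mem/fg ->.
Qed.

Lemma C1_tree_differentiable n (F : point -> 'rV[R]_n) p : C1_tree T F -> E p ->
  differentiable (F \o chart T p.1) p.2.
Proof.
move=> CF /tree_coreE hp; have [df hdf] := CF p.1.
have sub : pdom T p.1 `<=` chart_dom T p.1.
  move: p.1 => [[] s] y //= hy; exact: edge_dom_pdom.
have [_ _ h] := C1_on_sub hdf (@open_pdom _ _ _ T p.1) sub.
have := h p.2; rewrite (_ : (pdom T p.1)°%classic = pdom T p.1); first by move=> /(_ hp)[].
exact/interior_id/open_pdom.
Qed.

(** A real matrix acting on the real and imaginary parts covers real multiples and multiplication by
    i at once. The jets are compared on [tree_core], where differentiability is known. *)
Lemma test_fun_op (A : 'M[R]_2) f g : test_fun T f -> test_fun T g ->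
  exists2 e, test_fun T e & forall p, E p -> forall o b,
    jet e o b p = \sum_b' jet f o b' p * A b' b + jet g o b p.
Proof.
move=> [Cf f0 Lf Lgf] [Cg g0 Lg Lgg].
pose e := cplx (fun b p => (row_of_complex (f p) *m A + row_of_complex (g p)) 0 b).
have eE : row_of_complex \o e = fun p => row_of_complex (f p) *m A + row_of_complex (g p).
  by apply/funext => p; rewrite /= row_of_cplx; apply/rowP => b; rewrite mxE.
have jE p : E p -> forall o b, jet e o b p = \sum_b' jet f o b' p * A b' b + jet g o b p.
  move=> Ep [j|] b.
    rewrite !jet_grad.
    have -> : row_of_complex \o e \o chart T p.1 = fun y => (row_of_complex \o f \o chart T p.1) y *m A +
        (row_of_complex \o g \o chart T p.1) y by rewrite eE.
    have [_ ->] := jacobian_mulmxr A (C1_tree_differentiable Cf Ep) (C1_tree_differentiable Cg Ep).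
    by rewrite [LHS]mxE [X in X + _]mxE; congr (_ + _); apply: eq_bigr => b' _; rewrite jet_grad.
  by rewrite /jet /field_of /comps /comp_of eE !mxE.
have sq o b : sqint vol E (jet e o b).
  have sf b' : sqint vol E (jet f o b') by case: (o) => [j|]; [exact: (L2P _).1|exact: (L2P _).1].
  have sg : sqint vol E (jet g o b) by case: (o) => [j|]; [exact: (L2P _).1|exact: (L2P _).1].
  apply: (@sqint_eq (fun p => A ord0 b * jet f o ord0 p + (A ord_max b * jet f o ord_max p + jet g o b p))).
    by move=> p Ep; rewrite jE// sum2; ring.
  by do 2!(apply: sqintP => //; first exact: measurable_tree_core).
exists e; last exact: jE.
split.
- move=> c; have [df hf] := Cf c; have [dg hg] := Cg c.
  exists (fun y => df y *m A + dg y); rewrite eE.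
  exact: (C1_on_mulmxr A hf hg).
- move=> x Tx; rewrite /e /cplx f0// g0//.
  have r0 : row_of_complex (0 : C) = 0 by apply/rowP; apply: ord2P; rewrite !mxE.
  by rewrite r0 mul0mx addr0 !mxE.
- by apply/L2P => b; exact: (sq None b).
- by move=> j; apply/L2P => b; exact: (sq (Some j) b).
Qed.

Lemma jet0 : jet (fun=> 0) = fun _ _ _ => 0.
Proof.
apply/funext => o; apply/funext => b; apply/funext => p.
case: o => [j|]; last by move: b; apply: ord2P; rewrite /jet /field_of ?comps0 ?comps1.
rewrite jet_grad (_ : _ \o _ = cst 0); first by rewrite /jacobian diff_cst mxE mxE.
by apply/funext => y; apply/rowP; apply: ord2P; rewrite !mxE.
Qed.

Lemma test_fun0 : test_fun T (fun=> 0).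
Proof.
have r0 : row_of_complex (0 : C) = 0 by apply/rowP; apply: ord2P; rewrite !mxE.
have sq o b : sqint vol E (jet (fun=> 0) o b) by rewrite jet0; exact: sqint0.
split => //.
- move=> c; exists (fun=> 0); split.
  + rewrite (_ : _ \o _ = cst 0); last by apply/funext => y; rewrite /= r0.
    exact: cst_continuous.
  + exact: cst_continuous.
  + move=> y _; rewrite (_ : _ \o _ = cst 0); last by apply/funext => z; rewrite /= r0.
    split; first exact: differentiable_cst.
    by apply/matrixP => i j; rewrite /jacobian diff_cst !mxE.
- by apply/L2P => b; exact: (sq None b).
- by move=> j; apply/L2P => b; exact: (sq (Some j) b).
Qed.

End test_functions.

(** * The form domain *)

Lemma eventually_sum_lt {R : realType} (I : finType) (a : I -> nat -> R) :
  (forall i e, 0 < e -> exists N, forall n, (N <= n)%N -> a i n < e) ->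
  forall e : R, 0 < e -> exists N, forall n, (N <= n)%N -> \sum_i a i n < e.
Proof.
move=> ha e e0; have c0 : 0 < #|I|.+1%:R :> R by rewrite ltr0n.
have [N hN] := choice (fun i => ha i _ (divr_gt0 e0 c0)).
exists (\max_i N i) => n Nn.
apply: (@le_lt_trans _ _ (\sum_(i : I) e / #|I|.+1%:R)).
  by apply: ler_sum => i _; apply/ltW/hN/(leq_trans _ Nn); exact: leq_bigmax.
rewrite sumr_const -(mulr_natr (e / _)) -mulrA gtr_pMr// mulrC ltr_pdivrMr// mul1r ltr_nat.
by rewrite ltnS.
Qed.

Section form_domain.
Context {R : realType} {d k : nat} (T : inflated_tree R d k).
Local Notation V := 'rV[R]_(d + 1).
Local Notation point := (piece k * V)%type.
Local Notation C := R[i].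
Local Notation E := (tree_core T).
Local Notation vol := (@vol R d k).
Local Notation field := (@field R d k).
Local Notation index := (option 'I_(d + 1)).
Local Notation ip := (ip vol E).
Implicit Types u v w : field.

Let mE : measurable E := measurable_tree_core T.

(** [pred1 None] gives the real L^2 inner product of the values, [predC1 None] the form of the
    gradients, and [predT] the inner product of H^1. *)
Definition tree_form (P : pred index) u v : R := \sum_(o | P o) \sum_b ip (u o b) (v o b).

Definition sqfield u : Prop := forall o b, sqint vol E (u o b).

Lemma sqfield_subspace : linear_subspace sqfield.
Proof.
split; first by move=> o b; exact: sqint0.
move=> a x y hx hy o b; exact: (sqintP mE a (hx o b) (hy o b)).
Qed.

Lemma form_sym P : sym_form sqfield (tree_form P).
Proof.
split.
- move=> z hz a x y hx hy; rewrite /tree_form mulr_sumr -big_split; apply: eq_bigr => o _ /=.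
  rewrite mulr_sumr -big_split; apply: eq_bigr => b _ /=.
  exact: (ipP mE a (hx o b) (hy o b) (hz o b)).
- by move=> x y _ _; apply: eq_bigr => o _; apply: eq_bigr => b _; exact: ipC.
- by move=> x _; apply: sumr_ge0 => o _; apply: sumr_ge0 => b _; exact: ip_ge0.
Qed.

Lemma form_ge0 P u : 0 <= tree_form P u u.
Proof. by apply: sumr_ge0 => o _; apply: sumr_ge0 => b _; exact: ip_ge0. Qed.

Lemma form_mono (P Q : pred index) u : (forall o, P o -> Q o) -> tree_form P u u <= tree_form Q u u.
Proof.
move=> PQ; rewrite /tree_form [leRHS](bigID P) /=.
rewrite (eq_bigl (fun o => Q o && P o)); last by move=> o; case: (boolP (P o)) => [/PQ ->|]; rewrite ?andbF.
by rewrite lerDl sumr_ge0// => o _; apply: sumr_ge0 => b _; exact: ip_ge0.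
Qed.

Lemma ip_eq (f f' g g' : point -> R) : (forall p, E p -> f p = f' p) -> (forall p, E p -> g p = g' p) ->
  ip f g = ip f' g'.
Proof. by move=> ff gg; apply: eq_Rintegral => p /set_mem Ep; rewrite ff// gg. Qed.

Lemma form_eq P u u' v v' : (forall p, E p -> forall o b, u o b p = u' o b p) ->
  (forall p, E p -> forall o b, v o b p = v' o b p) -> tree_form P u v = tree_form P u' v'.
Proof.
move=> uu vv; apply: eq_bigr => o _; apply: eq_bigr => b _.
by apply: ip_eq => p Ep; [exact: uu|exact: vv].
Qed.

Lemma form_add_le P u v : sqfield u -> sqfield v -> tree_form P (u + v) (u + v) <= 2 * tree_form P u u + 2 * tree_form P v v.
Proof.
move=> hu hv; have := form_ge0 P (u - v).
rewrite (sym_formB sqfield_subspace (form_sym P))//.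
have := sym_form_expand sqfield_subspace (form_sym P) 1 hu hv.
by rewrite scale1r => ->; lra.
Qed.

Lemma tree_formZ P a u : sqfield u -> tree_form P (a *: u) (a *: u) = a ^+ 2 * tree_form P u u.
Proof.
move=> hu; have [l s _] := form_sym P; have ha := subspaceZ sqfield_subspace a hu.
rewrite (linear_onZ sqfield_subspace (l _ ha))// (s _ _ hu ha).
by rewrite (linear_onZ sqfield_subspace (l _ hu))// mulrA.
Qed.

Lemma sqfield_jet f : test_fun T f -> sqfield (jet T f).
Proof. by move=> [_ _ Lf Lgf] [j|]; [exact: (L2P _ _).1|exact: (L2P _ _).1]. Qed.

(* The closure of the test functions; an element of [field] consists of the
   real and imaginary parts of a function and of the components of its gradient. *)
Definition form_dom u : Prop := sqfield u /\
  forall e : R, 0 < e -> exists2 f, test_fun T f & tree_form predT (u - jet T f) (u - jet T f) < e.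

Definition mul_i u : field := fun o b => if b == ord0 then - u o ord_max else u o ord0.

Lemma mul_i_linear a u v : mul_i (a *: u + v) = a *: mul_i u + mul_i v.
Proof.
apply/funext => o; apply/funext => b; apply/funext => p; rewrite /mul_i.
rewrite -[RHS]/(a * mul_i u o b p + mul_i v o b p) /mul_i; case: (b == ord0) => //.
by rewrite -[LHS]/(- (a * u o ord_max p + v o ord_max p)) opprD -mulrN.
Qed.

Lemma mul_i_mul_i u : mul_i (mul_i u) = - u.
Proof.
apply/funext => o; apply/funext; apply: ord2P; apply/funext => p; rewrite /mul_i//=.
Qed.

Lemma sqfield_rot u : sqfield u -> sqfield (mul_i u).
Proof.
move=> hu o; apply: ord2P; rewrite /mul_i /=; last exact: hu.
have := sqintB mE (sqint0 vol E) (hu o ord_max); congr sqint.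
by apply/funext => p; rewrite sub0r.
Qed.

Lemma form_rot P u v : sqfield u -> sqfield v -> tree_form P (mul_i u) (mul_i v) = tree_form P u v.
Proof.
move=> hu hv; apply: eq_bigr => o _; rewrite !sum2 /mul_i /= addrC; congr (_ + _).
by apply: eq_Rintegral => p _; rewrite -[LHS]/(- u o ord_max p * - v o ord_max p) mulrNN.
Qed.

Lemma jet_comb (a : R) f g : test_fun T f -> test_fun T g -> exists2 e, test_fun T e &
  forall p, E p -> forall o b, jet T e o b p = (a *: jet T f + jet T g) o b p.
Proof.
move=> tf tg; have [e te eE] := test_fun_op a%:M tf tg; exists e => // p Ep o b.
rewrite eE// -[RHS]/(a * jet T f o b p + jet T g o b p); congr (_ + _).
by rewrite (bigD1 b)//= mxE eqxx mulr1n mulrC big1 ?addr0// => b' /negbTE bb; rewrite mxE bb mulr0.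
Qed.

Lemma jet_rot f : test_fun T f -> exists2 e, test_fun T e &
  forall p, E p -> forall o b, jet T e o b p = mul_i (jet T f) o b p.
Proof.
move=> tf; pose A : 'M[R]_2 := \matrix_(i, j) (if j == ord0 then if i == ord0 then 0 else -1 else if i == ord0 then 1 else 0).
have [e te eE] := test_fun_op A tf (test_fun0 T).
exists e => // p Ep o; apply: ord2P; rewrite eE// jet0 addr0 sum2 !mxE /= /mul_i /=.
  by rewrite mulr0 add0r mulrN1.
by rewrite mulr1 mulr0 addr0.
Qed.

Lemma form_dom_subspace : linear_subspace form_dom.
Proof.
have sS := sqfield_subspace.
split.
  split; first by case: sS.
  move=> e e0; exists (fun=> 0); first exact: test_fun0.
  have := tree_formZ predT 0 sS.1; rewrite scale0r expr0n mul0r jet0 => z0.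
  by rewrite (_ : 0 - _ = 0) ?z0// subr0.
move=> a x y [sx hx] [sy hy]; split; first exact: (sS.2 a x y sx sy).
move=> e e0; have a1 : 0 < 1 + a ^+ 2 by rewrite ltr_pwDl// sqr_ge0.
have e1 : 0 < e / 4 / (1 + a ^+ 2) by rewrite !divr_gt0.
have [f tf hf] := hx _ e1; have [g tg hg] := hy _ e1.
have [c tc cE] := jet_comb a tf tg; exists c => //.
have sf := subspaceB sS sx (sqfield_jet tf); have sg := subspaceB sS sy (sqfield_jet tg).
rewrite (@form_eq _ _ (a *: (x - jet T f) + (y - jet T g)) _ (a *: (x - jet T f) + (y - jet T g))); last 2 first.
- move=> p Ep o b; rewrite -[LHS]/(a * x o b p + y o b p - jet T c o b p) cE//.
  rewrite -[RHS]/(a * (x o b p - jet T f o b p) + (y o b p - jet T g o b p)).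
  by rewrite -[(_ + _ : field) o b p]/(a * jet T f o b p + jet T g o b p); ring.
- move=> p Ep o b; rewrite -[LHS]/(a * x o b p + y o b p - jet T c o b p) cE//.
  rewrite -[RHS]/(a * (x o b p - jet T f o b p) + (y o b p - jet T g o b p)).
  by rewrite -[(_ + _ : field) o b p]/(a * jet T f o b p + jet T g o b p); ring.
apply: le_lt_trans (form_add_le _ (subspaceZ sS a sf) sg) _; rewrite tree_formZ//.
rewrite ltr_pdivlMr// in hf; rewrite ltr_pdivlMr// in hg.
have h1 := form_ge0 predT (x - jet T f); have h2 := form_ge0 predT (y - jet T g).
move: (tree_form _ _ _) (tree_form _ _ _) h1 h2 hf hg => X Y X0 Y0 hX hY.
have := mulr_ge0 Y0 (sqr_ge0 a); move: X0; lra.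
Qed.

Lemma form_dom_rot u : form_dom u -> form_dom (mul_i u).
Proof.
move=> [su hu]; split; first exact: sqfield_rot.
move=> e e0; have [f tf hf] := hu e e0; have [g tg gE] := jet_rot tf.
exists g => //; have sf := subspaceB sqfield_subspace su (sqfield_jet tf).
rewrite -(form_rot _ sf sf) in hf; apply: le_lt_trans hf; rewrite le_eqVlt; apply/orP; left; apply/eqP.
have h p : E p -> forall o b, (mul_i u - jet T g) o b p = mul_i (u - jet T f) o b p.
  move=> Ep o b; rewrite -[LHS]/(mul_i u o b p - jet T g o b p) gE// /mul_i; case: (b == ord0) => //.
  by rewrite -[LHS]/(- u o ord_max p - - jet T f o ord_max p) -[RHS]/(- (u o ord_max p - jet T f o ord_max p)) opprB opprK addrC.
by apply: form_eq.
Qed.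

Lemma form_dom_sym P : sym_form form_dom (tree_form P).
Proof.
have [l s p] := form_sym P; split.
- by move=> z [hz _] a x y [hx _] [hy _]; exact: l.
- by move=> x y [hx _] [hy _]; exact: s.
- by move=> x [hx _]; exact: p.
Qed.

Lemma form_split u v : tree_form predT u v = tree_form (pred1 None) u v + tree_form (predC1 None) u v.
Proof. by rewrite /tree_form (bigID (pred1 None)). Qed.

Lemma form_value u v : tree_form (pred1 None) u v = \sum_b ip (u None b) (v None b).
Proof. by rewrite /tree_form big_pred1_eq. Qed.

(** Each component converges in L^2. The limit is close to some [x N], which is close to a test
    function; a quarter of [e] for either error suffices, as the form of a sum is at most twice the
    sum of the forms. *)
Lemma form_dom_complete : complete_form form_dom (tree_form predT).
Proof.
move=> x Dx cx; have sx n : sqfield (x n) by case: (Dx n).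
have ip_le o b w : sqfield w -> ip (w o b) (w o b) <= tree_form predT w w.
  move=> sw; rewrite /tree_form (bigD1 o)//= (bigD1 b)//= -addrA lerDl addr_ge0//.
    by apply: sumr_ge0 => b' _; exact: ip_ge0.
  by apply: sumr_ge0 => o' _; apply: sumr_ge0 => b' _; exact: ip_ge0.
have sS := sqfield_subspace.
have /choice[Y hY] (ob : index * 'I_2) : exists g : point -> R, sqint vol E g /\
    forall e : R, 0 < e -> exists N, forall n, (N <= n)%N ->
      ip (fun p => x n ob.1 ob.2 p - g p) (fun p => x n ob.1 ob.2 p - g p) < e.
  have cob (e : R) : 0 < e -> exists N, forall m n, (N <= m)%N -> (N <= n)%N ->
      ip (fun p => x m ob.1 ob.2 p - x n ob.1 ob.2 p) (fun p => x m ob.1 ob.2 p - x n ob.1 ob.2 p) < e.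
    move=> e0; have [N hN] := cx e e0; exists N => m n Nm Nn; apply: le_lt_trans (hN m n Nm Nn).
    exact: (ip_le _ _ (x m - x n) (subspaceB sS (sx m) (sx n))).
  by have [g hg hlim] := sqint_complete mE (fun n => sx n ob.1 ob.2) cob; exists g.
pose y : field := fun o b => Y (o, b).
have sy : sqfield y by move=> o b; have [] := hY (o, b).
have lim_y e : 0 < e -> exists N, forall n, (N <= n)%N -> tree_form predT (x n - y) (x n - y) < e.
  move=> e0; have [N hN] := @eventually_sum_lt R (index * 'I_2)%type
    (fun ob n => ip (fun p => x n ob.1 ob.2 p - Y ob p) (fun p => x n ob.1 ob.2 p - Y ob p)) (fun ob => (hY ob).2) e e0.
  exists N => n Nn; apply: le_lt_trans (hN n Nn); rewrite /tree_form pair_bigA /=.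
  by apply: ler_sum => ob _; case: ob.
exists y => //; split => // e e0; have e4 : 0 < e / 4 by rewrite divr_gt0.
have [N hN] := lim_y _ e4; have [_ hx] := Dx N; have [f tf hf] := hx _ e4; exists f => //.
have s1 := subspaceB sS (sx N) (sqfield_jet tf); have s2 := subspaceB sS sy (sx N).
have := form_add_le predT s1 s2; rewrite addrC subrKA.
have -> : tree_form predT (y - x N) (y - x N) = tree_form predT (x N - y) (x N - y).
  have s3 := subspaceB sS (sx N) sy.
  by rewrite -opprB -scaleN1r (tree_formZ _ _ s3) sqrrN expr1n mul1r.
move/le_lt_trans; apply; have := hN N (leqnn N).
move: (tree_form _ _ _) (tree_form _ _ _) hf => X Z; lra.
Qed.

Section compact.
Hypothesis hT : (tree_radius T < +oo)%E.

(** The estimate for test functions extends to the domain by approximation, because both the form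
    and the functionals are continuous in the norm of H^1. *)
Lemma form_dom_compact (e : R) : 0 < e -> exists m (l : 'I_m -> field -> R) (K : R),
  [/\ forall i, linear_on form_dom (l i),
      forall i u, form_dom u -> l i u ^+ 2 <= K * tree_form (pred1 None) u u &
      forall u, form_dom u -> tree_form (pred1 None) u u <= e * tree_form (predC1 None) u u + \sum_i l i u ^+ 2].
Proof.
(* In [general] the factor is [4 * eps]: the bound 1 / 8 leaves half of the value part to be
   absorbed on the left, and [e / 8] yields [e] after this absorption. The functionals then carry
   [8 * C], whence [r] below. *)
move=> e0; pose eps : R := Num.min (e / 8) (1 / 8).
have eps0 : 0 < eps by rewrite lt_min !divr_gt0.
have eps1 : eps <= e / 8 by rewrite ge_min lexx.
have eps2 : eps <= 1 / 8 by rewrite ge_min lexx orbT.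
have [I [Q [C [hQ C0 hC]]]] := tree_compactness hT eps0.
pose l (i : I * 'I_2) (u : field) : R := (\int[vol]_(p in Q i.1) u None i.2 p)%R.
have lin i : linear_on sqfield (l i).
  move=> a x y sx sy; have [mQ QE Qoo] := hQ i.1.
  have [ix _] := integral_sqint_le mE mQ QE Qoo (sx None i.2).
  have [iy _] := integral_sqint_le mE mQ QE Qoo (sy None i.2).
  rewrite /l -RintegralZl// -RintegralD//; exact: (integrableZl _ _ ix).
have linB i (x y : field) : sqfield x -> sqfield y -> l i (x - y) = l i x - l i y.
  exact: linear_onB.
pose K := \sum_i fine (vol (Q i)).
have lK i u : sqfield u -> l i u ^+ 2 <= K * tree_form (pred1 None) u u.
  move=> su; have [mQ QE Qoo] := hQ i.1.
  have [_ h] := integral_sqint_le mE mQ QE Qoo (su None i.2).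
  apply: le_trans h _; apply: ler_pM.
  - exact: fine_ge0.
  - exact: ip_ge0.
  - by rewrite /K (bigD1 i.1)//= lerDl sumr_ge0// => j _; exact: fine_ge0.
  - by rewrite form_value (bigD1 i.2)//= lerDl sumr_ge0// => b _; exact: ip_ge0.
have test f : test_fun T f -> tree_form (pred1 None) (jet T f) (jet T f) <=
    eps * tree_form predT (jet T f) (jet T f) + C * \sum_i l i (jet T f) ^+ 2.
  move=> tf; have sf := sqfield_jet tf; have [Cf _ _ _] := tf.
  have hb b : ip (jet T f None b) (jet T f None b) <= eps * (\sum_o ip (jet T f o b) (jet T f o b)) +
      C * \sum_i l (i, b) (jet T f) ^+ 2.
    have := hC _ _ b Cf (ip (jet T f None b) (jet T f None b))
       (\sum_(j < d + 1) ip (jet T f (Some j) b) (jet T f (Some j) b)).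
    rewrite [in X in X -> _](ipE (sf None b)) => /(_ erefl); rewrite -sumEFin.
    have -> : (\int[vol]_(p in E) (grad2 T (row_of_complex \o f) b p)%:E =
        \sum_(j < d + 1) (ip (jet T f (Some j) b) (jet T f (Some j) b))%:E)%E.
      under [RHS]eq_bigr do rewrite -ipE//.
      rewrite -ge0_integral_sum//.
      - by apply: eq_integral => p _; rewrite /grad2 -sumEFin; apply: eq_bigr => j _; rewrite jet_grad.
      - by move=> j; apply/measurable_EFinP; apply: measurable_funX; have [] := sf (Some j) b.
      - by move=> j p _; rewrite lee_fin sqr_ge0.
    move=> /(_ erefl); rewrite (bigD1 None)//= => h; apply: le_trans h _; rewrite lerD2r.
    rewrite ler_wpM2l ?(ltW eps0)// lerD2l le_eqVlt; apply/orP; left; apply/eqP.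
    rewrite [RHS](reindex_omap (@Some 'I_(d + 1)) id)//=; last by case.
    by apply: eq_bigl => j; rewrite eqxx.
  rewrite form_value; apply: le_trans (ler_sum _ (fun b _ => hb b)) _.
  rewrite big_split -!mulr_sumr /= le_eqVlt; apply/orP; left; apply/eqP; congr (_ * _ + _ * _).
    by rewrite /tree_form exchange_big.
  by rewrite exchange_big pair_bigA; apply: eq_bigr => ib _; case: ib.
have K0 : 0 <= K by apply: sumr_ge0 => i _; exact: fine_ge0.
have general u : form_dom u -> tree_form (pred1 None) u u <=
    4 * eps * tree_form predT u u + 4 * C * \sum_i l i u ^+ 2.
  move=> [su hu]; apply/ler_addgt0Pr => t t0.
  (* [c0] collects the factors of the approximation error: from the splitting of [u], from the full
     norm of the test function and from the functionals. *)
  pose c0 : R := 2 + 4 * eps + 4 * C * (#|{: I * 'I_2}|%:R * K).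
  have c00 : 0 < c0.
    by rewrite /c0 -addrA ltr_pwDl// addr_ge0 ?mulr_ge0// ltW.
  have [f tf hf] := hu (t / c0) (divr_gt0 t0 c00).
  have sf := sqfield_jet tf; set w := u - jet T f in hf *.
  have sw : sqfield w := subspaceB sqfield_subspace su sf.
  have h1 := form_add_le (pred1 None) sw sf.
  have h2 : tree_form predT (jet T f) (jet T f) <= 2 * tree_form predT w w + 2 * tree_form predT u u.
    have snw : sqfield (- w) by rewrite -scaleN1r; exact: (subspaceZ sqfield_subspace).
    have := form_add_le predT snw su; rewrite addrC subKr.
    by rewrite -(scaleN1r w) tree_formZ// sqrrN expr1n mul1r.
  have h3 : \sum_i l i (jet T f) ^+ 2 <= 2 * (#|{: I * 'I_2}|%:R * K * tree_form predT w w) + 2 * \sum_i l i u ^+ 2.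
    have [X XE] : exists X, X = tree_form predT w w by exists (tree_form predT w w).
    rewrite -XE; have -> : #|{: I * 'I_2}|%:R * K * X = \sum_(i : I * 'I_2) K * X.
      by rewrite sumr_const -(mulr_natl (K * _)) mulrA.
    rewrite !mulr_sumr -big_split; apply: ler_sum => i _ /=.
    have lw : l i w = l i u - l i (jet T f) by exact: linB.
    have := lK i w sw; rewrite lw => hw.
    have : K * tree_form (pred1 None) w w <= K * X by rewrite XE ler_wpM2l// form_mono.
    have := sqr_ge0 (l i u + (l i u - l i (jet T f))).
    move: hw; move: (l i u) (l i (jet T f)) (tree_form (pred1 None) w w) => a b Z h5; nra.
  have h4 := test f tf; have h5 := @form_mono (pred1 None) predT w (fun=> fun=> isT).
  have uE : w + jet T f = u by rewrite subrK.
  rewrite uE in h1.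
  rewrite ltr_pdivlMr// in hf.
  have h6 := ler_wpM2l (ltW eps0) h2; have h7 := ler_wpM2l C0 h3.
  move: hf; rewrite /c0.
  move: h1 h4 h5 h6 h7; move: (tree_form (pred1 None) u u) (tree_form (pred1 None) w w) (tree_form predT w w) (tree_form predT u u)
    (tree_form (pred1 None) _ _) (tree_form predT _ _) (\sum_i l i u ^+ 2) (\sum_i _) (#|{: I * 'I_2}|%:R * K) => a1 a2 a3 a4 a5 a6 a7 a8 a9.
  by move=> h1 h4 h5 h6 h7 hf; lra.
pose r := Num.sqrt (8 * C).
exists #|{: I * 'I_2}|, (fun i u => r * l (enum_val i) u), (8 * C * K); split.
- move=> i a x y [sx _] [sy _]; rewrite (lin (enum_val i))//; ring.
- move=> i u [su _]; rewrite exprMn sqr_sqrtr ?mulr_ge0// -mulrA ler_wpM2l ?mulr_ge0//; exact: lK.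
- move=> u Du; have := general u Du.
  under [in X in _ -> X]eq_bigr do rewrite exprMn sqr_sqrtr ?mulr_ge0//.
  rewrite -mulr_sumr -(big_enum_val (fun i => l i u ^+ 2)) /= form_split.
  have h0 := form_ge0 (pred1 None) u; have q0 := form_ge0 (predC1 None) u.
  have h1 := ler_wpM2r h0 eps2; have h2 := ler_wpM2r q0 eps1.
  move: h0 q0 h1 h2; move: (tree_form (pred1 None) u u) (tree_form (predC1 None) u u) (\sum_(i in _) _) => a1 a2 a3; lra.
Qed.
End compact.

End form_domain.

(** * The spectrum *)

Lemma cvg0_EFin {R : realType} (r : nat -> R) : (forall n, 0 <= r n) ->
  ((r n)%:E @[n --> \oo] --> 0%E)%E <-> forall e : R, 0 < e -> exists N, forall n, (N <= n)%N -> r n < e.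
Proof.
move=> r0; split.
  move=> /fine_cvgP[_ /cvgr0Pnorm_lt h] e e0; have [N _ hN] := h e e0; exists N => n Nn.
  by have := hN n Nn; rewrite /= ger0_norm.
move=> h; apply/fine_cvgP; split; first exact: nearW.
apply/cvgr0Pnorm_lt => e e0; have [N hN] := h e e0; exists N => // n Nn /=.
by rewrite ger0_norm//; exact: hN.
Qed.

Section operator.
Context {R : realType} {d k : nat} (T : inflated_tree R d k).
Local Notation V := 'rV[R]_(d + 1).
Local Notation point := (piece k * V)%type.
Local Notation C := R[i].
Local Notation E := (tree_core T).
Local Notation vol := (@vol R d k).
Local Notation field := (@field R d k).
Local Notation ip := (ip vol E).
Local Notation D := (form_dom T).
Local Notation h := (tree_form T (pred1 None)).
Local Notation q := (tree_form T (predC1 None)).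
Implicit Types u v w : field.

Let mE : measurable E := measurable_tree_core T.
Let sD := form_dom_subspace T.
Let fh := form_dom_sym T (pred1 None).
Let fq := form_dom_sym T (predC1 None).

Lemma form_grad u v : q u v = \sum_j \sum_b ip (u (Some j) b) (v (Some j) b).
Proof.
rewrite /tree_form (reindex_omap (@Some 'I_(d + 1)) id)//=; last by case.
by apply: eq_bigl => j; rewrite eqxx.
Qed.

Lemma field_of_cplx u : field_of (cplx (u None)) (fun j => cplx (u (Some j))) = u.
Proof. by apply/funext => -[j|]; apply/funext => b; rewrite /field_of cplxK. Qed.

Lemma field_of_value U gU : cplx (field_of U gU None) = U :> (point -> C).
Proof. exact: compsK. Qed.

Lemma field_of_deriv U gU j : cplx (field_of U gU (Some j)) = gU j :> (point -> C).
Proof. exact: compsK. Qed.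

Lemma comps_sub (f g : point -> C) b p : comps (f \- g) b p = comps f b p - comps g b p.
Proof. by move: b; apply: ord2P; rewrite ?comps0 ?comps1 /=; case: (f p) (g p) => ? ? [? ?]. Qed.

Lemma L2_sub (f g : point -> C) : L2 T f -> L2 T g -> L2 T (f \- g).
Proof.
move=> /L2P hf /L2P hg; apply/L2P => b.
apply: (@sqint_eq _ _ _ T (fun p => comps f b p - comps g b p)).
  by move=> p _; rewrite comps_sub.
exact: sqintB.
Qed.

Lemma normsq_sub (f g : point -> C) : L2 T f -> L2 T g -> normsq T (f \- g) =
  (\sum_b ip (fun p => comps f b p - comps g b p) (fun p => comps f b p - comps g b p))%:E.
Proof.
move=> hf hg; rewrite normsqE; last exact: L2_sub.
by congr (_%:E); apply: eq_bigr => b _; apply: ip_eq => p _; rewrite comps_sub.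
Qed.

(** Approximations with errors below [2 ^- n] form a sequence as required by [H10]; conversely a
    late member of the sequence is an approximation, after the finitely many limits are combined. *)
Lemma H10P U gU : H10 T U gU <-> D (field_of U gU).
Proof.
have formE f : tree_form T predT (field_of U gU - jet T f) (field_of U gU - jet T f) =
   \sum_b ip (fun p => comps f b p - comps U b p) (fun p => comps f b p - comps U b p) +
   \sum_j \sum_b ip (fun p => comps (grad T f j) b p - comps (gU j) b p)
      (fun p => comps (grad T f j) b p - comps (gU j) b p).
  rewrite form_split form_value form_grad; congr (_ + _).
    by apply: eq_bigr => b _; apply: eq_Rintegral => p _; rewrite -mulrNN !opprB.
  by apply: eq_bigr => j _; apply: eq_bigr => b _; apply: eq_Rintegral => p _; rewrite -mulrNN !opprB.
have s0 (f g : 'I_2 -> point -> R) : 0 <= \sum_b ip (fun p => f b p - g b p) (fun p => f b p - g b p).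
  by apply: sumr_ge0 => b _; exact: ip_ge0.
split.
  move=> [LU LgU [phi [tphi cU cgU]]]; split.
    by move=> [j|] b; [exact: (L2P _ _).1|exact: (L2P _ _).1].
  move=> e e0; have e2 : 0 < e / 2 by rewrite divr_gt0.
  have [N1 hN1] : exists N, forall n, (N <= n)%N ->
      \sum_b ip (fun p => comps (phi n) b p - comps U b p) (fun p => comps (phi n) b p - comps U b p) < e / 2.
    apply: (iffLR (cvg0_EFin _)) e2; first by move=> n; exact: s0.
    rewrite (_ : (fun n => _%:E) = (fun n => normsq T (phi n \- U))); first exact: cU.
    by apply/funext => n; rewrite normsq_sub//; have [] := tphi n.
  pose r j n := \sum_b ip (fun p => comps (grad T (phi n) j) b p - comps (gU j) b p)
      (fun p => comps (grad T (phi n) j) b p - comps (gU j) b p).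
  have hr j e1 : 0 < e1 -> exists N, forall n, (N <= n)%N -> r j n < e1.
    apply: (iffLR (cvg0_EFin _)); first by move=> n; exact: s0.
    rewrite (_ : (fun n => _%:E) = (fun n => normsq T (grad T (phi n) j \- gU j))); first exact: cgU.
    by apply/funext => n; rewrite normsq_sub//; have [] := tphi n.
  have [N2 hN2] := eventually_sum_lt hr e2.
  exists (phi (maxn N1 N2)); first exact: tphi.
  rewrite formE; have := hN1 _ (leq_maxl N1 N2); have := hN2 _ (leq_maxr N1 N2).
  move: (\sum_b _) (\sum_j _) => x y; lra.
move=> [sU hU].
have LU : L2 T U by apply/L2P; exact: sU None.
have LgU j : L2 T (gU j) by apply/L2P; exact: sU (Some j).
have /choice[phi hphi] : forall n, exists f, test_fun T f /\ tree_form T predT (field_of U gU - jet T f) (field_of U gU - jet T f) < 1 / 2 ^+ n.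
  move=> n; have [|f tf hf] := hU (1 / 2 ^+ n); first by rewrite divr_gt0// exprn_gt0.
  by exists f.
have small (r : nat -> R) : (forall n, 0 <= r n) -> (forall n, r n <= tree_form T predT (field_of U gU - jet T (phi n)) (field_of U gU - jet T (phi n))) ->
    ((r n)%:E @[n --> \oo] --> 0%E)%E.
  move=> r0 rle; apply/cvg0_EFin => // e e0; have [N hN] := exp2_small ler01 e0.
  exists N => n Nn; apply: le_lt_trans (rle n) _; apply: lt_trans (hphi n).2 _.
  apply: le_lt_trans hN; rewrite !mul1r lef_pV2 ?posrE ?exprn_gt0//.
  by rewrite ler_eXn2l// ltr1n.
split => //; exists phi; split.
- by move=> n; have [] := hphi n.
- rewrite (_ : (fun n => _) = fun n => (\sum_b ip (fun p => comps (phi n) b p - comps U b p) (fun p => comps (phi n) b p - comps U b p))%:E).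
    apply: small => n; first exact: s0.
    by rewrite formE lerDl; apply: sumr_ge0 => j _; exact: s0.
  by apply/funext => n; rewrite normsq_sub//; have [[]] := hphi n.
- move=> j; rewrite (_ : (fun n => _) = fun n => (\sum_b ip (fun p => comps (grad T (phi n) j) b p - comps (gU j) b p)
      (fun p => comps (grad T (phi n) j) b p - comps (gU j) b p))%:E).
    apply: small => n; first exact: s0.
    rewrite formE (bigD1 j)//= addrCA lerDl addr_ge0//; apply: sumr_ge0 => i _; exact: s0.
  by apply/funext => n; rewrite normsq_sub//; have [[]] := hphi n.
Qed.

(** The imaginary part of the complex inner product is the real inner product with [mul_i w]. *)
Lemma inner_cplx o u w : sqfield T u -> sqfield T w -> inner T (cplx (u o)) (cplx (w o)) =
  Complex (\sum_b ip (u o b) (w o b)) (\sum_b ip (u o b) (mul_i w o b)).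
Proof.
move=> su sw; have sr := sqfield_rot sw; rewrite /inner !sum2.
have int b (v : field) : sqfield T v -> vol.-integrable E (fun p => (u o b p * v o b p)%:E).
  by move=> sv; exact: (sqint_integrable mE (su o b) (sv o b)).
congr Complex; rewrite /ip -RintegralD//; try exact: int; apply: eq_Rintegral => p _ /=.
by rewrite mulrN opprK.
Qed.

Lemma sum_Complex (I : finType) (a b : I -> R) : \sum_i Complex (a i) (b i) = Complex (\sum_i a i) (\sum_i b i).
Proof. by elim/big_rec3: _ => // i x y z _ ->. Qed.

(** The weak equation is equivalent to its real part for all [w], because the domain is stable under
    multiplication by i and replacing [w] by [mul_i w] recovers the imaginary part. *)
Lemma laplaceP U F : laplace T U F <-> L2 T F /\ exists u, [/\ D u, cplx (u None) = U &
  forall w, D w -> q u w = \sum_b ip (comps F b) (w None b)].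
Proof.
split=> [[LF [gU [HU hU]]]|[LF [u [Du <- hu]]]]; split => //.
  exists (field_of U gU); split; [exact/H10P|exact: field_of_value|move=> w Dw].
  have Hw : H10 T (cplx (w None)) (fun j => cplx (w (Some j))) by apply/H10P; rewrite field_of_cplx.
  have := hU _ _ Hw.
  (* The gradient slots are filled with [gU] only to obtain a square integrable field; [inner_cplx]
     at [None] reads the values alone. *)
  have sF : sqfield T (field_of F gU).
    by move=> [j|] b; [have [_ h _] := HU; exact: (L2P _ _).1|exact: (L2P _ _).1].
  have [sw _] := Dw; have sU : sqfield T (field_of U gU) by have [] := (H10P _ _).1 HU.
  rewrite -{1}(field_of_value F gU) (inner_cplx None sF sw).
  under eq_bigr do rewrite -{1}(field_of_deriv U gU) (inner_cplx _ sU sw).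
  by rewrite sum_Complex form_grad => -[e1 _]; exact: e1.
exists (fun j => cplx (u (Some j))); split; first by apply/H10P; rewrite field_of_cplx.
move=> W gW /H10P Dw; have [su _] := Du; have [sw _] := Dw.
pose w := field_of W gW.
have sF : sqfield T (field_of F (fun j => cplx (u (Some j)))).
  by move=> [j|] b; [rewrite /field_of cplxK; exact: su|exact: (L2P _ _).1].
rewrite -{1}(field_of_value F (fun j => cplx (u (Some j)))) -{1}(field_of_value W gW) (inner_cplx None sF sw).
under eq_bigr do rewrite -{1}(field_of_deriv W gW) (inner_cplx _ su sw).
rewrite sum_Complex; congr Complex.
  by rewrite -(form_grad u (field_of W gW)) hu.
by rewrite -(form_grad u (mul_i (field_of W gW))) (hu _ (form_dom_rot Dw)).
Qed.

Lemma form_dom_sq u : D u -> sqfield T u. Proof. by case. Qed.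

Lemma L2_value u : sqfield T u -> L2 T (cplx (u None)).
Proof. by move=> su; apply/L2P => b; rewrite cplxK. Qed.

Lemma normsq_value u : sqfield T u -> normsq T (cplx (u None)) = (h u u)%:E.
Proof. by move=> su; rewrite normsqE ?cplxK ?form_value//; exact: L2_value. Qed.

Lemma ae_value0 u : sqfield T u -> h u u = 0 <-> ae_eq_tree T (cplx (u None)) (cst 0).
Proof.
move=> su; rewrite form_value sum2; split=> [h0|ae0].
  have i0 := ip_ge0 vol E (u None ord0); have i1 := ip_ge0 vol E (u None ord_max).
  have e0 : ip (u None ord0) (u None ord0) = 0 by lra.
  have e1 : ip (u None ord_max) (u None ord_max) = 0 by lra.
  have := ip_eq0 mE (su None ord0) e0; have := ip_eq0 mE (su None ord_max) e1.
  by apply: filterS2 => p h1 h2 Ep; rewrite /cplx h1// h2.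
have [m0 _] := su None ord0; have [m1 _] := su None ord_max.
rewrite !ip_eq0E ?addr0//; apply: filterS ae0 => p hp Ep; by have [] := hp Ep.
Qed.

Lemma comps_scale (a b : R) u : comps (Complex a b \*o cplx (u None)) = (a *: u + b *: mul_i u) None.
Proof.
apply/funext; apply: ord2P; apply/funext => p; rewrite ?comps0 ?comps1 /cplx /=.
  by rewrite -[RHS]/(a * u None ord0 p + b * - u None ord_max p) mulrN.
by rewrite -[RHS]/(a * u None ord_max p + b * u None ord0 p).
Qed.

Lemma sqfield_scale (a b : R) u : sqfield T u -> sqfield T (a *: u + b *: mul_i u).
Proof.
move=> su; apply: (sqfield_subspace T).2 => //.
by apply: (subspaceZ (sqfield_subspace T)); exact: sqfield_rot.
Qed.

Lemma form_scale (a b : R) u w : sqfield T u -> sqfield T w ->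
  h (a *: u + b *: mul_i u) w = a * h u w + b * h (mul_i u) w.
Proof.
move=> su sw; have sr := sqfield_rot su; have [l _ _] := form_sym T (pred1 None).
have sS := sqfield_subspace T.
by rewrite (l _ sw _ _ _ su (subspaceZ sS b sr)) (linear_onZ sS (l _ sw) b sr).
Qed.

Lemma laplace_eigenP (a b : R) U : laplace T U (Complex a b \*o U) <->
  exists2 u, eigenvector D h q mul_i a b u & cplx (u None) = U.
Proof.
split=> [/laplaceP[LF [u [Du uU hu]]]|[u [Du hu] <-]].
  exists u => //; split => // w Dw; have su := form_dom_sq Du; have sw := form_dom_sq Dw.
  by rewrite /pencil hu// -uU comps_scale -form_value form_scale//; ring.
have su := form_dom_sq Du; apply/laplaceP; split.
  by apply/L2P => c; rewrite comps_scale; exact: (sqfield_scale a b su None).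
exists u; split => // w Dw; have sw := form_dom_sq Dw.
rewrite comps_scale -form_value form_scale//.
by have := hu w Dw; rewrite /pencil; lra.
Qed.

(** * Discreteness from compactness *)

Section spectrum.
Hypothesis hT : (tree_radius T < +oo)%E.

Let compact := form_dom_compact hT.

Let DJ u : D u -> D (mul_i u). Proof. exact: form_dom_rot. Qed.
Let hJ u v : D u -> D v -> h (mul_i u) (mul_i v) = h u v.
Proof. by move=> [su _] [sv _]; exact: form_rot. Qed.
Let qJ u v : D u -> D v -> q (mul_i u) (mul_i v) = q u v.
Proof. by move=> [su _] [sv _]; exact: form_rot. Qed.

Let complete_hq : complete_form D (fun u v => h u v + q u v).
Proof.
rewrite (_ : (fun u v => _) = tree_form T predT); first exact: form_dom_complete.
by apply/funext => u; apply/funext => v; rewrite form_split.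
Qed.

(** The equation is solved for the functional [h f], which the Cauchy-Schwarz inequality bounds with
    the constant [h f f]; the bound of [fredholm] is then the resolvent bound. *)
Lemma resolventP (a b : R) : (forall u, eigenvector D h q mul_i a b u -> h u u = 0) ->
  resolvent_set T (laplace T) (Complex a b).
Proof.
move=> noeig; split.
  move=> U /laplace_eigenP[u eu <-]; have [Du _] := eu.
  by apply/ae_value0; [exact: form_dom_sq|exact: noeig].
have [K hK] := fredholm sD fh fq complete_hq DJ (@mul_i_linear _ _ _) (@mul_i_mul_i _ _ _) hJ compact noeig.
(* The gradient slots are dummies: [f] need not belong to the domain, and [h] reads the values
   alone. *)
exists K => F LF; have sF : sqfield T (field_of F (fun=> F)) by move=> [j|] c; exact: (L2P _ _).1.
set f := field_of F (fun=> F) in sF.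
have [l _ _] := form_sym T (pred1 None).
have [u [Du hu uK]] := hK (fun w => h f w) (h f f) (form_ge0 _ _ _)
   (fun a x y Dx Dy => sym_formr (sqfield_subspace T) (form_sym T (pred1 None)) sF a (form_dom_sq Dx) (form_dom_sq Dy))
   (fun w Dw => form_CauchySchwarz (sqfield_subspace T) (form_sym T (pred1 None)) sF (form_dom_sq Dw)).
have su := form_dom_sq Du.
pose g : point -> C := fun p => Complex a b * cplx (u None) p + F p.
have gE c : comps g c = (1 *: (a *: u + b *: mul_i u) + f) None c.
  apply/funext => z; rewrite scale1r -[RHS]/((a *: u + b *: mul_i u) None c z + comps F c z) -comps_scale.
  move: c; apply: ord2P; rewrite ?comps0 ?comps1 /g /=; by case: (F z).
have sg : sqfield T (1 *: (a *: u + b *: mul_i u) + f).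
  by apply: (sqfield_subspace T).2 => //; exact: sqfield_scale.
exists (cplx (u None)), g; split.
- apply/laplaceP; split; first by apply/L2P => c; rewrite gE; exact: sg.
  exists u; split => // w Dw; have sw := form_dom_sq Dw.
  rewrite (eq_bigr (fun c => ip ((1 *: (a *: u + b *: mul_i u) + f) None c) (w None c))); last by move=> c _; rewrite gE.
  rewrite -form_value (l _ sw) ?mul1r ?form_scale//; last exact: sqfield_scale.
  by have := hu w Dw; rewrite /pencil; lra.
- by apply: nearW => p _; rewrite /g /= addrC addKr.
- rewrite normsq_value// (_ : normsq T F = (h f f)%:E); first by rewrite -EFinM lee_fin.
  by rewrite -(normsq_value sF) field_of_value.
Qed.

Lemma spectrum_eigen lam : spectrum T (laplace T) lam -> exists (a : R) u,
  [/\ lam = Complex a 0, eigenvector D h q mul_i a 0 u & h u u != 0].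
Proof.
case: lam => a b hlam.
have [u [eu hu]] : exists u, eigenvector D h q mul_i a b u /\ h u u != 0.
  apply: contrapT => no; apply: hlam; apply: resolventP => u eu.
  by apply/eqP; apply: contrapT => /negP hu; apply: no; exists u.
have b0 := eigenvalue_real sD fh fq DJ (@mul_i_mul_i _ _ _) hJ qJ eu hu.
by rewrite {}b0 in eu *; exists a, u.
Qed.

Lemma eigenvectorZ (a c : R) u : eigenvector D h q mul_i a 0 u -> eigenvector D h q mul_i a 0 (c *: u).
Proof.
move=> [Du hu]; split; first exact: (subspaceZ sD).
have [lh _ _] := fh; have [lq _ _] := fq; move=> w Dw; rewrite /pencil.
rewrite (linear_onZ sD (lq w Dw) _ Du) (linear_onZ sD (lh w Dw) _ Du).
have := hu w Dw; rewrite /pencil !mul0r !subr0 => hh.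
by rewrite mulrCA -mulrBr hh mulr0.
Qed.

Lemma eigenvectorP (a c : R) u v : eigenvector D h q mul_i a 0 u -> eigenvector D h q mul_i a 0 v ->
  eigenvector D h q mul_i a 0 (c *: u + v).
Proof.
move=> eu ev; have [Dcu hcu] := eigenvectorZ c eu; have [Dv hv] := ev.
split; first exact: (subspaceD sD).
have [lh _ _] := fh; have [lq _ _] := fq; move=> w Dw.
have := hcu w Dw; have := hv w Dw; rewrite /pencil !mul0r !subr0.
by rewrite (linear_onD (lq w Dw) Dcu Dv) (linear_onD (lh w Dw) Dcu Dv); lra.
Qed.

Lemma eigenvector_normal (a : R) u : eigenvector D h q mul_i a 0 u -> h u u != 0 ->
  exists2 v, eigenvector D h q mul_i a 0 v & h v v = 1 /\ exists c : R, v = c *: u.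
Proof.
move=> eu hu; have h0 : 0 < h u u by rewrite lt_neqAle eq_sym hu form_ge0.
exists ((Num.sqrt (h u u))^-1 *: u); first exact: eigenvectorZ.
split; last by eexists.
have [Du _] := eu; rewrite tree_formZ; last exact: form_dom_sq.
by rewrite exprVn sqr_sqrtr ?ltW// mulVf.
Qed.

(** Normalized eigenvectors of distinct eigenvalues are orthonormal, so the length of a list of
    distinct eigenvalues up to [L] is bounded; a longest list contains them all. *)
Lemma eigenvalues_finite (L : R) : exists s : seq R, forall a u,
  eigenvector D h q mul_i a 0 u -> h u u != 0 -> a <= L -> a \in s.
Proof.
have [m hm] := eigenvector_count sD mul_i fh fq compact L.
pose P (s : seq R) := uniq s /\ forall a, a \in s -> a <= L /\ exists2 u, eigenvector D h q mul_i a 0 u & h u u != 0.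
have bound s : P s -> (size s <= m)%N.
  move=> [us hs].
  have /choice[u hu] : forall i : 'I_(size s), exists u, eigenvector D h q mul_i s`_i 0 u /\ h u u = 1.
    move=> i; have [_ [v ev v0]] := hs _ (mem_nth 0 (ltn_ord i)).
    by have [w ew [w1 _]] := eigenvector_normal ev v0; exists w.
  apply: (hm _ u (fun i => s`_i)).
  - by move=> i; have [] := hu i.
  - by move=> i; have [] := hs _ (mem_nth 0 (ltn_ord i)).
  move=> i j; have [-> |ij] := eqVneq i j; first by have [_ ->] := hu j.
  by apply: (eigenvector_ortho fh fq (hu i).1 (hu j).1); rewrite nth_uniq.
have ex0 : exists n, `[< exists2 s, P s & size s = n >] by exists 0%N; apply/asboolP; exists [::].
have le n : `[< exists2 s, P s & size s = n >] -> (n <= m)%N by move=> /asboolP[s Ps <-]; exact: bound.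
have [n /asboolP[s [us hs] sn] nmax] := ex_maxnP ex0 le.
exists s => a u eu hu aL; apply: contrapT => /negP as_.
have : `[< exists2 s, P s & size s = n.+1 >].
  apply/asboolP; exists (a :: s); last by rewrite /= sn.
  split; first by rewrite /= as_.
  move=> b; rewrite inE => /orP[/eqP->|/hs//]; split => //; by exists u.
by move/nmax; rewrite ltnn.
Qed.

(** A largest orthonormal family spans: otherwise the normalized remainder of a projection would
    extend it. Spanning is up to fields with zero value part, on which [h] vanishes. *)
Lemma eigenspace_finite (a : R) : exists n (b : 'I_n -> field),
  (forall i, eigenvector D h q mul_i a 0 (b i)) /\
  forall u, eigenvector D h q mul_i a 0 u -> exists c : 'I_n -> R,
    h (u - \sum_i c i *: b i) (u - \sum_i c i *: b i) = 0.
Proof.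
have [m hm] := eigenvector_count sD mul_i fh fq compact a.
pose P n := exists2 b : 'I_n -> field, forall i, eigenvector D h q mul_i a 0 (b i) & orthonormal_family h b.
have ex0 : exists n, `[< P n >].
  by exists 0%N; apply/asboolP; exists (fun=> 0) => [[]|[]].
have le n : `[< P n >] -> (n <= m)%N by move=> /asboolP[b eb ob]; exact: (hm n b (fun=> a)).
have [n /asboolP[b eb ob] nmax] := ex_maxnP ex0 le.
exists n, b; split => // u eu; exists (fun i => h u (b i)).
set w := u - _; have [Du _] := eu.
have Db i : D (b i) by have [] := eb i.
have ew : eigenvector D h q mul_i a 0 w.
  have es (r : seq 'I_n) : eigenvector D h q mul_i a 0 (\sum_(i <- r) h u (b i) *: b i).
    elim: r => [|i r ih]; first by rewrite big_nil -(scale0r u); exact: eigenvectorZ.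
    by rewrite big_cons; exact: eigenvectorP.
  by rewrite /w addrC -scaleN1r; apply: eigenvectorP.
apply/eqP; apply: contrapT => /negP w0.
have [v ev [v1 [c vE]]] := eigenvector_normal ew w0.
have [Dw _] := ew; have [Dv _] := ev.
have [lh sh _] := fh.
have vb i : h v (b i) = 0.
  have Ds : D (\sum_i h u (b i) *: b i) by exact: (subspace_sum sD).
  rewrite vE (linear_onZ sD (lh _ (Db i)) _ Dw) (linear_onB (lh _ (Db i)) Du Ds).
  by rewrite (orthonormal_expand sD fh _ Db ob) subrr mulr0.
have : `[< P n.+1 >].
  apply/asboolP; exists (fun i => if unlift ord0 i is Some j then b j else v).
    by move=> i; case: unliftP.
  move=> i j; case: unliftP => [i' ->|->]; case: unliftP => [j' ->|->].
  - by rewrite ob (inj_eq lift_inj).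
  - by rewrite sh// vb.
  - by rewrite vb.
  - by rewrite v1 eqxx.
by move/nmax; rewrite ltnn.
Qed.

Lemma seq_isolated (s : seq R) (a : R) : exists2 e : R, 0 < e & e <= 1 /\ forall x, x \in s -> `|x - a| < e -> x = a.
Proof.
elim: s => [|y s [e e0 [e1 he]]]; first by exists 1 => //; split.
have [->|ya] := eqVneq y a.
  by exists e => //; split => // x; rewrite inE => /orP[/eqP//|]; exact: he.
exists (Num.min e `|y - a|); first by rewrite lt_min e0 normr_gt0 subr_eq0.
split; first by rewrite ge_min e1.
move=> x; rewrite inE lt_min => /orP[/eqP-> /andP[_]|xs /andP[xe _]]; first by rewrite ltxx.
exact: he.
Qed.

Lemma laplace_discrete : purely_discrete T (laplace T).
Proof.
move=> lam /(spectrum_eigen)[a [u [-> eu hu]]]; have [Du _] := eu; split; last split.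
(* The eigenvalues up to [a + 1] are enough since the radius of isolation is at most 1. *)
- have [s hs] := eigenvalues_finite (a + 1); have [e e0 [e1 he]] := seq_isolated s a.
  exists e => // mu /spectrum_eigen[b [v [-> ev hv]]] bl.
  have {}bl : `|b - a| < e.
    move: bl; rewrite (_ : Complex b 0 - Complex a 0 = Complex (b - a) (0 - 0))//.
    by rewrite subrr normc_def /= expr0n addr0 sqrtr_sqr ltcR.
  congr Complex; apply: he => //; apply: hs ev hv _.
  by move: bl; rewrite ltr_norml => /andP[_]; lra.
- exists (cplx (u None)); first by apply/laplace_eigenP; exists u.
  by move/(ae_value0 (form_dom_sq Du)) => h0; rewrite h0 eqxx in hu.
- have [n [b [eb hb]]] := eigenspace_finite a.
  exists n, (fun i => cplx (b i None)); split.
    by move=> i; apply/laplace_eigenP; exists (b i).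
  move=> U /laplace_eigenP[v ev <-]; have [c hc] := hb v ev; exists (fun i => ((c i)%:C)%C).
  have Db i : D (b i) by have [] := eb i.
  have [Dv _] := ev; have Ds := subspace_sum sD c Db.
  have := (ae_value0 (form_dom_sq (subspaceB sD Dv Ds))).1 hc.
  apply: filterS => p hp Ep; have := hp Ep.
  have -> : \sum_i ((c i)%:C)%C * cplx (b i None) p = cplx ((\sum_i c i *: b i) None) p.
    clear; elim: n b c => [|n ih] b c; first by rewrite !big_ord0.
    rewrite !big_ord_recl (ih (fun i => b (lift ord0 i)) (fun i => c (lift ord0 i))) -[RHS]/(Complex (c ord0 * b ord0 None ord0 p + _) (c ord0 * b ord0 None ord_max p + _)).
    by rewrite /cplx /=; congr Complex; ring.
  set S := \sum_i _; move=> -[h1 h2]; rewrite /cplx; congr Complex; apply/eqP; rewrite -subr_eq0.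
    by apply/eqP; exact: h1.
  by apply/eqP; exact: h2.
Qed.

End spectrum.
End operator.

Theorem theorem4p8 (R : realType) (d k : nat) (hd : (0 < d)%N)
    (T : inflated_tree R d k) (hT : (tree_radius T < +oo)%E)
    (S : straight_tree R d k) :
  tree_diffeo T S \/ vertex_diffeo T S -> purely_discrete T (laplace T).
Proof. by move=> _; exact: laplace_discrete. Qed.
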